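(* Let $P\subset\mathbb R^3$ be a regular polyhedron (Platonic solid) with $S$ faces, $U$ vertices and $H=S+U-2$ edges, and let $o$ be the center of $P$. Let $P'\subset\mathbb R^3$ be a convex polyhedron with $S$ faces, $U$ vertices and $H$ edges, each containing an equilibrium point of $P'$ with respect to some fixed $q\in\operatorname{int}P'$ (i.e. each face and each edge contains an equilibrium point in its relative interior and each vertex is an equilibrium point). Then $$\rho^{in}(P',q)\le\rho^{in}(P,o),$$ with equality if, and only if, $P'$ is a similar copy of $P$ with $q$ as its center.
   Context: Let $P\subset\mathbb R^3$ be a convex polyhedron (a convex polytope with nonempty interior) and $z\in\mathbb R^3$ a reference point. A point $x\in\operatorname{bd}P$ is an equilibrium point of $P$ with respect to $z$ if the plane through $x$ perpendicular to $x-z$ supports $P$; if $z$ lies in the relative interior of a face, $x=z$ is also counted as an equilibrium point. Nondegenerate equilibrium points are of three types. Stable: $x$ is in the relative interior of a face $F$ and $x-z$ is orthogonal to $F$ (possibly $x=z$). Saddle: $x$ is in the relative interior of an edge $e$, $x-z$ is orthogonal to $e$, and $\langle y-x,z-x\rangle>0$ for all $y\in P\setminus e$. Unstable: $x$ is a vertex and $\langle y-x,z-x\rangle>0$ for all $y\in P\setminus\{x\}$. All other equilibrium points are degenerate; reference points $z$ on an edge or at a vertex are regarded as yielding a degenerate equilibrium. Standing assumption: $P$ and $P'$ have only nondegenerate equilibrium points with respect to the given reference points $o$ and $q$. For $p\in\operatorname{int}P$ such that $P$ has only nondegenerate equilibrium points with respect to $p$, let $R(P,p)\subseteq\mathbb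 R^3$ be the set of all points $z\in\mathbb R^3$ (not necessarily in $P$) with respect to which $P$ has only nondegenerate equilibrium points and has the same numbers of stable, saddle and unstable points as with respect to $p$. The internal robustness of $P$ with respect to $p$ is $$\rho^{in}(P,p)=\frac{\min\{|z-p|:z\notin R(P,p)\}}{\sqrt{\operatorname{surf}P}},$$ where $\operatorname{surf}P$ is the surface area of $P$. *)

(* Defs.v *)
From HB Require Import structures.
From mathcomp Require Import all_boot all_order all_algebra.
From mathcomp Require Import all_classical all_reals all_analysis.
Set Implicit Arguments.
Unset Strict Implicit.
Unset Printing Implicit Defensive.
Import Order.TTheory GRing.Theory Num.Theory.
Import numFieldNormedType.Exports.
Local Open Scope classical_set_scope.
Local Open Scope ring_scope.

(* Euclidean 3-space is 'rV[R]_3.  The norm `|x| that the library puts on this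
   type is the sup norm, so the Euclidean length is defined separately; the
   topology (interior, closure, nbhs) is the same for both norms. *)
Definition dot (R : realType) (u v : 'rV[R]_3) : R := (u *m v^T) 0 0.

Definition elen (R : realType) (u : 'rV[R]_3) : R := Num.sqrt (dot u u).

Definition conv_hull (R : realType) (A : set 'rV[R]_3) : set 'rV[R]_3 :=
  smallest (@convex_set R 'rV[R]_3) A.

Definition affine_set (R : realType) (A : set 'rV[R]_3) : Prop :=
  forall (x y : 'rV[R]_3) (t : R), A x -> A y -> A (x + t *: (y - x)).

Definition affine_hull (R : realType) (A : set 'rV[R]_3) : set 'rV[R]_3 :=
  smallest (@affine_set R) A.

Definition affine_dim (R : realType) (A : set 'rV[R]_3) (k : nat) : Prop :=
  exists (x : 'rV[R]_3) (W : {vspace 'rV[R]_3}),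
    \dim W = k /\ affine_hull A = [set x + w | w in [set` W]].

Definition relint (R : realType) (A : set 'rV[R]_3) : set 'rV[R]_3 :=
  [set x | A x /\ \forall y \near x, affine_hull A y -> A y].

Definition bd (R : realType) (A : set 'rV[R]_3) : set 'rV[R]_3 :=
  closure A `\` interior A.

Definition polyhedron (R : realType) (P : set 'rV[R]_3) : Prop :=
  (exists A : set 'rV[R]_3, finite_set A /\ P = conv_hull A) /\
  interior P !=set0.

(* The plane {y | <u, y> = h} supports P, with P on the side <u, y> <= h. *)
Definition supports (R : realType) (P : set 'rV[R]_3) (u : 'rV[R]_3) (h : R) :
    Prop :=
  [/\ u != 0, forall y, P y -> dot u y <= h & exists2 x, P x & dot u x = h].

(* The proper faces of P of dimension k: k = 2 are the faces of the polyhedron,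
   k = 1 its edges, and k = 0 the singletons of its vertices. *)
Definition kfaces (R : realType) (P : set 'rV[R]_3) (k : nat) :
    set (set 'rV[R]_3) :=
  [set F | (exists (u : 'rV[R]_3) (h : R),
              supports P u h /\ F = P `&` [set y | dot u y = h]) /\
           affine_dim F k].

(* The two disjuncts "supports" are the two sides on which P may lie; the
   second one only occurs for z outside P.  Every boundary point z counts as an
   equilibrium with respect to itself: it is of type [stable] when it is in the
   relative interior of a face, and of none of the three types when it is on an
   edge or at a vertex, where the equilibrium is degenerate by convention. *)
Definition equilibrium (R : realType) (P : set 'rV[R]_3) (z : 'rV[R]_3) :
    set 'rV[R]_3 :=
  [set x | bd P x /\
           [\/ x = z,
               supports P (x - z) (dot (x - z) x) |
               supports P (z - x) (dot (z - x) x)]].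

Definition orthogonal_to (R : realType) (v : 'rV[R]_3) (F : set 'rV[R]_3) :
    Prop :=
  forall y y', F y -> F y' -> dot v (y - y') = 0.

Definition stable (R : realType) (P : set 'rV[R]_3) (z : 'rV[R]_3) :
    set 'rV[R]_3 :=
  [set x | exists F, [/\ kfaces P 2 F, relint F x & orthogonal_to (x - z) F]].

Definition saddle (R : realType) (P : set 'rV[R]_3) (z : 'rV[R]_3) :
    set 'rV[R]_3 :=
  [set x | exists e, [/\ kfaces P 1 e, relint e x, orthogonal_to (x - z) e &
                         forall y, (P `\` e) y -> 0 < dot (y - x) (z - x)]].

Definition unstable (R : realType) (P : set 'rV[R]_3) (z : 'rV[R]_3) :
    set 'rV[R]_3 :=
  [set x | kfaces P 0 [set x] /\
           forall y, (P `\ x) y -> 0 < dot (y - x) (z - x)].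

Definition only_nondegenerate (R : realType) (P : set 'rV[R]_3) (z : 'rV[R]_3) :
    Prop :=
  equilibrium P z `<=` stable P z `|` saddle P z `|` unstable P z.

Definition robust_region (R : realType) (P : set 'rV[R]_3) (p : 'rV[R]_3) :
    set 'rV[R]_3 :=
  [set z | [/\ only_nondegenerate P z, (stable P z #= stable P p)%card,
               (saddle P z #= saddle P p)%card &
               (unstable P z #= unstable P p)%card]].

(* Two-dimensional area of a subset F of a plane: the Lebesgue measure of F in
   Cartesian coordinates (s, t) of an orthonormal frame (c; a, b) of the plane.
   It does not depend on the frame, by isometry invariance of the measure. *)
Definition planar_area (R : realType) (F : set 'rV[R]_3) : R :=
  xget 0 [set m : R | exists c a b : 'rV[R]_3,
    [/\ dot a a = 1, dot b b = 1, dot a b = 0,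
        F `<=` [set c + s *: a + t *: b | s in [set: R] & t in [set: R]] &
        m = fine ((@lebesgue_measure R \x @lebesgue_measure R)%E
                    [set st | F (c + st.1 *: a + st.2 *: b)])]].

Definition surf (R : realType) (P : set 'rV[R]_3) : R :=
  \sum_(F \in kfaces P 2) planar_area F.

(* The infimum is attained, i.e. it is a minimum: for p interior to P and P
   nondegenerate with respect to p, the complement of [robust_region P p] is
   closed, and it is nonempty since it contains the vertices of P. *)
Definition rho_in (R : realType) (P : set 'rV[R]_3) (p : 'rV[R]_3) : R :=
  inf [set elen (z - p) | z in ~` robust_region P p] / Num.sqrt (surf P).

Definition is_isometry (R : realType) (g : 'rV[R]_3 -> 'rV[R]_3) : Prop :=
  forall x y, elen (g x - g y) = elen (x - y).

Definition flag (R : realType) (P V E F : set 'rV[R]_3) : Prop :=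
  [/\ kfaces P 0 V, kfaces P 1 E, kfaces P 2 F, V `<=` E & E `<=` F].

(* Regularity: the symmetry group is transitive on the flags. *)
Definition regular_polyhedron (R : realType) (P : set 'rV[R]_3) : Prop :=
  polyhedron P /\
  forall V E F V' E' F' : set 'rV[R]_3, flag P V E F -> flag P V' E' F' ->
    exists g : 'rV[R]_3 -> 'rV[R]_3,
      [/\ is_isometry g, g @` P = P, g @` V = V', g @` E = E' & g @` F = F'].

(* The center of a regular polyhedron is the center of its circumscribed
   sphere. *)
Definition is_center (R : realType) (P : set 'rV[R]_3) (c : 'rV[R]_3) : Prop :=
  forall v w, kfaces P 0 [set v] -> kfaces P 0 [set w] ->
    elen (v - c) = elen (w - c).

Definition similar_copy (R : realType) (P P' : set 'rV[R]_3) : Prop :=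
  exists (k : R) (f : 'rV[R]_3 -> 'rV[R]_3),
    [/\ 0 < k, forall x y, elen (f x - f y) = k * elen (x - y) & P' = f @` P].

(* Main.v *)
Require Import Defs.
From HB Require Import structures.
From mathcomp Require Import all_boot all_order all_algebra.
From mathcomp Require Import all_classical all_reals all_analysis.
From mathcomp Require Import measurable_realfun ring lra.
Set Implicit Arguments.
Unset Strict Implicit.
Unset Printing Implicit Defensive.
Import Order.TTheory GRing.Theory Num.Theory.
Import numFieldNormedType.Exports.
Local Open Scope classical_set_scope.
Local Open Scope ring_scope.

(* Call (P, z) good when the foot Q of the perpendicular from z to each face and the foot E
   of the perpendicular to each edge are relatively interior.  Every flag (v, e, F) of a good
   pair yields a right triangle Q E v in F, and these 4H triangles tile the faces.  Moving z
   along a leg pushes a stable point onto an edge or a saddle point onto a vertex, so the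
   radius r of the robust region is at most every leg; for the regular polyhedron the feet
   survive within the shorter leg, and r equals it.  If t is the tangent of the angle of a
   triangle at Q, its area is at least (r^2 / 2) max (t, 1/t), which lies above its tangent
   line as a function of the angle (measured as the area of a unit sector).  The angles at
   the feet Q add up to S full turns, as they do for P, where they are all equal: summing
   the tangent lines gives the inequality.

   In the case of equality all triangles of P' are congruent to the same multiple k of those
   of P.  Neighbouring faces then have the same distance to q, hence all faces have, by
   connectivity.  The angles of the vertex figures are determined by this distance and the
   legs, and they add up to U full turns, as for P; so the distance is scaled by k too.
   Finally, a similarity that matches a flag of P with a flag of P' matches their neighbours,
   which are mirror images, hence all flags, and the face planes determine the polyhedron.
   The converse is the inequality applied in both directions. *)

(** * Vectors *)

(** Angles never appear as such: the angle with tangent [t] is represented by the area of its unit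
    sector. Angle sums and face areas then both come from one statement on tilings of the plane by
    cones, and the derivative of the inverse tangent is replaced by comparing sectors with right
    triangles. The tangent lines add up to something computable because every edge lies in exactly
    four flags: a constant summed over the flags depends only on [H], the angles at the feet only on
    [S]. The face lattice is treated by linear programming: proper faces are sets of maximizers of
    functionals, a face of a face comes from a perturbed functional, and a neighbour from a tilted
    one. Connectivity is also an extremal argument: a face that is extremal for a suitable
    functional, and not the target, would have a better neighbour. For the regular polyhedron only
    flag transitivity is given, so it has to be derived that the feet of the perpendiculars from the
    center are relatively interior; the key is that its edges join closest pairs of vertices. *)

Definition k0 : 'I_3 := @Ordinal 3 0 isT.
Definition k1 : 'I_3 := @Ordinal 3 1 isT.
Definition k2 : 'I_3 := @Ordinal 3 2 isT.

Section Vectors.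
Context {R : realType}.
Local Notation vec := 'rV[R]_3.
Implicit Types (u v w x y : vec) (a b : R).

Lemma dot3 u v : dot u v = u 0 k0 * v 0 k0 + u 0 k1 * v 0 k1 + u 0 k2 * v 0 k2.
Proof.
rewrite /dot !mxE !big_ord_recl big_ord0 !mxE addr0 addrA.
by do ![congr (_ + _)]; congr (_ * _); congr (_ _ _); apply/val_inj.
Qed.

Lemma rv3P u v : u 0 k0 = v 0 k0 -> u 0 k1 = v 0 k1 -> u 0 k2 = v 0 k2 -> u = v.
Proof.
move=> e0 e1 e2; apply/rowP => -[[|[|[|//]]] i3].
- by rewrite (_ : Ordinal i3 = k0)//; apply/val_inj.
- by rewrite (_ : Ordinal i3 = k1)//; apply/val_inj.
- by rewrite (_ : Ordinal i3 = k2)//; apply/val_inj.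
Qed.

Lemma dotC u v : dot u v = dot v u.
Proof. by rewrite !dot3; ring. Qed.
Lemma dotDl u v w : dot (u + v) w = dot u w + dot v w.
Proof. by rewrite !dot3 !mxE; ring. Qed.
Lemma dotNl u w : dot (- u) w = - dot u w.
Proof. by rewrite !dot3 !mxE; ring. Qed.
Lemma dotZl a u w : dot (a *: u) w = a * dot u w.
Proof. by rewrite !dot3 !mxE; ring. Qed.
Lemma dot0l w : dot 0 w = 0.
Proof. by rewrite !dot3 !mxE; ring. Qed.
Lemma dotBl u v w : dot (u - v) w = dot u w - dot v w.
Proof. by rewrite dotDl dotNl. Qed.
Lemma dotDr u v w : dot w (u + v) = dot w u + dot w v.
Proof. by rewrite ![dot w _]dotC dotDl. Qed.
Lemma dotNr u w : dot w (- u) = - dot w u.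
Proof. by rewrite ![dot w _]dotC dotNl. Qed.
Lemma dotBr u v w : dot w (u - v) = dot w u - dot w v.
Proof. by rewrite dotDr dotNr. Qed.
Lemma dotZr a u w : dot w (a *: u) = a * dot w u.
Proof. by rewrite ![dot w _]dotC dotZl. Qed.
Lemma dot0r w : dot w 0 = 0.
Proof. by rewrite dotC dot0l. Qed.

Definition dotE := (dotDl, dotDr, dotNl, dotNr, dotZl, dotZr, dot0l, dot0r).

Lemma dot_ge0 u : 0 <= dot u u.
Proof. by rewrite dot3 !addr_ge0// -expr2 sqr_ge0. Qed.

Lemma dot_eq0 u : (dot u u == 0) = (u == 0).
Proof.
apply/eqP/eqP => [|->]; last by rewrite dot0l.
rewrite dot3 => h.
have := sqr_ge0 (u 0 k0); have := sqr_ge0 (u 0 k1); have := sqr_ge0 (u 0 k2).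
rewrite !expr2 => h2 h1 h0.
by apply: rv3P; rewrite mxE; apply/eqP; rewrite -sqrf_eq0 expr2; apply/eqP; lra.
Qed.

Lemma dot_gt0 u : (0 < dot u u) = (u != 0).
Proof. by rewrite lt_neqAle dot_ge0 andbT eq_sym dot_eq0. Qed.

Lemma elen_ge0 u : 0 <= elen u.
Proof. exact: sqrtr_ge0. Qed.
Lemma elen_sqr u : elen u ^+ 2 = dot u u.
Proof. by rewrite sqr_sqrtr// dot_ge0. Qed.
Lemma elen_eq u v : dot u u = dot v v -> elen u = elen v.
Proof. by rewrite /elen => ->. Qed.
Lemma elen_eqE u v : elen u = elen v -> dot u u = dot v v.
Proof. by move=> h; rewrite -!elen_sqr h. Qed.
Lemma elen_lt u v : (elen u < elen v) = (dot u u < dot v v).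
Proof. by rewrite -!elen_sqr ltr_pXn2r// nnegrE elen_ge0. Qed.
Lemma elen_le u v : (elen u <= elen v) = (dot u u <= dot v v).
Proof. by rewrite leNgt elen_lt -leNgt. Qed.
Lemma elen_gt0 u : (0 < elen u) = (u != 0).
Proof. by rewrite sqrtr_gt0 dot_gt0. Qed.
Lemma elenZ a u : elen (a *: u) = `|a| * elen u.
Proof. by rewrite /elen !dotE mulrA -expr2 sqrtrM ?sqr_ge0// sqrtr_sqr. Qed.
Lemma elenC u v : elen (u - v) = elen (v - u).
Proof. by apply: elen_eq; rewrite !dotE; ring. Qed.

Lemma CS u v : dot u v ^+ 2 <= dot u u * dot v v.
Proof.
rewrite -subr_ge0 !dot3.
rewrite [X in _ <= X](_ : _ = (u 0 k0 * v 0 k1 - u 0 k1 * v 0 k0) ^+ 2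
  + (u 0 k0 * v 0 k2 - u 0 k2 * v 0 k0) ^+ 2
  + (u 0 k1 * v 0 k2 - u 0 k2 * v 0 k1) ^+ 2); last by ring.
by rewrite !addr_ge0// sqr_ge0.
Qed.

Lemma CS_elen u v : dot u v <= elen u * elen v.
Proof.
case: (lerP (dot u v) 0) => [h|h]; first by rewrite (le_trans h)// mulr_ge0// elen_ge0.
rewrite -(@ler_pXn2r _ 2)// ?nnegrE ?(ltW h) ?mulr_ge0 ?elen_ge0//.
by rewrite exprMn !elen_sqr CS.
Qed.

Definition cross u v : vec := \row_(i < 3)
  [:: u 0 k1 * v 0 k2 - u 0 k2 * v 0 k1; u 0 k2 * v 0 k0 - u 0 k0 * v 0 k2;
      u 0 k0 * v 0 k1 - u 0 k1 * v 0 k0]`_i.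

Lemma dot_crossl u v : dot u (cross u v) = 0.
Proof. by rewrite dot3 ?mxE /=; ring. Qed.
Lemma dot_crossr u v : dot v (cross u v) = 0.
Proof. by rewrite dot3 ?mxE /=; ring. Qed.
Lemma dot_cross_cross u v :
  dot (cross u v) (cross u v) = dot u u * dot v v - dot u v ^+ 2.
Proof. by rewrite !dot3 ?mxE /=; ring. Qed.
Lemma cross_cross u v w : cross (cross u v) w = dot u w *: v - dot v w *: u.
Proof. by apply: rv3P; rewrite ?(mxE, dot3) /= ?(mxE, dot3) /=; ring. Qed.

(* Lagrange: |u x v|^2 w, expanded along u x v and the plane of u and v. *)
Lemma cross_decomp u v w :
  dot (cross u v) (cross u v) *: w =
  (dot v v * dot u w - dot u v * dot v w) *: u +
  (dot u u * dot v w - dot u v * dot u w) *: v + dot (cross u v) w *: cross u v.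
Proof. by apply: rv3P; rewrite ?(mxE, dot3) /= ?(mxE, dot3) /=; ring. Qed.

Lemma cross_eq0 u v : u != 0 -> cross u v = 0 -> v = (dot u v / dot u u) *: u.
Proof.
move=> u0 c0; have := cross_cross u v u; rewrite c0.
have -> : cross 0 u = 0 by apply: rv3P; rewrite ?mxE /= ?mxE; ring.
move/esym/eqP; rewrite subr_eq0 => /eqP h.
by rewrite mulrC -scalerA [dot u v]dotC -h scalerA mulVf ?scale1r// dot_eq0.
Qed.

Lemma cross_neq0 u v : u != 0 -> (forall k, v <> k *: u) -> cross u v != 0.
Proof. by move=> u0 h; apply/eqP => /(cross_eq0 u0); apply: h. Qed.

(** The vectors orthogonal to two independent ones form a line; this is how a vector is pinned down
    from two vanishing products throughout. *)
Lemma perp2 u v w : cross u v != 0 -> dot u w = 0 -> dot v w = 0 ->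
  w = (dot (cross u v) w / dot (cross u v) (cross u v)) *: cross u v.
Proof.
move=> c0 uw vw; have := cross_decomp u v w.
rewrite uw vw !mulr0 !subrr !scale0r !add0r => /(congr1 (fun z => (dot (cross u v) (cross u v))^-1 *: z)).
by rewrite scalerA mulVf ?dot_eq0// scale1r scalerA mulrC.
Qed.

Lemma orthonormal_decomp u v w x : dot u u = 1 -> dot v v = 1 -> dot w w = 1 ->
  dot u v = 0 -> dot u w = 0 -> dot v w = 0 ->
  x = dot u x *: u + dot v x *: v + dot w x *: w.
Proof.
move=> uu vv ww uv uw vw.
have c1 : dot (cross u v) (cross u v) = 1 by rewrite dot_cross_cross uu vv uv; ring.
have c0 : cross u v != 0 by rewrite -dot_eq0 c1 oner_eq0.
have := cross_decomp u v x; rewrite c1 scale1r uu vv uv !mul1r !mul0r !subr0 => {1}->.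
congr (_ + _).
have := perp2 c0 uw vw; rewrite c1 divr1; set k := dot _ w => ->.
rewrite !dotE -/(cross u v).
(* [w] is [cross u v] up to a sign [k], which enters the last term twice. *)
have k2 : k * k = 1 by have := ww; rewrite (perp2 c0 uw vw) c1 divr1 -/k !dotE c1 mulr1.
by rewrite scalerA mulrAC k2 mul1r.
Qed.

End Vectors.

Ltac vring := by apply: rv3P; rewrite ?mxE; ring.
Ltac vfield := by apply: rv3P; rewrite ?mxE; field.

(** * Convex hulls and exposed faces *)

Section Hulls.
Context {R : realType}.
Local Notation vec := 'rV[R]_3.
Implicit Types (u v w x y : vec) (s : seq vec) (P F : set vec).

Lemma convexP (A : set vec) : @convex_set R vec A <->
  forall x y t, 0 <= t -> t <= 1 -> A x -> A y -> A (x + t *: (y - x)).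
Proof.
have e (a b : vec) (t : R) : t *: a + (1 - t) *: b = b + t *: (a - b).
  by rewrite scalerBr addrCA -{2}[b]scale1r -scalerBl addrC.
split=> [cA x y t t0 t1 Ax Ay|cA x y l].
  by have := cA y x (Itv01 t0 t1); rewrite !inE -e; exact.
rewrite !inE => Ax Ay.
by have := cA y x l%:num (ge0 l) (le1 l) Ay Ax; rewrite -e; exact.
Qed.

Definition hull s := conv_hull [set` s].

Lemma hull_mem s a : a \in s -> hull s a.
Proof. by move=> sa; apply: sub_gen_smallest. Qed.

Lemma hull_convex s x y t : 0 <= t -> t <= 1 -> hull s x -> hull s y ->
  hull s (x + t *: (y - x)).
Proof.
move=> t0 t1 sx sy A [cA sA]; move/convexP : (cA); apply => //; [exact: sx|exact: sy].
Qed.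

Lemma hull_min s (A : set vec) : (forall x y t, 0 <= t -> t <= 1 -> A x -> A y ->
    A (x + t *: (y - x))) -> (forall a, a \in s -> A a) -> hull s `<=` A.
Proof. by move=> cA sA; apply: smallest_sub; first exact/convexP. Qed.

Lemma hull_le s u h x : (forall a, a \in s -> dot u a <= h) -> hull s x ->
  dot u x <= h.
Proof.
move=> sh; apply: (@hull_min s [set x | dot u x <= h]) => //= y z t t0 t1 yh zh.
rewrite !dotE; nra.
Qed.

Lemma hull_lt s u h x : hull s x -> h < dot u x ->
  exists2 a, a \in s & h < dot u a.
Proof.
move=> sx ux; apply: contrapT => nex.
have := @hull_le s u h x _ sx; rewrite leNgt ux => /(_ _)/negP; apply => // a sa.
by rewrite leNgt; apply/negP => ha; apply: nex; exists a.
Qed.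

Lemma seq_max (T : eqType) (s : seq T) (f : T -> R) : s != [::] ->
  exists2 a, a \in s & forall b, b \in s -> f b <= f a.
Proof.
elim: s => // a s ih _; have [->|/ih [b sb bm]] := eqVneq s [::].
  by exists a; rewrite ?mem_head// => b; rewrite inE => /eqP ->.
have [ab|ba] := leP (f a) (f b).
  by exists b; rewrite ?inE ?sb ?orbT// => c; rewrite inE => /orP[/eqP ->|/bm].
exists a; rewrite ?mem_head// => c; rewrite inE => /orP[/eqP ->//|/bm] /le_trans; apply.
exact: ltW.
Qed.

(** Finiteness of the generating set enters here: it supplies the large factors with which one
    functional outweighs another, and the margins in open conditions. *)
Lemma seq_dominate (T : eqType) (s : seq T) (f g : T -> R) :
  (forall a, a \in s -> 0 < f a) ->
  exists M0, forall M, M0 <= M -> forall a, a \in s -> g a < M * f a.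
Proof.
elim: s => [|a s ih] fs; first by exists 0.
have [b bs|M0 hM0] := ih; first by apply: fs; rewrite inE bs orbT.
have fa : 0 < f a by apply: fs; rewrite mem_head.
exists (Num.max M0 ((g a + 1) / f a)) => M; rewrite ge_max => /andP[M0M Ma] b.
rewrite inE => /orP[/eqP ->|/(hM0 _ M0M)//].
by move: Ma; rewrite ler_pdivrMr//; apply: lt_le_trans; rewrite ltrDl.
Qed.

(** For nonzero [u] these are the exposed faces. Leaving out the value of the maximum lets a face of
    a face be written as an iterated [amax]. *)
Definition amax P u : set vec :=
  [set x | P x /\ forall y, P y -> dot u y <= dot u x].

Lemma amax_sub P u : amax P u `<=` P.
Proof. by move=> x []. Qed.

Lemma amax_eq P u x y : amax P u x -> amax P u y -> dot u x = dot u y.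
Proof. by move=> [Px mx] [Py my]; apply: le_anti; rewrite mx// my. Qed.

Lemma amaxP P u x y : amax P u x -> P y -> dot u x <= dot u y -> amax P u y.
Proof. by move=> [Px mx] Py xy; split=> // z /mx /le_trans; apply. Qed.

Lemma amax_lt P u x y : amax P u x -> P y -> ~ amax P u y -> dot u y < dot u x.
Proof. by move=> ux Py nuy; rewrite ltNge; apply/negP => /(amaxP ux Py). Qed.

Lemma hull_amax s u : s != [::] -> exists s',
  [/\ s' != [::], amax (hull s) u = hull s', {subset s' <= s} &
   forall a, a \in s -> amax (hull s) u a -> a \in s'].
Proof.
move=> /(@seq_max _ s (dot u))[a sa ma].
have mm x : hull s x -> dot u x <= dot u a by exact: hull_le.
pose s' := [seq b <- s | dot u b == dot u a].
have s'a : a \in s' by rewrite mem_filter eqxx.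
exists s'; split.
- by case: s' s'a.
- rewrite predeqE => x; split=> [[sx mx]|s'x]; last first.
    have ss' : hull s x.
      apply: hull_min s'x => [y z t|b]; first exact: hull_convex.
      by rewrite mem_filter => /andP[_ /hull_mem].
    split=> // y /mm /le_trans; apply; rewrite -lerN2 -!dotNl.
    apply: hull_le s'x => b; rewrite mem_filter => /andP[/eqP ba _].
    by rewrite !dotNl ba.
  have ux : dot u x = dot u a by apply: le_anti; rewrite mm// mx//; apply: hull_mem.
  have : dot u x < dot u a \/ hull s' x.
    (* [Q] is convex: a proper convex combination involving a point strictly below the maximum is
       again strictly below, and otherwise both points lie in [hull s']. It contains all
       generators. *)
    pose Q := [set y | dot u y <= dot u a /\ (dot u y < dot u a \/ hull s' y)].
    suff : Q x by case.
    apply: (@hull_min s Q) sx => /= [y z t t0 t1 [ya hy] [za hz]|b sb].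
      split; first by rewrite !dotE; nra.
      have [->|tn0] := eqVneq t 0; first by rewrite scale0r addr0.
      have [->|tn1] := eqVneq t 1; first by rewrite scale1r addrC subrK.
      have {t0 tn0} t0 : 0 < t by rewrite lt_def tn0.
      have {t1 tn1} t1 : t < 1 by rewrite lt_def eq_sym tn1.
      case: hy => hy; first by left; rewrite !dotE; nra.
      case: hz => hz; first by left; rewrite !dotE; nra.
      by right; apply: hull_convex => //; exact: ltW.
    split; first exact: ma.
    have [ba|ab] := ltP (dot u b) (dot u a); first by left.
    right; apply: hull_mem; rewrite mem_filter sb andbT.
    by rewrite eq_le ab ma.
  by rewrite ux ltxx => -[].
- by move=> b; rewrite mem_filter => /andP[].
- move=> b sb [_ mb]; rewrite mem_filter sb andbT eq_le ma//= mb//.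
  exact: hull_mem.
Qed.

Lemma amax_hull_neq0 s u : s != [::] -> exists x, amax (hull s) u x.
Proof.
move=> /hull_amax-/(_ u)[[|a s'] [//_ -> _ _]].
by exists a; apply: hull_mem; rewrite mem_head.
Qed.

(** A lexicographic maximum is the maximum of one functional: with a large weight on [u], generators
    off the first face cannot win. *)
Lemma amax_amax s u d : s != [::] -> exists M0, forall M, M0 <= M ->
  amax (amax (hull s) u) d = amax (hull s) (M *: u + d).
Proof.
move=> s0; have [s' [s'0 uE s's ss']] := hull_amax u s0.
have [x0 [ux0 dx0]] : exists x, amax (amax (hull s) u) d x.
  by rewrite uE; exact: amax_hull_neq0.
have [|M0 hM0] := @seq_dominate _ [seq a <- s | dot u a < dot u x0]
  (fun a => dot u x0 - dot u a) (fun a => dot d a - dot d x0).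
  by move=> a; rewrite mem_filter subr_gt0 => /andP[].
have {}hM0 : forall M, M0 <= M -> forall a, hull s a ->
    M * dot u a + dot d a <= M * dot u x0 + dot d x0.
  move=> M MM a sa; rewrite -!dotZl -!dotDl; apply: hull_le sa => {}a sa.
  rewrite !dotE.
  have [au|ua] := ltP (dot u a) (dot u x0).
    by have := hM0 M MM a; rewrite mem_filter au sa => /(_ isT); lra.
  have ua' : amax (hull s) u a by apply: amaxP ux0 _ ua; exact: hull_mem.
  by rewrite (amax_eq ux0 ua') lerD2l; apply: dx0.
(* The unit of slack gives two comparisons, with the weights [M0] and [M]; their difference forces
   [x] to be maximal for [u]. *)
exists (M0 + 1) => M MM; have MM0 : M0 <= M by lra.
rewrite predeqE => x; split.
  move=> [ux dx]; split; first by case: ux.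
  move=> y sy; have := hM0 M MM0 y sy; rewrite !dotE => /le_trans; apply.
  by rewrite (amax_eq ux ux0) lerD2l; apply: dx.
move=> [sx mx].
have := mx x0 (amax_sub ux0); rewrite !dotE => h1.
have h2 := hM0 M0 (lexx _) x sx.
have h3 : dot u x <= dot u x0 by case: ux0 => _; apply.
have h4 : dot u x = dot u x0 by apply: le_anti; rewrite h3/=; nra.
have ux : amax (hull s) u x by apply: amaxP ux0 sx _; rewrite h4.
split=> // y /dx0 /le_trans; apply.
by move: h1; rewrite h4; lra.
Qed.

Lemma amax_amax_neq0 s u d : s != [::] -> u != 0 -> exists f M,
  [/\ f != 0, f = M *: u + d & amax (amax (hull s) u) d = amax (hull s) f].
Proof.
move=> s0 u0; have [M0 hM] := amax_amax u d s0.
have [e|e] := eqVneq (M0 *: u + d) 0.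
  exists ((M0 + 1) *: u + d), (M0 + 1); split=> //; last by apply: hM; rewrite lerDl.
  by rewrite scalerDl scale1r addrAC e add0r.
by exists (M0 *: u + d), M0; split=> //; exact: hM.
Qed.

(** Ties are broken by the three coordinates in turn, after which a single point is left. *)
Lemma amax_vertex s u : s != [::] -> u != 0 -> exists v w,
  [/\ w != 0, amax (hull s) w = [set v] & amax (hull s) u v].
Proof.
move=> s0 u0.
have [f0 [M0 [f00 _ f0E]]] := amax_amax_neq0 (delta_mx 0 k0) s0 u0.
have [f1 [M1 [f10 _ f1E]]] := amax_amax_neq0 (delta_mx 0 k1) s0 f00.
have [f2 [M2 [f20 _ f2E]]] := amax_amax_neq0 (delta_mx 0 k2) s0 f10.
have [v vE] := amax_hull_neq0 f2 s0; exists v, f2; split=> //; last first.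
  by move: vE; rewrite -f2E => /amax_sub; rewrite -f1E => /amax_sub; rewrite -f0E => /amax_sub.
have dotdelta (k : 'I_3) x : dot (delta_mx 0 k) x = x 0 k.
  rewrite /dot mxE (bigD1 k)//= big1 ?addr0 ?mxE ?eqxx ?mul1r// => j jk.
  by rewrite !mxE eqxx (negPf jk) mul0r.
rewrite predeqE => x; split=> [xE|->//].
move: vE xE; rewrite -f2E => v2 x2.
have := v2 => /amax_sub; rewrite -f1E => v1; have := x2 => /amax_sub; rewrite -f1E => x1.
have := v1 => /amax_sub; rewrite -f0E => v0; have := x1 => /amax_sub; rewrite -f0E => x0.
by apply: rv3P; rewrite -!dotdelta; apply: amax_eq; eassumption.
Qed.

(* Gift wrapping: tilting the functional [u] about the face where [c] is maximal
   on [amax P u] until it meets a new point of [P]. *)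
Lemma rotate s u c : s != [::] -> (exists2 x, hull s x & ~ amax (hull s) u x) ->
  exists g x, [/\ hull s x, ~ amax (hull s) u x, amax (hull s) (c + g *: u) x,
    amax (amax (hull s) u) c `<=` amax (hull s) (c + g *: u) &
    amax (hull s) (c + g *: u) `&` amax (hull s) u `<=` amax (amax (hull s) u) c].
Proof.
move=> s0 [z sz nz]; have [s' [s'0 uE s's ss']] := hull_amax u s0.
have [x0 x0E] : exists x, amax (amax (hull s) u) c x.
  by rewrite uE; exact: amax_hull_neq0.
have ux0 := amax_sub x0E.
pose t := [seq a <- s | dot u a < dot u x0].
have t0 : t != [::].
  have uz := amax_lt ux0 sz nz.
  have := @hull_lt s (- u) (- dot u x0) z sz; rewrite dotNl ltrN2 => /(_ uz)[a sa].
  rewrite dotNl ltrN2 => ua; have : a \in t by rewrite mem_filter ua.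
  by case: t.
(* The largest slope of a generator off the face: a larger tilt [g] would reach no new point, a
   smaller one would leave [b] above the supporting plane. *)
have [b tb bm] := seq_max (fun a => (dot c a - dot c x0) / (dot u x0 - dot u a)) t0.
move: tb; rewrite mem_filter => /andP[ub sb].
set g := (dot c b - dot c x0) / (dot u x0 - dot u b) in bm.
have gb : g * (dot u x0 - dot u b) = dot c b - dot c x0.
  by rewrite mulfVK// gt_eqF// subr_gt0.
have mx a : hull s a -> dot (c + g *: u) a <= dot (c + g *: u) x0.
  apply: hull_le => a' sa'; rewrite !dotE.
  have [au|ua] := ltP (dot u a') (dot u x0).
    have := bm a'; rewrite mem_filter au sa' => /(_ isT).
    by rewrite ler_pdivrMr ?subr_gt0//; lra.
  have ua' : amax (hull s) u a' by apply: amaxP ux0 _ ua; exact: hull_mem.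
  by rewrite (amax_eq ux0 ua') lerD2r; case: x0E => _; apply.
have x0m : amax (hull s) (c + g *: u) x0 by split=> //; exact: (amax_sub ux0).
exists g, b; split.
- exact: hull_mem.
- by move=> ub'; move: ub; rewrite (amax_eq ux0 ub') ltxx.
- by apply: amaxP x0m (hull_mem sb) _; rewrite !dotE; lra.
- move=> y yE; apply: amaxP x0m _ _; first by case: yE => -[].
  by rewrite !dotE (amax_eq yE x0E) (amax_eq (amax_sub yE) ux0).
- move=> y [yE uy]; split=> // w uw.
  have := amax_eq x0m yE; rewrite !dotE (amax_eq ux0 uy) => /addIr <-.
  by case: x0E => _; apply.
Qed.

End Hulls.

(** * Affine dimension of exposed faces *)

Section Faces.
Context {R : realType}.
Local Notation vec := 'rV[R]_3.
Implicit Types (u v w x y : vec) (s : seq vec) (P F : set vec).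

Lemma kfaces_amax P k F : kfaces P k F <->
  exists u, [/\ u != 0, F = amax P u, F !=set0 & affine_dim F k].
Proof.
split=> [[[u [h [[u0 mx [x Px ux]] ->]]] d]|[u [u0 FE [x Fx] d]]].
  have E : P `&` [set y | dot u y = h] = amax P u.
    rewrite predeqE => y; split=> [[Py /= uy]|[Py my]]; last first.
      by split=> //=; apply: le_anti; rewrite mx//= -ux my.
    by split=> // z /mx; rewrite uy.
  by exists u; rewrite -E; split=> //; exists x.
split=> //; exists u, (dot u x); move: Fx; rewrite FE => Fx; split.
  by split=> //; [case: Fx | exists x => //; case: Fx].
rewrite predeqE => y; split=> [Fy|[Py uy]]; last by apply: amaxP Fx Py _; rewrite uy.
by split; [case: Fy | apply: amax_eq Fy Fx].
Qed.

Lemma affine_hull_sub (A : set vec) : A `<=` affine_hull A.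
Proof. exact: sub_gen_smallest. Qed.

Lemma affine_hull_affine (A : set vec) : affine_set (affine_hull A).
Proof. by move=> x y t Ax Ay B hB; case: (hB) => aB _; exact: aB x y t (Ax B hB) (Ay B hB). Qed.

Lemma affine_hull_min (A B : set vec) : affine_set B -> A `<=` B -> affine_hull A `<=` B.
Proof. exact: smallest_sub. Qed.

Lemma affine_dim_at (A : set vec) k x : affine_dim A k -> A x ->
  exists W : {vspace vec}, \dim W = k /\ affine_hull A = [set x + w | w in [set` W]].
Proof.
move=> [x0 [W [dW AE]]] Ax; exists W; split=> //; rewrite AE.
have : affine_hull A x by exact: affine_hull_sub.
rewrite AE => -[w0 /= Ww0 <-]; rewrite predeqE => y; split=> -[w Ww <-].
  by exists (w - w0); [exact: rpredB | vring].
by exists (w0 + w); [exact: rpredD | vring].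
Qed.

Lemma affine_dim_neq0 (A : set vec) k : affine_dim A k -> A !=set0.
Proof.
move=> [x0 [W [dW AE]]]; apply: contrapT => /set0P/negP/negPn/eqP A0.
have : affine_hull A `<=` set0 by apply: affine_hull_min => //; rewrite A0.
by apply; rewrite AE; exists 0 => //=; rewrite rpred0.
Qed.

Lemma affine_set_vspace x (W : {vspace vec}) : affine_set [set x + w | w in [set` W]].
Proof.
move=> _ _ t [w1 /= W1 <-] [w2 /= W2 <-]; exists (w1 + t *: (w2 - w1)); rewrite /=.
  by rewrite rpredD// rpredZ// rpredB.
by vring.
Qed.

Lemma affine_dim0 (A : set vec) : affine_dim A 0 <-> exists x, A = [set x].
Proof.
split=> [d|[x ->]].
  have [x Ax] := affine_dim_neq0 d; exists x; have [W [/eqP]] := affine_dim_at d Ax.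
  rewrite dimv_eq0 => /eqP -> AE; rewrite predeqE => y; split=> [Ay|-> //].
  have : affine_hull A y by exact: affine_hull_sub.
  by rewrite AE => -[w /=]; rewrite memv0 => /eqP ->; rewrite addr0.
exists x, 0%VS; split; first exact: dimv0.
rewrite eqEsubset; split.
  apply: affine_hull_min; first exact: affine_set_vspace.
  by move=> y ->; exists 0; rewrite /= ?addr0// memv0.
by move=> y [w /=]; rewrite memv0 => /eqP -> <-; rewrite addr0; exact: affine_hull_sub.
Qed.

Lemma affine_dim1 (A : set vec) : affine_dim A 1 <-> exists v w,
  [/\ v <> w, A v, A w & forall x, A x -> exists t, x = v + t *: (w - v)].
Proof.
split=> [d|[v [w [vw Av Aw Avw]]]].
  have [x Ax] := affine_dim_neq0 d; have [W [W1 AE]] := affine_dim_at d Ax.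
  have [y [Ay yx]] : exists y, A y /\ y <> x.
    apply: contrapT => nex.
    have AE0 : A = [set x].
      by rewrite predeqE => y; split=> [Ay|-> //]; apply: contrapT => yx; apply: nex; exists y.
    have /(affine_dim_at)/(_ Ax)[W0 [W00 AE']] : affine_dim A 0 by apply/affine_dim0; exists x.
    move: AE'; rewrite AE => AE'; have := W1; suff -> : W = W0 by rewrite W00.
    apply/vspaceP => w; apply/idP/idP => Ww.
      have : [set x + w | w in [set` W]] (x + w) by exists w.
      by rewrite AE' => -[w' /= Ww' /addrI <-].
    have : [set x + w | w in [set` W0]] (x + w) by exists w.
    by rewrite -AE' => -[w' /= Ww' /addrI <-].
  exists x, y; split=> //; first by move=> /esym.
  have inW z : A z -> z - x \in W.
    move=> Az; have : affine_hull A z by exact: affine_hull_sub.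
    by rewrite AE => -[w /= Ww <-]; rewrite addrAC subrr add0r.
  have WE : W = <[y - x]>%VS.
    apply/esym/eqP; rewrite eqEdim -memvE inW//= W1 dim_vline.
    by rewrite subr_eq0; move/eqP: yx => ->.
  move=> z /inW; rewrite WE => /vlineP[t tE]; exists t.
  by rewrite -tE addrC subrK.
have wv0 : w - v != 0 by rewrite subr_eq0; apply/eqP => /esym.
exists v, <[w - v]>%VS; split; first by rewrite dim_vline wv0.
rewrite eqEsubset; split.
  apply: affine_hull_min; first exact: affine_set_vspace.
  by move=> x /Avw[t ->]; exists (t *: (w - v)) => //=; rewrite memvZ// memv_line.
move=> _ [z /= /vlineP[t ->] <-].
by apply: affine_hull_affine; exact: affine_hull_sub.
Qed.

(** Affine dimension two made concrete: three noncollinear points of [A] in a plane with normal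
    [u]. *)
Definition spans u (A : set vec) := exists x0 x1 x2,
  [/\ A x0, A x1 & A x2] /\
  [/\ dot u (x1 - x0) = 0, dot u (x2 - x0) = 0 & cross (x1 - x0) (x2 - x0) != 0].

Lemma exists_indep u : exists m, forall k, m <> k *: u.
Proof.
have [->|u0] := eqVneq u 0.
  exists (delta_mx 0 k0) => k; rewrite scaler0 => /rowP/(_ k0)/eqP.
  by rewrite !mxE eqxx oner_eq0.
apply: contrapT => nex.
have all m : exists k, m = k *: u.
  by apply: contrapT => nk; apply: nex; exists m => k mk; apply: nk; exists k.
have [a aE] := all (delta_mx 0 k0); have [b bE] := all (delta_mx 0 k1).
have := congr1 (fun x : vec => x 0 k0) aE; have := congr1 (fun x : vec => x 0 k1) aE.
have := congr1 (fun x : vec => x 0 k0) bE; have := congr1 (fun x : vec => x 0 k1) bE.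
rewrite !mxE /= => b1 b0 a1 a0.
have : a * u 0 k0 * (b * u 0 k1) = b * u 0 k0 * (a * u 0 k1) by ring.
rewrite -b1 -b0 -a1 -a0 mulr0 mulr1.
by move/eqP; rewrite oner_eq0.
Qed.

Lemma affine_dim2 (A : set vec) u h : u != 0 -> (forall x, A x -> dot u x = h) ->
  (affine_dim A 2 <-> spans u A).
Proof.
move=> u0 uA; split=> [d|].
  have [x0 Ax0] := affine_dim_neq0 d; have [W [W2 AE]] := affine_dim_at d Ax0.
  (* If a functional independent of [u] were constant on [A], the direction space would be
     orthogonal to both and so of dimension at most one. *)
  have nc m : (forall k, m <> k *: u) -> exists2 x, A x & dot m x <> dot m x0.
    move=> mu; apply: contrapT => nex.
    have cW w : w \in W -> dot u w = 0 /\ dot m w = 0.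
      move=> Ww; have : affine_hull A (x0 + w) by rewrite AE; exists w.
      have : affine_hull A `<=` [set x | dot u x = h /\ dot m x = dot m x0].
        apply: affine_hull_min => [x y t [ux mx] [uy my]|x Ax] /=.
          by rewrite !dotE ux mx uy my; split; ring.
        split; first exact: uA.
        by apply: contrapT => mx; apply: nex; exists x.
      by move=> /[apply] -[]; rewrite !dotE (uA _ Ax0); split; lra.
    have c0 : cross u m != 0 by exact: cross_neq0.
    suff : (W <= <[cross u m]>)%VS by move/dimvS; rewrite W2 dim_vline; case: eqP.
    apply/subvP => w /cW[uw mw]; rewrite (perp2 c0 uw mw).
    by rewrite memvZ// memv_line.
  have [m mu] := exists_indep u; have [x1 Ax1 mx1] := nc m mu.
  have w10 : x1 - x0 != 0 by rewrite subr_eq0; apply: contra_notN mx1 => /eqP ->.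
  have ux1 : dot u (x1 - x0) = 0 by rewrite dotBr !uA// subrr.
  have c0 : cross u (x1 - x0) != 0.
    apply: cross_neq0 => // k k0; move: w10; rewrite -dot_eq0 {1}k0 dotZl ux1 mulr0 eqxx//.
  have [|x2 Ax2 x2E] := nc (cross u (x1 - x0)).
    move=> k k0; move: c0; rewrite -dot_eq0 {1}k0 dotZl.
    by rewrite -[X in _ * X]/(dot u (cross u (x1 - x0))) dot_crossl mulr0 eqxx.
  exists x0, x1, x2; split=> //; split=> //; first by rewrite dotBr !uA// subrr.
  apply: cross_neq0 => // k kE; apply: x2E; apply/eqP; rewrite -subr_eq0 -dotBr kE.
  by rewrite dotZr dotC dot_crossr mulr0.
move=> [x0 [x1 [x2 [[Ax0 Ax1 Ax2] [ux1 ux2 c0]]]]].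
set w1 := x1 - x0 in ux1 c0; set w2 := x2 - x0 in ux2 c0.
have uc := perp2 c0 (etrans (dotC _ _) ux1) (etrans (dotC _ _) ux2).
pose W := (<[w1]> + <[w2]>)%VS.
have w1W : w1 \in W by rewrite memvE addvSl.
have w2W : w2 \in W by rewrite memvE addvSr.
exists x0, W; split.
  have w10 : w1 != 0.
    apply: contra_neq c0 => ->; apply: rv3P; rewrite ?mxE /= ?mxE; ring.
  have dj : (<[w1]> :&: <[w2]>)%VS = 0%VS.
    apply/eqP; rewrite -subv0; apply/subvP => x.
    rewrite memv_cap => /andP[/vlineP[a ->] /vlineP[b ab]]; rewrite memv0.
    apply: contra_neqT c0 => aw0.
    have a0 : a != 0 by apply: contra_neq aw0 => ->; rewrite scale0r.
    have -> : w1 = (b / a) *: w2 by rewrite mulrC -scalerA -ab scalerA mulVf// scale1r.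
    by apply: rv3P; rewrite ?mxE /= ?mxE; ring.
  rewrite /W; have := dimv_disjoint_sum dj => ->; rewrite !dim_vline w10.
  suff -> : w2 != 0 by [].
  by apply: contra_neq c0 => ->; apply: rv3P; rewrite ?mxE /= ?mxE; ring.
rewrite eqEsubset; split.
  apply: affine_hull_min; first exact: affine_set_vspace.
  move=> x Ax; exists (x - x0); last by rewrite addrC subrK.
  have ux : dot u (x - x0) = 0 by rewrite dotBr !uA// subrr.
  have cx : dot (cross w1 w2) (x - x0) = 0.
    move: ux; rewrite uc dotZl => /eqP; rewrite mulf_eq0 => /orP[/eqP k0|/eqP//].
    by move: u0; rewrite uc k0 scale0r eqxx.
  have := cross_decomp w1 w2 (x - x0); rewrite cx scale0r addr0.
  move/(congr1 (fun z => (dot (cross w1 w2) (cross w1 w2))^-1 *: z)).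
  rewrite scalerA mulVf ?dot_eq0// scale1r => -> /=.
  by rewrite memvZ// memvD// memvZ.
move=> _ [_ /= /memv_addP[_ /vlineP[a ->] [_ /vlineP[b ->] ->]] <-].
(* The required combination is the midpoint of these doubled points, so closure under lines
   suffices. *)
set y1 := x0 + (2 * a) *: (x1 - x0); set y2 := x0 + (2 * b) *: (x2 - x0).
have -> : x0 + (a *: w1 + b *: w2) = y1 + 2^-1 *: (y2 - y1).
  by rewrite /w1 /w2 /y1 /y2; apply: rv3P; rewrite !mxE; field.
by apply: affine_hull_affine; apply: affine_hull_affine; exact: affine_hull_sub.
Qed.

End Faces.

(** * Facets, edges and vertices *)

Section Combinatorics.
Context {R : realType}.
Local Notation vec := 'rV[R]_3.
Implicit Types (u v w x y : vec) (s : seq vec) (P F e : set vec).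

Definition polytope P := exists s, s != [::] /\ P = hull s.
Definition fulldim P := forall m (c : R), m != 0 -> exists2 x, P x & dot m x <> c.

(* [p] is in the relative interior of the polytope [G], in terms of functionals only. *)
Definition inner (G : set vec) (p : vec) := G p /\
  forall m, (exists2 x, G x & dot m x <> dot m p) -> exists2 x, G x & dot m p < dot m x.

Lemma polytope_amax P u : polytope P -> polytope (amax P u).
Proof. by move=> [s [s0 ->]]; have [s' [s'0 -> _ _]] := hull_amax u s0; exists s'. Qed.

Lemma polytope_neq0 P : polytope P -> exists x, P x.
Proof.
by move=> [[|a s] [// _ ->]]; exists a; apply: hull_mem; rewrite mem_head.
Qed.

Lemma polytope_convex P x y t : polytope P -> P x -> P y -> 0 <= t -> t <= 1 ->
  P (x + t *: (y - x)).
Proof. by move=> [s [_ ->]] Px Py t0 t1; exact: hull_convex. Qed.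

Lemma polyhedron_polytope P : polyhedron P -> polytope P.
Proof.
move=> [[A [/finite_seqP[s ->] PE]] [x /interior_subset Px]].
exists s; split=> //; apply/eqP => s0; move: Px; rewrite PE s0.
by move=> /(@hull_min _ [::] set0); apply.
Qed.

Lemma face_neq0 P k F : kfaces P k F -> exists x, F x.
Proof. by move=> /kfaces_amax[u [_ _ [x Fx] _]]; exists x. Qed.

Lemma fulldim_nmax P u : polytope P -> fulldim P -> u != 0 -> exists2 x, P x & ~ amax P u x.
Proof.
move=> /(@polytope_amax _ u)/polytope_neq0[x ux] fP u0.
have [y Py uy] := fP u (dot u x) u0; exists y => // /amax_eq-/(_ _ ux).
exact: uy.
Qed.

Lemma facetP P F : kfaces P 2 F -> exists u, [/\ u != 0, F = amax P u & spans u F].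
Proof.
move=> /kfaces_amax[u [u0 FE [x Fx] d]]; exists u; split=> //.
apply/(@affine_dim2 _ _ _ (dot u x)) => // y Fy.
by move: Fx Fy; rewrite FE => Fx Fy; exact: amax_eq Fy Fx.
Qed.

Lemma facet_spans P u : u != 0 -> spans u (amax P u) -> kfaces P 2 (amax P u).
Proof.
move=> u0 us; have [x0 [_ [_ [[x0E _ _] _]]]] := us.
apply/kfaces_amax; exists u; split=> //; first by exists x0.
by apply/(@affine_dim2 _ _ u (dot u x0)) => // y uy; exact: amax_eq uy x0E.
Qed.

Lemma facet_of3 P u x y z : u != 0 -> amax P u x -> amax P u y -> amax P u z ->
  cross (y - x) (z - x) != 0 -> kfaces P 2 (amax P u).
Proof.
move=> u0 ux uy uz c0; apply: facet_spans => //; exists x, y, z; split=> //.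
by split=> //; rewrite dotBr; apply/eqP; rewrite subr_eq0; apply/eqP; apply: (@amax_eq _ P).
Qed.

Lemma spans_const u m (A : set vec) c : spans u A -> u != 0 ->
  (forall x, A x -> dot m x = c) -> exists k, m = k *: u.
Proof.
move=> [x0 [x1 [x2 [[A0 A1 A2] [u1 u2 c0]]]]] u0 mc.
have m1 : dot (x1 - x0) m = 0 by rewrite dotC dotBr !mc// subrr.
have m2 : dot (x2 - x0) m = 0 by rewrite dotC dotBr !mc// subrr.
have uE := perp2 c0 (etrans (dotC _ _) u1) (etrans (dotC _ _) u2).
have mE := perp2 c0 m1 m2.
move: uE mE; set k := _ / _; set l := _ / _ => uE mE.
have k0 : k != 0 by apply: contra_neq u0 => k0; rewrite uE k0 scale0r.
by exists (l / k); rewrite uE scalerA mulfVK// -mE.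
Qed.

(** Facet normals are unique up to a factor; many identifications of facets and of feet of
    perpendiculars reduce to this. *)
Lemma facet_const P F u m c d : kfaces P 2 F -> u != 0 ->
  (forall x, F x -> dot u x = d) -> (forall x, F x -> dot m x = c) ->
  exists k, m = k *: u.
Proof.
move=> /facetP[w [w0 _ ws]] u0 uc mc.
have [k uE] := spans_const ws w0 uc; have [l mE] := spans_const ws w0 mc.
have k0' : k != 0 by apply: contra_neq u0 => k0'; rewrite uE k0' scale0r.
by exists (l / k); rewrite uE scalerA mulfVK// -mE.
Qed.

Lemma facet_inner P F : polytope P -> kfaces P 2 F -> exists p, inner F p.
Proof.
move=> pP /facetP[u [u0 FE us]]; have [x0 [x1 [x2 [[F0 F1 F2] [u1 u2 c0]]]]] := us.
(* The centroid of the three points: a functional that nowhere on [F] exceeds its value there is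
   equal at all three, hence constant on the plane of [F]. *)
pose p := x0 + (2 / 3) *: ((x1 + 2^-1 *: (x2 - x1)) - x0).
have pF : polytope F by rewrite FE; exact: polytope_amax.
exists p; split.
  have Fm : F (x1 + 2^-1 *: (x2 - x1)) by apply: (polytope_convex pF) => //; lra.
  by apply: (polytope_convex pF F0 Fm) => //; lra.
move=> m [x Fx mx]; apply: contrapT => nex.
have le y : F y -> dot m y <= dot m p.
  by move=> Fy; rewrite leNgt; apply/negP => my; apply: nex; exists y.
have mp : dot m p = (dot m x0 + dot m x1 + dot m x2) / 3 by rewrite /p !dotE; field.
have := le _ F0; have := le _ F1; have := le _ F2; rewrite mp => m2 m1 m0.
have e1 : dot (x1 - x0) m = 0 by rewrite dotC dotBr; lra.
have e2 : dot (x2 - x0) m = 0 by rewrite dotC dotBr; lra.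
have mE := perp2 c0 e1 e2.
have uE := perp2 c0 (etrans (dotC _ _) u1) (etrans (dotC _ _) u2).
apply: mx; rewrite mp.
have : dot u x = dot u x0 by move: Fx F0; rewrite FE; exact: amax_eq.
rewrite uE !dotZl => h; have {h} h : dot (cross (x1 - x0) (x2 - x0)) x = dot (cross (x1 - x0) (x2 - x0)) x0.
  apply: mulfI h; apply: contra_neq u0 => k0'; by rewrite uE k0' scale0r.
have : dot m x = dot m x0 by rewrite mE !dotZl h.
by move=> ->; move: e1 e2; rewrite ![dot _ m]dotC !dotBr; lra.
Qed.

Lemma edgeP P e : kfaces P 1 e <-> exists u, [/\ u != 0, e = amax P u & exists v w,
  [/\ v <> w, e v, e w & forall x, e x -> exists t, x = v + t *: (w - v)]].
Proof.
split=> [/kfaces_amax[u [u0 eE _ /affine_dim1 d]]|[u [u0 eE d]]]; first by exists u.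
apply/kfaces_amax; exists u; split=> //; last by apply/affine_dim1.
by have [v [w [_ ev _ _]]] := d; exists v.
Qed.

Lemma vertexP P v : kfaces P 0 [set v] <-> exists2 u, u != 0 & amax P u = [set v].
Proof.
split=> [/kfaces_amax[u [u0 uE _ _]]|[u u0 uE]]; first by exists u.
apply/kfaces_amax; exists u; split=> //; first by exists v.
by apply/affine_dim0; exists v.
Qed.

Lemma vertex_set P V : kfaces P 0 V -> exists v, V = [set v].
Proof. by move=> /kfaces_amax[u [_ _ _ /affine_dim0]]. Qed.

Lemma vertex_in P v : kfaces P 0 [set v] -> P v.
Proof. by move=> /vertexP[u _ uE]; have /amax_sub : amax P u v by rewrite uE. Qed.

Lemma face_trichotomy P u : polytope P -> u != 0 ->
  [\/ kfaces P 0 (amax P u), kfaces P 1 (amax P u) | kfaces P 2 (amax P u)].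
Proof.
move=> pP u0; have [x ux] := polytope_neq0 (polytope_amax u pP).
have [[y uy yx]|sing] := pselect (exists2 y, amax P u y & y <> x); last first.
  apply: Or31; suff -> : amax P u = [set x].
    apply/vertexP; exists u => //; rewrite predeqE => y; split=> [uy|->//].
    by apply: contrapT => yx; apply: sing; exists y.
  rewrite predeqE => y; split=> [uy|->//].
  by apply: contrapT => yx; apply: sing; exists y.
have [[z uz c0]|lin] := pselect (exists2 z, amax P u z & cross (y - x) (z - x) != 0).
  by apply: Or33; exact: facet_of3 ux uy uz c0.
apply: Or32; apply/edgeP; exists u; split=> //; exists x, y; split=> // [/esym//|z uz].
have yx0 : y - x != 0 by rewrite subr_eq0; apply/eqP.
have : cross (y - x) (z - x) = 0.
  by apply/eqP; apply: contrapT => /negP c0; apply: lin; exists z.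
move/(cross_eq0 yx0) => zE; exists (dot (y - x) (z - x) / dot (y - x) (y - x)).
by rewrite -zE addrC subrK.
Qed.

Lemma amax_face P u d : polytope P -> u != 0 -> exists f M,
  [/\ f != 0, f = M *: u + d & amax (amax P u) d = amax P f].
Proof. by move=> [s [s0 ->]]; exact: amax_amax_neq0. Qed.

Lemma facet_sub_eq P F G : kfaces P 2 F -> kfaces P 2 G -> F `<=` G -> F = G.
Proof.
move=> Ff Gf FG; have [u [u0 FE _]] := facetP Ff; have [w [w0 GE _]] := facetP Gf.
have [x Fx] := face_neq0 Ff.
have [k wE] : exists k, w = k *: u.
  apply: (@facet_const P F u w (dot w x) (dot u x)) => // y Fy.
    by move: Fx Fy; rewrite FE => Fx Fy; exact: amax_eq Fy Fx.
  by move: (FG _ Fx) (FG _ Fy); rewrite GE => Gx Gy; exact: amax_eq Gy Gx.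
have k0' : k != 0 by apply: contra_neq w0 => k0'; rewrite wE k0' scale0r.
rewrite eqEsubset; split=> // y Gy; have Gx := FG _ Fx.
move: Gx Gy Fx; rewrite GE FE => Gx Gy Fx; apply: (amaxP Fx (amax_sub Gy)).
have := amax_eq Gx Gy; rewrite wE !dotZl => /(mulfI k0') ->; exact: lexx.
Qed.

Lemma edge_not_facet P e F : kfaces P 1 e -> kfaces P 2 F -> ~ F `<=` e.
Proof.
move=> /edgeP[u [u0 eE [v [w [vw ev ew lin]]]]] /facetP[m [m0 _ [x [y [z [[Fx Fy Fz] [_ _ c0]]]]]]] Fe.
have [a xE] := lin _ (Fe _ Fx); have [b yE] := lin _ (Fe _ Fy); have [c zE] := lin _ (Fe _ Fz).
move: c0; rewrite (_ : cross _ _ = 0) ?eqxx// xE yE zE.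
by apply: rv3P; rewrite ?mxE /= ?mxE; ring.
Qed.

(** The endpoints are the faces of the edge in its two directions, hence faces of [P]. A vertex
    strictly between them would be the only maximizer of its functional, which is however at least
    as large at one of the ends. *)
Lemma edge_endpoints P e : polytope P -> kfaces P 1 e -> exists v w,
  [/\ v <> w, kfaces P 0 [set v], kfaces P 0 [set w],
   forall x, e x <-> exists t, [/\ 0 <= t, t <= 1 & x = v + t *: (w - v)] &
   forall x, kfaces P 0 [set x] -> e x -> x = v \/ x = w].
Proof.
move=> pP /edgeP[u [u0 eE [a [b [ab ea eb lin]]]]].
have [d dE] : exists d, d = b - a by exists (b - a).
have d0 : 0 < dot d d by rewrite dot_gt0 dE subr_eq0; apply/eqP => /esym.
have pe : polytope e by rewrite eE; exact: polytope_amax.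
have ext c : (c = 1 \/ c = -1) -> exists v, [/\ kfaces P 0 [set v], e v &
    forall x, e x -> c * dot d x <= c * dot d v].
  move=> c1; have [f [M [f0 _ fE]]] := amax_face (c *: d) pP u0.
  have [v vE] := polytope_neq0 (polytope_amax (c *: d) pe).
  have vE' : amax P f = [set v].
    rewrite -fE -eE predeqE => x; split=> [xE|->//].
    have [s sE] := lin _ (amax_sub vE); have [t tE] := lin _ (amax_sub xE).
    have := amax_eq vE xE; rewrite sE tE -dE !dotE => h.
    suff -> : s = t by [].
    have c0 : c != 0 by case: c1 => ->; rewrite ?oppr_eq0 oner_eq0.
    have {}h : c * (s * dot d d) = c * (t * dot d d) by lra.
    exact: (mulIf (lt0r_neq0 d0) (mulfI c0 h)).
  exists v; split; first by apply/vertexP; exists f.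
    exact: amax_sub vE.
  by move=> x ex; rewrite -!dotZl; case: vE => _; apply.
have [w [wv ew wm]] := ext 1 (or_introl erefl).
have [v [vv ev vm]] := ext (-1) (or_intror erefl).
have [s vE] := lin _ ev; have [t wE] := lin _ ew.
have st : s < t.
  have := wm _ eb; have := vm _ ea; rewrite vE wE -dE.
  have -> : b = a + 1 *: d by rewrite scale1r dE addrC subrK.
  rewrite !dotE => h1 h2; have h1' : s * dot d d <= 0 by lra.
  have h2' : dot d d <= t * dot d d by lra.
  nra.
have seg x : e x <-> exists t0, [/\ 0 <= t0, t0 <= 1 & x = v + t0 *: (w - v)].
  split=> [ex|[r [r0 r1 ->]]]; last exact: polytope_convex.
  have [r xE] := lin _ ex.
  have := wm _ ex; have := vm _ ex; rewrite vE wE xE -dE !dotE => h1 h2.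
  have h1' : s * dot d d <= r * dot d d by lra.
  have h2' : r * dot d d <= t * dot d d by lra.
  rewrite !ler_pM2r// in h1' h2'.
  exists ((r - s) / (t - s)); split.
  - by rewrite divr_ge0// subr_ge0// ltW.
  - by rewrite ler_pdivrMr ?subr_gt0// mul1r; lra.
  - by apply: rv3P; rewrite !mxE; field; rewrite subr_eq0 gt_eqF.
exists v, w; split=> //.
  move=> vw; move: st; suff -> : s = t by rewrite ltxx.
  have : dot d v = dot d w by rewrite vw.
  rewrite vE wE -dE !dotE => /addrI h; exact: (mulIf (lt0r_neq0 d0) h).
move=> x /vertexP[m m0 mE] /seg[r [r0 r1 xE]].
have mx : amax P m x by rewrite mE.
have uniq y : P y -> dot m x <= dot m y -> y = x by move=> Py /(amaxP mx Py); rewrite mE.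
have [/(uniq _ (vertex_in vv))|h1] := leP (dot m x) (dot m v); first by left.
have [/(uniq _ (vertex_in wv))|h2] := leP (dot m x) (dot m w); first by right.
exfalso; move: h1 h2; rewrite xE !dotE => h1 h2.
have [h|h] := leP (dot m w) (dot m v).
  by have := mulr_ge0 r0 (_ : 0 <= dot m v - dot m w); rewrite subr_ge0 => /(_ h); lra.
have r1' : 0 <= 1 - r by rewrite subr_ge0.
by have := mulr_ge0 r1' (_ : 0 <= dot m w - dot m v); rewrite subr_ge0 => /(_ (ltW h)); lra.
Qed.

Lemma edge_line P e v w x u : kfaces P 1 e -> e v -> e w -> v <> w -> e = amax P u ->
  P x -> ~ e x -> cross (w - v) (x - v) != 0.
Proof.
move=> ee ev ew vw eE Px nex; apply: cross_neq0.
  by rewrite subr_eq0; apply/eqP => /esym.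
move=> k xE; apply: nex; rewrite eE.
have uv : amax P u v by rewrite -eE.
apply: amaxP uv Px _; rewrite -[x](subrK v) xE !dotE.
have -> : dot u w = dot u v by apply: (@amax_eq _ P); rewrite -eE.
lra.
Qed.

End Combinatorics.

(** * The two facets at an edge, and dual normals *)

Section FacetNormals.
Context {R : realType}.
Local Notation vec := 'rV[R]_3.
Implicit Types (u v w x y z : vec) (s : seq vec) (P F G e : set vec).

(** Interiority of [z] in terms of functionals only; it also makes [P] full-dimensional. *)
Definition strict P z := forall u, u != 0 -> exists2 y, P y & dot u z < dot u y.

Lemma strict_fulldim P z : strict P z -> fulldim P.
Proof.
move=> sP m c m0; have [y Py zy] := sP m m0.
have [|y' Py' zy'] := sP (- m); first by rewrite oppr_eq0.
have [e|e] := eqVneq (dot m y) c; last by exists y => //; apply/eqP.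
by exists y' => // e'; move: zy'; rewrite !dotNl e'; lra.
Qed.

Lemma amax_opp_full P u x : fulldim P -> u != 0 -> amax P u x -> amax P (- u) x -> False.
Proof.
move=> fP u0 [Px mx] [_ mx']; have [y Py uy] := fP u (dot u x) u0.
apply: uy; apply: le_anti; rewrite mx//=.
by have := mx' _ Py; rewrite !dotNl lerN2.
Qed.

(** The supporting plane of the edge is rotated in the direction [c] until it meets a new point of
    [P]. As [c] is constant on the edge, all of the edge stays in the new face, which has a third
    point off its line. *)
Lemma edge_tilt P e u c v w : polytope P -> fulldim P -> kfaces P 1 e -> u != 0 ->
  e = amax P u -> e v -> e w -> v <> w -> dot c (w - v) = 0 -> cross u c != 0 ->
  exists g, [/\ c + g *: u != 0, kfaces P 2 (amax P (c + g *: u)) &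
    e `<=` amax P (c + g *: u)].
Proof.
move=> pP fP ee u0 eE ev ew vw cvw c0.
have f0 g : c + g *: u != 0.
  apply: contra_neq c0 => /eqP; rewrite addr_eq0 => /eqP ->.
  by apply: rv3P; rewrite ?mxE /= ?mxE; ring.
have [x0 Px0 nx0] := fulldim_nmax pP fP u0.
have [s [s0 PE]] := pP; rewrite PE in Px0 nx0 *; rewrite -PE.
have [|g [x [Px nx fx sub _]]] := rotate c s0 (u := u); first by exists x0.
rewrite -PE in Px nx fx sub.
have esub : e `<=` amax P (c + g *: u).
  move=> y ey; apply: sub; rewrite -eE; split=> // y' ey'.
  have [u' [_ _ [a [b [ab ea eb lin]]]]] := (edgeP P e).1 ee.
  have [t vE] := lin _ ev; have [r wE] := lin _ ew; have [p yE] := lin _ ey.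
  have [q y'E] := lin _ ey'.
  have cab : dot c (b - a) = 0.
    have : (r - t) * dot c (b - a) = 0.
      by rewrite -cvw vE wE -dotZr; congr dot; vring.
    move/eqP; rewrite mulf_eq0 subr_eq0 => /orP[/eqP rt|/eqP//].
    by case: vw; rewrite vE wE rt.
  by rewrite y'E yE [dot c (a + q *: _)]dotDr [dot c (a + p *: _)]dotDr !dotZr cab !mulr0.
exists g; split=> //.
have nex : ~ e x by rewrite eE.
have := edge_line ee ev ew vw eE Px nex.
exact: facet_of3 (f0 g) (esub _ ev) (esub _ ew) fx.
Qed.

Lemma edge_two_facets P e : polytope P -> fulldim P -> kfaces P 1 e -> exists F G,
  [/\ kfaces P 2 F, kfaces P 2 G, F <> G, e `<=` F & e `<=` G].
Proof.
move=> pP fP ee; have [u [u0 eE [v [w [vw ev ew lin]]]]] := (edgeP P e).1 ee.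
have uvw : dot u (w - v) = 0.
  by rewrite dotBr; apply/eqP; rewrite subr_eq0; apply/eqP; apply: (@amax_eq _ P); rewrite -eE.
have wv0 : w - v != 0 by rewrite subr_eq0; apply/eqP => /esym.
pose c := cross u (w - v).
have cvw : dot c (w - v) = 0 by rewrite dotC dot_crossr.
have uc : dot u c = 0 by rewrite dot_crossl.
have c0 : c != 0.
  by rewrite -dot_eq0 dot_cross_cross uvw expr0n subr0 mulf_neq0 ?dot_eq0.
have ucr : cross u c != 0.
  by rewrite -dot_eq0 dot_cross_cross uc expr0n subr0 mulf_neq0 ?dot_eq0.
have ucr' : cross u (- c) != 0.
  rewrite -dot_eq0 dot_cross_cross !(dotNl, dotNr) uc oppr0 expr0n subr0 opprK.
  by rewrite mulf_neq0 ?dot_eq0.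
have [g [f0 Ff Fe]] := edge_tilt pP fP ee u0 eE ev ew vw cvw ucr.
have cvw' : dot (- c) (w - v) = 0 by rewrite dotNl cvw oppr0.
have [h [h0 Gf Ge]] := edge_tilt pP fP ee u0 eE ev ew vw cvw' ucr'.
exists (amax P (c + g *: u)), (amax P (- c + h *: u)); split=> // FG.
have [k kE] : exists k, - c + h *: u = k *: (c + g *: u).
  apply: (@facet_const _ P _ _ _ (dot (- c + h *: u) v) (dot (c + g *: u) v) Ff f0) => x Fx.
    exact: amax_eq Fx (Fe _ ev).
  by rewrite FG in Fx; exact: amax_eq Fx (Ge _ ev).
(* Opposite tilts have opposite components along [c], so equal facets would be maximal for a
   functional and for its negative, and [P] would be flat. *)
have k1 : k = -1.
  have : dot c (- c + h *: u) = dot c (k *: (c + g *: u)) by rewrite kE.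
  rewrite !dotE [dot c u]dotC uc !mulr0 !addr0 => h1.
  by apply: (mulIf (x := dot c c)); rewrite ?dot_eq0// -h1 mulN1r.
have uv' : amax P (- (c + g *: u)) v.
  by rewrite -scaleN1r -k1 -kE; exact: Ge.
exact: amax_opp_full fP f0 (Fe _ ev) uv'.
Qed.

(** Weaker than [strict], since it only tests facet normals: it can be checked for the center of a
    regular polyhedron before the center is known to lie in [P]. *)
Definition inside P z := forall F u x, kfaces P 2 F -> u != 0 -> F = amax P u -> F x ->
  dot u z < dot u x.

Lemma strict_inside P z : strict P z -> inside P z.
Proof.
move=> sP F u x Ff u0 -> [Px mx]; have [y Py zy] := sP u u0.
by apply: lt_le_trans zy _; exact: mx.
Qed.

(** The normal is scaled so that the facet is at level one above [z]: [y] is the vertex of the polar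
    dual of [P] about [z] that corresponds to [F]. *)
Definition facet_normal P z F y := (forall x, P x -> dot y (x - z) <= 1) /\
  F = [set x | P x /\ dot y (x - z) = 1].

Lemma facet_normal_exists P z F : inside P z -> kfaces P 2 F -> exists y, facet_normal P z F y.
Proof.
move=> iP Ff; have [u [u0 FE _]] := facetP Ff; have [x Fx] := face_neq0 Ff.
have zx := iP F u x Ff u0 FE Fx.
have h0 : 0 < dot u (x - z) by rewrite dotBr subr_gt0.
have FxE y : F y -> dot u y = dot u x by move: Fx; rewrite FE => Fx Fy; exact: amax_eq Fy Fx.
exists ((dot u (x - z))^-1 *: u); split=> [y Py|].
  rewrite dotZl mulrC ler_pdivrMr// mul1r !dotBr lerD2r.
  by move: Fx; rewrite FE => -[_]; apply.
rewrite predeqE => y; split=> [Fy|[Py]].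
  split; first by move: Fy; rewrite FE; exact: amax_sub.
  by rewrite dotZl !dotBr (FxE y)// mulVf// -dotBr gt_eqF.
rewrite dotZl => /(congr1 (fun t => dot u (x - z) * t)).
rewrite mulrA mulfV ?gt_eqF// mul1r mulr1 !dotBr => /addIr uy.
by move: Fx; rewrite FE => Fx; apply: amaxP Fx Py _; rewrite uy.
Qed.

Lemma facet_normal_amax P z F y : kfaces P 2 F -> facet_normal P z F y ->
  y != 0 /\ F = amax P y.
Proof.
move=> Ff [le FE]; have [x Fx] := face_neq0 Ff; move: (Fx); rewrite {1}FE => -[Px yx].
split; first by apply: contra_eq_neq yx => ->; rewrite dot0l eq_sym oner_eq0.
have xm : amax P y x.
  by split=> // t /le; rewrite -yx !dotBr lerD2r.
rewrite predeqE => t; split.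
  rewrite {1}FE => -[Pt yt]; apply: amaxP xm Pt _.
  by move: yt; rewrite -yx !dotBr => /addIr ->.
move=> tm; rewrite FE; split; first exact: amax_sub tm.
by rewrite -yx !dotBr (amax_eq xm tm).
Qed.

Lemma facet_normal_eq P z F G y y' : kfaces P 2 F -> facet_normal P z F y ->
  facet_normal P z G y' -> F `<=` G -> y = y'.
Proof.
move=> Ff Fy Gy FG; have [y0 _] := facet_normal_amax Ff Fy.
have [x Fx] := face_neq0 Ff.
have cst H y0' : facet_normal P z H y0' -> forall t, H t -> dot y0' t = 1 + dot y0' z.
  by move=> [_ ->] t [_]; rewrite dotBr => <-; rewrite subrK.
have [k kE] := @facet_const _ P F y y' _ _ Ff y0 (cst _ _ Fy) (fun t Ft => cst _ _ Gy t (FG _ Ft)).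
move: (Fx) (FG _ Fx); rewrite {1}(proj2 Fy) (proj2 Gy) => -[_ e1] [_].
by rewrite kE dotZl e1 mulr1 => ->; rewrite scale1r.
Qed.

(** At a point of [G] the inequalities of [F] and [K] combine to an equality with positive weights,
    so both are equalities and [G] lies in [F]. Dually, no vertex of the polar lies between two
    others. *)
Lemma facet_normal_between P z F G K y1 y2 y3 t : 0 < t -> t < 1 ->
  kfaces P 2 F -> kfaces P 2 G -> kfaces P 2 K ->
  facet_normal P z F y1 -> facet_normal P z G y2 -> facet_normal P z K y3 ->
  y2 = y1 + t *: (y3 - y1) -> F = G.
Proof.
move=> t0 t1 Ff Gf Kf Fy Gy Ky yE; apply/esym/(facet_sub_eq Gf Ff) => x.
rewrite (proj2 Gy) (proj2 Fy) => -[Px]; rewrite yE !dotE => h; split=> //.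
have := proj1 Fy _ Px; have := proj1 Ky _ Px; rewrite !dotE => h3 h1.
nra.
Qed.

(** The normals of the facets through an edge satisfy two linear equations and so lie on a line; of
    three different points on a line one is between the others. The case distinction finds out
    which. *)
Lemma edge_facets_le2 P z e F G K : inside P z -> kfaces P 1 e ->
  kfaces P 2 F -> kfaces P 2 G -> kfaces P 2 K -> e `<=` F -> e `<=` G -> e `<=` K ->
  F <> G -> F <> K -> G <> K -> False.
Proof.
move=> iP ee Ff Gf Kf eF eG eK FG FK GK.
have [u [u0 eE [v [w [vw ev ew lin]]]]] := (edgeP P e).1 ee.
have [y1 Fy] := facet_normal_exists iP Ff.
have [y2 Gy] := facet_normal_exists iP Gf.
have [y3 Ky] := facet_normal_exists iP Kf.
have one H y : facet_normal P z H y -> e `<=` H -> dot (v - z) y = 1 /\ dot (w - v) y = 0.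
  move=> [_ HE] eH; move: (eH _ ev) (eH _ ew); rewrite HE => -[_ e1] [_ e2].
  by split; rewrite dotC//; move: e1 e2; rewrite !dotE; lra.
have [F1 F2] := one _ _ Fy eF; have [G1 G2] := one _ _ Gy eG; have [K1 K2] := one _ _ Ky eK.
have vz0 : v - z != 0 by apply: contra_eq_neq F1 => ->; rewrite dot0l eq_sym oner_eq0.
have c0 : cross (v - z) (w - v) != 0.
  apply: cross_neq0 => // k kE; move: F2; rewrite kE dotZl F1 mulr1 => k0.
  by apply: vw; apply/eqP; rewrite eq_sym -subr_eq0 kE k0 scale0r.
have lin2 y : dot (v - z) y = 1 -> dot (w - v) y = 0 -> exists m,
    y = y1 + m *: cross (v - z) (w - v).
  move=> e1 e2; exists (dot (cross (v - z) (w - v)) (y - y1) /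
    dot (cross (v - z) (w - v)) (cross (v - z) (w - v))).
  rewrite -(perp2 c0) ?[_ + (_ - _)]addrC ?subrK//.
    by rewrite dotBr e1 F1 subrr.
  by rewrite dotBr e2 F2 subrr.
have [m2 y2E] := lin2 _ G1 G2; have [m3 y3E] := lin2 _ K1 K2.
move: y2E y3E; move: (cross _ _) => n y2E y3E.
have m20 : m2 != 0.
  apply: contra_not_neq FG => m20; rewrite (proj2 Fy) (proj2 Gy) y2E m20 scale0r addr0//.
have m30 : m3 != 0.
  apply: contra_not_neq FK => m30; rewrite (proj2 Fy) (proj2 Ky) y3E m30 scale0r addr0//.
have m23 : m2 != m3.
  by apply: contra_not_neq GK => m23; rewrite (proj2 Gy) (proj2 Ky) y2E y3E m23.
have btw (a b c : R) : a < b -> b < c -> 0 < (b - a) / (c - a) < 1.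
  move=> ab bc; have ac := lt_trans ab bc; apply/andP; split.
    by apply: divr_gt0; rewrite subr_gt0.
  by rewrite ltr_pdivrMr ?subr_gt0// mul1r ltrD2r.
have step A B C (a b c : R) ya yb yc : a < b -> b < c -> kfaces P 2 A -> kfaces P 2 B -> kfaces P 2 C ->
    facet_normal P z A ya -> facet_normal P z B yb -> facet_normal P z C yc ->
    ya = y1 + a *: n -> yb = y1 + b *: n -> yc = y1 + c *: n -> A = B.
  move=> ab bc Af Bf Cf Aa Bb Cc aE bE cE.
  have /andP[t0 t1] := btw _ _ _ ab bc.
  apply: (facet_normal_between t0 t1 Af Bf Cf Aa Bb Cc).
  have ca : c - a != 0 by rewrite subr_eq0 gt_eqF//; exact: lt_trans bc.
  by rewrite aE bE cE; apply: rv3P; rewrite !mxE; field.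
have y1E : y1 = y1 + 0 *: n by rewrite scale0r addr0.
have [h1|h1|h1] := ltgtP 0 m2; last by rewrite -h1 eqxx in m20.
- have [h2|h2|h2] := ltgtP m2 m3; last by rewrite h2 eqxx in m23.
    exact/FG/(step _ _ _ _ _ _ _ _ _ h1 h2 Ff Gf Kf Fy Gy Ky y1E y2E y3E).
  have [h3|h3|h3] := ltgtP 0 m3; last by rewrite -h3 eqxx in m30.
    exact/FK/(step _ _ _ _ _ _ _ _ _ h3 h2 Ff Kf Gf Fy Ky Gy y1E y3E y2E).
  exact/FK/esym/(step _ _ _ _ _ _ _ _ _ h3 h1 Kf Ff Gf Ky Fy Gy y3E y1E y2E).
- have [h2|h2|h2] := ltgtP m2 m3; last by rewrite h2 eqxx in m23.
    have [h3|h3|h3] := ltgtP 0 m3; last by rewrite -h3 eqxx in m30.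
      exact/FG/esym/(step _ _ _ _ _ _ _ _ _ h1 h3 Gf Ff Kf Gy Fy Ky y2E y1E y3E).
    exact/GK/(step _ _ _ _ _ _ _ _ _ h2 h3 Gf Kf Ff Gy Ky Fy y2E y3E y1E).
  exact/GK/esym/(step _ _ _ _ _ _ _ _ _ h2 h1 Kf Gf Ff Ky Gy Fy y3E y2E y1E).
Qed.

Lemma edge_facets P z e : polytope P -> strict P z -> kfaces P 1 e -> exists F G,
  [/\ kfaces P 2 F, kfaces P 2 G, F <> G, (e `<=` F) /\ (e `<=` G) &
      forall K, kfaces P 2 K -> e `<=` K -> K = F \/ K = G].
Proof.
move=> pP sP ee; have [F [G [Ff Gf FG eF eG]]] := edge_two_facets pP (strict_fulldim sP) ee.
exists F, G; split=> // K Kf eK; apply: contrapT => /not_orP[KF KG].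
by apply: (edge_facets_le2 (strict_inside sP) ee Ff Gf Kf) => // /esym.
Qed.

End FacetNormals.

(** * Rays inside a facet *)

Section Exits.
Context {R : realType}.
Local Notation vec := 'rV[R]_3.
Implicit Types (u v w x y z c d p : vec) (s : seq vec) (P F G e : set vec).

Lemma facet_nonconst P F u m p : kfaces P 2 F -> u != 0 -> F = amax P u -> F p ->
  (forall k, m <> k *: u) -> exists2 x, F x & dot m x <> dot m p.
Proof.
move=> Ff u0 FE Fp mu; apply: contrapT => nex.
have [||k] := @facet_const _ P F u m (dot m p) (dot u p) Ff u0; last exact: mu.
  by move=> x; move: Fp; rewrite FE => Fp Fx; exact: amax_eq Fx Fp.
by move=> x Fx; apply: contrapT => mx; apply: nex; exists x.
Qed.

Lemma facet_edge P F u f x y w : polytope P -> kfaces P 2 F -> u != 0 -> F = amax P u ->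
  amax F f x -> amax F f y -> x <> y -> F w -> ~ amax F f w ->
  kfaces P 1 (amax F f).
Proof.
move=> pP Ff u0 FE fx fy xy Fw nfw.
have [g [M [g0 gE fgE]]] := amax_face f pP u0.
rewrite FE in fx fy nfw *; rewrite fgE in fx fy nfw *.
have [|//|Gf] := face_trichotomy pP g0.
  move=> /vertex_set[v vE]; case: xy.
  by move: fx fy; rewrite vE => -> ->.
exfalso; have GF : amax P g `<=` F by rewrite -fgE -FE; exact: amax_sub.
by apply: nfw; rewrite (facet_sub_eq Gf Ff GF).
Qed.

(** A linear program in the plane of the facet, with axes [d] and [d']: the exit point is the
    farthest crossing of the line through [c] by a segment between generators, and the edge is the
    face exposed there by a supporting line. *)
Lemma facet_exit P F u c d : polytope P -> kfaces P 2 F -> u != 0 -> F = amax P u ->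
  inner F c -> d != 0 -> dot u d = 0 ->
  exists e t, [/\ kfaces P 1 e, e `<=` F, 0 < t & e (c + t *: d)].
Proof.
move=> pP Ff u0 FE [Fc inn] d0 ud.
have [s [s0 FsE]] : polytope F by rewrite FE; exact: polytope_amax.
have [d' d'E] : exists d', d' = cross u d by exists (cross u d).
have ud' : dot u d' = 0 by rewrite d'E dot_crossl.
have dd' : dot d d' = 0 by rewrite d'E dot_crossr.
have d'0 : d' != 0.
  by rewrite d'E -dot_eq0 dot_cross_cross ud expr0n subr0 mulf_neq0 ?dot_eq0.
have D0 : 0 < dot d d by rewrite dot_gt0.
have np m : m != 0 -> dot u m = 0 -> forall k, m <> k *: u.
  move=> m0 um k mE; move: um; rewrite mE dotZr => /eqP.
  rewrite mulf_eq0 dot_eq0 (negPf u0) orbF => /eqP k0'.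
  by move: m0; rewrite mE k0' scale0r eqxx.
have side m : m != 0 -> dot u m = 0 -> exists2 a, a \in s & dot m c < dot m a.
  move=> m0 um; have [x Fx mx] : exists2 x, F x & dot m c < dot m x.
    exact/inn/(facet_nonconst Ff u0 FE Fc)/np.
  by rewrite FsE in Fx; exact: hull_lt Fx mx.
pose X a := dot d a - dot d c; pose Y a := dot d' a - dot d' c.
have sF a : a \in s -> F a by rewrite FsE; exact: hull_mem.
have ext x y : F x -> F y -> dot d x = dot d y -> dot d' x = dot d' y -> x = y.
  move=> Fx Fy dxy d'xy; apply/eqP; rewrite -subr_eq0; apply/eqP.
  have c0 : cross u d != 0 by rewrite -d'E.
  have uxy : dot u (x - y) = 0.
    by rewrite dotBr; apply/eqP; rewrite subr_eq0; apply/eqP; apply: (@amax_eq _ P); rewrite -FE.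
  have dxy' : dot d (x - y) = 0 by rewrite dotBr dxy subrr.
  by rewrite (perp2 c0 uxy dxy') -d'E dotBr d'xy subrr mul0r scale0r.
have FX x y : F x -> F y -> forall t, 0 <= t -> t <= 1 -> F (x + t *: (y - x)).
  by move=> *; rewrite FsE; apply: hull_convex => //; rewrite -FsE.
pose U := [seq a <- s | 0 < Y a]; pose L := [seq a <- s | Y a < 0].
have [a0 a0s a0Y] := side d' d'0 ud'.
have [b0 b0s b0Y] : exists2 b, b \in s & Y b < 0.
  have [||b bs bY] := side (- d'); first by rewrite oppr_eq0.
    by rewrite dotNr ud' oppr0.
  by exists b => //; move: bY; rewrite !dotNl ltrN2 /Y subr_lt0.
have U0 : U != [::].
  have : a0 \in U by rewrite mem_filter a0s /Y subr_gt0 a0Y.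
  by case: (U).
(* the points where the segments joining points of [s] cross the line *)
pose I (ab : vec * vec) := (X ab.1 * - Y ab.2 + X ab.2 * Y ab.1) / (Y ab.1 - Y ab.2).
pose C := [seq (a, b) | a <- U, b <- L] ++ [seq (a, b0) | a <- s & Y a == 0].
have C0 : C != [::].
  have : (a0, b0) \in C.
    rewrite mem_cat; apply/orP; left; apply/allpairsP; exists (a0, b0) => /=.
    by rewrite !mem_filter a0s b0s b0Y /Y subr_gt0 a0Y.
  by case: (C).
have [[a1 b1] Cab maxC] := seq_max I C0.
have [X' X'E] : exists X', X' = I (a1, b1) by eexists.
rewrite -X'E in maxC.
have [a2 a2U mina2] := seq_max (fun a => - ((X' - X a) / Y a)) U0.
(* The line through the crossing point and [a2], chosen with the smallest [tau], supports the facet: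
   for generators above the axis by the choice of [a2], for those below because their crossings with
   [a2] are not beyond [X']. *)
pose tau := (X' - X a2) / Y a2.
move: (a2U); rewrite mem_filter => /andP[a2Y a2s].
have leX a : a \in s -> X a + tau * Y a <= X'.
  move=> sa; have [aY|aY|aY] := ltgtP (Y a) 0.
  - have /maxC : (a2, a) \in C.
      rewrite mem_cat; apply/orP; left; apply/allpairsP; exists (a2, a) => /=.
      by rewrite a2U mem_filter aY sa.
    rewrite /I /= ler_pdivrMr; last by rewrite subr_gt0; exact: lt_trans a2Y.
    have e2 : X a2 = X' - tau * Y a2 by rewrite /tau mulfVK ?gt_eqF//; ring.
    rewrite e2; move: aY a2Y; nra.
  - have /mina2 : a \in U by rewrite mem_filter aY sa.
    by rewrite lerN2 -/tau ler_pdivlMr//; lra.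
  - rewrite aY mulr0 addr0; have /maxC : (a, b0) \in C.
      rewrite mem_cat; apply/orP; right; apply/mapP; exists a => //.
      by rewrite mem_filter aY eqxx sa.
    by rewrite /I /= aY mulr0 addr0 sub0r mulfK// oppr_eq0 lt_eqF.
pose f := d + tau *: d'.
have fE a : dot f a - dot f c = X a + tau * Y a by rewrite /f !dotE /X /Y; ring.
have f0 : f != 0.
  have : dot d f != 0 by rewrite /f dotDr dotZr dd' mulr0 addr0 gt_eqF.
  by apply: contra_neq => ->; rewrite dot0r.
have uf : dot u f = 0 by rewrite /f !dotE ud ud'; ring.
have leF x : F x -> dot f x - dot f c <= X'.
  rewrite FsE => Fx; rewrite lerBlDr; apply: hull_le Fx => a sa.
  by rewrite -lerBlDr fE leX.
have [x Fx fx] : exists2 x, F x & dot f c < dot f x.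
  exact/inn/(facet_nonconst Ff u0 FE Fc)/np.
have X'0 : 0 < X' by have := leF _ Fx; lra.
have Fp : F (c + (X' / dot d d) *: d).
  have [q [Fq qX qY]] : exists q, [/\ F q, X q = X' & Y q = 0].
    move: Cab; rewrite mem_cat => /orP[/allpairsP[[a b] /= [aU bL [a1E b1E]]]|/mapP[a] ].
      rewrite a1E b1E in X'E.
      rewrite !mem_filter in aU bL; have /andP[aY sa] := aU; have /andP[bY sb] := bL.
      have ab0 : 0 < Y a - Y b by rewrite subr_gt0; exact: lt_trans aY.
      exists (a + (Y a / (Y a - Y b)) *: (b - a)); split.
      - apply: FX; [exact: sF|exact: sF| |]; first by rewrite divr_ge0// ltW.
        by rewrite ler_pdivrMr// mul1r; lra.
      - rewrite X'E /I /=; move: (lt0r_neq0 ab0); rewrite /Y /X !dotE => h; field; exact: h.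
      - move: (lt0r_neq0 ab0); rewrite /Y !dotE => h; field; exact: h.
    rewrite mem_filter => /andP[/eqP aY sa] [a1E b1E]; exists a; split=> //; first exact: sF.
    by rewrite X'E a1E b1E /I /= aY mulr0 addr0 sub0r mulfK// oppr_eq0 lt_eqF.
  suff -> : c + (X' / dot d d) *: d = q by [].
  have [k Fk] : exists k, k = X' / dot d d by eexists.
  have qE : cross u d != 0 by rewrite -d'E.
  have uqc : dot u (q - c - (X' / dot d d) *: d) = 0.
    have : dot u q = dot u c by apply: (@amax_eq _ P); rewrite -FE.
    by rewrite !dotE ud mulr0 => ->; ring.
  have dqc : dot d (q - c - (X' / dot d d) *: d) = 0.
    by rewrite !dotE mulfVK ?gt_eqF// -qX /X; ring.
  have d'qc : dot d' (q - c - (X' / dot d d) *: d) = 0.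
    by rewrite !dotE [dot d' d]dotC dd' mulr0; move: qY; rewrite /Y; lra.
  have := perp2 qE uqc dqc; rewrite -d'E d'qc mul0r scale0r => /eqP.
  by rewrite subr_eq0 subr_eq addrC => /eqP ->; rewrite addrC.
have fp : dot f (c + (X' / dot d d) *: d) - dot f c = X'.
  rewrite dotDr addrAC subrr add0r dotZr /f !dotDl dotZl [dot d' d]dotC dd' mulr0 addr0.
  by rewrite mulfVK// gt_eqF.
have pm : amax F f (c + (X' / dot d d) *: d).
  by split=> // y /leF; rewrite -{1}fp lerD2r.
have a2m : amax F f a2.
  apply: (amaxP pm (sF _ a2s)); suff : dot f a2 - dot f c = X' by rewrite -{1}fp => /addIr ->.
  by rewrite fE /tau mulfVK ?gt_eqF//; ring.
have cnm : ~ amax F f c by move=> /(amax_eq pm); move: fp X'0; lra.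
(* The face contains the crossing point, on the axis, and [a2], off it; it misses [c]. So it is an
   edge. *)
exists (amax F f), (X' / dot d d); split=> //.
- apply: (facet_edge pP Ff u0 FE pm a2m _ Fc cnm) => h.
  move: a2Y; rewrite -h /Y !dotE [dot d' d]dotC dd'; lra.
- exact: amax_sub.
- exact: divr_gt0.
Qed.

(** The analogue of [facet_normal] inside the plane of a facet, with a point [c] of it as origin. *)
Definition edge_normal F c e m := (forall x, F x -> dot m (x - c) <= 1) /\
  e = [set x | F x /\ dot m (x - c) = 1].

Lemma edge_normal_exists P F u c e : kfaces P 2 F -> u != 0 -> F = amax P u ->
  inner F c -> kfaces P 1 e -> e `<=` F -> exists m, edge_normal F c e m /\ dot u m = 0.
Proof.
move=> Ff u0 FE [Fc inn] ee eF; have [w [w0 eE [v [v' [vv' ev ev' _]]]]] := (edgeP P e).1 ee.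
(* Projecting [w] into the plane of the facet subtracts a multiple of [u], which is constant on
   [F]. *)
pose m := w - (dot w u / dot u u) *: u.
have um : dot u m = 0 by rewrite /m !dotE mulfVK ?dot_eq0// [dot u w]dotC subrr.
have Fu x : F x -> dot u x = dot u v.
  by move=> Fx; apply: (@amax_eq _ P); rewrite -FE//; exact: eF.
have mE x : F x -> dot m x - dot m v = dot w x - dot w v.
  by move=> Fx; rewrite /m !dotE (Fu x Fx); ring.
have mle x : F x -> dot m x <= dot m v.
  move=> Fx; rewrite -subr_le0 mE// subr_le0.
  by move: ev; rewrite eE => -[_]; apply; move: Fx; rewrite FE => /amax_sub.
have eE' : e = [set x | F x /\ dot m x = dot m v].
  rewrite predeqE => x; split=> [ex|[Fx mx]].
    split; first exact: eF.
    apply/eqP; rewrite -subr_eq0 mE; last exact: eF.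
    by rewrite subr_eq0; apply/eqP; apply: (@amax_eq _ P); rewrite -eE.
  move: ev; rewrite eE => wv; apply: amaxP wv _ _; first by move: Fx; rewrite FE => /amax_sub.
  by rewrite -subr_le0 -opprB oppr_le0 -mE// mx subrr.
have h0 : 0 < dot m (v - c).
  rewrite dotBr subr_gt0.
  have [|x Fx mx] := inn m; last by apply: lt_le_trans mx _; exact: mle.
  apply: contrapT => nex; apply: (edge_not_facet ee Ff) => x Fx; rewrite eE'; split=> //.
  have cst y : F y -> dot m y = dot m c.
    by move=> Fy; apply: contrapT => my; apply: nex; exists y.
  by rewrite !cst//; exact: eF.
exists ((dot m (v - c))^-1 *: m); split; last by rewrite dotZr um mulr0.
split=> [x Fx|].
  by rewrite dotZl mulrC ler_pdivrMr// mul1r !dotBr lerD2r mle.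
rewrite {1}eE' predeqE => x; split=> -[Fx mx]; split=> //.
  by rewrite dotZl !dotBr mx mulVf// -dotBr gt_eqF.
move: mx; rewrite dotZl => /(congr1 (fun t => dot m (v - c) * t)).
by rewrite mulrA mulfV ?gt_eqF// mul1r mulr1 !dotBr => /addIr.
Qed.

(** Gift wrapping inside the facet: the functional of [e] is rotated about [v], with a functional
    exposing [v] as the direction of rotation. *)
Lemma other_edge P F e v : polytope P -> kfaces P 2 F -> kfaces P 1 e -> e `<=` F ->
  kfaces P 0 [set v] -> e v ->
  exists e', [/\ kfaces P 1 e', e' `<=` F, e' v & e' <> e].
Proof.
move=> pP Ff ee eF /vertexP[wv wv0 wvE] ev.
have [u [u0 FE _]] := facetP Ff; have [w [w0 eE [a [b [ab ea eb _]]]]] := (edgeP P e).1 ee.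
have pF : polytope F by rewrite FE; exact: polytope_amax.
have FP : F `<=` P by rewrite FE; exact: amax_sub.
have eE' : e = amax F w.
  rewrite predeqE => x; split=> [ex|fx].
    split; first exact: eF.
    by move=> y /FP; move: ex; rewrite eE => -[_]; apply.
  rewrite eE; apply: (@amaxP _ _ _ v); [by rewrite -eE|exact/FP/(amax_sub fx)|].
  by case: fx => _; apply; apply: eF.
have nFe : exists2 x, F x & ~ amax F w x.
  apply: contrapT => nex; apply: (edge_not_facet ee Ff) => x Fx.
  by rewrite eE'; apply: contrapT => nx; apply: nex; exists x.
have [s [s0 FsE]] := pF; rewrite FsE in nFe.
have [g [x [Fx nx fx sub1 sub2]]] := rotate wv s0 nFe; rewrite -FsE -?eE' in Fx nx fx sub1 sub2.
have vm : amax e wv v.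
  split=> // y ey; have : amax P wv v by rewrite wvE.
  by case=> _; apply; exact/FP/eF.
have [w' [ew' nw']] : exists w', e w' /\ w' <> v.
  by have [av|av] := eqVneq a v; [exists b; rewrite -av; split=> // /esym|exists a; split=> //; exact/eqP].
have nfw : ~ amax F (wv + g *: w) w'.
  move=> fw'; have /sub2 : (amax F (wv + g *: w) `&` e) w' by [].
  move=> [_ /(_ _ ev)] h; apply: nw'.
  have : amax P wv w' by apply: (@amaxP _ _ _ v) => //; [rewrite wvE|exact/FP/eF].
  by rewrite wvE.
have vf := sub1 _ vm.
exists (amax F (wv + g *: w)); split.
- apply: (facet_edge pP Ff u0 FE vf fx _ (eF _ ew') nfw) => vx; apply: nx; by rewrite -vx.
- exact: amax_sub.
- exact: vf.
- by move=> eq; apply: nfw; rewrite eq.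
Qed.

End Exits.

(** * Interiors in terms of Euclidean length and functionals *)

Section Topology.
Context {R : realType}.
Local Notation vec := 'rV[R]_3.
Implicit Types (u v w x y z c d p : vec) (s : seq vec) (P F G e : set vec).

Lemma nbhs_elen x (A : set vec) :
  nbhs x A <-> exists2 r, 0 < r & forall y, elen (y - x) < r -> A y.
Proof.
have coord y (i : 'I_3) : `|y 0 i| <= elen y.
  rewrite -[`|_|]sqrtr_sqr /elen ler_wsqrtr// dot3.
  have := sqr_ge0 (y 0 k0); have := sqr_ge0 (y 0 k1); have := sqr_ge0 (y 0 k2).
  rewrite !expr2; case: i => -[|[|[|//]]] i3.
  - by rewrite (_ : Ordinal i3 = k0); [lra|exact/val_inj].
  - by rewrite (_ : Ordinal i3 = k1); [lra|exact/val_inj].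
  - by rewrite (_ : Ordinal i3 = k2); [lra|exact/val_inj].
split.
  move=> /nbhs_ballP[r r0 rA]; exists r => // y yr; apply: rA.
  rewrite -ball_normE /= -normrN opprB /Num.Def.normr /= mx_normrE.
  apply/bigmax_ltP; split=> // -[i j] _ /=.
  rewrite (ord1 i); exact: le_lt_trans (coord _ _) yr.
(* Three coordinates below [r / 3] have a sum of squares below [r ^+ 2]. *)
move=> [r r0 rA]; apply/nbhs_ballP; exists (r / 3); first by rewrite /= divr_gt0.
move=> y; rewrite -ball_normE /= -normrN opprB /Num.Def.normr /= mx_normrE.
move=> /bigmax_ltP[_ h]; apply: rA.
have hi (i : 'I_3) : `|(y - x) 0 i| < r / 3 by exact: (h (0, i)).
rewrite -(ltr_pXn2r (n := 2)) ?nnegrE ?elen_ge0 ?ltW// elen_sqr dot3.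
have sq (i : 'I_3) : (y - x) 0 i * (y - x) 0 i < r ^+ 2 / 9.
  have -> : r ^+ 2 / 9 = (r / 3) ^+ 2 by field.
  by rewrite -expr2 -real_normK ?num_real// ltr_pXn2r// nnegrE// divr_ge0// ltW.
have := sq k0; have := sq k1; have := sq k2; have : 0 < r ^+ 2 by rewrite exprn_gt0.
lra.
Qed.

Lemma interior_strict P z : interior P z -> strict P z.
Proof.
move=> /nbhs_elen[r r0 rP] u u0; exists (z + (r / (2 * elen u)) *: u).
  apply: rP; rewrite addrAC subrr add0r elenZ ger0_norm.
    by rewrite invfM mulrA mulfVK ?gt_eqF ?elen_gt0//; lra.
  by rewrite divr_ge0 ?mulr_ge0 ?elen_ge0// ltW.
by rewrite dotDr ltrDl dotZr mulr_gt0 ?dot_gt0// divr_gt0// mulr_gt0// elen_gt0.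
Qed.

Lemma relint_inner G x : relint G x -> inner G x.
Proof.
move=> [Gx /nbhs_elen[r r0 rG]]; split=> // m [y Gy myx].
have [h|h|h] := ltgtP (dot m x) (dot m y); [by exists y| |by rewrite h in myx].
have yx0 : y - x != 0.
  by apply: contra_not_neq myx => /eqP; rewrite subr_eq0 => /eqP ->.
pose t := - (r / (2 * elen (y - x))).
have t0 : t < 0 by rewrite oppr_lt0 divr_gt0// mulr_gt0// elen_gt0.
exists (x + t *: (y - x)).
  apply: rG.
    rewrite addrAC subrr add0r elenZ ltr0_norm// opprK.
    by rewrite invfM mulrA mulfVK ?gt_eqF ?elen_gt0//; lra.
  by apply: affine_hull_affine; exact: affine_hull_sub.
rewrite dotDr ltrDl dotZr nmulr_rgt0// dotBr; lra.
Qed.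

Lemma facet_relint P F u x r : kfaces P 2 F -> F = amax P u -> F x -> 0 < r ->
  (forall y, dot u y = dot u x -> elen (y - x) < r -> F y) -> relint F x.
Proof.
move=> Ff FE Fx r0 rF; split=> //; apply/nbhs_elen; exists r => // y yr hy.
apply: rF => //; move: hy; apply: (@affine_hull_min _ _ [set y | dot u y = dot u x]).
  by move=> a b t /= ax bx; rewrite !dotE ax bx; ring.
by move=> a Fa /=; apply: (@amax_eq _ P); rewrite -FE.
Qed.

Lemma segment_relint e v w t : v <> w ->
  (forall x, e x <-> exists t, [/\ 0 <= t, t <= 1 & x = v + t *: (w - v)]) ->
  0 < t -> t < 1 -> relint e (v + t *: (w - v)).
Proof.
move=> vw eE t0 t1.
have d0 : 0 < elen (w - v) by rewrite elen_gt0 subr_eq0; apply/eqP => /esym.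
split; first by apply/eE; exists t; split=> //; exact: ltW.
have r0 : 0 < Num.min t (1 - t) * elen (w - v).
  by rewrite mulr_gt0// lt_min t0 subr_gt0.
apply/nbhs_elen; exists (Num.min t (1 - t) * elen (w - v)) => // y yr hy.
have [r yE] : exists r, y = v + r *: (w - v).
  move: hy; apply: (@affine_hull_min _ _ [set y | exists r, y = v + r *: (w - v)]).
    move=> a b q /= [r1 ->] [r2 ->]; exists (r1 + q * (r2 - r1)); vring.
  by move=> a /eE[q [_ _ ->]]; exists q.
move: yr; have -> : y - (v + t *: (w - v)) = (r - t) *: (w - v) by rewrite yE; vring.
rewrite elenZ ltr_pM2r// lt_min => /andP[].
rewrite !ltr_norml => /andP[h1 h2] /andP[h3 h4].
apply/eE; exists r; split=> //; lra.
Qed.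

Lemma segment_inner e v w x : v <> w ->
  (forall x, e x <-> exists t, [/\ 0 <= t, t <= 1 & x = v + t *: (w - v)]) ->
  inner e x -> exists t, [/\ 0 < t, t < 1 & x = v + t *: (w - v)].
Proof.
move=> vw eE [ex inn]; have /eE[t [t0 t1 xE]] := ex; exists t.
have d0 : 0 < dot (w - v) (w - v) by rewrite dot_gt0 subr_eq0; apply/eqP => /esym.
have ev : e v by apply/eE; exists 0; split=> //; rewrite scale0r addr0.
have ew : e w by apply/eE; exists 1; split=> //; rewrite scale1r addrC subrK.
split=> //.
  rewrite lt_neqAle t0 andbT; apply/negP => /eqP t00.
  have xv : x = v by rewrite xE -t00 scale0r addr0.
  have [|y /eE[q [q0 _ ->]]] := inn (- (w - v)).
    by exists w => //; rewrite xv; apply/eqP; rewrite -subr_eq0 -dotBr dotNl oppr_eq0 gt_eqF.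
  rewrite xv -subr_gt0 -dotBr addrAC subrr add0r dotZr dotNl mulrN oppr_gt0.
  by rewrite ltNge mulr_ge0// ltW.
rewrite lt_neqAle t1 andbT; apply/negP => /eqP t11.
have xw : x = w by rewrite xE t11 scale1r addrC subrK.
have [|y /eE[q [q0 q1 ->]]] := inn (w - v).
  exists v => //; rewrite xw; apply/eqP; rewrite -subr_eq0 -dotBr -[v - w]opprB dotNr.
  by rewrite oppr_eq0 gt_eqF.
rewrite xw -subr_gt0 -dotBr.
have -> : v + q *: (w - v) - w = (q - 1) *: (w - v) by vring.
rewrite dotZr pmulr_lgt0//; lra.
Qed.

(** A functional attaining its maximum over [P] at an inner point of [G] cannot increase on [G], so
    it is constant there. This is the main tool for comparing faces that share a point. *)
Lemma inner_exposed P G u F x : inner G x -> G `<=` P -> F = amax P u -> F x -> G `<=` F.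
Proof.
move=> [Gx inn] GP -> Fx y Gy.
apply: (amaxP Fx (GP _ Gy)); rewrite leNgt; apply/negP => h.
have [|y' Gy'] := inn u; first by exists y => // e; rewrite e ltxx in h.
by case: Fx => _ /(_ _ (GP _ Gy')); rewrite leNgt => /negP.
Qed.

End Topology.

(** * The polytope as an intersection of half-spaces *)

Section HalfSpaces.
Context {R : realType}.
Local Notation vec := 'rV[R]_3.
Implicit Types (u v w x y z c d p : vec) (s : seq vec) (P F G e : set vec).

Lemma facet_normal_sub1 P z F y x : facet_normal P z F y -> F x -> P x /\ dot y (x - z) = 1.
Proof. by move=> [_ ->]. Qed.

Lemma facet_normal_inner P z F G y p : polytope P -> kfaces P 2 F -> kfaces P 2 G -> F <> G ->
  inner F p -> facet_normal P z G y -> dot y (p - z) < 1.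
Proof.
move=> pP Ff Gf FG ip Gy; have [u [u0 FE _]] := facetP Ff.
have FP : F `<=` P by rewrite FE; exact: amax_sub.
have [y0 GE] := facet_normal_amax Gf Gy.
have Pp := FP _ (proj1 ip).
rewrite lt_neqAle (proj1 Gy _ Pp) andbT; apply/negP => /eqP yp.
apply: FG; apply: (facet_sub_eq Ff Gf); apply: (inner_exposed ip FP GE).
by rewrite (proj2 Gy).
Qed.

(** One step of the walks below: from an inner point of a facet, along its plane, across an edge and
    into the adjacent facet, with the values of the new normal at the start and at the exit. *)
Lemma facet_neighbor P c0 z F y p d : polytope P -> strict P c0 -> inside P z ->
  kfaces P 2 F -> facet_normal P z F y -> inner F p -> d != 0 -> dot y d = 0 ->
  exists e t G y', [/\ kfaces P 1 e, e `<=` F, e `<=` G, kfaces P 2 G & G <> F] /\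
    [/\ 0 < t, facet_normal P z G y', dot y' (p - z) < 1,
        dot y' (p + t *: d - z) = 1 & e (p + t *: d)].
Proof.
move=> pP sP iP Ff Fy ip d0 yd; have [y0 FE] := facet_normal_amax Ff Fy.
have [e [t [ee eF t0 et]]] := facet_exit pP Ff y0 FE ip d0 yd.
have [G [Gf GF eG]] : exists G, [/\ kfaces P 2 G, G <> F & e `<=` G].
  have [G1 [G2 [G1f G2f G12 [eG1 eG2] _]]] := edge_facets pP sP ee.
  have [E|E] := pselect (G1 = F); last by exists G1.
  by exists G2; split=> // E2; apply: G12; rewrite E E2.
have [y' Gy] := facet_normal_exists iP Gf.
exists e, t, G, y'; split; split=> //.
  by apply: (facet_normal_inner pP Ff Gf _ ip Gy) => /esym.
by have [] := facet_normal_sub1 Gy (eG _ et).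
Qed.

Lemma inner_mid F p x : inner F p -> F x -> F (p + 2^-1 *: (x - p)) ->
  inner F (p + 2^-1 *: (x - p)).
Proof.
move=> [Fp inn] Fx Fm; split=> // m [y Fy my].
have [h|h] := ltP (dot m p) (dot m x).
  by exists x => //; rewrite !dotE; lra.
have [|x' Fx' mx'] := inn m; last by exists x' => //; rewrite !dotE; lra.
have [e|e] := eqVneq (dot m y) (dot m p); last by exists y => //; exact/eqP.
exists x => // mx; apply: my; rewrite !dotE mx e; lra.
Qed.

Lemma exists_facet P c0 : polytope P -> strict P c0 -> exists F, kfaces P 2 F.
Proof.
move=> pP sP; have fP := strict_fulldim sP.
have ofedge e : kfaces P 1 e -> exists F, kfaces P 2 F.
  by move=> ee; have [F [_ [Ff _ _ _ _]]] := edge_two_facets pP fP ee; exists F.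
pose u : vec := delta_mx 0 k0.
have u0 : u != 0.
  by apply/eqP => /rowP/(_ k0)/eqP; rewrite !mxE eqxx oner_eq0.
have [|ee|Ff] := face_trichotomy pP u0; [|exact: ofedge ee|by exists (amax P u)].
move=> /vertex_set[v vE].
have [m mu] := exists_indep u.
have [x0 Px0 nx0] := fulldim_nmax pP fP u0.
have [s [s0 PE]] := pP; rewrite PE in Px0 nx0.
have [|g [x [Px nx fx sub _]]] := rotate m s0 (u := u); first by exists x0.
rewrite -PE in Px nx fx sub.
have f0 : m + g *: u != 0.
  apply/eqP => /eqP; rewrite addr_eq0 => /eqP mE; apply: (mu (- g)).
  by rewrite mE scaleNr.
have fv : amax P (m + g *: u) v.
  by apply: sub; split; rewrite vE// => y ->.
have [|ee|Ff] := face_trichotomy pP f0; [|exact: ofedge ee|by eexists; exact: Ff].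
move=> /vertex_set[v' vE']; case: nx; move: fx fv; rewrite vE' => -> <-.
by rewrite vE.
Qed.

(** The facet hit by the ray is the one whose normal is greatest on [d]. To see that the ray meets
    that facet and not only its plane, walk from an inner point towards the ray: the neighbour that
    is entered is no better, so the exit does not come before the ray. *)
Lemma ray_facet P c0 z d : polytope P -> strict P c0 -> inside P z ->
  finite_set (kfaces P 2) -> d != 0 ->
  exists F y, [/\ kfaces P 2 F, facet_normal P z F y, 0 < dot y d,
    F (z + (dot y d)^-1 *: d) &
    forall G y', kfaces P 2 G -> facet_normal P z G y' -> dot y' d <= dot y d].
Proof.
move=> pP sP iP /finite_seqP[fs fsE] d0.
have inP G : kfaces P 2 G -> G \in fs by move=> Gf; have : [set` fs] G by rewrite -fsE.
pose nrm G : vec := xget 0 [set y | facet_normal P z G y].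
have nrmP G : kfaces P 2 G -> facet_normal P z G (nrm G).
  by move=> /(facet_normal_exists iP) [y Gy]; rewrite /nrm; case: xgetP => [//|/(_ _ Gy)].
have [F0 F0f] := exists_facet pP sP.
have fs0 : fs != [::] by have := inP _ F0f; case: (fs).
have [F Ffs maxF] := seq_max (fun G => dot (nrm G) d) fs0.
have Ff : kfaces P 2 F by rewrite fsE.
have Fy := nrmP _ Ff; set y := nrm F in Fy maxF.
have mx G y' : kfaces P 2 G -> facet_normal P z G y' -> dot y' d <= dot y d.
  move=> Gf Gy; rewrite (facet_normal_eq Gf Gy (nrmP _ Gf))//.
  exact/maxF/inP.
exists F, y; suff [h1 h2] : 0 < dot y d /\ F (z + (dot y d)^-1 *: d) by split.
have pF : polytope F.
  by have [u [_ -> _]] := facetP Ff; exact: polytope_amax.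
have key p : inner F p -> d - dot y d *: (p - z) != 0 ->
    0 < dot y d /\ F (z + (dot y d)^-1 *: d).
  move=> ip d'0; set l := dot y d in mx d'0 *.
  have [Pp yp] := facet_normal_sub1 Fy (proj1 ip).
  have yd' : dot y (d - l *: (p - z)) = 0 by rewrite dotBr dotZr yp mulr1 subrr.
  have [e [t [G [y' [[ee eF eG Gf GF] [t0 Gy k1 k2 et]]]]]] :=
    facet_neighbor pP sP iP Ff Fy ip d'0 yd'.
  have h := mx _ _ Gf Gy.
  have : dot y' (p - z) + t * (dot y' d - l * dot y' (p - z)) = 1.
    by rewrite -k2 !dotE; ring.
  set k := dot y' (p - z) in k1 * => kE.
  have tl : 1 <= t * l.
    have : 1 - k <= t * l * (1 - k) by nra.
    by rewrite ler_pMl// subr_gt0.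
  have l0 : 0 < l by rewrite -(pmulr_rgt0 _ t0); exact: lt_le_trans tl.
  split=> //.
  have -> : z + l^-1 *: d = p + (t * l)^-1 *: (p + t *: (d - l *: (p - z)) - p).
    by apply: rv3P; rewrite !mxE; field; rewrite !gt_eqF.
  apply: (polytope_convex pF (proj1 ip) (eF _ et)).
    by rewrite invr_ge0; exact: le_trans tl.
  by rewrite invf_le1//; exact: lt_le_trans tl.
have [p ip] := facet_inner pP Ff.
have [d'0|/(key _ ip)//] := eqVneq (d - dot y d *: (p - z)) 0.
have dE : d = dot y d *: (p - z) by apply/eqP; rewrite -subr_eq0; apply/eqP.
have l0 : dot y d != 0 by apply: contra_neq d0 => l0; rewrite dE l0 scale0r.
have [x Fx xp] : exists2 x, F x & x <> p.
  have [u [u0 _ [x [y1 [y2 [[Fx Fy1 Fy2] [_ _ cr]]]]]]] := facetP Ff.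
  have [xp|xp] := eqVneq x p; last by exists x => //; exact/eqP.
  exists y1 => // y1p; move: cr; rewrite y1p xp subrr.
  by rewrite (_ : cross _ _ = 0) ?eqxx//; apply: rv3P; rewrite ?mxE /= ?mxE; ring.
(* When [d] is parallel to [p - z] the walk has no direction; another inner point is taken. *)
apply: (key (p + 2^-1 *: (x - p))).
  apply: inner_mid => //; apply: (polytope_convex pF (proj1 ip) Fx); lra.
have -> : d - dot y d *: (p + 2^-1 *: (x - p) - z) = - (dot y d / 2) *: (x - p).
  by rewrite {1}dE; apply: rv3P; rewrite !mxE; field.
rewrite scaler_eq0 oppr_eq0 mulf_eq0 (negPf l0) invr_eq0 pnatr_eq0 /= subr_eq0.
exact/eqP.
Qed.

(** A point satisfying all facet inequalities lies on the segment from [z] to the exit point of its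
    ray. *)
Lemma hrep P c0 z x : polytope P -> strict P c0 -> inside P z ->
  finite_set (kfaces P 2) ->
  (forall F y, kfaces P 2 F -> facet_normal P z F y -> dot y (x - z) <= 1) -> P x.
Proof.
move=> pP sP iP fP h.
have FP F y t : facet_normal P z F y -> F t -> P t by move=> Fy /(facet_normal_sub1 Fy)[].
(* [z] itself lies between the exit points of two opposite rays. *)
have Pz : P z.
  pose d : vec := delta_mx 0 k0.
  have d0 : d != 0.
    by apply/eqP => /rowP/(_ k0)/eqP; rewrite !mxE eqxx oner_eq0.
  have [F [y [_ Fy y0 yF _]]] := ray_facet pP sP iP fP d0.
  have d0' : - d != 0 by rewrite oppr_eq0.
  have [G [y' [_ Gy y0' yG _]]] := ray_facet pP sP iP fP d0'.
  set a := (dot y d)^-1 in yF; set b := (dot y' (- d))^-1 in yG.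
  have a0 : 0 < a by rewrite invr_gt0.
  have b0 : 0 < b by rewrite invr_gt0.
  have -> : z = (z + a *: d) + (a / (a + b)) *: ((z + b *: - d) - (z + a *: d)).
    by apply: rv3P; rewrite !mxE; field; rewrite gt_eqF// addr_gt0.
  apply: (polytope_convex pP (FP _ _ _ Fy yF) (FP _ _ _ Gy yG)).
    by rewrite divr_ge0 ?addr_ge0// ltW.
  by rewrite ler_pdivrMr ?addr_gt0// mul1r lerDl ltW.
have [->//|xz] := eqVneq x z.
have xz0 : x - z != 0 by rewrite subr_eq0.
have [F [y [Ff Fy y0 yF _]]] := ray_facet pP sP iP fP xz0.
have -> : x = z + dot y (x - z) *: (z + (dot y (x - z))^-1 *: (x - z) - z).
  by apply: rv3P; rewrite !mxE; field; rewrite gt_eqF.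
apply: (polytope_convex pP Pz (FP _ _ _ Fy yF)); first exact: ltW.
exact: h Ff Fy.
Qed.

Lemma closure_dot_le P u x h : (forall y, P y -> dot u y <= h) -> closure P x -> dot u x <= h.
Proof.
move=> Ph clx; rewrite leNgt; apply/negP => hx.
pose r := (dot u x - h) / (elen u + 1).
have u1 : 0 < elen u + 1 by have := elen_ge0 u; lra.
have r0 : 0 < r by rewrite divr_gt0// subr_gt0.
have /clx[y [Py yr]] : nbhs x [set y | elen (y - x) < r] by apply/nbhs_elen; exists r.
have := Ph _ Py; apply/negP; rewrite -ltNge.
have := CS_elen u (x - y); rewrite elenC dotBr => cs.
have : elen u * elen (y - x) <= elen u * r.
  by rewrite ler_wpM2l ?elen_ge0// ltW.
have : elen u * r = (dot u x - h) - r by rewrite /r; field; exact: lt0r_neq0.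
lra.
Qed.

(** Off all facets the finitely many inequalities are strict, and a common margin gives a ball
    inside [P]. *)
Lemma bd_facet P c0 z x : polytope P -> strict P c0 -> inside P z ->
  finite_set (kfaces P 2) -> bd P x -> exists F, kfaces P 2 F /\ F x.
Proof.
move=> pP sP iP fP [clx nint]; have /finite_seqP[fs fsE] := fP.
pose nrm G : vec := xget 0 [set y | facet_normal P z G y].
have nrmP G : kfaces P 2 G -> facet_normal P z G (nrm G).
  by move=> /(facet_normal_exists iP) [y Gy]; rewrite /nrm; case: xgetP => [//|/(_ _ Gy)].
have clo F : kfaces P 2 F -> dot (nrm F) (x - z) <= 1.
  move=> /nrmP[le _]; rewrite dotBr lerBlDr; apply: closure_dot_le clx => y /le.
  by rewrite dotBr lerBlDr.
have Px : P x.
  apply: (hrep pP sP iP fP) => F y Ff Fy.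
  by rewrite (facet_normal_eq Ff Fy (nrmP _ Ff))//; exact: clo.
apply: contrapT => nF; apply: nint.
have [|M0 hM] := @seq_dominate _ _ fs (fun G => 1 - dot (nrm G) (x - z)) (fun G => elen (nrm G)).
  move=> G Gfs; have Gf : kfaces P 2 G by rewrite fsE.
  rewrite subr_gt0 lt_neqAle clo// andbT; apply/negP => /eqP e; apply: nF; exists G; split=> //.
  by rewrite (proj2 (nrmP _ Gf)).
pose M := Num.max M0 1.
have M0M : M0 <= M by rewrite le_max lexx.
have M1 : 0 < M by rewrite lt_max ltr01 orbT.
apply/nbhs_elen; exists M^-1; first by rewrite invr_gt0.
move=> x' xx'; apply: (hrep pP sP iP fP) => F y Ff Fy.
rewrite (facet_normal_eq Ff Fy (nrmP _ Ff))//.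
have Ffs : F \in fs by have : [set` fs] F by rewrite -fsE.
have h := hM _ M0M _ Ffs.
have := CS_elen (nrm F) (x' - x); rewrite !dotBr => cs.
have : elen (nrm F) * elen (x' - x) <= elen (nrm F) * M^-1.
  by rewrite ler_wpM2l ?elen_ge0// ltW.
have : elen (nrm F) * M^-1 <= 1 - dot (nrm F) (x - z).
  by rewrite ler_pdivrMr// mulrC ltW.
rewrite dotBr; lra.
Qed.

(** The ray from [z] to [v] ends in a facet; if it went on beyond [v], then [v] would be strictly
    between two points of [P]. *)
Lemma vertex_facet P c0 z v : polytope P -> strict P c0 -> inside P z -> P z ->
  finite_set (kfaces P 2) -> kfaces P 0 [set v] -> v <> z -> exists F, kfaces P 2 F /\ F v.
Proof.
move=> pP sP iP Pz fP vv vz.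
have vz0 : v - z != 0 by rewrite subr_eq0; exact/eqP.
have [F [y [Ff Fy y0 yF _]]] := ray_facet pP sP iP fP vz0.
exists F; split=> //.
have [_ y1] := facet_normal_sub1 Fy yF; have le := proj1 Fy _ (vertex_in vv).
have [e|e] := eqVneq (dot y (v - z)) 1.
  by move: yF; rewrite e invr1 scale1r addrC subrK.
have /vertexP[w w0 wE] := vv.
set l := dot y (v - z) in y0 yF le e y1.
have l1 : l < 1 by rewrite lt_neqAle e.
have Pt : P (z + l^-1 *: (v - z)) by have [] := facet_normal_sub1 Fy yF.
have wv : amax P w v by rewrite wE.
have uq t : P t -> dot w v <= dot w t -> t = v by move=> Pt' /(amaxP wv Pt'); rewrite wE.
have [/(uq _ Pz)/esym//|h1] := leP (dot w v) (dot w z).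
exfalso.
have := proj2 wv _ Pt; rewrite !dotE.
have : 1 < l^-1 by rewrite invf_gt1.
nra.
Qed.

(** The argument of [vertex_facet] inside the facet; an exit before [v] is excluded by the normal of
    the exit edge. *)
Lemma vertex_edge P F c v : polytope P -> kfaces P 2 F -> inner F c -> F v ->
  kfaces P 0 [set v] -> exists e, [/\ kfaces P 1 e, e `<=` F & e v].
Proof.
move=> pP Ff ic Fv vv; have [u [u0 FE _]] := facetP Ff; have /vertexP[w w0 wE] := vv.
have wv : amax P w v by rewrite wE.
have FP : F `<=` P by rewrite FE; exact: amax_sub.
have uq t : P t -> dot w v <= dot w t -> t = v by move=> Pt' /(amaxP wv Pt'); rewrite wE.
have [vc|vc] := eqVneq v c.
  exfalso.
  have sub : F `<=` [set v] by apply: (inner_exposed ic FP (esym wE)); rewrite -vc.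
  have [e [ee eF]] : exists e, kfaces P 1 e /\ e `<=` F.
    have [m mu] := exists_indep u.
    have d0 : cross u m != 0 by exact: cross_neq0.
    have [e [t [ee eF t0 _]]] := facet_exit pP Ff u0 FE ic d0 (dot_crossl _ _).
    by exists e.
  have [a [b [ab va vb _ _]]] := edge_endpoints pP ee.
  have [u' [_ _ [a' [b' [ab' ea eb _]]]]] := (edgeP P e).1 ee.
  by apply: ab'; rewrite (sub _ (eF _ ea)) (sub _ (eF _ eb)).
have d0 : v - c != 0 by rewrite subr_eq0.
have ud : dot u (v - c) = 0.
  rewrite dotBr; apply/eqP; rewrite subr_eq0; apply/eqP.
  by apply: (@amax_eq _ P); rewrite -FE//; case: ic.
have [e [t [ee eF t0 et]]] := facet_exit pP Ff u0 FE ic d0 ud.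
exists e; split=> //.
have Pt := FP _ (eF _ et); have Pc := FP _ (proj1 ic).
have [h1|h1] := leP (dot w v) (dot w c).
  by rewrite (uq _ Pc h1) eqxx in vc.
have [t1|t1] := leP 1 t.
  have ht : dot w v <= dot w (c + t *: (v - c)) by rewrite !dotE; nra.
  by rewrite -(uq _ Pt ht).
exfalso; have [u' [u'0 eE _]] := (edgeP P e).1 ee.
have [m [[mle mE] _]] := edge_normal_exists Ff u0 FE ic ee eF.
move: et; rewrite mE => -[_]; rewrite addrAC subrr add0r dotZr => h.
have := mle _ Fv; have : 0 < dot m (v - c) by rewrite -(pmulr_rgt0 _ t0) h.
by nra.
Qed.

End HalfSpaces.

(** * Areas of plane sectors *)

Section PlaneMeasure.
Context {R : realType}.
Local Notation T1 := (measurableTypeR R).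
Local Notation T2 := (measurableTypeR R * measurableTypeR R)%type.
Local Notation leb := (@lebesgue_measure R).
Implicit Types (A X : set T2).

Definition leb2 : set T2 -> \bar R := (leb \x leb)%E.

HB.instance Definition _ := Measure.on leb2.

Lemma leb2X (A B : set T1) : measurable A -> measurable B -> leb2 (A `*` B) = (leb A * leb B)%E.
Proof. by move=> mA mB; rewrite /leb2 product_measure1E. Qed.

Lemma leb_shift c (A : set T1) : measurable A -> leb [set x | A (x + c)] = leb A.
Proof.
move=> mA.
have mf : measurable_fun setT (fun x : T1 => x + c : T1).
  by apply: measurable_funD => //; exact: measurable_cst.
rewrite -/(pushforward leb (fun x : T1 => x + c : T1) A).
apply/esym/lebesgue_measure_unique => //= _ [[a b]] _ <-.
rewrite /pushforward.
have -> : (fun x : T1 => x + c) @^-1` `]a, b] = `]a - c, b - c]%classic.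
  by rewrite predeqE => x /=; rewrite !in_itv/= ltrBlDr lerBrDr.
rewrite !lebesgue_measure_itv/= !lte_fin ltrD2r.
by case: ifP => // _; congr (_%:E); ring.
Qed.

Definition pres (f : T2 -> T2) := measurable_fun setT f /\
  forall A, measurable A -> leb2 (f @^-1` A) = leb2 A.

Lemma pres_comp f g : pres f -> pres g -> pres (f \o g).
Proof.
move=> [mf f1] [mg g1]; split; first exact: measurableT_comp.
move=> A mA; rewrite comp_preimage g1 ?f1//.
by rewrite -[X in measurable X]setTI; exact: mf.
Qed.

Lemma pres_ext f g : f =1 g -> pres f -> pres g.
Proof. by move=> /funext ->. Qed.

Lemma measurable_lin (a b c : R) :
  measurable_fun setT (fun z : T2 => a + b * z.1 + c * z.2 : R).
Proof.
apply: measurable_funD; [apply: measurable_funD; [exact: measurable_cst|]|].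
  by apply: measurable_funM; [exact: measurable_cst|exact: measurable_fst].
by apply: measurable_funM; [exact: measurable_cst|exact: measurable_snd].
Qed.

Lemma measurable_affine (p q a b c d : R) :
  measurable_fun setT (fun z : T2 => (p + a * z.1 + b * z.2, q + c * z.1 + d * z.2) : T2).
Proof. by apply: measurable_fun_pair; exact: measurable_lin. Qed.

Lemma leb2_swap A : measurable A -> leb2 A = (leb \x^ leb)%E A.
Proof.
by move=> mA; apply: product_measure_unique => // B C mB mC; rewrite /= product_measure2E.
Qed.

(** Every section is translated, so translation invariance on the line suffices. *)
Lemma pres_shear2 (k c : R) : pres (fun z : T2 => (z.1, z.2 + (k * z.1 + c)) : T2).
Proof.
have mf : measurable_fun setT (fun z : T2 => (z.1, z.2 + (k * z.1 + c)) : T2).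
  apply: (eq_measurable_fun (fun z : T2 => (0 + 1 * z.1 + 0 * z.2, c + k * z.1 + 1 * z.2) : T2)).
    by move=> z _; congr (_, _); ring.
  exact: measurable_affine.
split=> // A mA; rewrite /leb2 /product_measure1; apply: eq_integral => x _ /=.
rewrite -(@leb_shift (k * x + c) (xsection A x)); last exact: measurable_xsection.
by congr (leb _); rewrite predeqE => y; rewrite /xsection /= !inE.
Qed.

Lemma pres_shear1 (k c : R) : pres (fun z : T2 => (z.1 + (k * z.2 + c), z.2) : T2).
Proof.
have mf : measurable_fun setT (fun z : T2 => (z.1 + (k * z.2 + c), z.2) : T2).
  apply: (eq_measurable_fun (fun z : T2 => (c + 1 * z.1 + k * z.2, 0 + 0 * z.1 + 1 * z.2) : T2)).
    by move=> z _; congr (_, _); ring.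
  exact: measurable_affine.
split=> // A mA; rewrite !leb2_swap//; last by rewrite -[X in measurable X]setTI; exact: mf.
rewrite /product_measure2; apply: eq_integral => y _ /=.
rewrite -(@leb_shift (k * y + c) (ysection A y)); last exact: measurable_ysection.
by congr (leb _); rewrite predeqE => x; rewrite /ysection /= !inE.
Qed.

Lemma pres_opp2 : pres (fun z : T2 => (z.1, - z.2) : T2).
Proof.
have mf : measurable_fun setT (fun z : T2 => (z.1, - z.2) : T2).
  apply: (eq_measurable_fun (fun z : T2 => (0 + 1 * z.1 + 0 * z.2, 0 + 0 * z.1 + (-1) * z.2) : T2)).
    by move=> z _; congr (_, _); ring.
  exact: measurable_affine.
split=> // A mA; rewrite /leb2 /product_measure1; apply: eq_integral => x _ /=.
rewrite -(@lebesgue_measureN _ (xsection A x)); last exact: measurable_xsection.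
by rewrite /pushforward; congr (leb _); rewrite predeqE => y; rewrite /xsection /= !inE.
Qed.

Lemma pres_opp1 : pres (fun z : T2 => (- z.1, z.2) : T2).
Proof.
have mf : measurable_fun setT (fun z : T2 => (- z.1, z.2) : T2).
  apply: (eq_measurable_fun (fun z : T2 => (0 + (-1) * z.1 + 0 * z.2, 0 + 0 * z.1 + 1 * z.2) : T2)).
    by move=> z _; congr (_, _); ring.
  exact: measurable_affine.
split=> // A mA; rewrite !leb2_swap//; last by rewrite -[X in measurable X]setTI; exact: mf.
rewrite /product_measure2; apply: eq_integral => y _ /=.
rewrite -(@lebesgue_measureN _ (ysection A y)); last exact: measurable_ysection.
by rewrite /pushforward; congr (leb _); rewrite predeqE => x; rewrite /ysection /= !inE.
Qed.

(* A rotation by an angle that is not a multiple of pi is a product of three shears. *)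
Lemma pres_rotation (p q c d : R) : c ^+ 2 + d ^+ 2 = 1 ->
  pres (fun z : T2 => (p + c * z.1 - d * z.2, q + d * z.1 + c * z.2) : T2).
Proof.
move=> cd.
have shift : pres (fun z : T2 => (z.1 + p, z.2 + q) : T2).
  apply: (@pres_ext _ _ _ (pres_comp (pres_shear1 0 p) (pres_shear2 0 q))) => z /=.
  by congr (_, _); ring.
have [d0|d0] := eqVneq d 0.
  have : (c == 1) || (c == -1).
    by move: cd; rewrite d0 expr0n addr0 => /eqP; rewrite sqrf_eq1.
  case/orP => /eqP ->.
    by apply: (@pres_ext _ _ _ shift) => z /=; rewrite d0; congr (_, _); ring.
  apply: (@pres_ext _ _ _ (pres_comp shift (pres_comp pres_opp1 pres_opp2))) => z /=.
  by rewrite d0; congr (_, _); ring.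
have S := pres_shear1 ((c - 1) / d) 0.
apply: (@pres_ext _ _ _ (pres_comp shift (pres_comp S (pres_comp (pres_shear2 d 0) S)))) => z /=.
have c2 : c ^+ 2 = 1 - d ^+ 2 by rewrite -cd addrK.
congr (_, _); last by field.
apply/eqP; rewrite -subr_eq0; apply/eqP.
rewrite (_ : _ - _ = (c ^+ 2 - 1 + d ^+ 2) / d * z.2); last by field.
by rewrite c2; ring.
Qed.

Lemma pres_isometry (p q a b c d : R) : a ^+ 2 + b ^+ 2 = 1 -> c ^+ 2 + d ^+ 2 = 1 ->
  a * c + b * d = 0 ->
  pres (fun z : T2 => (p + a * z.1 + b * z.2, q + c * z.1 + d * z.2) : T2).
Proof.
move=> ab cd abcd.
(* The determinant: for [e = 1] the map is a rotation, for [e = -1] a rotation followed by a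
   reflection. *)
pose e := a * d - b * c.
have dE : d = e * a.
  rewrite /e (_ : (a * d - b * c) * a = (a ^+ 2 + b ^+ 2) * d - b * (a * c + b * d)); last by ring.
  by rewrite ab abcd; ring.
have cE : c = - e * b.
  rewrite /e (_ : - (a * d - b * c) * b = (a ^+ 2 + b ^+ 2) * c - a * (a * c + b * d)); last by ring.
  by rewrite ab abcd; ring.
have e1 : e ^+ 2 = 1.
  by rewrite -cd cE dE -[LHS]mulr1 -{1}ab; ring.
have : (e == 1) || (e == -1) by rewrite -sqrf_eq1 e1.
have ba : a ^+ 2 + (- b) ^+ 2 = 1 by rewrite sqrrN.
have rot := pres_rotation p q ba.
case/orP => /eqP eE.
  apply: (@pres_ext _ _ _ rot) => z /=; rewrite cE dE eE; congr (_, _); ring.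
apply: (@pres_ext _ _ _ (pres_comp pres_opp2 (pres_rotation p (- q) ba))) => z /=.
by rewrite cE dE eE; congr (_, _); ring.
Qed.

End PlaneMeasure.

(** * Cones, right triangles and unit sectors *)

Section Sectors.
Context {R : realType}.
Local Notation T1 := (measurableTypeR R).
Local Notation T2 := (measurableTypeR R * measurableTypeR R)%type.
Local Notation leb := (@lebesgue_measure R).
Local Notation leb2 := (@leb2 R).
Implicit Types (A X : set T2) (a s t : R).

Lemma measurable_lt2 (f g : T2 -> R) : measurable_fun setT f -> measurable_fun setT g ->
  measurable [set z : T2 | f z < g z].
Proof.
move=> mf mg; have mh : measurable_fun setT (g \- f) by exact: measurable_realfun.measurable_funB.
have := mh measurableT _ (measurable_itv `]0, +oo[); rewrite setTI.
by congr (measurable _); rewrite predeqE => z /=; rewrite in_itv /= andbT subr_gt0.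
Qed.

Lemma measurable_le2 (f g : T2 -> R) : measurable_fun setT f -> measurable_fun setT g ->
  measurable [set z : T2 | f z <= g z].
Proof.
move=> mf mg; have := measurableC (measurable_lt2 mg mf).
by congr (measurable _); rewrite predeqE => z /=; rewrite leNgt; split=> /negP.
Qed.

Lemma measurable_eq2 (f g : T2 -> R) : measurable_fun setT f -> measurable_fun setT g ->
  measurable [set z : T2 | f z = g z].
Proof.
move=> mf mg; have := measurableI _ _ (measurable_le2 mf mg) (measurable_le2 mg mf).
congr (measurable _); rewrite predeqE => z /=; split=> [[h1 h2]|->//].
by apply: le_anti; rewrite h1.
Qed.

(** The angle at the origin from the first axis up to the slope [t]. The open version serves for
    disjointness and the closed one for covering; for positive [t] they differ by a null set. *)
Definition cone t : set T2 := [set z | 0 < z.2 /\ z.2 < t * z.1].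
Definition ccone t : set T2 := [set z | 0 <= z.2 /\ z.2 <= t * z.1].
Definition disc : set T2 := [set z | z.1 ^+ 2 + z.2 ^+ 2 < 1].
Definition tri a t : set T2 := cone t `&` [set z | z.1 <= a].

Lemma mfst : measurable_fun setT (fun z : T2 => z.1 : R). Proof. exact: measurable_fst. Qed.
Lemma msnd : measurable_fun setT (fun z : T2 => z.2 : R). Proof. exact: measurable_snd. Qed.
Lemma mcst c : measurable_fun setT (fun z : T2 => c : R). Proof. exact: measurable_cst. Qed.
Lemma mscale c : measurable_fun setT (fun z : T2 => c * z.1 : R).
Proof. by apply: measurable_realfun.measurable_funM; [exact: mcst|exact: mfst]. Qed.

Lemma measurable_cone t : measurable (cone t).
Proof.
apply: measurableI (measurable_lt2 (mcst 0) msnd) (measurable_lt2 msnd (mscale t)).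
Qed.

Lemma measurable_ccone t : measurable (ccone t).
Proof.
apply: measurableI (measurable_le2 (mcst 0) msnd) (measurable_le2 msnd (mscale t)).
Qed.

Lemma measurable_disc : measurable disc.
Proof.
apply: measurable_lt2 (mcst 1).
by apply: measurable_realfun.measurable_funD; apply: measurable_realfun.measurable_funX;
  [exact: mfst|exact: msnd].
Qed.

Lemma measurable_tri a t : measurable (tri a t).
Proof. exact: measurableI (measurable_cone t) (measurable_le2 mfst (mcst a)). Qed.

Lemma leb2_line t : leb2 [set z : T2 | z.2 = t * z.1] = 0%E.
Proof.
have [_ /(_ (setT `*` [set 0]))] := pres_shear2 (- t) 0.
rewrite leb2X//.
rewrite lebesgue_measure_set1 mule0 => <-; last exact: measurableX.
apply: congr1; rewrite predeqE => z /=; split=> [->|[_]]; first by split=> //=; ring.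
by rewrite /= => /eqP; rewrite addr0 mulNr subr_eq0 => /eqP.
Qed.

Lemma leb2_itv (i j : interval R) :
  leb2 ([set` i] `*` [set` j]) = (leb [set` i] * leb [set` j])%E.
Proof. exact: leb2X. Qed.

Lemma leb2_null_sub A N : measurable A -> measurable N -> A `<=` N -> leb2 N = 0%E ->
  leb2 A = 0%E.
Proof.
move=> mA mN AN N0; apply/eqP; rewrite -measure_le0 -N0.
by apply: le_measure; rewrite ?inE.
Qed.

Lemma leb2_tri a t : 0 < a -> 0 < t -> leb2 (tri a t) = (t * a ^+ 2 / 2)%:E.
Proof.
move=> a0 t0; have ta0 : 0 < t * a by rewrite mulr_gt0.
(* The half-turn about the center of the rectangle carries the triangle to the other side of the
   diagonal. *)
pose f (z : T2) : T2 := (a + (-1) * z.1 + 0 * z.2, t * a + 0 * z.1 + (-1) * z.2).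
have [mf pf] : pres f by apply: pres_isometry; ring.
pose Q : set T2 := [set` `[0, a]] `*` [set` `]0, (t * a)[].
pose D := Q `&` [set z : T2 | z.2 = t * z.1].
have mQ : measurable Q by exact: measurableX.
have mD : measurable D by apply: measurableI => //; apply: measurable_eq2; [exact: msnd|exact: mscale].
have D0 : leb2 D = 0%E.
  apply: (leb2_null_sub mD _ _ (leb2_line t)) => [|z []//].
  by apply: measurable_eq2; [exact: msnd|exact: mscale].
have mT := measurable_tri a t.
have mT' : measurable (f @^-1` tri a t) by rewrite -[X in measurable X]setTI; exact: mf.
have fE z : (f @^-1` tri a t) z <-> [/\ t * z.1 < z.2, z.2 < t * a & 0 <= z.1].
  by rewrite /f /tri /cone /=; split=> [[[h1 h2] h3]|[h1 h2 h3]]; repeat split; lra.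
have QE : Q = (tri a t `|` f @^-1` tri a t) `|` D.
  rewrite predeqE => z; split.
    move=> [/=]; rewrite !in_itv /= => /andP[z0 za] /andP[y0 ya].
    have [h|h|h] := ltgtP z.2 (t * z.1).
    - by left; left.
    - by left; right; apply/fE.
    - by right; split=> //; split; rewrite /= in_itv /= ?z0 ?za ?y0.
  move=> [[[[h1 h2] h3]|/fE[h1 h2 h3]]|[]//].
    rewrite /= in h3; split; rewrite /= in_itv /=; apply/andP; split=> //; first by nra.
    by apply: lt_le_trans h2 _; rewrite ler_pM2l.
  split; rewrite /= in_itv /=; apply/andP; split=> //.
    by rewrite -(ler_pM2l t0); apply/ltW/(lt_trans h1).
  by apply: le_lt_trans h1; rewrite mulr_ge0// ltW.
have dT : tri a t `&` f @^-1` tri a t = set0.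
  rewrite predeqE => z; split=> // -[[[_ h1] _] /fE[h2 _ _]].
  by have := lt_trans h1 h2; rewrite ltxx.
have dD : (tri a t `|` f @^-1` tri a t) `&` D = set0.
  rewrite predeqE => z; split=> // -[h [_ /= e]]; case: h => [[[_]]|/fE[]]; rewrite e ltxx//.
have : leb2 Q = (leb2 (tri a t) + leb2 (tri a t))%E.
  rewrite QE (measureU _ _ mD dD); last exact: measurableU.
  by rewrite (measureU _ mT mT' dT) /= pf// D0 adde0.
rewrite leb2_itv !lebesgue_measure_itv /= !lte_fin a0 ta0 -!EFinD -EFinM !subr0.
have : (leb2 (tri a t) \is a fin_num).
  rewrite ge0_fin_numE ?measure_ge0//; apply: (@le_lt_trans _ _ (leb2 Q)).
    by apply: le_measure; rewrite ?inE// QE => z h; left; left.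
  by rewrite leb2_itv !lebesgue_measure_itv /= !lte_fin a0 ta0 -!EFinD -EFinM ltry.
move/fineK => <-; rewrite -EFinD => -[h]; congr (_%:E); lra.
Qed.

(** Half the angle with tangent [t], as an area: additivity of the measure takes the place of
    additivity of angles. *)
Definition sector t : R := fine (leb2 (cone t `&` disc)).

Lemma measurable_sector t : measurable (cone t `&` disc).
Proof. exact: measurableI (measurable_cone t) measurable_disc. Qed.

Lemma disc_fin A : measurable A -> A `<=` disc -> leb2 A \is a fin_num.
Proof.
move=> mA Ad; rewrite ge0_fin_numE ?measure_ge0//.
apply: (@le_lt_trans _ _ (leb2 ([set` `[-1, 1]] `*` [set` `[-1, 1]]))).
  apply: le_measure; rewrite ?inE//; first exact: measurableX.
  move=> z /Ad; rewrite /disc /= => h; split; rewrite /= in_itv /=; apply/andP; split; nra.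
rewrite leb2_itv !lebesgue_measure_itv /= lte_fin.
have -> : (-1 < 1 :> R) by lra.
by rewrite -!EFinD -EFinM ltry.
Qed.

Lemma sectorE t : leb2 (cone t `&` disc) = (sector t)%:E.
Proof. by rewrite fineK// disc_fin//; exact: measurable_sector. Qed.

Lemma sector_le t : 0 < t -> sector t <= t / 2.
Proof.
move=> t0; rewrite -lee_fin -sectorE (_ : t / 2 = t * 1 ^+ 2 / 2); last by ring.
rewrite -leb2_tri//; apply: le_measure; rewrite ?inE; [exact: measurable_sector|exact: measurable_tri|].
move=> z [c]; rewrite /disc /= => d; split=> //=; nra.
Qed.

Lemma sector_ge t : 0 < t -> t / (1 + t ^+ 2) / 2 <= sector t.
Proof.
move=> t0; rewrite -lee_fin -sectorE.
have t2 : 0 < 1 + t ^+ 2 by rewrite ltr_wpDr// sqr_ge0.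
(* The cosine of the angle: the right triangle with hypotenuse one lies in the sector. *)
pose a := (Num.sqrt (1 + t ^+ 2))^-1.
have a0 : 0 < a by rewrite invr_gt0 sqrtr_gt0.
have a2 : a ^+ 2 = (1 + t ^+ 2)^-1 by rewrite exprVn sqr_sqrtr// ltW.
rewrite -a2 -leb2_tri//; apply: le_measure; rewrite ?inE; [exact: measurable_tri|exact: measurable_sector|].
move=> z [c /= za]; split=> //; rewrite /disc /=; case: c => z20 zt.
have z10 : 0 < z.1 by rewrite -(pmulr_rgt0 _ t0); exact: lt_trans zt.
have h1 : z.1 ^+ 2 <= a ^+ 2 by rewrite ler_pXn2r// nnegrE ltW.
have h2 : z.2 ^+ 2 < (t * z.1) ^+ 2 by rewrite ltr_pXn2r// nnegrE ?ltW// (lt_trans z20).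
apply: (@lt_le_trans _ _ (z.1 ^+ 2 + (t * z.1) ^+ 2)); first by rewrite ltrD2l.
rewrite exprMn -{1}[z.1 ^+ 2]mul1r -mulrDl.
by apply: le_trans (ler_wpM2l (ltW t2) h1) _; rewrite a2 mulfV// gt_eqF.
Qed.

(** The subtraction formula for the tangent: the part of the sector above the slope [s] is rotated
    down to the first axis, and the line of slope [s] is null. *)
Lemma sectorD s t : 0 < s -> s < t ->
  sector t = sector s + sector ((t - s) / (1 + t * s)).
Proof.
move=> s0 st; set d := (t - s) / (1 + t * s).
have t0 := lt_trans s0 st.
have ts : 0 < 1 + t * s by rewrite addr_gt0// mulr_gt0.
have s2 : 0 < 1 + s ^+ 2 by rewrite ltr_wpDr// sqr_ge0.
(* [k] and [k * s] are the cosine and the sine of the angle with tangent [s]; [f] turns by the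
   negative of this angle. *)
pose k := (Num.sqrt (1 + s ^+ 2))^-1.
have k0 : 0 < k by rewrite invr_gt0 sqrtr_gt0.
have k2 : k ^+ 2 = (1 + s ^+ 2)^-1 by rewrite exprVn sqr_sqrtr// ltW.
have ks : k ^+ 2 * (1 + s ^+ 2) = 1 by rewrite k2 mulVf// gt_eqF.
pose f (z : T2) : T2 := (0 + k * z.1 + (k * s) * z.2, 0 + (- (k * s)) * z.1 + k * z.2).
have [mf pf] : pres f.
  by apply: pres_isometry; [rewrite -[RHS]ks; ring|rewrite -[RHS]ks; ring|ring].
have fdisc z : disc (f z) <-> disc z.
  rewrite /disc /f /= (_ : _ + _ = (k ^+ 2 * (1 + s ^+ 2)) * (z.1 ^+ 2 + z.2 ^+ 2)); last by ring.
  by rewrite ks mul1r.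
have fcone z : cone d (f z) <-> s * z.1 < z.2 /\ z.2 < t * z.1.
  rewrite /cone /f /=.
  have e1 : 0 + - (k * s) * z.1 + k * z.2 = k * (z.2 - s * z.1) by ring.
  have e2 : d * (0 + k * z.1 + k * s * z.2) - k * (z.2 - s * z.1) =
    (k * (1 + s ^+ 2) / (1 + t * s)) * (t * z.1 - z.2).
    by rewrite /d; field; exact: lt0r_neq0.
  have c0 : 0 < k * (1 + s ^+ 2) / (1 + t * s) by rewrite divr_gt0// mulr_gt0.
  rewrite e1 pmulr_rgt0// subr_gt0 -[k * (_ - _) < _]subr_gt0 e2 pmulr_rgt0// subr_gt0.
  by split=> -[].
have mB : measurable (f @^-1` (cone d `&` disc)).
  by rewrite -[X in measurable X]setTI; apply: mf => //; exact: measurable_sector.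
pose L := (cone t `&` disc) `&` [set z : T2 | z.2 = s * z.1].
have mL0 : measurable [set z : T2 | z.2 = s * z.1].
  by apply: measurable_eq2; [exact: msnd|exact: mscale].
have mL : measurable L by apply: measurableI mL0; exact: measurable_sector.
have L0 : leb2 L = 0%E by apply: (leb2_null_sub mL mL0 _ (leb2_line s)) => z [].
have E : cone t `&` disc = ((cone s `&` disc) `|` f @^-1` (cone d `&` disc)) `|` L.
  rewrite predeqE => z; split=> [[[z2 zt] dz]|].
    have [h|h|h] := ltgtP z.2 (s * z.1).
    - by left; left.
    - by left; right; split; [apply/fcone|apply/fdisc].
    - by right; do !split.
  move=> [[[[z2 zs] dz]|[/fcone[h1 h2] /fdisc dz]]|[]//]; split=> //.
    split=> //; apply: (lt_trans zs); rewrite ltr_pM2r//.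
    by rewrite -(pmulr_rgt0 _ s0); exact: lt_trans zs.
  split=> //; have h3 := lt_trans h1 h2.
  have z1 : 0 < z.1 by rewrite -subr_gt0 -mulrBl pmulr_rgt0 ?subr_gt0 in h3.
  by apply: lt_trans h1; rewrite mulr_gt0.
have d1 : (cone s `&` disc) `&` (f @^-1` (cone d `&` disc)) = set0.
  rewrite predeqE => z; split=> // -[[[_ h1] _] [/fcone[h2 _] _]].
  by have := lt_trans h1 h2; rewrite ltxx.
have d2 : ((cone s `&` disc) `|` f @^-1` (cone d `&` disc)) `&` L = set0.
  rewrite predeqE => z; split=> // -[h [_ /= e]].
  case: h => [[[_]]|[/fcone[]]]; rewrite e ltxx//.
have : leb2 (cone t `&` disc) = (leb2 (cone s `&` disc) + leb2 (cone d `&` disc))%E.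
  rewrite {1}E (measureU _ _ mL d2); last first.
    by apply: measurableU => //; exact: measurable_sector.
  rewrite (measureU _ _ mB d1); last exact: measurable_sector.
  by rewrite /= L0 adde0 pf//; exact: measurable_sector.
by rewrite !sectorE -EFinD => -[].
Qed.

(** The two triangle bounds, applied to the difference angle. Divided by [t - s], both sides tend to
    [1 / (1 + t ^+ 2)] as [s] tends to [t], so they do the work of the derivative of the inverse
    tangent. *)
Lemma sector_bounds s t : 0 < s -> s < t ->
  (t - s) * (1 + t * s) / ((1 + t ^+ 2) * (1 + s ^+ 2)) <= 2 * (sector t - sector s) /\
  2 * (sector t - sector s) <= (t - s) / (1 + t * s).
Proof.
move=> s0 st; have t0 := lt_trans s0 st.
have ts : 0 < 1 + t * s by rewrite addr_gt0// mulr_gt0.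
have d0 : 0 < (t - s) / (1 + t * s) by rewrite divr_gt0// subr_gt0.
have := sector_le d0; have := sector_ge d0.
rewrite (sectorD s0 st); set d := sector (_ / _).
have -> : (t - s) / (1 + t * s) / (1 + ((t - s) / (1 + t * s)) ^+ 2) =
  (t - s) * (1 + t * s) / ((1 + t ^+ 2) * (1 + s ^+ 2)).
  have n1 : 1 + t ^+ 2 != 0 by rewrite gt_eqF// ltr_wpDr// sqr_ge0.
  have n2 : 1 + s ^+ 2 != 0 by rewrite gt_eqF// ltr_wpDr// sqr_ge0.
  have n3 : (1 + t * s) ^+ 2 + (t - s) ^+ 2 != 0.
    by rewrite (_ : _ + _ = (1 + t ^+ 2) * (1 + s ^+ 2)); [rewrite mulf_neq0|ring].
  by field; rewrite n1 n2 n3 gt_eqF.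
by move: (sector s) => b; clearbody d => ? ?; split; lra.
Qed.

Lemma sector_lt s t : 0 < s -> s < t -> sector s < sector t.
Proof.
move=> s0 st; have [h _] := sector_bounds s0 st.
have t0 := lt_trans s0 st.
have : 0 < (t - s) * (1 + t * s) / ((1 + t ^+ 2) * (1 + s ^+ 2)).
  rewrite divr_gt0 ?mulr_gt0 ?subr_gt0//; last 2 first.
  - by rewrite ltr_wpDr// sqr_ge0.
  - by rewrite ltr_wpDr// sqr_ge0.
  by rewrite addr_gt0// mulr_gt0.
by move: h; move: (sector s) (sector t) => ? ?; lra.
Qed.

Lemma sector_inj s t : 0 < s -> 0 < t -> sector s = sector t -> s = t.
Proof.
move=> s0 t0 e; have [h|h|//] := ltgtP s t.
  by have := sector_lt s0 h; rewrite e ltxx.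
by have := sector_lt t0 h; rewrite e ltxx.
Qed.

(* The tangent inequality replacing the convexity of [max (tan a) (cot a)] as a
   function of the angle [a = 2 * sector (tan a)]. *)
Lemma sector_tangent t0 : 0 < t0 -> exists m, forall t, 0 < t ->
  Num.max t0 t0^-1 + m * (sector t - sector t0) <= Num.max t t^-1 /\
  (Num.max t0 t0^-1 + m * (sector t - sector t0) = Num.max t t^-1 -> t = t0).
Proof.
move=> t00; have q (s : R) : 0 < 1 + s ^+ 2 by rewrite ltr_wpDr// sqr_ge0.
(* [g] is the branch of the maximum that is active at [t0]; a tangent line below this branch is also
   below the maximum. *)
suff [m [g [gt0 gle hm]]] : exists m (g : R -> R), [/\ g t0 = Num.max t0 t0^-1,
    (forall t, 0 < t -> g t <= Num.max t t^-1) &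
    forall t, 0 < t -> t != t0 -> g t0 + m * (sector t - sector t0) < g t].
  exists m => t tp; rewrite -gt0; have [->|tt0] := eqVneq t t0.
    by rewrite subrr mulr0 addr0 gt0.
  have h := lt_le_trans (hm _ tp tt0) (gle _ tp).
  by split; [exact: ltW|move=> e; rewrite e ltxx in h].
have [h|h] := leP 1 t0.
  (* The derivative of the tangent with respect to the sector area, which is half the angle. *)
  exists (2 * (1 + t0 ^+ 2)), id; split.
  - by rewrite max_l//; apply: (le_trans _ h); rewrite invf_le1.
  - by move=> t _; rewrite le_max lexx.
  - move=> t tp; rewrite neq_lt => /orP[tt|tt].
      have [lo _] := sector_bounds tp tt.
      have : t0 - t < (1 + t0 ^+ 2) * (2 * (sector t0 - sector t)); last by move: (sector t) (sector t0) => ? ?; lra.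
      apply: lt_le_trans (ler_wpM2l (ltW (q t0)) lo).
      have -> : (1 + t0 ^+ 2) * ((t0 - t) * (1 + t0 * t) / ((1 + t0 ^+ 2) * (1 + t ^+ 2))) =
          (t0 - t) * ((1 + t0 * t) / (1 + t ^+ 2)).
        by field; rewrite !gt_eqF.
      rewrite ltr_pMr ?subr_gt0// ltr_pdivlMr// mul1r ltrD2l expr2 ltr_pM2r//.
    have [_ hi] := sector_bounds t00 tt.
    have : (1 + t0 ^+ 2) * (2 * (sector t - sector t0)) < t - t0; last by move: (sector t) (sector t0) => ? ?; lra.
    apply: le_lt_trans (ler_wpM2l (ltW (q t0)) hi) _.
    have p : 0 < 1 + t * t0 by rewrite addr_gt0// mulr_gt0.
    rewrite mulrCA gtr_pMr ?subr_gt0// ltr_pdivrMr// mul1r ltrD2l expr2 ltr_pM2r//.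
(* The same derivative for the cotangent. *)
exists (- (2 * ((1 + t0 ^+ 2) / t0 ^+ 2))), (fun t => t^-1); split.
- rewrite max_r//; apply/ltW/(lt_le_trans h).
  by rewrite invf_ge1// ltW.
- by move=> t _; rewrite le_max lexx orbT.
- move=> t tp; rewrite neq_lt => /orP[tt|tt].
    have [_ hi] := sector_bounds tp tt.
    have : (1 + t0 ^+ 2) / t0 ^+ 2 * (2 * (sector t0 - sector t)) < t^-1 - t0^-1; last by move: (sector t) (sector t0) => ? ?; lra.
    have q0 : 0 <= (1 + t0 ^+ 2) / t0 ^+ 2 by rewrite divr_ge0 ?sqr_ge0// ltW.
    apply: le_lt_trans (ler_wpM2l q0 hi) _.
    have p : 0 < 1 + t0 * t by rewrite addr_gt0// mulr_gt0.
    rewrite -subr_gt0 (_ : _ - _ = (t0 - t) ^+ 2 / (t * t0 ^+ 2 * (1 + t0 * t))).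
      rewrite divr_gt0//; first by rewrite exprn_gt0// subr_gt0.
      by rewrite !mulr_gt0// exprn_gt0.
    by field; rewrite !gt_eqF.
  have [lo _] := sector_bounds t00 tt.
  have : t0^-1 - t^-1 < (1 + t0 ^+ 2) / t0 ^+ 2 * (2 * (sector t - sector t0)); last by move: (sector t) (sector t0) => ? ?; lra.
  have q0 : 0 <= (1 + t0 ^+ 2) / t0 ^+ 2 by rewrite divr_ge0 ?sqr_ge0// ltW.
  apply: lt_le_trans (ler_wpM2l q0 lo).
  rewrite -subr_gt0 (_ : _ - _ = (t - t0) ^+ 2 / (t * t0 ^+ 2 * (1 + t ^+ 2))).
    rewrite divr_gt0//; first by rewrite exprn_gt0// subr_gt0.
    by rewrite !mulr_gt0// exprn_gt0.
  by field; rewrite !gt_eqF.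
Qed.

End Sectors.

(** * Tilings of the plane by cones *)

Section Tiling.
Context {R : realType}.
Local Notation T1 := (measurableTypeR R).
Local Notation T2 := (measurableTypeR R * measurableTypeR R)%type.
Local Notation leb := (@lebesgue_measure R).
Local Notation leb2 := (@leb2 R).
Implicit Types (A X : set T2) (a s t : R).

Lemma ccone_null t : 0 < t -> leb2 (ccone t `\` cone t) = 0%E.
Proof.
move=> t0; pose N := [set z : T2 | z.2 = 0 * z.1] `|` [set z : T2 | z.2 = t * z.1].
have m1 k : measurable [set z : T2 | z.2 = k * z.1].
  by apply: measurable_eq2; [exact: msnd|exact: mscale].
have mN : measurable N by exact: measurableU.
apply: (leb2_null_sub _ mN) => //.
- by apply: measurableD; [exact: measurable_ccone|exact: measurable_cone].
- move=> z [[h1 h2] nc]; have [e|e] := eqVneq z.2 (t * z.1); first by right.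
  left=> /=; rewrite mul0r; apply: le_anti; rewrite h1 andbT leNgt; apply/negP => z2.
  by apply: nc; split=> //; rewrite lt_neqAle e.
- apply/eqP; rewrite -measure_le0; apply: le_trans (measureU2 _ _ _) _ => //.
  by rewrite /= !leb2_line adde0.
Qed.

(** The open cones are disjoint and the closed ones cover [X], so the defect lies in finitely many
    null sets. [X] is left free: it is a facet for areas and a disc for angles. *)
Lemma cone_tiling (I : choiceType) (D : set I) (f : I -> T2 -> T2) (t : I -> R) X :
  finite_set D -> (forall i, D i -> pres (f i)) -> (forall i, D i -> 0 < t i) ->
  (forall i j z, D i -> D j -> cone (t i) (f i z) -> cone (t j) (f j z) -> i = j) ->
  (forall z, X z -> exists2 i, D i & ccone (t i) (f i z)) ->
  measurable X ->
  leb2 X = (\sum_(i \in D) leb2 (X `&` f i @^-1` cone (t i)))%E.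
Proof.
move=> fD pf t0 disj cov mX.
have mpre i A : D i -> measurable A -> measurable (f i @^-1` A).
  by move=> /pf[mf _] mA; rewrite -[X in measurable X]setTI; exact: mf.
have mc i : D i -> measurable (f i @^-1` cone (t i)).
  by move=> Di; apply: mpre => //; exact: measurable_cone.
pose C := \bigcup_(i in D) (X `&` f i @^-1` cone (t i)).
pose N := \bigcup_(i in D) (f i @^-1` (ccone (t i) `\` cone (t i))).
have mC : measurable C.
  by apply: fin_bigcup_measurable => // i Di; apply: measurableI => //; exact: mc.
have mdc i : D i -> measurable (f i @^-1` (ccone (t i) `\` cone (t i))).
  move=> Di; apply: mpre => //.
  by apply: measurableD; [exact: measurable_ccone|exact: measurable_cone].
have mN : measurable N by apply: fin_bigcup_measurable.
have N0 : leb2 N = 0%E.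
  apply/eqP; rewrite -measure_le0.
  rewrite /N -fsbig_setU// fsbig_finite//=.
  have [r rD] : exists r : seq I, r = finmap.enum_fset (fset_set D) by eexists.
  rewrite -rD.
  have rDi i : i \in r -> D i by rewrite rD => ir; have := ir; rewrite in_fset_set// inE.
  elim: r {rD} rDi => [|i r ih] rDi; first by rewrite big_nil measure0.
  have Di : D i by apply: rDi; rewrite mem_head.
  have rDr j : j \in r -> D j by move=> jr; apply: rDi; rewrite inE jr orbT.
  rewrite big_cons; apply: le_trans (measureU2 _ _ _) _; first exact: mdc.
    elim: (r) rDr => [|j r' ih'] rDr; first by rewrite big_nil.
    rewrite big_cons; apply: measurableU; first by apply: mdc; apply: rDr; exact: mem_head.
    by apply: ih' => j' j'r; apply: rDr; rewrite inE j'r orbT.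
  rewrite /= (proj2 (pf _ Di)); last first.
    by apply: measurableD; [exact: measurable_ccone|exact: measurable_cone].
  by rewrite ccone_null ?add0e ?ih//; exact: t0.
have XE : leb2 X = leb2 C.
  apply/eqP; rewrite eq_le; apply/andP; split; last first.
    by apply: le_measure; rewrite ?inE// => z [i Di []].
  rewrite -[leRHS]adde0 -N0; apply: le_trans (measureU2 _ mC mN).
  apply: le_measure; rewrite ?inE//; first exact: measurableU.
  move=> z Xz; have [i Di ci] := cov _ Xz.
  have [c|nc] := pselect (cone (t i) (f i z)); first by left; exists i.
  by right; exists i.
rewrite XE /C measure_fin_bigcup//.
  by move=> i j Di Dj [z [[_ zi] [_ zj]]]; exact: disj zi zj.
by move=> i Di; apply: measurableI => //; exact: mc.
Qed.

End Tiling.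

(** * Flags *)

Section Good.
Context {R : realType}.
Local Notation vec := 'rV[R]_3.
Implicit Types (u v w x y z c d p : vec) (P F G e : set vec).

(** The foot of the perpendicular from [z], provided that it lies in [G]; the default value is
    [0]. *)
Definition proj z G : vec := xget 0 [set x | G x /\ orthogonal_to (x - z) G].

Lemma proj_unique z G x x' : G x -> orthogonal_to (x - z) G -> G x' ->
  orthogonal_to (x' - z) G -> x = x'.
Proof.
move=> Gx ox Gx' ox'; apply/eqP; rewrite -subr_eq0 -dot_eq0; apply/eqP.
by have := ox _ _ Gx Gx'; have := ox' _ _ Gx Gx'; rewrite !dotE; lra.
Qed.

Lemma projE z G x : G x -> orthogonal_to (x - z) G -> proj z G = x.
Proof.
move=> Gx ox; rewrite /proj; case: xgetP => [y _ [Gy oy]|/(_ x)[]//].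
exact: (proj_unique Gy oy Gx ox).
Qed.

(* [z] projects into the relative interior of all faces and edges of [P]. *)
Record good P z : Prop := Good {
  good_polytope : polytope P;
  good_strict : exists c, strict P c;
  good_inside : inside P z;
  good_finite : forall k, (k <= 2)%N -> finite_set (kfaces P k);
  good_facet : forall F, kfaces P 2 F -> exists2 x, inner F x & orthogonal_to (x - z) F;
  good_edge : forall e, kfaces P 1 e -> exists2 x, inner e x & orthogonal_to (x - z) e }.

Lemma facet_proj P z F : good P z -> kfaces P 2 F ->
  inner F (proj z F) /\ orthogonal_to (proj z F - z) F.
Proof. by move=> gP /(good_facet gP)[x ix ox]; rewrite (projE (proj1 ix) ox). Qed.

Lemma edge_proj P z e : good P z -> kfaces P 1 e ->
  inner e (proj z e) /\ orthogonal_to (proj z e - z) e.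
Proof. by move=> gP /(good_edge gP)[x ix ox]; rewrite (projE (proj1 ix) ox). Qed.

Definition triple := (vec * set vec * set vec)%type.
Implicit Types (i j : triple).

Definition flags P : set triple := [set i | [/\ kfaces P 0 [set i.1.1], kfaces P 1 i.1.2,
  kfaces P 2 i.2, i.1.2 i.1.1 & i.1.2 `<=` i.2]].

Definition legV i : vec := i.1.1.
Definition legE z i := proj z i.1.2.
Definition legQ z i := proj z i.2.
Definition legA z i := elen (legE z i - legQ z i).
Definition legB z i := elen (legV i - legE z i).
Definition slope z i := legB z i / legA z i.
(** With [flagY], Cartesian coordinates in the plane of the facet: the origin is the foot [legQ],
    the axes have the directions of the two legs, and [slope] is the tangent of the angle at the
    origin. *)
Definition flagX z i x := dot (legE z i - legQ z i) (x - legQ z i) / legA z i.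
Definition flagY z i x := dot (legV i - legE z i) (x - legQ z i) / legB z i.

Section Fixed.
Context P z (gP : good P z).

(** The theorem of the three perpendiculars: [legE - z] and [legQ - z] are both orthogonal to the
    edge, hence so is their difference. The path from [z] over the two feet to the vertex consists
    of three pairwise orthogonal steps. *)
Lemma flag_orth i : flags P i ->
  [/\ dot (legQ z i - z) (legE z i - legQ z i) = 0,
      dot (legQ z i - z) (legV i - legE z i) = 0 &
      dot (legE z i - legQ z i) (legV i - legE z i) = 0].
Proof.
case: i => [[v e] F] [/= vv ee Ff ev eF]; rewrite /legV /legE /legQ /=.
have [[eE _] oE] := edge_proj gP ee; have [[FQ _] oQ] := facet_proj gP Ff.
have h1 := oQ _ _ (eF _ eE) FQ; have h2 := oQ _ _ (eF _ ev) (eF _ eE).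
split=> //; have := oE _ _ ev eE; move: h2; rewrite !dotE; lra.
Qed.

Lemma legA_gt0 i : flags P i -> 0 < legA z i.
Proof.
case: i => [[v e] F] [/= vv ee Ff ev eF]; rewrite elen_gt0 subr_eq0 /legE /legQ /=.
have [[eE _] _] := edge_proj gP ee; have [iQ _] := facet_proj gP Ff.
apply/negP => /eqP EQ; have [u [u0 eE' _]] := (edgeP P e).1 ee.
apply: (edge_not_facet ee Ff); apply: (inner_exposed iQ _ eE'); last by rewrite -EQ.
by have [w [_ -> _]] := facetP Ff; exact: amax_sub.
Qed.

Lemma legB_gt0 i : flags P i -> 0 < legB z i.
Proof.
case: i => [[v e] F] [/= vv ee Ff ev eF]; rewrite elen_gt0 subr_eq0 /legE /legV /=.
have [iE _] := edge_proj gP ee; apply/negP => /eqP vE.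
have [u u0 uE] := (vertexP P v).1 vv.
have [w [_ eE [a [b [ab ea eb _]]]]] := (edgeP P e).1 ee.
have sub : e `<=` [set v].
  apply: (inner_exposed iE _ (esym uE)); last by rewrite -vE.
  by rewrite eE; exact: amax_sub.
by apply: ab; rewrite (sub _ ea) (sub _ eb).
Qed.

Lemma slope_gt0 i : flags P i -> 0 < slope z i.
Proof. by move=> fi; rewrite divr_gt0// ?legA_gt0// legB_gt0. Qed.

Lemma legQ_neq i : flags P i -> 0 < dot (legQ z i - z) (legQ z i - z).
Proof.
case: i => [[v e] F] [/= vv ee Ff ev eF]; rewrite dot_gt0 subr_eq0 /legQ /=.
have [[FQ _] _] := facet_proj gP Ff; have [u [u0 FE _]] := facetP Ff.
apply/negP => /eqP Qz; have := good_inside gP Ff u0 FE FQ.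
by rewrite Qz ltxx.
Qed.

Lemma flag_coord i x : flags P i -> dot (legQ z i - z) (x - legQ z i) = 0 ->
  x = legQ z i + (flagX z i x / legA z i) *: (legE z i - legQ z i)
    + (flagY z i x / legB z i) *: (legV i - legE z i).
Proof.
move=> fi nx; have [orth1 orth2 orth3] := flag_orth fi.
have a0 := legA_gt0 fi; have b0 := legB_gt0 fi; have n0 := legQ_neq fi.
rewrite -addrA; apply/eqP; rewrite addrC -subr_eq; apply/eqP.
set E := legE z i in orth1 orth2 orth3 *; set Q := legQ z i in nx n0 orth1 orth2 orth3 *; set v := legV i in orth2 orth3 *.
have aE : dot (E - Q) (E - Q) = legA z i ^+ 2 by rewrite elen_sqr.
have bE : dot (v - E) (v - E) = legB z i ^+ 2 by rewrite elen_sqr.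
pose h := elen (Q - z); have h0 : 0 < h by rewrite elen_gt0 -dot_gt0.
have hE : dot (Q - z) (Q - z) = h ^+ 2 by rewrite elen_sqr.
have := @orthonormal_decomp _ (h^-1 *: (Q - z)) ((legA z i)^-1 *: (E - Q))
  ((legB z i)^-1 *: (v - E)) (x - Q).
rewrite !(dotZl, dotZr) hE aE bE orth1 orth2 orth3 nx !mulr0 scale0r add0r.
move=> -> //; try (by field; exact: lt0r_neq0).
rewrite /flagX /flagY -/E -/Q -/v !scalerA; congr (_ *: _ + _ *: _); ring.
Qed.

Lemma flag_coordB i x : flags P i -> dot (legQ z i - z) (x - legQ z i) = 0 ->
  x - legQ z i = (flagX z i x / legA z i) *: (legE z i - legQ z i)
    + (flagY z i x / legB z i) *: (legV i - legE z i).
Proof. by move=> fi nx; rewrite {1}(flag_coord fi nx); vring. Qed.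

Lemma flag_norm i x : flags P i -> dot (legQ z i - z) (x - legQ z i) = 0 ->
  dot (x - legQ z i) (x - legQ z i) = flagX z i x ^+ 2 + flagY z i x ^+ 2.
Proof.
move=> fi nx; have [_ _ orth3] := flag_orth fi.
have a0 := legA_gt0 fi; have b0 := legB_gt0 fi.
have xE := flag_coord fi nx.
have aE : dot (legE z i - legQ z i) (legE z i - legQ z i) = legA z i ^+ 2 by rewrite elen_sqr.
have bE : dot (legV i - legE z i) (legV i - legE z i) = legB z i ^+ 2 by rewrite elen_sqr.
rewrite flag_coordB//.
move: aE bE orth3; move: (legE z i - _) (legV i - _) => m t aE bE orth3.
rewrite !(dotDl, dotDr, dotZl, dotZr) aE bE [dot t m]dotC orth3.
by field; rewrite !gt_eqF.
Qed.

Lemma flagX_dir i x l : flagX z i (legQ z i + l *: (x - legQ z i)) = l * flagX z i x.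
Proof. by rewrite /flagX addrAC subrr add0r dotZr mulrA. Qed.

Lemma flag_plane i x : flags P i -> i.2 x -> dot (legQ z i - z) (x - legQ z i) = 0.
Proof.
case: i => [[v e] F] [/= vv ee Ff ev eF] Fx; rewrite /legQ /=.
by have [[FQ _] oQ] := facet_proj gP Ff; exact: oQ.
Qed.

(** The normal of the edge within the facet is one at the foot on the edge and constant along the
    edge, so on the facet it is [flagX / legA]. *)
Lemma flagX_le i x : flags P i -> i.2 x -> flagX z i x <= legA z i.
Proof.
move=> fi; have [vv ee Ff ev eF] := fi => Fx.
have [u [u0 FE _]] := facetP Ff; have [iQ oQ] := facet_proj gP Ff.
have [M [[Mle ME] uM]] := edge_normal_exists Ff u0 FE iQ ee eF.
have [[eE _] oE] := edge_proj gP ee.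
have a0 := legA_gt0 fi; have b0 := legB_gt0 fi; have xE := flag_coordB fi (flag_plane fi Fx).
have M1 : dot M (legE z i - legQ z i) = 1 by move: eE; rewrite {1}ME => -[].
have M2 : dot M (legV i - legE z i) = 0.
  by move: ev M1; rewrite ME /legQ /legE /legV => -[_]; rewrite !dotE; lra.
have := Mle _ Fx; rewrite -/(legQ z i) xE.
by rewrite dotDr !dotZr M1 M2 mulr0 addr0 mulr1 ler_pdivrMr// mul1r.
Qed.

Lemma flag_half e x : kfaces P 1 e -> e x -> exists v b, [/\ kfaces P 0 [set v], e v, 0 <= b, b <= 1 &
  x = proj z e + b *: (v - proj z e)].
Proof.
move=> ee ex; have [v1 [v2 [v12 vv1 vv2 seg _]]] := edge_endpoints (good_polytope gP) ee.
have [iE _] := edge_proj gP ee; have [s [s0 s1 ->]] := segment_inner v12 seg iE.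
have ev1 : e v1 by apply/seg; exists 0; rewrite scale0r addr0; split.
have ev2 : e v2 by apply/seg; exists 1; rewrite scale1r addrC subrK; split.
have [r [r0 r1 ->]] := (seg x).1 ex.
have s1' : 0 < 1 - s by rewrite subr_gt0.
have [rs|rs] := leP s r.
  exists v2, ((r - s) / (1 - s)); split=> //.
  - by rewrite divr_ge0// ?subr_ge0// ltW.
  - by rewrite ler_pdivrMr//; lra.
  - by apply: rv3P; rewrite !mxE; field; rewrite gt_eqF.
exists v1, ((s - r) / s); split=> //.
- by rewrite divr_ge0// ?subr_ge0// ltW.
- by rewrite ler_pdivrMr//; lra.
- by apply: rv3P; rewrite !mxE; field; rewrite gt_eqF.
Qed.

Lemma flag_opposite e v v' : kfaces P 1 e -> kfaces P 0 [set v] -> kfaces P 0 [set v'] ->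
  e v -> e v' -> v <> v' -> exists2 k, 0 < k & v' - proj z e = - k *: (v - proj z e).
Proof.
move=> ee vv vv' ev ev' nv.
have [v1 [v2 [v12 vv1 vv2 seg only]]] := edge_endpoints (good_polytope gP) ee.
have [iE _] := edge_proj gP ee; have [s [s0 s1 ->]] := segment_inner v12 seg iE.
have s1' : 0 < 1 - s by rewrite subr_gt0.
have [vE|vE] := only _ vv ev; have [vE'|vE'] := only _ vv' ev'; rewrite vE vE' in nv *.
- by case: nv.
- exists ((1 - s) / s); first exact: divr_gt0.
  by apply: rv3P; rewrite !mxE; field; rewrite gt_eqF.
- exists (s / (1 - s)); first exact: divr_gt0.
  by apply: rv3P; rewrite !mxE; field; rewrite gt_eqF.
- by case: nv.
Qed.

Lemma edge_sub_proj e v b : kfaces P 1 e -> e v -> 0 <= b -> b <= 1 ->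
  e (proj z e + b *: (v - proj z e)).
Proof.
move=> ee ev b0 b1; have [u [_ eE _]] := (edgeP P e).1 ee.
have pe : polytope e by rewrite eE; apply: polytope_amax (good_polytope gP).
by apply: (polytope_convex pe) => //; case: (edge_proj gP ee) => -[].
Qed.

Lemma facet_convex F x y b : kfaces P 2 F -> F x -> F y -> 0 <= b -> b <= 1 ->
  F (x + b *: (y - x)).
Proof.
move=> Ff Fx Fy b0 b1; have [u [_ FE _]] := facetP Ff.
have pF : polytope F by rewrite FE; apply: polytope_amax (good_polytope gP).
exact: (polytope_convex pF).
Qed.

(** The ray from the foot through [x] leaves the facet at an edge; the half of the edge that is hit
    determines the flag. *)
Lemma flag_cover F x : kfaces P 2 F -> dot (proj z F - z) (x - proj z F) = 0 -> x != proj z F ->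
  exists i, [/\ flags P i, i.2 = F & ccone (slope z i) (flagX z i x, flagY z i x)].
Proof.
move=> Ff nx xQ; have [iQ oQ] := facet_proj gP Ff.
have [u [u0 FE us]] := facetP Ff.
have d0 : x - proj z F != 0 by rewrite subr_eq0.
have ud : dot u (x - proj z F) = 0.
  have [||k nE] := @facet_const _ P F u (proj z F - z)
      (dot (proj z F - z) (proj z F)) (dot u (proj z F)) Ff u0.
  - by move=> y Fy; apply: (@amax_eq _ P); rewrite -FE//; case: iQ.
  - by move=> y Fy; have := oQ _ _ Fy (proj1 iQ); rewrite dotBr; lra.
  move: nx; rewrite {1}nE dotZl => /eqP; rewrite mulf_eq0 => /orP[/eqP k0'|/eqP//].
  exfalso; have /eqP := good_inside gP Ff u0 FE (proj1 iQ).
  have : dot u (proj z F - z) = 0 by rewrite nE k0' scale0r dot0r.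
  rewrite dotBr => /eqP; rewrite subr_eq0 => /eqP ->; rewrite ltxx//.
have [e [t [ee eF t0 et]]] := facet_exit (good_polytope gP) Ff u0 FE iQ d0 ud.
have [v [b [vv ev b0 b1 xE]]] := flag_half ee et.
pose i : triple := (v, e, F); have fi : flags P i by split.
exists i; split=> //.
have [_ _ orth3] := flag_orth fi; have a0 := legA_gt0 fi; have bb0 := legB_gt0 fi.
have xE' : x - legQ z i = t^-1 *: ((legE z i - legQ z i) + b *: (legV i - legE z i)).
  move: xE; rewrite -/(legE z i) -/(legQ z i) -/(legV i) => xE.
  have -> : legE z i - legQ z i + b *: (legV i - legE z i) = t *: (x - legQ z i).
    rewrite -[RHS](addKr (legQ z i)) xE; vring.
  by rewrite scalerA mulVf ?scale1r// gt_eqF.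
have lxE : flagX z i x = legA z i / t.
  rewrite /flagX xE' dotZr dotDr dotZr orth3 mulr0 addr0 -elen_sqr -/(legA z i).
  by field; rewrite !gt_eqF.
have lyE : flagY z i x = b * legB z i / t.
  rewrite /flagY xE' dotZr dotDr dotZr [dot _ (legE _ _ - _)]dotC orth3 add0r -elen_sqr -/(legB z i).
  by field; rewrite !gt_eqF.
rewrite /ccone /= lxE lyE; split.
  by rewrite divr_ge0 ?mulr_ge0// ltW.
have -> : slope z i * (legA z i / t) = 1 * legB z i / t by rewrite /slope; field; rewrite !gt_eqF.
by rewrite ler_pM2r ?invr_gt0// ler_pM2r.
Qed.

Lemma flag_tri i x : flags P i -> dot (legQ z i - z) (x - legQ z i) = 0 ->
  ccone (slope z i) (flagX z i x, flagY z i x) -> flagX z i x <= legA z i -> i.2 x.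
Proof.
move=> fi nx [/= y0 yx] xa; have [vv ee Ff ev eF] := fi.
have a0 := legA_gt0 fi; have b0 := legB_gt0 fi.
have xE := flag_coord fi nx.
have [iQ oQ] := facet_proj gP Ff.
have x0 : 0 <= flagX z i x by rewrite -(pmulr_rge0 _ (slope_gt0 fi)); exact: le_trans yx.
have [x00|x00] := eqVneq (flagX z i x) 0.
  have y00 : flagY z i x = 0 by apply: le_anti; rewrite y0 andbT; move: yx; rewrite x00 mulr0.
  by rewrite xE x00 y00 !mul0r !scale0r !addr0; case: iQ.
have {x00} x0 : 0 < flagX z i x by rewrite lt_def x00.
pose b := flagY z i x / flagX z i x / slope z i.
have b00 : 0 <= b.
  by apply: divr_ge0; [apply: divr_ge0 => //; exact: ltW|exact/ltW/slope_gt0].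
have b1 : b <= 1 by rewrite ler_pdivrMr ?slope_gt0// mul1r ler_pdivrMr.
have ep := edge_sub_proj ee ev b00 b1.
have mu0 : 0 <= flagX z i x / legA z i by rewrite divr_ge0// ltW.
have mu1 : flagX z i x / legA z i <= 1 by rewrite ler_pdivrMr// mul1r.
have := facet_convex Ff (proj1 iQ) (eF _ ep) mu0 mu1.
congr (i.2 _); rewrite [RHS]xE -/(legQ z i) -/(legE z i) -/(legV i) /b /slope.
by apply: rv3P; rewrite !mxE; field; rewrite !gt_eqF.
Qed.

Lemma flag_edge_point i x : flags P i -> dot (legQ z i - z) (x - legQ z i) = 0 ->
  cone (slope z i) (flagX z i x, flagY z i x) -> exists l b, [/\ 0 < l, 0 < b, b < 1,
    l * flagX z i x = legA z i & legQ z i + l *: (x - legQ z i) = legE z i + b *: (legV i - legE z i)].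
Proof.
move=> fi nx [/= y0 yx]; have a0 := legA_gt0 fi; have b0 := legB_gt0 fi; have t0 := slope_gt0 fi.
have x0 : 0 < flagX z i x by rewrite -(pmulr_rgt0 _ t0); exact: lt_trans yx.
exists (legA z i / flagX z i x), (flagY z i x / flagX z i x / slope z i); split.
- exact: divr_gt0.
- exact: divr_gt0 (divr_gt0 y0 x0) t0.
- by rewrite ltr_pdivrMr// mul1r ltr_pdivrMr.
- by rewrite mulfVK// gt_eqF.
- rewrite {2}(flag_coord fi nx) /slope; apply: rv3P; rewrite !mxE; field; rewrite !gt_eqF//.
Qed.

Lemma segment_open_inner e v b : kfaces P 1 e -> kfaces P 0 [set v] -> e v -> 0 < b -> b < 1 ->
  inner e (proj z e + b *: (v - proj z e)).
Proof.
move=> ee vv ev b0 b1.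
have [v1 [v2 [v12 vv1 vv2 seg only]]] := edge_endpoints (good_polytope gP) ee.
have [iE _] := edge_proj gP ee; have [s [s0 s1 ->]] := segment_inner v12 seg iE.
have key r : 0 < r -> r < 1 -> inner e (v1 + r *: (v2 - v1)).
  by move=> r0 r1; apply: relint_inner; apply: segment_relint.
case: (only _ vv ev) => ->.
  have -> : v1 + s *: (v2 - v1) + b *: (v1 - (v1 + s *: (v2 - v1))) =
    v1 + (s * (1 - b)) *: (v2 - v1) by vring.
  apply: key; first by rewrite mulr_gt0// subr_gt0.
  by nra.
have -> : v1 + s *: (v2 - v1) + b *: (v2 - (v1 + s *: (v2 - v1))) =
  v1 + (s + b * (1 - s)) *: (v2 - v1) by vring.
by apply: key; nra.
Qed.

(** The ray through [x] is prolonged to both edges. Neither exit can come first, as the facet stays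
    on one side of each edge line; so the exits coincide, at an inner point of both edges, and the
    edges agree. The two ends of an edge are on opposite sides of its foot. *)
Lemma flag_disjoint i j x : flags P i -> flags P j -> i.2 = j.2 ->
  dot (legQ z i - z) (x - legQ z i) = 0 ->
  cone (slope z i) (flagX z i x, flagY z i x) -> cone (slope z j) (flagX z j x, flagY z j x) -> i = j.
Proof.
move=> fi fj ij nx ci cj.
have Qij : legQ z j = legQ z i by rewrite /legQ ij.
have [l [b [l0 b0 b1 lE pE]]] := flag_edge_point fi nx ci.
have nx' : dot (legQ z j - z) (x - legQ z j) = 0 by rewrite Qij.
have [l' [b' [l0' b0' b1' lE' pE']]] := flag_edge_point fj nx' cj.
have [vv ee Ff ev eF] := fi; have [vv' ee' Ff' ev' eF'] := fj.
have ep : i.1.2 (legQ z i + l *: (x - legQ z i)) by rewrite pE; apply: edge_sub_proj => //; exact: ltW.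
have ep' : j.1.2 (legQ z j + l' *: (x - legQ z j)) by rewrite pE'; apply: edge_sub_proj => //; exact: ltW.
have ll : l = l'.
  apply: le_anti; apply/andP; split.
    have := flagX_le fj (_ : j.2 (legQ z i + l *: (x - legQ z i))).
    rewrite -ij -Qij flagX_dir Qij => /(_ (eF _ ep)); rewrite -lE' ler_pM2r//.
    by rewrite -(pmulr_rgt0 _ l0') lE' legA_gt0.
  have := flagX_le fi (_ : i.2 (legQ z j + l' *: (x - legQ z j))).
  rewrite ij Qij flagX_dir => /(_ _); rewrite -Qij => /(_ (eF' _ ep')); rewrite -lE ler_pM2r//.
  by rewrite -(pmulr_rgt0 _ l0) lE legA_gt0.
have inn := segment_open_inner ee vv ev b0 b1.
have inn' := segment_open_inner ee' vv' ev' b0' b1'.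
rewrite -/(legE z i) -/(legV i) -pE in inn; rewrite -/(legE z j) -/(legV j) -pE' in inn'.
rewrite Qij -ll in inn' ep'.
have eij : i.1.2 = j.1.2.
  have [u [_ eE _]] := (edgeP P _).1 ee; have [u' [_ eE' _]] := (edgeP P _).1 ee'.
  rewrite eqEsubset; split.
    by apply: (inner_exposed inn _ eE') => //; rewrite eE; exact: amax_sub.
  by apply: (inner_exposed inn' _ eE) => //; rewrite eE'; exact: amax_sub.
have Eij : legE z i = legE z j by rewrite /legE eij.
suff vij : i.1.1 = j.1.1.
  by move: vij eij ij; case: (i) => [[? ?] ?]; case: (j) => [[? ?] ?] /= -> -> ->.
apply: contrapT => vij; rewrite -eij in ev'.
have [k k0 kE] := flag_opposite ee vv vv' ev ev' vij.
move: pE'; rewrite -ll Qij pE -Eij => /addrI.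
rewrite [in RHS]/legV kE scalerA => h; have := legB_gt0 fi.
rewrite elen_gt0 -dot_gt0 => h1.
have := congr1 (dot (legV i - legE z i)) h; rewrite !dotZr => /(mulIf (lt0r_neq0 h1)).
nra.
Qed.

End Fixed.
End Good.

(** * Areas of the facets and angles at their feet *)

Section Areas.
Context {R : realType}.
Local Notation vec := 'rV[R]_3.
Local Notation T2 := (measurableTypeR R * measurableTypeR R)%type.
Local Notation leb2 := (@leb2 R).
Implicit Types (u v w x y z c d p : vec) (P F G e : set vec) (i j : @triple R).

Definition chart c a b (st : T2) : vec := c + st.1 *: a + st.2 *: b.

Lemma ortho_coord (a b w w' : vec) al be al' be' : dot a a = 1 -> dot b b = 1 -> dot a b = 0 ->
  w = al *: a + be *: b -> w' = al' *: a + be' *: b ->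
  dot w w' = dot w a * dot w' a + dot w b * dot w' b.
Proof.
by move=> aa bb ab -> ->; rewrite !dotE aa bb ab [dot b a]dotC ab; ring.
Qed.

(** [m] and [t] stand for two orthogonal legs spanning the plane of the arbitrary orthonormal frame
    in [planar_area]; passing between the two coordinate systems is an isometry of the plane. *)
Lemma chart_pres (m t c a b q : vec) A B al be al' be' : dot a a = 1 -> dot b b = 1 ->
  dot a b = 0 -> 0 < A -> 0 < B -> dot m m = A ^+ 2 -> dot t t = B ^+ 2 -> dot m t = 0 ->
  m = al *: a + be *: b -> t = al' *: a + be' *: b ->
  pres (fun st => (dot m (chart c a b st - q) / A, dot t (chart c a b st - q) / B) : T2).
Proof.
move=> aa bb ab A0 B0 mA tB mt mE tE.
have h1 := ortho_coord aa bb ab mE mE; have h2 := ortho_coord aa bb ab tE tE.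
have h3 := ortho_coord aa bb ab mE tE.
apply: (@pres_ext _ _ _ _ (@pres_isometry _ (dot m (c - q) / A) (dot t (c - q) / B)
   (dot m a / A) (dot m b / A) (dot t a / B) (dot t b / B) _ _ _)).
- move=> st /=; rewrite /chart !dotE; congr (_, _); ring.
- rewrite (_ : _ + _ = dot m m / A ^+ 2); last by rewrite h1; field; exact: lt0r_neq0.
  by rewrite mA divff// expf_neq0// gt_eqF.
- rewrite (_ : _ + _ = dot t t / B ^+ 2); last by rewrite h2; field; exact: lt0r_neq0.
  by rewrite tB divff// expf_neq0// gt_eqF.
- rewrite (_ : _ + _ = dot m t / (A * B)); first by rewrite mt mul0r.
  by rewrite h3; field; rewrite !gt_eqF.
Qed.

Lemma chart_normal (n m t a b : vec) al be al' be' : dot a a = 1 -> dot b b = 1 ->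
  dot a b = 0 -> dot m m != 0 -> dot t t != 0 -> dot m t = 0 ->
  m = al *: a + be *: b -> t = al' *: a + be' *: b -> dot n m = 0 -> dot n t = 0 ->
  dot n a = 0 /\ dot n b = 0.
Proof.
move=> aa bb ab m0 t0 mt mE tE h1 h2.
have ba : dot b a = 0 by rewrite dotC.
have e1 : dot m m = al ^+ 2 + be ^+ 2 by rewrite mE !dotE aa bb ab ba; ring.
have e2 : dot t t = al' ^+ 2 + be' ^+ 2 by rewrite tE !dotE aa bb ab ba; ring.
have e3 : al * al' + be * be' = 0 by rewrite -mt mE tE !dotE aa bb ab ba; ring.
have {}h1 : al * dot n a + be * dot n b = 0 by rewrite -h1 mE !dotE.
have {}h2 : al' * dot n a + be' * dot n b = 0 by rewrite -h2 tE !dotE.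
rewrite e1 in m0; rewrite e2 in t0.
(* The determinant of the legs in the frame; by Lagrange's identity and orthogonality its square is
   the product of their squared lengths. *)
set D := al * be' - be * al'.
have D0 : D != 0.
  apply: contra_neq (mulf_neq0 m0 t0) => D0.
  have -> : (al ^+ 2 + be ^+ 2) * (al' ^+ 2 + be' ^+ 2) =
    D ^+ 2 + (al * al' + be * be') ^+ 2 by rewrite /D; ring.
  by rewrite D0 e3; ring.
split; apply: (mulfI D0); rewrite mulr0 /D.
- have -> : (al * be' - be * al') * dot n a =
    be' * (al * dot n a + be * dot n b) - be * (al' * dot n a + be' * dot n b) by ring.
  by rewrite h1 h2; ring.
- have -> : (al * be' - be * al') * dot n b =
    al * (al' * dot n a + be' * dot n b) - al' * (al * dot n a + be * dot n b) by ring.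
  by rewrite h1 h2; ring.
Qed.

(** The number pi; it serves as the full turn that both polyhedra share. *)
Definition disc_area : R := fine (leb2 disc).

Lemma disc_areaE : leb2 disc = disc_area%:E.
Proof. by rewrite fineK// disc_fin//; exact: measurable_disc. Qed.

Section Fixed.
Context P z (gP : good P z).

Lemma flags_finite : finite_set (flags P).
Proof.
have f0 := good_finite gP (k := 0) isT; have f1 := good_finite gP (k := 1) isT.
have f2 := good_finite gP (k := 2) isT.
pose h (x : set vec * set vec * set vec) : @triple R := (xget 0 x.1.1, x.1.2, x.2).
apply: (@sub_finite_set _ _ (h @` (kfaces P 0 `*` kfaces P 1 `*` kfaces P 2))).
  move=> [[v e] F] [/= vv ee Ff ev eF]; exists ([set v], e, F) => //=.
  have -> : h ([set v], e, F) = (xget 0 [set v], e, F) by [].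
  suff -> : xget 0 [set v] = v by [].
  by case: xgetP => [y _ ->//|/(_ v) nv]; exfalso; apply: nv.
by apply: finite_image; apply: finite_setX => //; apply: finite_setX.
Qed.

Definition flags_of F := flags P `&` [set i | i.2 = F].

Lemma flags_of_finite F : finite_set (flags_of F).
Proof. by apply: (sub_finite_set _ flags_finite) => i []. Qed.

Lemma facet_flag F : kfaces P 2 F -> exists i, flags_of F i.
Proof.
move=> Ff; have [iQ oQ] := facet_proj gP Ff.
have [x Fx xQ] : exists2 x, F x & x != proj z F.
  have [u [u0 _ [x [y1 [y2 [[Fx Fy1 Fy2] [_ _ cr]]]]]]] := facetP Ff.
  have [xp|xp] := eqVneq x (proj z F); last by exists x.
  exists y1 => //; apply/eqP => y1p; move: cr; rewrite y1p xp subrr.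
  by rewrite (_ : cross _ _ = 0) ?eqxx//; apply: rv3P; rewrite ?mxE /= ?mxE; ring.
have nx : dot (proj z F - z) (x - proj z F) = 0 by apply: oQ => //; case: iQ.
by have [i [fi iF _]] := flag_cover gP Ff nx xQ; exists i.
Qed.

Section Chart.
Context F c a b (Ff : kfaces P 2 F) (aa : dot a a = 1) (bb : dot b b = 1) (ab : dot a b = 0)
  (Fab : F `<=` [set c + s *: a + t *: b | s in [set: R] & t in [set: R]]).

Let co i (st : T2) : T2 := (flagX z i (chart c a b st), flagY z i (chart c a b st)).

Lemma flag_chart i : flags_of F i -> pres (co i) /\
  forall st, dot (legQ z i - z) (chart c a b st - legQ z i) = 0.
Proof.
move=> [fi iF]; have [orth1 orth2 orth3] := flag_orth gP fi.
have [vv ee _ ev eF] := fi; rewrite /= in iF.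
have [[FQ _] _] := facet_proj gP Ff; have [[eE _] _] := edge_proj gP ee.
have span x x' : F x -> F x' -> exists al be, x - x' = al *: a + be *: b.
  move=> /Fab[s _ [t _ <-]] /Fab[s' _ [t' _ <-]]; exists (s - s'), (t - t'); vring.
have FE : F (legE z i) by rewrite -iF; exact: eF.
have FV : F (legV i) by rewrite -iF; exact: eF.
have FQ' : F (legQ z i) by rewrite /legQ iF.
have [al [be mE]] := span _ _ FE FQ'; have [al' [be' tE]] := span _ _ FV FE.
have A0 := legA_gt0 gP fi; have B0 := legB_gt0 gP fi.
have mA : dot (legE z i - legQ z i) (legE z i - legQ z i) = legA z i ^+ 2 by rewrite elen_sqr.
have tB : dot (legV i - legE z i) (legV i - legE z i) = legB z i ^+ 2 by rewrite elen_sqr.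
split; first exact: (chart_pres c (legQ z i) aa bb ab A0 B0 mA tB orth3 mE tE).
have [||na nb] := chart_normal aa bb ab _ _ orth3 mE tE orth1 orth2.
- by rewrite mA expf_neq0// gt_eqF.
- by rewrite tB expf_neq0// gt_eqF.
have [s _ [t _ QE]] := Fab FQ'.
move=> st; have -> : chart c a b st - legQ z i = (st.1 - s) *: a + (st.2 - t) *: b.
  by rewrite /chart -QE; vring.
by rewrite dotDr !dotZr na nb !mulr0 addr0.
Qed.

Let tri_of i : set T2 := co i @^-1` (ccone (slope z i) `&` [set st | st.1 <= legA z i]).

(** This also shows that the facet is measurable, as a finite union of closed triangles. *)
Lemma facet_chart_tri : [set st : T2 | F (chart c a b st)] = \bigcup_(i in flags_of F) tri_of i.
Proof.
rewrite predeqE => st; split=> [/= Fx|[i [fi iF] [ci xa]]].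
  have [i0 fi0] := facet_flag Ff.
  (* At the foot itself there is no ray to follow, but the origin lies in every closed cone. *)
  have [xQ|xQ] := eqVneq (chart c a b st) (proj z F).
    exists i0 => //; have [fi iF] := fi0; rewrite /tri_of /co /= /flagX /flagY xQ.
    rewrite -iF -/(legQ z i0) subrr !dot0r !mul0r; split; first by rewrite /ccone /= mulr0.
    exact/ltW/(legA_gt0 gP).
  have [_ h] := flag_chart fi0.
  have nx : dot (proj z F - z) (chart c a b st - proj z F) = 0.
    by have := h st; rewrite /legQ (proj2 fi0).
  have [i [fi iF ci]] := flag_cover gP Ff nx xQ; exists i => //; split=> //.
  by apply: (flagX_le gP fi); rewrite iF.
have [_ h] := flag_chart (conj fi iF).
by rewrite /= -iF; exact: (flag_tri gP fi (h st) ci xa).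
Qed.

Lemma tri_measurable i : flags_of F i -> measurable (tri_of i).
Proof.
move=> /flag_chart[[mf _] _]; rewrite -[X in measurable X]setTI; apply: mf => //.
apply: measurableI; first exact: measurable_ccone.
exact: measurable_le2 (mfst (R := R)) (mcst _).
Qed.

Lemma facet_chart_measurable : measurable [set st : T2 | F (chart c a b st)].
Proof.
rewrite facet_chart_tri; apply: fin_bigcup_measurable; first exact: flags_of_finite.
exact: tri_measurable.
Qed.

Lemma flag_chart_tiling (X : set T2) : measurable X ->
  leb2 X = (\sum_(i \in flags_of F) leb2 (X `&` co i @^-1` cone (slope z i)))%E.
Proof.
move=> mX; apply: cone_tiling => //.
- exact: flags_of_finite.
- by move=> i /flag_chart[].
- by move=> i [fi _]; exact: (slope_gt0 gP).
- move=> i j st [fi iF] [fj jF] ci cj.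
  have [_ h] := flag_chart (conj fi iF).
  have ij : i.2 = j.2 by rewrite iF jF.
  exact: (flag_disjoint gP fi fj ij (h st) ci cj).
- move=> st _; have [i0 fi0] := facet_flag Ff.
  have [xQ|xQ] := eqVneq (chart c a b st) (proj z F).
    exists i0 => //; have [fi iF] := fi0; rewrite /co /= /flagX /flagY xQ.
    by rewrite -iF -/(legQ z i0) subrr !dot0r !mul0r /ccone /= mulr0.
  have [_ h] := flag_chart fi0.
  have nx : dot (proj z F - z) (chart c a b st - proj z F) = 0.
    by have := h st; rewrite /legQ (proj2 fi0).
  by have [i [fi iF ci]] := flag_cover gP Ff nx xQ; exists i.
Qed.

Lemma leb2_facet : leb2 [set st : T2 | F (chart c a b st)] =
  (\sum_(i \in flags_of F) (legA z i * legB z i / 2))%:E.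
Proof.
rewrite flag_chart_tiling; last exact: facet_chart_measurable.
rewrite -fsumEFin; last exact: flags_of_finite.
apply: eq_fsbigr => i /set_mem[fi iF].
have [pf h] := flag_chart (conj fi iF).
have A0 := legA_gt0 gP fi; have B0 := legB_gt0 gP fi.
have -> : [set st : T2 | F (chart c a b st)] `&` co i @^-1` cone (slope z i) =
    co i @^-1` tri (legA z i) (slope z i).
  rewrite predeqE => st; split=> [[Fx ci]|[ci xa]].
    by split=> //; apply: (flagX_le gP fi); rewrite iF.
  split=> //; rewrite /= -iF; apply: (flag_tri gP fi (h st)) => //.
  by case: ci => c1 c2; split; exact: ltW.
rewrite (proj2 pf); last exact: measurable_tri.
rewrite leb2_tri//; last exact: (slope_gt0 gP).
by congr (_%:E); rewrite /slope; field; exact: lt0r_neq0.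
Qed.

(** The angles at the foot make a full turn. The charts of all flags of [F] share their origin, so
    the disc is the same set in each. *)
Lemma disc_flags : disc_area = \sum_(i \in flags_of F) sector (slope z i).
Proof.
have [i0 fi0] := facet_flag Ff; have [pf0 h0] := flag_chart fi0.
have mX : measurable (co i0 @^-1` disc).
  by rewrite -[X in measurable X]setTI; apply: pf0.1 => //; exact: measurable_disc.
suff : disc_area%:E = (\sum_(i \in flags_of F) sector (slope z i))%:E by move=> [].
rewrite -disc_areaE -(proj2 pf0); last exact: measurable_disc.
rewrite flag_chart_tiling// -fsumEFin; last exact: flags_of_finite.
apply: eq_fsbigr => i /set_mem fi.
have [pf h] := flag_chart fi.
have -> : co i0 @^-1` disc `&` co i @^-1` cone (slope z i) =
    co i @^-1` (cone (slope z i) `&` disc).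
  have E st : (co i0 @^-1` disc) st <-> (co i @^-1` disc) st.
    rewrite /disc /= -(flag_norm gP (proj1 fi) (h st)) -(flag_norm gP (proj1 fi0) (h0 st)).
    by rewrite /legQ (proj2 fi) (proj2 fi0).
  rewrite predeqE => st; split=> [[x y]|[y x]]; [exact: (conj y ((E st).1 x))|exact: (conj ((E st).2 x) y)].
by rewrite (proj2 pf) ?sectorE//; exact: measurable_sector.
Qed.

End Chart.

Lemma facet_frame F : kfaces P 2 F -> exists c a b, [/\ dot a a = 1, dot b b = 1, dot a b = 0 &
  F `<=` [set c + s *: a + t *: b | s in [set: R] & t in [set: R]]].
Proof.
move=> Ff; have [i [fi iF]] := facet_flag Ff.
have A0 := legA_gt0 gP fi; have B0 := legB_gt0 gP fi; have [_ _ orth3] := flag_orth gP fi.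
have mA : dot (legE z i - legQ z i) (legE z i - legQ z i) = legA z i ^+ 2 by rewrite elen_sqr.
have tB : dot (legV i - legE z i) (legV i - legE z i) = legB z i ^+ 2 by rewrite elen_sqr.
exists (legQ z i), ((legA z i)^-1 *: (legE z i - legQ z i)), ((legB z i)^-1 *: (legV i - legE z i)).
split.
- by rewrite dotZl dotZr mA; field; exact: lt0r_neq0.
- by rewrite dotZl dotZr tB; field; exact: lt0r_neq0.
- by rewrite dotZl dotZr orth3 !mulr0.
- move=> x; rewrite -iF => Fx; exists (flagX z i x) => //; exists (flagY z i x) => //.
  by rewrite [RHS](flag_coord gP fi (flag_plane gP fi Fx)) !scalerA.
Qed.

(** [planar_area] selects some frame; one exists by [facet_frame], and every frame gives the same
    sum. *)
Lemma facet_area F : kfaces P 2 F ->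
  planar_area F = \sum_(i \in flags_of F) (legA z i * legB z i / 2).
Proof.
move=> Ff; have [c0 [a0 [b0 [aa bb ab Fab]]]] := facet_frame Ff.
rewrite /planar_area; case: xgetP => [m _ [c [a [b [aa' bb' ab' Fab' ->]]]]|].
  by rewrite -/leb2 -/(leb2 _) (leb2_facet Ff aa' bb' ab' Fab').
move=> /(_ (fine (leb2 [set st : T2 | F (chart c0 a0 b0 st)]))) []//.
by exists c0, a0, b0; split.
Qed.

Lemma disc_area_flags F : kfaces P 2 F ->
  disc_area = \sum_(i \in flags_of F) sector (slope z i).
Proof.
by move=> Ff; have [c [a [b [aa bb ab Fab]]]] := facet_frame Ff; exact: disc_flags aa bb ab Fab.
Qed.

End Fixed.
End Areas.

(** * Sums over all flags *)

Section Counting.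
Context {R : realType}.
Local Notation vec := 'rV[R]_3.
Implicit Types (P F G e : set vec).

Lemma fsum_partition (I J : choiceType) (A : set I) (D : set J) (p : I -> J) (g : I -> R) :
  finite_set A -> finite_set D -> (forall x, A x -> D (p x)) ->
  \sum_(x \in A) g x = \sum_(k \in D) \sum_(x \in A `&` [set x | p x = k]) g x.
Proof.
move=> fA fD pD.
under [RHS]eq_fsbigr do rewrite fsbig_mkcondr.
rewrite exchange_fsbig//; apply: eq_fsbigr => x /set_mem Ax.
rewrite (fsbigD1 (p x))//=; last exact: pD.
rewrite ifT ?inE// fsbig1 ?addr0// => k [Dk kp].
by rewrite ifF//; apply/negbTE; rewrite notin_setE /= => /esym.
Qed.

Lemma fsum_const (I : choiceType) (A : set I) (n : nat) (c : R) :
  (A #= `I_n)%card -> \sum_(x \in A) c = n%:R * c.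
Proof.
move=> /card_set_bijP[f bf].
have := @reindex_fsbig _ _ +%R _ _ f _ _ (fun=> c) bf => /= <-.
by rewrite -fsbig_ord sumr_const card_ord mulr_natl.
Qed.

Lemma fsum_pair (I : choiceType) (a b : I) (c : R) : a <> b -> \sum_(x \in [set a; b]) c = c *+ 2.
Proof.
move=> ab; rewrite fsbigU0//; first by rewrite !fsbig_set1.
by move=> x [-> /ab].
Qed.

Section Fixed.
Context P (z : vec) (gP : good P z).

(** Two endpoints times two facets: the origin of the factor four in the sums over flags. *)
Lemma edge_flags e : kfaces P 1 e -> exists v w F G, [/\ v <> w, F <> G &
  flags P `&` [set i | i.1.2 = e] = [set i | [/\ i.1.2 = e, i.1.1 = v \/ i.1.1 = w & i.2 = F \/ i.2 = G]]].
Proof.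
move=> ee; have [c sc] := good_strict gP.
have [v [w [vw vv ww seg only]]] := edge_endpoints (good_polytope gP) ee.
have [F [G [Ff Gf FG [eF eG] onlyF]]] := edge_facets (good_polytope gP) sc ee.
exists v, w, F, G; split=> //; rewrite predeqE => -[[x e'] K] /=; split.
  move=> [[/= xx ee' Kf ex eK] e'E]; rewrite e'E in ex eK.
  by split; [exact: e'E|exact: only|exact: onlyF].
have ev : e v by apply/seg; exists 0; rewrite scale0r addr0; split.
have ew : e w by apply/seg; exists 1; rewrite scale1r addrC subrK; split.
by move=> [-> [->|->] [->|->]].
Qed.

Lemma edge_flags_sum e (c : R) : kfaces P 1 e ->
  \sum_(i \in flags P `&` [set i | i.1.2 = e]) c = 4 * c.
Proof.
move=> /edge_flags[v [w [F [G [vw FG ->]]]]].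
have E : [set i : triple | [/\ i.1.2 = e, i.1.1 = v \/ i.1.1 = w & i.2 = F \/ i.2 = G]] =
  [set (v, e, F); (v, e, G)] `|` [set (w, e, F); (w, e, G)].
  rewrite predeqE => -[[x e'] K] /=; split.
    by move=> [-> [->|->] [->|->]]; [left; left|left; right|right; left|right; right].
  by move=> [] [] [-> -> ->]; split=> //; [left|left|left|right|right|left|right|right].
have d0 : [set (v, e, F); (v, e, G)] `&` [set (w, e, F); (w, e, G)] `<=` set0.
  by move=> i [] /= [->|->] [] [].
rewrite E fsbigU0//.
have F1 : (v, e, F) <> (v, e, G) by move=> [/FG].
have F2 : (w, e, F) <> (w, e, G) by move=> [/FG].
by rewrite (fsum_pair _ F1) (fsum_pair _ F2) /=; ring.
Qed.

Lemma flags_sum_const H (c : R) : (kfaces P 1 #= `I_H)%card ->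
  \sum_(i \in flags P) c = 4 * H%:R * c.
Proof.
move=> hH; rewrite (@fsum_partition _ _ _ (kfaces P 1) (fun i => i.1.2)).
- rewrite (eq_fsbigr (fun=> 4 * c)); last by move=> e /set_mem; exact: edge_flags_sum.
  by rewrite (fsum_const _ hH); ring.
- exact: flags_finite gP.
- exact: (good_finite gP).
- by move=> i [].
Qed.

Lemma surf_flags : surf P = \sum_(i \in flags P) (legA z i * legB z i / 2).
Proof.
rewrite (@fsum_partition _ _ _ (kfaces P 2) (fun i => i.2)).
- by apply: eq_fsbigr => F /set_mem Ff; exact: (facet_area gP Ff).
- exact: flags_finite gP.
- exact: (good_finite gP).
- by move=> i [].
Qed.

Lemma disc_flags_sum S : (kfaces P 2 #= `I_S)%card ->
  S%:R * disc_area = \sum_(i \in flags P) sector (slope z i).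
Proof.
move=> hS; rewrite (@fsum_partition _ _ _ (kfaces P 2) (fun i => i.2)).
- rewrite -(fsum_const _ hS); apply: eq_fsbigr => F /set_mem Ff; exact: (disc_area_flags gP Ff).
- exact: flags_finite gP.
- exact: (good_finite gP).
- by move=> i [].
Qed.

Lemma exists_flag : exists i, flags P i.
Proof.
have [c sc] := good_strict gP; have [F Ff] := exists_facet (good_polytope gP) sc.
by have [i [fi _]] := facet_flag gP Ff; exists i.
Qed.

End Fixed.
End Counting.

(** * Robustness *)

Section Robust.
Context {R : realType}.
Local Notation vec := 'rV[R]_3.
Implicit Types (u v w x y z c d p : vec) (P F G e : set vec) (i j : @triple R).

Lemma kface_exposed P k F : kfaces P k F -> exists u, F = amax P u.
Proof. by move=> /kfaces_amax[u [_ -> _ _]]; exists u. Qed.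

Lemma kface_sub P k F : kfaces P k F -> F `<=` P.
Proof. by move=> /kface_exposed[u ->]; exact: amax_sub. Qed.

Lemma relint_face_eq P k l F G x : kfaces P k F -> kfaces P l G -> relint F x -> relint G x -> F = G.
Proof.
move=> Ff Gf /relint_inner iF /relint_inner iG.
have [u FE] := kface_exposed Ff; have [w GE] := kface_exposed Gf.
rewrite eqEsubset; split.
  by apply: (inner_exposed iF (kface_sub Ff) GE); case: iG.
by apply: (inner_exposed iG (kface_sub Gf) FE); case: iF.
Qed.

Lemma affine_dim_inj (A : set vec) k l : affine_dim A k -> affine_dim A l -> k = l.
Proof.
move=> dk dl; have [x Ax] := affine_dim_neq0 dk.
have [W [<- WE]] := affine_dim_at dk Ax; have [W' [<- WE']] := affine_dim_at dl Ax.
suff -> : W = W' by [].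
apply/vspaceP => w; apply/idP/idP => Ww.
  have : [set x + w | w in [set` W]] (x + w) by exists w.
  by rewrite -WE WE' => -[w' /= Ww' /addrI <-].
have : [set x + w | w in [set` W']] (x + w) by exists w.
by rewrite -WE' WE => -[w' /= Ww' /addrI <-].
Qed.

Lemma kfaces_inj P k l F : kfaces P k F -> kfaces P l F -> k = l.
Proof. by move=> [_ dk] [_ dl]; exact: affine_dim_inj dk dl. Qed.

Definition full_stable P w := forall F, kfaces P 2 F ->
  exists2 x, relint F x & orthogonal_to (x - w) F.
Definition saddle_at P w e x := [/\ relint e x, orthogonal_to (x - w) e &
  forall y, (P `\` e) y -> 0 < dot (y - x) (w - x)].
Definition full_saddle P w := forall e, kfaces P 1 e -> exists x, saddle_at P w e x.
Definition unstable_at P w v := forall y, (P `\ v) y -> 0 < dot (y - v) (w - v).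
Definition full_unstable P w := forall v, kfaces P 0 [set v] -> unstable_at P w v.

(** A facet has at most one stable point, its foot, and different facets have disjoint relative
    interiors; so counting stable points is counting facets that contain their foot in the relative
    interior. *)
Lemma stable_card P w : (stable P w #=
  [set F | kfaces P 2 F /\ exists2 x, relint F x & orthogonal_to (x - w) F])%card.
Proof.
set A := (X in (_ #= X)%card).
have AP F : A F -> relint F (proj w F) /\ orthogonal_to (proj w F - w) F.
  by move=> [_ [x rx ox]]; rewrite (projE (proj1 rx) ox).
have -> : stable P w = proj w @` A.
  rewrite predeqE => x; split=> [[F [Ff rx ox]]|[F AF <-]].
    exists F; last by apply: projE ox; case: rx.
    by split=> //; exists x.
  by have [rx ox] := AP _ AF; case: AF => Ff _; exists F.
apply: inj_card_eq => F G /set_mem AF /set_mem AG e.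
have [rF _] := AP _ AF; have [rG _] := AP _ AG; rewrite -e in rG.
exact: relint_face_eq (proj1 AF) (proj1 AG) rF rG.
Qed.

Lemma saddle_card P w : (saddle P w #=
  [set e | kfaces P 1 e /\ exists x, saddle_at P w e x])%card.
Proof.
set A := (X in (_ #= X)%card).
have AP F : A F -> saddle_at P w F (proj w F).
  by move=> [_ [x [rx ox sx]]]; rewrite (projE (proj1 rx) ox).
have -> : saddle P w = proj w @` A.
  rewrite predeqE => x; split=> [[F [Ff rx ox sx]]|[F AF <-]].
    exists F; last by apply: projE ox; case: rx.
    by split=> //; exists x.
  by have [rx ox sx] := AP _ AF; case: AF => Ff _; exists F.
apply: inj_card_eq => F G /set_mem AF /set_mem AG e.
have [rF _ _] := AP _ AF; have [rG _ _] := AP _ AG; rewrite -e in rG.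
exact: relint_face_eq (proj1 AF) (proj1 AG) rF rG.
Qed.

Lemma finite_subset_card (T : choiceType) (A B : set T) n : A `<=` B -> (B #= `I_n)%card ->
  (A #= `I_n)%card -> A = B.
Proof.
move=> AB Bn An; rewrite eqEsubset; split=> // x Bx; apply: contrapT => nAx.
have fB : finite_set B by exists n.
have fA := sub_finite_set AB fB.
have : \sum_(y \in B) (1 : int) = \sum_(y \in A) (1 : int).
  have h (C : set T) : (C #= `I_n)%card -> \sum_(y \in C) (1 : int) = n%:R.
    move=> /card_set_bijP[f bf].
    have := @reindex_fsbig _ _ +%R _ _ f _ _ (fun=> 1 : int) bf => /= <-.
    by rewrite -fsbig_ord sumr_const card_ord.
  by rewrite !h.
rewrite (fsbigID A)//= (_ : B `&` A = A); last by apply/setIidPr.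
move=> /eqP; rewrite -subr_eq0 addrAC subrr add0r => /eqP h.
have := @pfsumr_eq0 _ _ (B `&` ~` A) (fun=> 1 : int) _ _ h x.
have f1 : finite_set (B `&` ~` A) by apply: (sub_finite_set _ fB) => y [].
by move=> /(_ f1 (fun _ _ => ler01) (conj Bx nAx))/eqP; rewrite oner_eq0.
Qed.

(** The count cannot exceed the number of facets, so equality says that no facet misses its stable
    point. This turns the counts in [robust_region] into conditions on single faces. *)
Lemma stable_full P w S : (kfaces P 2 #= `I_S)%card ->
  (stable P w #= `I_S)%card <-> full_stable P w.
Proof.
move=> hS; split=> [h F Ff|h].
  have E := finite_subset_card (A := [set F | kfaces P 2 F /\ exists2 x, relint F x &
    orthogonal_to (x - w) F]) (fun F h => proj1 h) hS.
  have : [set F | kfaces P 2 F /\ exists2 x, relint F x & orthogonal_to (x - w) F] F.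
    by rewrite E//; exact: card_eq_trans (card_esym (stable_card P w)) h.
  by case.
apply: card_eq_trans (stable_card P w) _.
rewrite (_ : [set F | _] = kfaces P 2)//; rewrite predeqE => F; split=> [[]//|Ff].
by split=> //; exact: h.
Qed.

Lemma saddle_full P w S : (kfaces P 1 #= `I_S)%card ->
  (saddle P w #= `I_S)%card <-> full_saddle P w.
Proof.
move=> hS; split=> [h F Ff|h].
  have E := finite_subset_card (A := [set e | kfaces P 1 e /\ exists x, saddle_at P w e x])
    (fun F h => proj1 h) hS.
  have : [set e | kfaces P 1 e /\ exists x, saddle_at P w e x] F.
    by rewrite E//; exact: card_eq_trans (card_esym (saddle_card P w)) h.
  by case.
apply: card_eq_trans (saddle_card P w) _.
rewrite (_ : [set F | _] = kfaces P 1)//; rewrite predeqE => F; split=> [[]//|Ff].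
by split=> //; exact: h.
Qed.

Lemma unstable_full P w U : (kfaces P 0 #= `I_U)%card -> full_unstable P w ->
  (unstable P w #= `I_U)%card.
Proof.
move=> hU h; apply: card_eq_trans hU; apply: card_esym.
have -> : kfaces P 0 = (fun v => [set v]) @` unstable P w.
  rewrite predeqE => V; split=> [VV|[v [vv _] <-]//].
  have [v vE] := vertex_set VV; exists v => //; rewrite vE in VV.
  by split=> //; exact: h.
by apply: inj_card_eq => v v' _ _ /(congr1 (fun A : set vec => A v)) E; have : [set v'] v by rewrite -E.
Qed.

Lemma equilibrium_orth P q k F x : strict P q -> kfaces P k F -> inner F x ->
  equilibrium P q x -> orthogonal_to (x - q) F.
Proof.
move=> sq Ff iF [_ eq].
have amq : amax P (x - q) x.
  have FP := kface_sub Ff; have Px := FP _ (proj1 iF).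
  case: eq => [xq|[_ le _]|[u0 le [y Py yE]]].
  - exfalso; have /kfaces_amax[u [u0 FE _ _]] := Ff; have [y Py uy] := sq u u0.
    by case: iF; rewrite FE xq => -[_ /(_ _ Py)]; rewrite leNgt uy.
  - by split=> //.
  (* This side is impossible for an interior [q]: some point of [P] lies beyond [q] in the direction
     [q - x], whereas the plane through [x] should bound [P] in that direction. *)
  - have xq0 : x - q != 0 by rewrite -opprB oppr_eq0.
    have [t Pt ht] := sq (q - x) u0.
    have := le _ Pt; move: ht; have := dot_ge0 (x - q); rewrite !dotE.
    rewrite [dot q x]dotC; lra.
have sub := inner_exposed iF (kface_sub Ff) erefl amq.
by move=> y y' /sub Fy /sub Fy'; rewrite dotBr; apply/eqP; rewrite subr_eq0; apply/eqP/(amax_eq Fy Fy').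
Qed.

Lemma robust_full P z w (S H : nat) : (kfaces P 2 #= `I_S)%card -> (kfaces P 1 #= `I_H)%card ->
  full_stable P z -> full_saddle P z -> robust_region P z w -> full_stable P w /\ full_saddle P w.
Proof.
move=> hS hH fS fH [_ h1 h2 _]; split.
  apply/(stable_full w hS); apply: card_eq_trans h1 _; exact/(stable_full z hS).
apply/(saddle_full w hH); apply: card_eq_trans h2 _; exact/(saddle_full z hH).
Qed.

Definition radius P z : R := inf [set elen (w - z) | w in ~` robust_region P z].

Lemma radius_le P z w : ~ robust_region P z w -> radius P z <= elen (w - z).
Proof.
move=> nr; apply: ge_inf; last by exists w.
by exists 0 => _ [y _ <-]; exact: elen_ge0.
Qed.

Lemma radius_ge0 P z : 0 <= radius P z.
Proof.
rewrite /radius; set A := (X in inf X).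
(* The infimum of the empty set is [0]. *)
have [->|/set0P[r Ar]] := eqVneq A set0; first by rewrite inf0.
by apply: lb_le_inf; [exists r|move=> _ [y _ <-]; exact: elen_ge0].
Qed.

Lemma not_relint_facet_edge P e F x : kfaces P 2 F -> kfaces P 1 e -> e `<=` F -> e x ->
  ~ relint F x.
Proof.
move=> Ff ee eF ex /relint_inner iF; have [u eE] := kface_exposed ee.
exact: (edge_not_facet ee Ff) (inner_exposed iF (kface_sub Ff) eE ex).
Qed.

Lemma not_relint_edge_vertex P e v : kfaces P 1 e -> kfaces P 0 [set v] -> e v -> ~ relint e v.
Proof.
move=> ee vv ev /relint_inner ie; have [u vE] := kface_exposed vv.
have sub := inner_exposed ie (kface_sub ee) vE erefl.
have [_ [_ _ [a [b [ab ea eb _]]]]] := (edgeP P e).1 ee.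
by apply: ab; rewrite (sub _ ea) (sub _ eb).
Qed.

Section Legs.
Context P (z : vec) (gP : good P z) (S H : nat).
Context (hS : (kfaces P 2 #= `I_S)%card) (hH : (kfaces P 1 #= `I_H)%card).
Context (fS : full_stable P z) (fH : full_saddle P z).

Lemma legA_not_robust i : flags P i -> ~ robust_region P z (z + (legE z i - legQ z i)).
Proof.
move=> fi; have [vv ee Ff ev eF] := fi.
move=> /(robust_full hS hH fS fH)[/(_ _ Ff)[x rx ox] _].
have [[eE _] _] := edge_proj gP ee; have [_ oQ] := facet_proj gP Ff.
suff xE : x = legE z i by apply: (not_relint_facet_edge Ff ee eF eE); rewrite -/(legE z i) -xE.
apply: (proj_unique (proj1 rx) ox (eF _ eE)).
by rewrite (_ : _ - _ = legQ z i - z)//; vring.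
Qed.

Lemma radius_le_legA i : flags P i -> radius P z <= legA z i.
Proof.
move=> fi; have -> : legA z i = elen (z + (legE z i - legQ z i) - z).
  by rewrite addrAC subrr add0r.
exact: radius_le (legA_not_robust fi).
Qed.

Lemma radius_le_legB i : flags P i -> radius P z <= legB z i.
Proof.
move=> fi; have [vv ee Ff ev eF] := fi.
have -> : legB z i = elen (z + (legV i - legE z i) - z) by rewrite addrAC subrr add0r.
apply: radius_le => /(robust_full hS hH fS fH)[_ /(_ _ ee)[x [rx ox _]]].
have [_ oE] := edge_proj gP ee.
suff xE : x = legV i by apply: (not_relint_edge_vertex ee vv ev); rewrite -/(legV i) -xE.
apply: (proj_unique (proj1 rx) ox ev).
by rewrite (_ : _ - _ = legE z i - z)//; rewrite /legV; vring.
Qed.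

End Legs.

Lemma good_of_equilibria P q (S U H : nat) : polyhedron P -> (kfaces P 2 #= `I_S)%card ->
  (kfaces P 0 #= `I_U)%card -> (kfaces P 1 #= `I_H)%card ->
  interior P q -> only_nondegenerate P q ->
  (forall F, kfaces P 2 F -> exists2 x, relint F x & equilibrium P q x) ->
  (forall e, kfaces P 1 e -> exists2 x, relint e x & equilibrium P q x) ->
  [/\ good P q, full_stable P q & full_saddle P q].
Proof.
move=> hP hS hU hH iq nd hface hedge; have sq := interior_strict iq.
have fS : full_stable P q.
  move=> F Ff; have [x rx ex] := hface _ Ff; exists x => //.
  exact: (equilibrium_orth sq Ff (relint_inner rx) ex).
split=> //.
  split.
  - exact: polyhedron_polytope.
  - by exists q.
  - exact: strict_inside.
  - by move=> [|[|[|//]]] _; [exists U|exists H|exists S].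
  - by move=> F /fS[x /relint_inner ix ox]; exists x.
  - move=> e ee; have [x rx ex] := hedge _ ee; exists x; first exact: relint_inner.
    exact: (equilibrium_orth sq ee (relint_inner rx) ex).
move=> e ee; have [x rx ex] := hedge _ ee.
(* Nondegeneracy leaves only the saddle type: the relative interior of an edge meets neither that of
   a facet nor the vertices. *)
have [[[F [Ff rF _]]|[e' [ee' re' ox sx]]]|[vx _]] := nd _ ex.
- by have := relint_face_eq Ff ee rF rx => FE; rewrite FE in Ff; have := kfaces_inj Ff ee.
- by exists x; rewrite (relint_face_eq ee ee' rx re').
- by exfalso; exact: (not_relint_edge_vertex ee vx (proj1 rx) rx).
Qed.

End Robust.

(** * The surface inequality and its case of equality *)

Section Inequality.
Context {R : realType}.
Local Notation vec := 'rV[R]_3.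
Implicit Types (P F G e : set vec) (z : vec) (i j : @triple R).

Definition uniform P z a b := forall i, flags P i -> legA z i = a /\ legB z i = b.

Lemma fsumD (I : choiceType) (A : set I) (f g : I -> R) : finite_set A ->
  \sum_(x \in A) (f x + g x) = \sum_(x \in A) f x + \sum_(x \in A) g x.
Proof. by move=> fA; rewrite -fsbig_split. Qed.

(** With [t = B / A] the product is [A ^+ 2 * t] and also [B ^+ 2 / t]; the form in which the
    maximum appears is estimated. *)
Lemma flag_product_ge (A B r : R) : 0 < A -> 0 < B -> 0 <= r -> r <= A -> r <= B ->
  r ^+ 2 * Num.max (B / A) (B / A)^-1 <= A * B.
Proof.
move=> A0 B0 r0 rA rB.
have rA2 : r ^+ 2 <= A ^+ 2 by rewrite ler_pXn2r// nnegrE ltW.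
have rB2 : r ^+ 2 <= B ^+ 2 by rewrite ler_pXn2r// nnegrE ltW.
have t0 : 0 < B / A by exact: divr_gt0.
have [h|h] := leP (B / A)^-1 (B / A).
  apply: le_trans (ler_wpM2r (ltW t0) rA2) _.
  have -> : A ^+ 2 * (B / A) = A * B by field; exact: lt0r_neq0.
  exact: lexx.
have ti : 0 <= (B / A)^-1 by rewrite invr_ge0 ltW.
apply: le_trans (ler_wpM2r ti rB2) _.
have -> : B ^+ 2 * (B / A)^-1 = A * B by field; rewrite !gt_eqF.
exact: lexx.
Qed.

Lemma flag_product_eq (A B r : R) : 0 < A -> 0 < B -> 0 < r ->
  r ^+ 2 * Num.max (B / A) (B / A)^-1 = A * B -> r = Num.min A B.
Proof.
move=> A0 B0 r0; have [h|h] := leP (B / A)^-1 (B / A).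
  have AB : A <= B.
    move: h; rewrite invf_div ler_pdivrMr// mulrAC ler_pdivlMr// => h.
    by rewrite -(@ler_pXn2r _ 2)// ?nnegrE ?ltW// !expr2.
  have -> : r ^+ 2 * (B / A) = (r ^+ 2 / A ^+ 2) * (A * B) by field; rewrite gt_eqF.
  move=> e; rewrite min_l//.
  have : r ^+ 2 / A ^+ 2 = 1.
    by apply: (mulIf (lt0r_neq0 (mulr_gt0 A0 B0))); rewrite e mul1r.
  move/(congr1 (fun q => q * A ^+ 2)); rewrite mulfVK ?expf_neq0 ?gt_eqF// mul1r.
  by move/eqP; rewrite eqrXn2 ?ltW// => /eqP.
have BA : B <= A.
  move: h; rewrite invf_div ltr_pdivlMr// mulrAC ltr_pdivrMr// => h.
  by rewrite -(@ler_pXn2r _ 2)// ?nnegrE ?ltW// !expr2.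
have -> : r ^+ 2 * (B / A)^-1 = (r ^+ 2 / B ^+ 2) * (A * B) by field; rewrite !gt_eqF.
move=> e; rewrite min_r//.
have : r ^+ 2 / B ^+ 2 = 1.
  by apply: (mulIf (lt0r_neq0 (mulr_gt0 A0 B0))); rewrite e mul1r.
move/(congr1 (fun q => q * B ^+ 2)); rewrite mulfVK ?expf_neq0 ?gt_eqF// mul1r.
by move/eqP; rewrite eqrXn2 ?ltW// => /eqP.
Qed.

Lemma flag_product_min (A B : R) : 0 < A -> 0 < B ->
  (Num.min A B) ^+ 2 * Num.max (B / A) (B / A)^-1 = A * B.
Proof.
move=> A0 B0; have [h|h] := leP A B.
  rewrite max_l; first by field; exact: lt0r_neq0.
  by rewrite invf_div ler_pdivrMr// mulrAC ler_pdivlMr//; apply: ler_pM => //; exact: ltW.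
rewrite max_r; first by field; rewrite !gt_eqF.
by rewrite invf_div ler_pdivrMr// mulrAC ler_pdivlMr//; apply: ler_pM => //; exact: ltW.
Qed.

Lemma half_gap (r A T M : R) : r * M <= A -> r * T <= r * M ->
  r / 2 * T <= A / 2 /\ (A / 2 - r / 2 * T = 0 -> r * M = A /\ r * T = r * M).
Proof. by move=> h1 h2; split=> [|e]; [|split]; lra. Qed.

Section Two.
Context P P' (z z' : vec) (gP : good P z) (gP' : good P' z') (S H : nat) (a b : R).
Context (hS : (kfaces P 2 #= `I_S)%card) (hH : (kfaces P 1 #= `I_H)%card).
Context (hS' : (kfaces P' 2 #= `I_S)%card) (hH' : (kfaces P' 1 #= `I_H)%card).
Context (a0 : 0 < a) (b0 : 0 < b) (uP : uniform P z a b).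

Lemma surf_uniform : surf P = 2 * H%:R * (a * b).
Proof.
rewrite (surf_flags gP) (eq_fsbigr (fun=> a * b / 2)); last first.
  by move=> i /set_mem /uP[-> ->].
by rewrite (flags_sum_const gP _ hH); field.
Qed.

Lemma disc_uniform : S%:R * disc_area = 4 * H%:R * sector (b / a).
Proof.
rewrite (disc_flags_sum gP hS) (eq_fsbigr (fun=> sector (b / a))); last first.
  by move=> i /set_mem /uP[aE bE]; rewrite /slope aE bE.
by rewrite (flags_sum_const gP _ hH).
Qed.

Lemma surf_compare r : 0 <= r -> (forall i, flags P' i -> r <= legA z' i) ->
  (forall i, flags P' i -> r <= legB z' i) ->
  r ^+ 2 * surf P <= (Num.min a b) ^+ 2 * surf P' /\
  (0 < r -> r ^+ 2 * surf P = (Num.min a b) ^+ 2 * surf P' ->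
    uniform P' z' (r / Num.min a b * a) (r / Num.min a b * b)).
Proof.
move=> r0 rA rB; set t0 := b / a; have t00 : 0 < t0 by exact: divr_gt0.
have m0 : 0 < Num.min a b by rewrite lt_min a0.
have [m hm] := sector_tangent t00.
set mu := Num.max t0 t0^-1 in hm.
have abE : (Num.min a b) ^+ 2 * mu = a * b by exact: flag_product_min.
pose g i := legA z' i * legB z' i / 2 - r ^+ 2 / 2 * (mu + m * (sector (slope z' i) - sector t0)).
have g0 i : flags P' i -> 0 <= g i.
  move=> fi; rewrite subr_ge0.
  have A0 := legA_gt0 gP' fi; have B0 := legB_gt0 gP' fi.
  have h1 := flag_product_ge A0 B0 r0 (rA _ fi) (rB _ fi).
  have [h2 _] := hm _ (slope_gt0 gP' fi).
  have h3 := ler_wpM2l (sqr_ge0 r) h2; exact: (half_gap h1 h3).1.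
have fl := flags_finite gP'.
(* The terms linear in [sector] add up to a multiple of [S%:R * disc_area], which [disc_uniform]
   evaluates on [P]; they cancel against the terms with [sector t0]. *)
have sg : \sum_(i \in flags P') g i = surf P' - r ^+ 2 * (2 * H%:R * mu).
  rewrite /g fsumD// -(surf_flags gP').
  rewrite (eq_fsbigr (fun i => (- (r ^+ 2 / 2) * m) * sector (slope z' i)
     + (- (r ^+ 2 / 2) * (mu - m * sector t0)))); last by move=> i _; ring.
  rewrite fsumD// -mulr_fsumr (flags_sum_const gP' _ hH') -(disc_flags_sum gP' hS').
  by rewrite disc_uniform -/t0; field.
(* The difference of the two sides is a positive multiple of the sum of the gaps [g i], so equality
   forces equality at every flag. *)
have key : (Num.min a b) ^+ 2 * surf P' - r ^+ 2 * surf P =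
    (Num.min a b) ^+ 2 * \sum_(i \in flags P') g i.
  by rewrite sg surf_uniform -abE; ring.
split; first by rewrite -subr_ge0 key mulr_ge0 ?sqr_ge0// fsumr_ge0.
move=> r0' e; have sg0 : \sum_(i \in flags P') g i = 0.
  have := key; rewrite e subrr => /esym/eqP; rewrite mulf_eq0 expf_eq0 /= gt_eqF//=.
  by move=> /eqP.
move=> i fi; have := pfsumr_eq0 fl g0 sg0 fi; rewrite /g => gi.
have A0 := legA_gt0 gP' fi; have B0 := legB_gt0 gP' fi.
have h1 := flag_product_ge A0 B0 r0 (rA _ fi) (rB _ fi).
have [h2 h2e] := hm _ (slope_gt0 gP' fi).
have r2 : 0 < r ^+ 2 by rewrite exprn_gt0.
have h3 := ler_wpM2l (ltW r2) h2; rewrite -/(slope z' i) in h1.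
have [e1 e2'] := (half_gap h1 h3).2 gi.
have e2 : mu + m * (sector (slope z' i) - sector t0) = Num.max (slope z' i) (slope z' i)^-1.
  exact: (mulfI (lt0r_neq0 r2) e2').
have st := h2e e2.
have rE := flag_product_eq A0 B0 r0' e1.
have BE : legB z' i = t0 * legA z' i by rewrite -st /slope mulfVK// gt_eqF.
have bE : b = t0 * a by rewrite /t0 mulfVK// gt_eqF.
have [h|h] := leP 1 t0.
  have ab : a <= b by rewrite bE ler_peMl// ltW.
  have AB : legA z' i <= legB z' i by rewrite BE ler_peMl// ltW.
  rewrite rE !min_l// BE bE; clearbody t0; split; field; exact: lt0r_neq0.
have ab : b <= a by rewrite bE ger_pMl// ltW.
have AB : legB z' i <= legA z' i by rewrite BE ger_pMl// ltW.
rewrite rE !min_r// BE bE; clearbody t0; split; field; rewrite ?gt_eqF//.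
Qed.

End Two.
End Inequality.

(** * Similarities of space and their action on faces *)

Section Similarity.
Context {R : realType}.
Local Notation vec := 'rV[R]_3.
Implicit Types (u v w x y z c d p : vec) (P F G e : set vec) (f g : vec -> vec).

Definition sim k f := 0 < k /\ forall x y, elen (f x - f y) = k * elen (x - y).

Lemma dot_mx_orth (M : 'M[R]_3) x y : M *m M^T = 1%:M -> dot (x *m M) (y *m M) = dot x y.
Proof. by move=> MM; rewrite /dot trmx_mul mulmxA -(mulmxA x) MM mulmx1. Qed.

(** After translation and rescaling the map preserves products, by polarization; the images of the
    unit vectors are the rows of the orthogonal matrix. *)
Lemma sim_affine k f : sim k f -> exists M : 'M[R]_3, [/\ M *m M^T = 1%:M, M^T *m M = 1%:M &
  forall x, f x = f 0 + k *: (x *m M)].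
Proof.
move=> [k0 fk]; pose phi x := k^-1 *: (f x - f 0).
have nphi x y : dot (phi x - phi y) (phi x - phi y) = dot (x - y) (x - y).
  have -> : phi x - phi y = k^-1 *: (f x - f y) by rewrite /phi; vring.
  by rewrite -!elen_sqr elenZ gtr0_norm ?invr_gt0// fk mulKf// gt_eqF.
have phi0 : phi 0 = 0 by rewrite /phi subrr scaler0.
have dphi x y : dot (phi x) (phi y) = dot x y.
  move: (nphi x y) (nphi x 0) (nphi y 0); rewrite phi0 !subr0; move: (phi x) (phi y) => X Y.
  rewrite !(dotDl, dotDr, dotNl, dotNr) [dot Y X]dotC [dot y x]dotC; lra.
have dotdelta (j : 'I_3) x : dot x (delta_mx 0 j) = x 0 j.
  rewrite dotC /dot mxE (bigD1 j)//= big1 ?addr0 ?mxE ?eqxx ?mul1r// => l jl.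
  by rewrite !mxE eqxx (negPf jl) mul0r.
pose M : 'M[R]_3 := \matrix_i phi (delta_mx 0 i).
have xMT x j : (phi x *m M^T) 0 j = x 0 j.
  rewrite -[RHS]dotdelta -dphi /dot !mxE; apply: eq_bigr => l _.
  by rewrite !mxE.
have MM : M *m M^T = 1%:M.
  apply/row_matrixP => i; rewrite row_mul rowK row1; apply/rowP => j.
  by rewrite xMT.
have MM' := mulmx1C MM; exists M; split=> // x.
have -> : x *m M = phi x.
  rewrite -[RHS]mulmx1 -MM' mulmxA; congr (_ *m _); apply/rowP => j; by rewrite xMT.
by rewrite /phi scalerA mulfV ?gt_eqF// scale1r addrC subrK.
Qed.

Lemma affine_sim k (b : vec) (M : 'M[R]_3) : 0 < k -> M *m M^T = 1%:M ->
  sim k (fun x => b + k *: (x *m M)).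
Proof.
move=> k0 MM; split=> // x y; have -> : b + k *: (x *m M) - (b + k *: (y *m M)) = k *: ((x - y) *m M).
  by rewrite mulmxBl; vring.
by rewrite elenZ gtr0_norm// /elen dot_mx_orth.
Qed.

Lemma sim_inverse k f : sim k f -> exists g, [/\ sim k^-1 g, cancel f g & cancel g f].
Proof.
move=> sf; have [M [MM MM' fE]] := sim_affine sf; have k0 := proj1 sf.
have kn : k != 0 by rewrite gt_eqF.
pose g x := - (k^-1 *: (f 0 *m M^T)) + k^-1 *: (x *m M^T).
exists g; split.
- by apply: affine_sim; rewrite ?invr_gt0// trmxK.
- move=> x; rewrite /g [f x]fE mulmxDl -scalemxAl -mulmxA MM mulmx1 scalerDr scalerA mulVf//.
  by rewrite scale1r addrA addNr add0r.
- move=> x; rewrite /g fE mulmxDl mulNmx -!scalemxAl -!mulmxA MM' !mulmx1 scalerDr scalerN.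
  by rewrite !scalerA mulfV// !scale1r addrA subrr add0r.
Qed.

Lemma sim_dot k f x y z t : sim k f -> dot (f x - f y) (f z - f t) = k ^+ 2 * dot (x - y) (z - t).
Proof.
move=> sf; have [M [MM _ fE]] := sim_affine sf; rewrite [f x]fE [f y]fE [f z]fE [f t]fE.
have e a b : f 0 + k *: (a *m M) - (f 0 + k *: (b *m M)) = k *: ((a - b) *m M).
  by rewrite mulmxBl; vring.
by rewrite !e dotZl dotZr dot_mx_orth// mulrA -expr2.
Qed.

Lemma sim_comb k f x y t : sim k f -> f (x + t *: (y - x)) = f x + t *: (f y - f x).
Proof.
move=> sf; have [M [MM _ fE]] := sim_affine sf.
rewrite [f (_ + _)]fE [f x]fE [f y]fE mulmxDl -scalemxAl mulmxBl; vring.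
Qed.

Lemma sim_inj k f : sim k f -> injective f.
Proof. by move=> sf; have [g [_ fg _]] := sim_inverse sf; exact: can_inj fg. Qed.

Lemma sim_amax k f P u : sim k f -> u != 0 -> exists2 u', u' != 0 &
  f @` amax P u = amax (f @` P) u'.
Proof.
move=> sf u0; have [M [MM MM' fE]] := sim_affine sf; have k0 := proj1 sf.
have du x : dot (u *m M) (f x) = dot (u *m M) (f 0) + k * dot u x.
  by rewrite [f x]fE dotDr dotZr dot_mx_orth.
exists (u *m M); first by rewrite -dot_eq0 dot_mx_orth// dot_eq0.
rewrite predeqE => y; split=> [[x [Px mx] <-]|[[x Px <-] mx]].
  split; first by exists x.
  by move=> _ [t Pt <-]; rewrite (du t) (du x) lerD2l ler_pM2l//; exact: mx.
exists x => //; split=> // t Pt; have := mx (f t) (ex_intro2 _ _ t Pt erefl).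
by rewrite (du t) (du x) lerD2l ler_pM2l.
Qed.

Lemma sim_kface k f P j F : sim k f -> (j <= 2)%N -> kfaces P j F -> kfaces (f @` P) j (f @` F).
Proof.
move=> sf j2 Ff; have k0 := proj1 sf; have fi := sim_inj sf.
have [u [u0 FE [x0 Fx0] d]] := (kfaces_amax P j F).1 Ff.
have [u' u'0 uE] := sim_amax P sf u0; rewrite -FE in uE.
have fF x : F x -> (f @` F) (f x) by move=> Fx; exists x.
case: j Ff j2 d => [|[|[|//]]] Ff _ d.
- apply/kfaces_amax; exists u'; split=> //; first by exists (f x0); exact: fF.
  have [x xE] := (affine_dim0 F).1 d; apply/affine_dim0; exists (f x).
  by rewrite xE image_set1.
- apply/edgeP; exists u'; split=> //; have [v [w [vw Fv Fw lin]]] := (affine_dim1 F).1 d.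
  exists (f v), (f w); split; [by move/fi|exact: fF|exact: fF|].
  by move=> _ [x /lin[t ->] <-]; exists t; exact: sim_comb sf.
- rewrite uE; apply: facet_spans => //; rewrite -uE.
  have [m [m0 _ [x [y [z [[Fx Fy Fz] [_ _ c0]]]]]]] := facetP Ff.
  exists (f x), (f y), (f z); split; first by split; exact: fF.
  have cst t t' : F t -> F t' -> dot u' (f t - f t') = 0.
    move=> Ft Ft'; rewrite dotBr; apply/eqP; rewrite subr_eq0; apply/eqP.
    by apply: (@amax_eq _ (f @` P)); rewrite -uE; exact: fF.
  split; [exact: cst|exact: cst|].
  rewrite -dot_eq0 dot_cross_cross !(sim_dot _ _ _ _ sf).
  rewrite (_ : _ - _ = k ^+ 4 * dot (cross (y - x) (z - x)) (cross (y - x) (z - x))).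
    by rewrite mulf_neq0// ?dot_eq0// expf_neq0// gt_eqF.
  by rewrite dot_cross_cross; ring.
Qed.

Lemma sim_image_can k f P g : sim k f -> cancel f g -> g @` (f @` P) = P.
Proof.
move=> sf fg; rewrite predeqE => x; split=> [[_ [y Py <-] <-]|Px]; first by rewrite fg.
by exists (f x); [exists x|rewrite fg].
Qed.

Lemma sim_kface_surj k f P j G : sim k f -> (j <= 2)%N -> kfaces (f @` P) j G ->
  exists2 F, kfaces P j F & G = f @` F.
Proof.
move=> sf j2 Gf; have [g [sg fg gf]] := sim_inverse sf.
exists (g @` G); last by rewrite (sim_image_can _ sg gf).
by have := sim_kface sg j2 Gf; rewrite (sim_image_can _ sf fg).
Qed.

End Similarity.

(** * Regular polyhedra *)

Section Vertices.
Context {R : realType}.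
Local Notation vec := 'rV[R]_3.
Implicit Types (u v w x y z c d p : vec) (P F G e : set vec) (f g : vec -> vec).

Lemma face_vertex P u : polytope P -> u != 0 -> exists2 v, kfaces P 0 [set v] & amax P u v.
Proof.
move=> [s [s0 ->]] u0; have [v [w [w0 wE uv]]] := amax_vertex s0 u0.
by exists v => //; apply/vertexP; exists w.
Qed.

Lemma vertex_le P d h : polytope P -> d != 0 -> (forall v, kfaces P 0 [set v] -> dot d v <= h) ->
  forall x, P x -> dot d x <= h.
Proof.
move=> pP d0 vh x Px; have [v vv [_ mv]] := face_vertex pP d0.
exact: le_trans (mv _ Px) (vh _ vv).
Qed.

Lemma face_vertex_le P u F d h : polytope P -> u != 0 -> F = amax P u ->
  (forall v, kfaces P 0 [set v] -> F v -> dot d v <= h) -> forall x, F x -> dot d x <= h.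
Proof.
move=> pP u0 FE vh x Fx; have [f [M [f0 _ fE]]] := amax_face d pP u0.
have [v vv] := face_vertex pP f0; rewrite -fE -FE => -[Fv mv].
exact: le_trans (mv _ Fx) (vh _ vv Fv).
Qed.

(** If the face were a facet, the functional [cross m (w - v)] would be constant on its vertices and
    hence on the facet, although it is independent of the normal. *)
Lemma two_vertex_edge P m v w : polytope P -> m != 0 -> amax P m v -> amax P m w -> v <> w ->
  (forall u, kfaces P 0 [set u] -> amax P m u -> u = v \/ u = w) -> kfaces P 1 (amax P m).
Proof.
move=> pP m0 mv mw vw only.
have [/vertex_set[x xE]|//|Ff] := face_trichotomy pP m0.
  by case: vw; move: mv mw; rewrite xE => -> ->.
exfalso; pose d := cross m (w - v).
have wv0 : w - v != 0 by rewrite subr_eq0; apply/eqP => /esym.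
have mwv : dot m (w - v) = 0 by rewrite dotBr (amax_eq mv mw) subrr.
have d0 : d != 0.
  by rewrite -dot_eq0 dot_cross_cross mwv expr0n subr0 mulf_neq0 ?dot_eq0.
have dwv : dot d w = dot d v.
  by apply/eqP; rewrite -subr_eq0 -dotBr dotC dot_crossr.
have nd k : d <> k *: m.
  move=> dk; move: d0; rewrite -dot_eq0 {1}dk dotZl dot_crossl mulr0 eqxx//.
have [x Fx dx] := facet_nonconst Ff m0 erefl mv nd.
have le (s : R) t : amax P m t -> dot (s *: d) t <= dot (s *: d) v.
  apply: (face_vertex_le pP m0 erefl) => u uu Fu.
  by case: (only u uu Fu) => ->; rewrite // !dotZl dwv.
apply: dx; apply: le_anti; have := le 1 _ Fx; have := le (-1) _ Fx.
by rewrite !dotZl !mulN1r !mul1r lerN2 => -> ->.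
Qed.

Lemma vertex_spread P w h : polytope P -> fulldim P -> w != 0 ->
  (forall v, kfaces P 0 [set v] -> dot w v = h) -> False.
Proof.
move=> pP fP w0 vh; have [x Px wx] := fP w h w0; apply: wx.
apply: le_anti; apply/andP; split.
  by apply: (vertex_le pP w0 _ Px) => v /vh ->.
have w0' : - w != 0 by rewrite oppr_eq0.
rewrite -lerN2 -dotNl; apply: (vertex_le pP w0' _ Px) => v /vh.
by rewrite dotNl => ->.
Qed.

(** Otherwise all vertices would have the same product with [o - o'] and lie in a plane. *)
Lemma center_unique P o o' : polytope P -> fulldim P -> is_center P o -> is_center P o' -> o = o'.
Proof.
move=> pP fP ho ho'; apply/eqP; rewrite -subr_eq0; apply: contrapT => /negP ne.
have [v0 vv0 _] := face_vertex pP ne.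
apply: (vertex_spread pP fP ne (h := dot (o - o') v0)) => v vv.
have h1 := elen_eqE (ho _ _ vv vv0); have h2 := elen_eqE (ho' _ _ vv vv0).
have e x : dot (x - o') (x - o') =
    dot (x - o) (x - o) + 2 * dot (o - o') (x - o) + dot (o - o') (o - o').
  have -> : x - o' = (x - o) + (o - o') by vring.
  move: (x - o) (o - o') => X D; rewrite !(dotDl, dotDr) [dot X D]dotC; ring.
move: h2; rewrite (e v) (e v0) h1 ![dot (o - o') (_ - o)]dotBr; lra.
Qed.

Lemma isometry_sim g : is_isometry g <-> sim 1 g.
Proof.
split=> [h|[_ h] x y]; last by rewrite h mul1r.
by split=> // x y; rewrite h mul1r.
Qed.

Lemma center_fixed P o g : polytope P -> fulldim P -> is_center P o -> is_isometry g ->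
  g @` P = P -> g o = o.
Proof.
move=> pP fP ho ig gP; apply/esym/(center_unique pP fP ho) => v w vv ww.
have sg := (isometry_sim g).1 ig.
have pre x : kfaces P 0 [set x] -> exists2 y, kfaces P 0 [set y] & x = g y.
  rewrite -{1}gP => xx; have [Y YY /esym xE] := sim_kface_surj (j := 0) sg isT xx.
  have [y yE] := vertex_set YY; exists y; first by rewrite -yE.
  by move: xE; rewrite yE image_set1 => E; have : [set g y] x by rewrite E.
have [v' vv' ->] := pre _ vv; have [w' ww' ->] := pre _ ww.
by rewrite !ig; exact: ho.
Qed.

Lemma isometry_vertex P g v : is_isometry g -> g @` P = P -> kfaces P 0 [set v] ->
  kfaces P 0 [set g v].
Proof.
move=> /isometry_sim sg gP vv; rewrite -{1}gP -image_set1; exact: (sim_kface (j := 0) sg isT vv).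
Qed.

Lemma edge_vertices P e : polytope P -> kfaces P 1 e -> exists v w,
  [/\ v <> w, kfaces P 0 [set v], kfaces P 0 [set w], e v /\ e w &
   forall x, kfaces P 0 [set x] -> e x -> x = v \/ x = w].
Proof.
move=> pP ee; have [v [w [vw vv ww seg only]]] := edge_endpoints pP ee.
exists v, w; split=> //; split; apply/seg.
- by exists 0; rewrite scale0r addr0; split.
- by exists 1; rewrite scale1r addrC subrK; split.
Qed.

Lemma closest_vertices P : polytope P -> finite_set (kfaces P 0) ->
  (exists e, kfaces P 1 e) -> exists v w, [/\ kfaces P 0 [set v], kfaces P 0 [set w], v <> w &
  forall x y, kfaces P 0 [set x] -> kfaces P 0 [set y] -> x <> y ->
    elen (v - w) <= elen (x - y)].
Proof.
move=> pP /finite_seqP[vs vsE] [e ee].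
have [a [b [ab va vb _ _]]] := edge_vertices pP ee.
pose L := [seq q <- [seq (xget 0 A, xget 0 B) | A <- vs, B <- vs] | q.1 != q.2 :> vec].
have xg x : xget 0 [set x] = x by case: xgetP => [y _ ->//|/(_ x) h]; exfalso; apply: h.
have inL x y : kfaces P 0 [set x] -> kfaces P 0 [set y] -> x <> y -> (x, y) \in L.
  move=> xx yy /eqP xy; rewrite mem_filter xy; apply/allpairsP.
  exists ([set x], [set y]); rewrite /= !xg; split=> //.
    by have : [set` vs] [set x] by rewrite -vsE.
  by have : [set` vs] [set y] by rewrite -vsE.
have Lin q : q \in L -> [/\ kfaces P 0 [set q.1], kfaces P 0 [set q.2] & q.1 <> q.2].
  rewrite mem_filter => /andP[/eqP ne /allpairsP[[A B] [/= Av Bv qE]]].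
  have AA : kfaces P 0 A by rewrite vsE.
  have BB : kfaces P 0 B by rewrite vsE.
  have [x xE] := vertex_set AA; have [y yE] := vertex_set BB.
  by rewrite qE xE yE !xg -xE -yE in ne *.
have L0 : L != [::] by have := inL _ _ va vb ab; case: (L).
have [[v w] /Lin[/= vv ww vw] mx] := seq_max (fun q : vec * vec => - elen (q.1 - q.2)) L0.
exists v, w; split=> // x y xx yy xy.
by have := mx _ (inL _ _ xx yy xy); rewrite lerN2.
Qed.

Section Regular.
Context P o (hP : regular_polyhedron P) (ho : is_center P o).
Context (fin : forall k, (k <= 2)%N -> finite_set (kfaces P k)).

Lemma reg_polytope : polytope P.
Proof. exact: polyhedron_polytope (proj1 hP). Qed.

Lemma reg_strict : exists c, strict P c.
Proof. by have [_ [c ic]] := proj1 hP; exists c; exact: interior_strict. Qed.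

Lemma reg_full : fulldim P.
Proof. by have [c sc] := reg_strict; exact: strict_fulldim sc. Qed.

Lemma facet_has_edge F : kfaces P 2 F -> exists e, kfaces P 1 e /\ e `<=` F.
Proof.
move=> Ff; have pP := reg_polytope; have [c ic] := facet_inner pP Ff.
have [u [u0 FE _]] := facetP Ff.
have [m mu] := exists_indep u.
have d0 : cross u m != 0 by exact: cross_neq0.
by have [e [t [ee eF _ _]]] := facet_exit pP Ff u0 FE ic d0 (dot_crossl _ _); exists e.
Qed.

Lemma edge_has_flag e v : kfaces P 1 e -> kfaces P 0 [set v] -> e v ->
  exists F, flag P [set v] e F.
Proof.
move=> ee vv ev; have [F [_ [Ff _ _ eF _]]] := edge_two_facets reg_polytope reg_full ee.
by exists F; split=> // _ ->.
Qed.

Lemma facet_has_flag F : kfaces P 2 F -> exists v e, flag P [set v] e F.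
Proof.
move=> /[dup] Ff /facet_has_edge[e [ee eF]].
have [v [_ [_ vv _ [ev _] _]]] := edge_vertices reg_polytope ee.
by exists v, e; split=> // _ ->.
Qed.

Lemma edge_length e e' v w v' w' : kfaces P 1 e -> kfaces P 1 e' ->
  kfaces P 0 [set v] -> kfaces P 0 [set w] -> e v -> e w -> v <> w ->
  kfaces P 0 [set v'] -> kfaces P 0 [set w'] -> e' v' -> e' w' -> v' <> w' ->
  elen (v - w) = elen (v' - w').
Proof.
move=> ee ee' vv ww ev ew vw vv' ww' ev' ew' vw'.
have [F fl] := edge_has_flag ee vv ev; have [F' fl'] := edge_has_flag ee' vv' ev'.
have [g [ig gP gv ge _]] := (proj2 hP) _ _ _ _ _ _ fl fl'.
have ge' x : e x -> e' (g x) by move=> ex; rewrite -ge; exists x.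
have gvE : g v = v'.
  by move: gv; rewrite image_set1 => E; have : [set g v] (g v) by []; rewrite E.
have gwE : g w = w'.
  have [a [b [ab _ _ _ only]]] := edge_vertices reg_polytope ee'.
  have gw := only _ (isometry_vertex ig gP ww) (ge' _ ew).
  have gw_ne : g w <> v' by rewrite -gvE => /(sim_inj ((isometry_sim g).1 ig)) /esym.
  have := only _ vv' ev'; have := only _ ww' ew'.
  by case=> hw'; case=> hv'; case: gw => hgw; congruence.
by rewrite -ig gvE gwE.
Qed.

(** The vertices lie on a sphere about [o], where distance decreases with the product. Any other
    vertex is at least as far from [v] and [w] as these are from each other, so its product with [m]
    is smaller than theirs, and the face exposed by [m] has only the vertices [v] and [w]. *)
Lemma min_pair_edge v w : kfaces P 0 [set v] -> kfaces P 0 [set w] -> v <> w ->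
  (forall x y, kfaces P 0 [set x] -> kfaces P 0 [set y] -> x <> y -> elen (v - w) <= elen (x - y)) ->
  exists e, [/\ kfaces P 1 e, e v & e w].
Proof.
move=> vv ww vw mn; have pP := reg_polytope.
pose m := (v - o) + (w - o).
have vwE := elen_eqE (ho vv ww).
have lt u : kfaces P 0 [set u] -> u <> v -> u <> w -> dot m u < dot m v.
  move=> uu uv uw.
  have := mn _ _ uu vv uv; have := mn _ _ uu ww uw; rewrite !elen_le => h1 h2.
  have uvE := elen_eqE (ho uu vv).
  have pos : 0 < dot (v - w) (v - w) by rewrite dot_gt0 subr_eq0; apply/eqP.
  have e x y : dot (x - y) (x - y) = dot (x - o) (x - o) + dot (y - o) (y - o) - 2 * dot (x - o) (y - o).
    have -> : x - y = (x - o) - (y - o) by vring.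
    move: (x - o) (y - o) => X Y; rewrite !(dotDl, dotDr, dotNl, dotNr) [dot Y X]dotC; ring.
  rewrite (e v w) (e u w) in h1; rewrite (e v w) (e u v) in h2; rewrite (e v w) in pos.
  rewrite -subr_gt0 -dotBr; have -> : v - u = (v - o) - (u - o) by vring.
  rewrite /m; move: vwE uvE h1 h2 pos; move: (v - o) (w - o) (u - o) => V W U.
  rewrite !(dotDl, dotDr, dotNl, dotNr) [dot W V]dotC [dot V U]dotC [dot W U]dotC; lra.
have mvw : dot m w = dot m v.
  have e : dot m (w - v) = dot (w - o) (w - o) - dot (v - o) (v - o).
    have -> : w - v = (w - o) - (v - o) by vring.
    rewrite /m; move: (v - o) (w - o) => V W.
    by rewrite !(dotDl, dotDr, dotNl, dotNr) [dot W V]dotC; ring.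
  by move: e; rewrite vwE subrr dotBr => /eqP; rewrite subr_eq0 => /eqP.
(* If [v] and [w] are antipodal, the strict inequality leaves no other vertex, and [P] would be
   flat. *)
have [m0|m0] := eqVneq m 0.
  exfalso; have wv0 : w - v != 0 by rewrite subr_eq0; apply/eqP => /esym.
  have [k kE] := exists_indep (w - v).
  have d0 : cross (w - v) k != 0 by exact: cross_neq0.
  apply: (vertex_spread pP reg_full d0 (h := dot (cross (w - v) k) v)) => u uu.
  have [->//|uv] := eqVneq u v; have [->|uw] := eqVneq u w.
    by apply/eqP; rewrite -subr_eq0 -dotBr dotC dot_crossl.
  have := lt _ uu; rewrite m0 !dot0l ltxx; move/eqP: uv => uv; move/eqP: uw => uw.
  by move=> /(_ uv uw).
have le x : P x -> dot m x <= dot m v.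
  apply: (vertex_le pP m0) => u uu.
  have [->//|uv] := eqVneq u v; have [->|uw] := eqVneq u w; first by rewrite mvw.
  by apply/ltW/lt => //; exact/eqP.
have mv : amax P m v by split=> //; exact: vertex_in.
have mw : amax P m w by apply: (amaxP mv (vertex_in ww)); rewrite mvw.
exists (amax P m); split=> //; apply: (two_vertex_edge pP m0 mv mw vw) => u uu um.
apply: contrapT => /not_orP[uv uw].
by have := lt _ uu uv uw; rewrite (amax_eq um mv) ltxx.
Qed.

(** Some edge joins a closest pair of vertices, and flag transitivity makes all edges equally long.
    That the edges realize the minimal distance is the metric input for all that follows. *)
Lemma reg_edge_min : exists2 l, 0 < l & 
  (forall x y, kfaces P 0 [set x] -> kfaces P 0 [set y] -> x <> y -> l <= elen (x - y)) /\
  (forall e x y, kfaces P 1 e -> kfaces P 0 [set x] -> kfaces P 0 [set y] -> e x -> e y -> x <> y ->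
     elen (x - y) = l).
Proof.
have pP := reg_polytope; have [c sc] := reg_strict.
have [F Ff] := exists_facet pP sc; have [e [ee _]] := facet_has_edge Ff.
have [v [w [vv ww vw mn]]] := closest_vertices pP (fin (k := 0) isT) (ex_intro _ e ee).
exists (elen (v - w)); first by rewrite elen_gt0 subr_eq0; apply/eqP.
split=> // e1 x y ee1 xx yy ex ey xy.
have [e2 [ee2 ev ew]] := min_pair_edge vv ww vw mn.
exact: edge_length ee1 ee2 xx yy ex ey xy vv ww ev ew vw.
Qed.

End Regular.
End Vertices.

(** * The feet of the perpendiculars in a regular polyhedron *)

Section RegularGood.
Context {R : realType}.
Local Notation vec := 'rV[R]_3.
Implicit Types (u v w x y z c d p : vec) (P F G e : set vec) (f g : vec -> vec).
Context P o (hP : regular_polyhedron P) (ho : is_center P o).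
Context (fin : forall k, (k <= 2)%N -> finite_set (kfaces P k)).
Context (l : R) (l0 : 0 < l).
Context (lmin : forall x y, kfaces P 0 [set x] -> kfaces P 0 [set y] -> x <> y -> l <= elen (x - y)).
Context (ledge : forall e x y, kfaces P 1 e -> kfaces P 0 [set x] -> kfaces P 0 [set y] ->
  e x -> e y -> x <> y -> elen (x - y) = l).

Let pP := reg_polytope hP.
Let fP := reg_full hP.

Lemma reg_edge e : kfaces P 1 e -> exists E, [/\ relint e E, orthogonal_to (E - o) e,
  (forall v, kfaces P 0 [set v] -> e v -> elen (v - E) = l / 2) &
  exists v w, [/\ v <> w, kfaces P 0 [set v], kfaces P 0 [set w], e v /\ e w & E = v + 2^-1 *: (w - v)]].
Proof.
move=> ee; have [v [w [vw vv ww seg only]]] := edge_endpoints pP ee.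
have ev : e v by apply/seg; exists 0; rewrite scale0r addr0; split.
have ew : e w by apply/seg; exists 1; rewrite scale1r addrC subrK; split.
exists (v + 2^-1 *: (w - v)); split; last by exists v, w.
- by apply: segment_relint => //; lra.
- have vwE := elen_eqE (ho vv ww).
  have h : dot (v + 2^-1 *: (w - v) - o) (w - v) = 0.
    have -> : v + 2^-1 *: (w - v) - o = 2^-1 *: ((v - o) + (w - o)) by vfield.
    have -> : w - v = (w - o) - (v - o) by vring.
    move: vwE; move: (v - o) (w - o) => V W; rewrite !(dotDl, dotDr, dotNl, dotNr, dotZl).
    by rewrite [dot W V]dotC => ->; ring.
  move=> y y' /seg[t [_ _ ->]] /seg[t' [_ _ ->]].
  have -> : v + t *: (w - v) - (v + t' *: (w - v)) = (t - t') *: (w - v) by vring.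
  by rewrite dotZr h mulr0.
- have len := ledge ee vv ww ev ew vw.
  move=> x xx /(only _ xx)[] ->.
    have -> : v - (v + 2^-1 *: (w - v)) = 2^-1 *: (v - w) by vfield.
    by rewrite elenZ len ger0_norm ?invr_ge0// mulrC.
  have -> : w - (v + 2^-1 *: (w - v)) = - (2^-1) *: (v - w) by vfield.
  by rewrite elenZ len normrN ger0_norm ?invr_ge0// mulrC.
Qed.

Lemma dist_expand (q x y : vec) : dot (x - y) (x - y) =
  dot (x - q) (x - q) + dot (y - q) (y - q) - 2 * dot (x - q) (y - q).
Proof.
have -> : x - y = (x - q) - (y - q) by vring.
by move: (x - q) (y - q) => X Y; rewrite !(dotDl, dotDr, dotNl, dotNr) [dot Y X]dotC; ring.
Qed.

(** At first the foot [Q] is only known to lie in the plane of [F]. From an inner point [c1], walk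
    towards [Q] until an edge is met; this edge joins a closest pair of vertices on a circle about
    [Q], so [E - Q] is maximal on it, and the exit can only come after [Q]. *)
Lemma reg_facet F : kfaces P 2 F -> exists2 Q, inner F Q & orthogonal_to (Q - o) F.
Proof.
move=> Ff; have [u [u0 FE us]] := facetP Ff; have [c1 ic] := facet_inner pP Ff.
have uu0 : dot u u != 0 by rewrite dot_eq0.
pose Q := o + (dot u (c1 - o) / dot u u) *: u.
have Fu x : F x -> dot u x = dot u c1.
  by move=> Fx; apply: (@amax_eq _ P); rewrite -FE//; case: ic.
have uQ : dot u Q = dot u c1 by rewrite /Q !dotE; field.
have oQ : orthogonal_to (Q - o) F.
  move=> x y Fx Fy; rewrite /Q addrAC subrr add0r dotZl [dot u (x - y)]dotBr (Fu x)// (Fu y)//.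
  by rewrite subrr mulr0.
have uFQ x : F x -> dot u (x - Q) = 0 by move=> Fx; rewrite dotBr Fu// uQ subrr.
exists Q => //; clearbody Q.
have oQ' x y : F x -> dot (Q - o) (x - Q) = 0 /\ dot (x - Q) (Q - o) = 0.
  have [k kE] : exists k, Q - o = k *: u.
    apply: (@facet_const _ P F u (Q - o) (dot (Q - o) c1) (dot u c1) Ff u0) => // t Ft.
    have := oQ _ _ Ft (proj1 ic); rewrite dotBr; lra.
  by move=> Fx; rewrite kE dotZl dotZr [dot (x - Q) u]dotC uFQ// mulr0.
have [Qc|Qc] := eqVneq Q c1; first by rewrite Qc.
have rho x y : kfaces P 0 [set x] -> kfaces P 0 [set y] -> F x -> F y ->
    dot (x - Q) (x - Q) = dot (y - Q) (y - Q).
  move=> xx yy Fx Fy; have := elen_eqE (ho xx yy).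
  have e t : F t -> dot (t - o) (t - o) = dot (t - Q) (t - Q) + dot (Q - o) (Q - o).
    move=> Ft; have [e1 e2] := oQ' t t Ft.
    have -> : t - o = (t - Q) + (Q - o) by vring.
    move: e1 e2; move: (t - Q) (Q - o) => A B e1 e2.
    by rewrite !(dotDl, dotDr) e1 e2; ring.
  by rewrite (e x)// (e y)// => /addIr.
have d0 : Q - c1 != 0 by rewrite subr_eq0.
have ud : dot u (Q - c1) = 0 by rewrite dotBr uQ subrr.
have [e [t [ee eF t0 et]]] := facet_exit pP Ff u0 FE ic d0 ud.
have [E [/relint_inner[eE _] oE _ [v [w [vw vv ww [ev ew] EE]]]]] := reg_edge ee.
have FE' := eF _ eE.
(* The computation of [min_pair_edge] in the plane of the facet, with [Q] in place of the center. *)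
have key x : kfaces P 0 [set x] -> F x -> x <> v -> x <> w -> dot (E - Q) x < dot (E - Q) E.
  move=> xx Fx xv xw.
  have := lmin xx vv xv; have := lmin xx ww xw; rewrite -(ledge ee vv ww ev ew vw).
  rewrite !elen_le (dist_expand Q v w) (dist_expand Q x w) (dist_expand Q x v).
  have pos : 0 < dot (v - w) (v - w) by rewrite dot_gt0 subr_eq0; apply/eqP.
  rewrite (dist_expand Q v w) in pos.
  have r1 := rho _ _ xx vv Fx (eF _ ev); have r2 := rho _ _ ww vv (eF _ ew) (eF _ ev).
  have EQ : E - Q = 2^-1 *: ((v - Q) + (w - Q)) by rewrite EE; vfield.
  rewrite -subr_gt0 -dotBr.
  have -> : E - x = 2^-1 *: ((v - Q) + (w - Q)) - (x - Q) by rewrite EE; vfield.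
  rewrite EQ; move: pos r1 r2; move: (v - Q) (w - Q) (x - Q) => V W X.
  rewrite !(dotDl, dotDr, dotNl, dotNr, dotZl, dotZr) [dot W V]dotC [dot V X]dotC [dot W X]dotC; lra.
have evE x : e x -> dot (E - Q) x = dot (E - Q) E.
  move=> ex; have e1 := oE _ _ ex eE; have e2 := oQ _ _ (eF _ ex) FE'.
  have e3 : dot (E - Q) (x - E) = dot (E - o) (x - E) - dot (Q - o) (x - E).
    by rewrite -dotBl; congr dot; vring.
  by move: e3; rewrite e1 e2 subrr [dot (E - Q) (x - E)]dotBr => /eqP; rewrite subr_eq0 => /eqP.
(* If the edge were a diameter of the circle, [F] would have no other vertices and would itself be
   an edge. *)
have EQ0 : E - Q != 0.
  apply: contraT => /negPn/eqP EQ0; exfalso; have [m [m0 me _]] := (edgeP P e).1 ee.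
  have only x : kfaces P 0 [set x] -> amax P u x -> x = v \/ x = w.
    move=> xx; rewrite -FE => Fx; apply: contrapT => /not_orP[xv xw].
    by have := key _ xx Fx xv xw; rewrite EQ0 !dot0l ltxx.
  have Fe : kfaces P 1 F.
    by rewrite FE; apply: (two_vertex_edge pP u0 _ _ vw only); rewrite -FE; exact: eF.
  by have := kfaces_inj Ff Fe.
have le x : F x -> dot (E - Q) x <= dot (E - Q) E.
  apply: (face_vertex_le pP u0 FE) => {}x xx Fx.
  have [->|xv] := eqVneq x v; first by rewrite evE.
  have [->|xw] := eqVneq x w; first by rewrite evE.
  by apply/ltW/key => //; exact/eqP.
have uEQ : dot u (E - Q) = 0 by exact: uFQ.
have lt1 : dot (E - Q) c1 < dot (E - Q) E.
  have nk k : E - Q <> k *: u.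
    move=> kE; move: uEQ; rewrite kE dotZr => /eqP; rewrite mulf_eq0 (negPf uu0) orbF => /eqP k0'.
    by move: EQ0; rewrite kE k0' scale0r eqxx.
  have [x Fx h] := (proj2 ic) _ (facet_nonconst Ff u0 FE (proj1 ic) nk).
  exact: lt_le_trans h (le _ Fx).
have ltQ : dot (E - Q) Q < dot (E - Q) E by rewrite -subr_gt0 -dotBr dot_gt0.
have tE := evE _ et; rewrite dotDr dotZr dotBr in tE.
(* [c1] and [Q] are both strictly below the level of the edge, so an exit between them would be
   below it as well. *)
have t1 : 1 < t.
  rewrite ltNge; apply/negP => t1; move: tE lt1 ltQ t0 t1.
  move: (dot (E - Q) c1) (dot (E - Q) Q) (dot (E - Q) E) => a b h; nra.
have FQ : F Q.
  have -> : Q = c1 + t^-1 *: (c1 + t *: (Q - c1) - c1).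
    by apply: rv3P; rewrite !mxE; field; rewrite gt_eqF.
  have pF : polytope F by rewrite FE; exact: polytope_amax.
  apply: (polytope_convex pF (proj1 ic) (eF _ et)); first by rewrite invr_ge0 ltW.
  by rewrite invf_le1// ltW.
split=> // m [y Fy my].
(* Q lies strictly between the inner point c1 and a point of F *)
have [h|h] := ltP (dot m Q) (dot m (c1 + t *: (Q - c1))); first by exists (c1 + t *: (Q - c1)) => //; exact: eF.
have [h'|h'] := ltP (dot m Q) (dot m c1); first by exists c1 => //; case: ic.
have mc : dot m c1 = dot m Q.
  apply: le_anti; rewrite h' /=; move: h; rewrite !dotE; nra.
have [|x Fx mx] := (proj2 ic) m; first by exists y; rewrite ?mc.
by exists x => //; rewrite -mc.
Qed.

(** The foot is the nearest point of its facet, and the symmetry that exchanges the facets fixes the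
    center. *)
Lemma proj_facet_dist F F' Q Q' : kfaces P 2 F -> kfaces P 2 F' -> F Q -> F' Q' ->
  orthogonal_to (Q - o) F -> orthogonal_to (Q' - o) F' ->
  dot (Q - o) (Q - o) = dot (Q' - o) (Q' - o).
Proof.
have min G X x : orthogonal_to (X - o) G -> G X -> G x -> dot (X - o) (X - o) <= dot (x - o) (x - o).
  move=> oX GX Gx; have := oX _ _ Gx GX; have := dot_ge0 (x - X).
  have -> : x - o = (x - X) + (X - o) by vring.
  by move: (x - X) (X - o) => A B; rewrite !(dotDl, dotDr) [dot A B]dotC => ? ->; lra.
have half G G' X X' : kfaces P 2 G -> kfaces P 2 G' -> G X -> G' X' ->
    orthogonal_to (X' - o) G' -> dot (X' - o) (X' - o) <= dot (X - o) (X - o).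
  move=> Gf Gf' GX GX' oX'; have [v [e fl]] := facet_has_flag hP Gf.
  have [v' [e' fl']] := facet_has_flag hP Gf'.
  have [g [ig gP _ _ gG]] := (proj2 hP) _ _ _ _ _ _ fl fl'.
  have go := center_fixed pP fP ho ig gP.
  have gX : G' (g X) by rewrite -gG; exists X.
  apply: le_trans (min _ _ _ oX' GX' gX) _.
  by have := ig X o; rewrite go => /elen_eqE ->.
move=> Ff Ff' FQ FQ' oQ oQ'; apply: le_anti; apply/andP; split.
  exact: half Ff' Ff FQ' FQ oQ.
exact: half Ff Ff' FQ FQ' oQ'.
Qed.

(** Otherwise [o] is on or beyond the plane of a facet. Another facet has its foot at the same
    distance from [o], on the side of that plane where [P] lies; the only such point is [Q], but
    different facets share no inner point. *)
Lemma reg_inside : inside P o.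
Proof.
move=> F u x Ff u0 FE Fx; rewrite ltNge; apply/negP => hx.
have [Q iQ oQ] := reg_facet Ff; have FQ := proj1 iQ.
have [e [ee eF]] := facet_has_edge hP Ff.
have [F2 [F2f F2n]] : exists F2, kfaces P 2 F2 /\ F2 <> F.
  have [G1 [G2 [G1f G2f G12 _ _]]] := edge_two_facets pP fP ee.
  have [E|E] := pselect (G1 = F); last by exists G1.
  by exists G2; split=> // E2; apply: G12; rewrite E E2.
have [Q2 iQ2 oQ2] := reg_facet F2f.
have hh := proj_facet_dist Ff F2f FQ (proj1 iQ2) oQ oQ2.
suff QQ : Q2 = Q.
  apply: F2n; have [u2 [_ F2E _]] := facetP F2f.
  rewrite QQ in iQ2; apply: (facet_sub_eq F2f Ff).
  exact: (inner_exposed iQ2 (kface_sub F2f) FE FQ).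
have uQ : dot u Q = dot u x by apply: (@amax_eq _ P); rewrite -FE.
have [k kE] : exists k, Q - o = k *: u.
  apply: (@facet_const _ P F u (Q - o) (dot (Q - o) Q) (dot u x) Ff u0) => t Ft.
    by apply: (@amax_eq _ P); rewrite -FE.
  have := oQ _ _ Ft FQ; rewrite dotBr; lra.
have uu : 0 < dot u u by rewrite dot_gt0.
have k0' : k <= 0.
  have : dot u (Q - o) <= 0 by rewrite dotBr uQ subr_le0.
  by rewrite kE dotZr pmulr_lle0.
have Q2le : dot u (Q2 - o) <= k * dot u u.
  have : dot u (Q - o) = k * dot u u by rewrite kE dotZr.
  rewrite !dotBr => <-; rewrite lerD2r; move: FQ; rewrite FE => -[_]; apply.
  exact: (kface_sub F2f) (proj1 iQ2).
apply/eqP; rewrite -subr_eq0 -dot_eq0; apply/eqP; apply: le_anti; rewrite dot_ge0 andbT.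
rewrite (dist_expand o Q2 Q) -hh.
have -> : dot (Q2 - o) (Q - o) = k * dot u (Q2 - o) by rewrite kE dotZr dotC.
have -> : dot (Q - o) (Q - o) = k * (k * dot u u) by rewrite kE dotZr dotZl; ring.
have := mulr_le0_ge0 k0' (_ : 0 <= k * dot u u - dot u (Q2 - o)).
by rewrite subr_ge0 => /(_ Q2le); lra.
Qed.

Lemma reg_good : good P o.
Proof.
split=> //.
- exact: reg_strict hP.
- exact: reg_inside.
- exact: reg_facet.
- by move=> e /reg_edge[E [/relint_inner iE oE _ _]]; exists E.
Qed.

Lemma reg_uniform : exists a, 0 < a /\ uniform P o a (l / 2).
Proof.
have gP := reg_good; have [i0 fi0] := exists_flag gP.
exists (legA o i0); split; first exact: (legA_gt0 gP fi0).
have B i : flags P i -> legB o i = l / 2.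
  move=> [vv ee Ff ev eF]; have [E [/relint_inner[eE _] oE lE _]] := reg_edge ee.
  by rewrite /legB /legE (projE eE oE) lE.
move=> i fi; split; last exact: B.
(* Pythagoras along the orthogonal path from [o] to the vertex: circumradius, facet distance and
   half edge determine the remaining leg. *)
have sq j : flags P j -> legA o j ^+ 2 = dot (legV j - o) (legV j - o) -
    dot (legQ o j - o) (legQ o j - o) - (l / 2) ^+ 2.
  move=> fj; have [orth1 orth2 orth3] := flag_orth gP fj.
  rewrite -(B _ fj) /legA /legB !elen_sqr.
  have -> : legV j - o = (legV j - legE o j) + (legE o j - legQ o j) + (legQ o j - o) by vring.
  move: orth1 orth2 orth3; move: (legV j - _) (legE o j - _) (legQ o j - o) => V E Q h1 h2 h3.
  by rewrite !(dotDl, dotDr) h1 h2 h3 ![dot _ Q]dotC h1 h2 [dot V E]dotC h3; ring.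
have [vv _ Ff _ _] := fi; have [vv0 _ Ff0 _ _] := fi0.
have [[FQ _] oQ] := facet_proj gP Ff; have [[FQ0 _] oQ0] := facet_proj gP Ff0.
have := sq _ fi; rewrite (elen_eqE (ho vv vv0)).
rewrite (proj_facet_dist Ff Ff0 FQ FQ0 oQ oQ0) -(sq _ fi0) => /eqP.
by rewrite eqrXn2 ?elen_ge0// => /eqP.
Qed.

End RegularGood.

(** * Reference points near the center *)

Section Ball.
Context {R : realType}.
Local Notation vec := 'rV[R]_3.
Implicit Types (u v w x y z c d p : vec) (P F G e : set vec) (f g : vec -> vec).

(** A strict form of [vertex_le]. For large [M] the functional [M *: d - m] is bounded on the
    finitely many vertices by its value on the face, and off the face [m] itself is strictly
    smaller. *)
Lemma vertex_lt P m d h : polytope P -> m != 0 -> finite_set (kfaces P 0) ->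
  (forall v, kfaces P 0 [set v] -> ~ amax P m v -> dot d v < h) ->
  (forall x, amax P m x -> dot d x = h) ->
  forall x, P x -> ~ amax P m x -> dot d x < h.
Proof.
move=> pP m0 /finite_seqP[vs vsE] lt eqh x Px nx.
have [x0 mx0] := polytope_neq0 (polytope_amax m pP).
have xg y : xget 0 [set y] = y by case: xgetP => [t _ ->//|/(_ y) hy]; exfalso; apply: hy.
pose s := [seq xget 0 A | A <- vs & `[< ~ amax P m (xget 0 A) >]].
have inS v : kfaces P 0 [set v] -> ~ amax P m v -> v \in s.
  move=> vv nv; apply/mapP; exists [set v]; rewrite ?xg// mem_filter xg; apply/andP; split.
    exact/asboolP.
  by have : [set` vs] [set v] by rewrite -vsE.
have sv v : v \in s -> kfaces P 0 [set v] /\ ~ amax P m v.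
  move=> /mapP[A]; rewrite mem_filter => /andP[/asboolP nA Av] ->.
  have AA : kfaces P 0 A by rewrite vsE.
  by have [t tE] := vertex_set AA; move: AA nA; rewrite tE xg.
have [|M0 hM] := @seq_dominate _ _ s (fun v => h - dot d v) (fun v => dot m x0 - dot m v).
  by move=> v /sv[vv nv]; rewrite subr_gt0; exact: lt.
(* The functional has to be nonzero; if [M1] fails, [M1 + 1] does not. *)
have [M [MM Mp Mn]] : exists M, [/\ M0 <= M, 0 < M & M *: d - m != 0].
  pose M1 := Num.max M0 1.
  have h1 : M0 <= M1 by rewrite le_max lexx.
  have h2 : 0 < M1 by rewrite lt_max ltr01 orbT.
  have [e|e] := eqVneq (M1 *: d - m) 0; last by exists M1.
  exists (M1 + 1); split; [lra|lra|].
  apply: contra_neq m0 => e'.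
  have d0 : d = ((M1 + 1) *: d - m) - (M1 *: d - m) by vring.
  rewrite e e' subrr in d0.
  by move: e; rewrite d0 scaler0 sub0r => /eqP; rewrite oppr_eq0 => /eqP.
have le : dot (M *: d - m) x <= M * h - dot m x0.
  apply: (vertex_le pP Mn _ Px) => v vv; rewrite dotBl dotZl.
  have [mv|nv] := pselect (amax P m v); first by rewrite (eqh _ mv) (amax_eq mv mx0).
  have := hM _ MM _ (inS _ vv nv); rewrite mulrBr; lra.
have := amax_lt mx0 Px nx; move: le; rewrite dotBl dotZl => h1 h2.
by rewrite -(ltr_pM2l Mp); lra.
Qed.

Lemma half_bounds (s : R) : -1 < s -> s < 1 ->
  [/\ 0 < (1 - s) / 2, (1 - s) / 2 < 1, 0 < (1 + s) / 2 & (1 + s) / 2 < 1].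
Proof. by move=> h1 h2; split; lra. Qed.

Section Fixed.
Context P o (ho : is_center P o) (gP : good P o) (a b : R) (b0 : 0 < b) (a0 : 0 < a).
Context (uP : uniform P o a b).
Context (lmin : forall x y, kfaces P 0 [set x] -> kfaces P 0 [set y] -> x <> y -> 2 * b <= elen (x - y)).

Let pP := good_polytope gP.

(** As [u] and [v] are equally far from [o], the product is half their squared distance plus a term
    bounded by the Cauchy-Schwarz inequality, and the distance is at least [2 * b]. The other points
    of [P] follow by [vertex_lt]. *)
Lemma ball_unstable w : elen (w - o) < b -> full_unstable P w.
Proof.
move=> wb v vv; have [m m0 mE] := (vertexP P v).1 vv.
have mv x : amax P m x <-> x = v by rewrite mE.
have key u : kfaces P 0 [set u] -> u <> v -> 0 < dot (u - v) (w - v).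
  move=> uu uv; have len := lmin uu vv uv.
  have e1 : dot (u - v) (w - v) = dot (u - v) (u - v) / 2 + dot (u - v) (w - o).
    have := elen_eqE (ho uu vv).
    have -> : u - v = (u - o) - (v - o) by vring.
    have -> : w - v = (w - o) - (v - o) by vring.
    move: (u - o) (v - o) (w - o) => U V W.
    by rewrite !(dotDl, dotDr, dotNl, dotNr) [dot V U]dotC => ->; field.
  have := CS_elen (v - u) (w - o).
  have -> : v - u = - (u - v) by vring.
  rewrite dotNl [elen (- _)](_ : _ = elen (u - v)); last first.
    by apply: elen_eq; rewrite dotNl dotNr opprK.
  rewrite e1 -elen_sqr => cs.
  have L0 : 0 < elen (u - v) by apply: lt_le_trans len; rewrite mulr_gt0.
  nra.
have h := @vertex_lt P m (v - w) (dot (v - w) v) pP m0 (good_finite gP (k := 0) isT).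
move=> y [Py yv].
suff : dot (v - w) y < dot (v - w) v.
  rewrite -subr_gt0 -dotBr => hh.
  have -> : dot (y - v) (w - v) = dot (v - w) (v - y) by rewrite !dotE ![dot w _]dotC ![dot y v]dotC; ring.
  exact: hh.
apply: h => //; last by move/mv.
- move=> u uu /mv uv; rewrite -subr_gt0 -dotBr.
  have -> : dot (v - w) (v - u) = dot (u - v) (w - v).
    have -> : v - w = - (w - v) by vring.
    have -> : v - u = - (u - v) by vring.
    by rewrite dotNl dotNr opprK dotC.
  exact: key.
- by move=> x /mv ->.
Qed.

(** All edges of the facet are at distance [a] from the foot, so [a] is its inradius. *)
Lemma facet_disc F y : kfaces P 2 F -> dot (proj o F - o) (y - proj o F) = 0 ->
  elen (y - proj o F) < a -> F y.
Proof.
move=> Ff ny ya; have [[FQ _] _] := facet_proj gP Ff.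
have [->//|yQ] := eqVneq y (proj o F).
have [i [fi iF ci]] := flag_cover gP Ff ny yQ.
have ny' : dot (legQ o i - o) (y - legQ o i) = 0 by rewrite /legQ iF.
rewrite -iF; apply: (flag_tri gP fi ny' ci).
have [-> _] := uP fi.
have := flag_norm gP fi ny'; rewrite -elen_sqr {1}/legQ iF => n2.
have ya2 : elen (y - proj o F) ^+ 2 < a ^+ 2 by rewrite ltr_pXn2r// nnegrE ?elen_ge0// ltW.
have [x0|x0] := leP (flagX o i y) 0; first by apply: le_trans x0 _; exact: ltW.
rewrite -(@ler_pXn2r _ 2)// ?nnegrE; [|exact: ltW|exact: ltW].
have := sqr_ge0 (flagY o i y); lra.
Qed.

Lemma ball_stable w : elen (w - o) < a -> full_stable P w.
Proof.
move=> wa F Ff; have [[FQ _] oQ] := facet_proj gP Ff.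
have [i [fi iF]] := facet_flag gP Ff.
have n0 := legQ_neq gP fi; rewrite /legQ iF in n0.
set Q := proj o F in FQ oQ n0 *.
have [n nE] : exists n, n = Q - o by eexists.
rewrite -nE in oQ n0.
have nn : dot n n != 0 by rewrite gt_eqF.
(* The projection of [w] to the plane of the facet; it is no farther from [Q] than [w] is from
   [o]. *)
pose x := w - (dot n (w - Q) / dot n n) *: n.
have nx : dot n (x - Q) = 0.
  have -> : x - Q = (w - Q) - (dot n (w - Q) / dot n n) *: n by rewrite /x; vring.
  move: (w - Q) => W; rewrite dotBr dotZr; field; exact: nn.
have xle : dot (x - Q) (x - Q) <= dot (w - o) (w - o).
  have -> : w - o = (x - Q) + (1 + dot n (w - Q) / dot n n) *: n.
    by rewrite /x; move: (_ / _) => k; rewrite nE; vring.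
  move: nx; move: (x - Q) (1 + _) n0 => X k n0 nx.
  rewrite !(dotDl, dotDr) !dotZl !dotZr [dot X n]dotC nx !mulr0 add0r addr0.
  rewrite lerDl mulrA mulr_ge0 ?(ltW n0)//; exact: sqr_ge0.
have xa : elen (x - Q) < a by apply: le_lt_trans wa; rewrite elen_le.
have [u [u0 FE _]] := facetP Ff.
have [k kE] : exists k, n = k *: u.
  apply: (@facet_const _ P F u n (dot n Q) (dot u Q) Ff u0) => t Ft.
    by apply: (@amax_eq _ P); rewrite -FE.
  have := oQ _ _ Ft FQ; rewrite dotBr; lra.
have Fx : F x by apply: facet_disc; rewrite -/Q -?nE.
exists x.
  apply: (facet_relint Ff FE Fx (r := a - elen (x - Q))); first by rewrite subr_gt0.
  move=> y uy yr; apply: facet_disc => //; rewrite -/Q.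
    rewrite -nE; have -> : y - Q = (y - x) + (x - Q) by vring.
    by rewrite dotDr nx addr0 kE dotZl dotBr uy subrr mulr0.
  have tri : elen (y - Q) <= elen (y - x) + elen (x - Q).
    rewrite -(@ler_pXn2r _ 2)// ?nnegrE ?addr_ge0 ?elen_ge0// sqrrD !elen_sqr.
    have -> : y - Q = (y - x) + (x - Q) by vring.
    have := CS_elen (y - x) (x - Q).
    move: (y - x) (x - Q) => A B; rewrite !(dotDl, dotDr) [dot B A]dotC; lra.
  by lra.
move=> y y' Fy Fy'; have -> : x - w = - (dot n (w - Q) / dot n n) *: n.
  by rewrite /x; move: (_ / _) => q; vring.
by rewrite dotZl (oQ _ _ Fy Fy') mulr0.
Qed.

(* The projection of [P] along an edge lies in the angle spanned by the two
   adjacent facets, whose bisector points to the center. *)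
Lemma edge_angle e F G y : kfaces P 1 e -> kfaces P 2 F -> kfaces P 2 G -> F <> G ->
  e `<=` F -> e `<=` G -> P y -> forall v, kfaces P 0 [set v] -> e v ->
  exists al be s, [/\ 0 <= al, 0 <= be & y - proj o e = al *: (proj o F - proj o e) +
    be *: (proj o G - proj o e) + s *: (v - proj o e)].
Proof.
move=> ee Ff Gf FG eF eG Py v vv ev.
have [yF nF] := facet_normal_exists (good_inside gP) Ff.
have [yG nG] := facet_normal_exists (good_inside gP) Gf.
have [[FQ iQF] oQF] := facet_proj gP Ff; have [[GQ iQG] oQG] := facet_proj gP Gf.
have [[eE _] oE] := edge_proj gP ee.
have fi : flags P (v, e, F) by split.
have fj : flags P (v, e, G) by split.
have tt := legB_gt0 gP fi.
set E := proj o e in eE oE *; set QF := proj o F in FQ iQF oQF *; set QG := proj o G in GQ iQG oQG *.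
have bE : dot (v - E) (v - E) = b ^+ 2 by rewrite -elen_sqr -(proj2 (uP fi)).
have [kF1 kF2] : dot yF (QF - o) = 1 /\ dot yG (QG - o) = 1.
  by have [] := facet_normal_sub1 nF FQ; have [] := facet_normal_sub1 nG GQ.
have yFE : dot yF (E - o) = 1 by have [] := facet_normal_sub1 nF (eF _ eE).
have yGE : dot yG (E - o) = 1 by have [] := facet_normal_sub1 nG (eG _ eE).
have yFv : dot yF (v - o) = 1 by have [] := facet_normal_sub1 nF (eF _ ev).
have yGv : dot yG (v - o) = 1 by have [] := facet_normal_sub1 nG (eG _ ev).
have sF : dot yG (QF - o) < 1 by apply: (facet_normal_inner pP Ff Gf FG _ nG); split.
have sG : dot yF (QG - o) < 1.
  by apply: (facet_normal_inner pP Gf Ff (fun h => FG (esym h)) _ nF); split.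
have leF := proj1 nF _ Py; have leG := proj1 nG _ Py.
have sub (Y X X' : vec) r r' : dot Y (X - o) = r -> dot Y (X' - o) = r' -> dot Y (X - X') = r - r'.
  by move=> <- <-; rewrite -dotBr; congr dot; vring.
have [orth1 orth2 orth3] := flag_orth gP fi; have [orth1' orth2' orth3'] := flag_orth gP fj.
rewrite /legQ /legE /legV /= -/E -/QF in orth1 orth2 orth3.
rewrite /legQ /legE /legV /= -/E -/QG in orth1' orth2' orth3'.
have d1 := sub _ _ _ _ _ kF1 yFE; have d2 := sub _ _ _ _ _ kF2 yGE.
have d3 : dot yG (QF - E) = dot yG (QF - o) - 1 by apply: sub.
have d4 : dot yF (QG - E) = dot yF (QG - o) - 1 by apply: sub.
have d5 := sub _ _ _ _ _ yFv yFE; have d6 := sub _ _ _ _ _ yGv yGE.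
have d7 : dot yF (y - E) = dot yF (y - o) - 1 by apply: sub.
have d8 : dot yG (y - E) = dot yG (y - o) - 1 by apply: sub.
rewrite subrr in d1 d2 d5 d6.
have h1 : dot (v - E) (QF - E) = 0 by rewrite dotC -opprB dotNl orth3 oppr0.
have h2 : dot (v - E) (QG - E) = 0 by rewrite dotC -opprB dotNl orth3' oppr0.
have {sF} sF : dot yG (QF - E) < 0 by rewrite d3 subr_lt0.
have {sG} sG : dot yF (QG - E) < 0 by rewrite d4 subr_lt0.
have {leF} leF : dot yF (y - E) <= 0 by rewrite d7 subr_le0.
have {leG} leG : dot yG (y - E) <= 0 by rewrite d8 subr_le0.
clear d3 d4 d7 d8.
move: sF sG leF leG d1 d2 d5 d6 h1 h2 bE.
move: (QF - E) (QG - E) (v - E) (y - E) => M N T Y sF sG leF leG d1 d2 d5 d6 h1 h2 bE.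
pose al := dot yG Y / dot yG M; pose be := dot yF Y / dot yF N; pose s := dot T Y / b ^+ 2.
exists al, be, s; split.
- by rewrite /al -mulrNN -invrN divr_ge0 ?oppr_ge0// ltW.
- by rewrite /be -mulrNN -invrN divr_ge0 ?oppr_ge0// ltW.
- apply/eqP; rewrite -subr_eq0; apply/eqP; set D := (X in X = 0).
  have b2 : b ^+ 2 != 0 by rewrite expf_neq0// gt_eqF.
  have e1 : dot yG D = 0.
    by rewrite /D !(dotDr, dotNr, dotZr) d2 d6 /al !mulr0 !addr0 mulfVK ?lt_eqF// subrr.
  have e2 : dot yF D = 0.
    by rewrite /D !(dotDr, dotNr, dotZr) d1 d5 /be !mulr0 add0r addr0 mulfVK ?lt_eqF// subrr.
  have e3 : dot T D = 0.
    by rewrite /D !(dotDr, dotNr, dotZr) h1 h2 /s bE !mulr0 !add0r mulfVK// subrr.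
  have c0 : cross yF yG != 0.
    apply/eqP => c0; have yF0 : yF != 0 by apply: contraTneq sG => ->; rewrite dot0l ltxx.
    have := cross_eq0 yF0 c0 => yGE'; move: sF; rewrite yGE' dotZl d1 mulr0 ltxx//.
  have t1 : dot yF T = 0 by []; have t2 : dot yG T = 0 by [].
  have T0 : dot T T != 0 by rewrite bE.
  have TE := perp2 c0 t1 t2; have DE := perp2 c0 e2 e1.
  move: e3; rewrite DE {1}TE !dotZl !dotZr => /eqP.
  have c00 : dot (cross yF yG) (cross yF yG) != 0 by rewrite dot_eq0.
  have k0 : dot (cross yF yG) T / dot (cross yF yG) (cross yF yG) != 0.
    by apply: contra_neq T0 => k0; rewrite TE k0 scale0r dot0l.
  rewrite mulf_eq0 (negPf k0) /= mulf_eq0 (negPf c00) orbF => /eqP ->.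
  by rewrite scale0r.
Qed.

Lemma ball_saddle w : elen (w - o) < a -> elen (w - o) < b -> full_saddle P w.
Proof.
move=> wa wb e ee; have [c sc] := good_strict gP.
have [v [v' [vv' vv vv'' [ev ev'] only]]] := edge_vertices pP ee.
have [F [G [Ff Gf FG eF eG]]] := edge_two_facets pP (strict_fulldim sc) ee.
have [iE oE] := edge_proj gP ee.
have fi : flags P (v, e, F) by split.
have fj : flags P (v, e, G) by split.
have [aF bF] := uP fi; have [aG _] := uP fj.
have ang := fun y Py => @edge_angle e F G y ee Ff Gf FG eF eG Py v vv ev.
have [orth1 orth2 orth3] := flag_orth gP fi; have [orth1' orth2' orth3'] := flag_orth gP fj.
move: aF bF aG orth1 orth2 orth3 orth1' orth2' orth3'.
rewrite /legA /legB /legV /legE /legQ /=.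
set E := proj o e in iE oE ang *; set QF := proj o F in ang *; set QG := proj o G in ang *.
move=> aF bF aG orth1 orth2 orth3 orth1' orth2' orth3'.
have bb : dot (v - E) (v - E) = b ^+ 2 by rewrite -elen_sqr bF.
have b2 : b ^+ 2 != 0 by rewrite expf_neq0// gt_eqF.
(* The position of the foot of [w] on the edge, in units of the half edge; [elen (w - o) < b] makes
   it less than one in absolute value. *)
pose s := dot (v - E) (w - o) / b ^+ 2.
have oEv : dot (v - E) (E - o) = 0 by rewrite dotC; apply: oE => //; case: iE.
have s1 : `|s| < 1.
  rewrite /s normrM normfV [`|b ^+ 2|]ger0_norm ?sqr_ge0// ltr_pdivrMr ?exprn_gt0// mul1r.
  have h1 := CS_elen (v - E) (w - o); have h2 := CS_elen (v - E) (- (w - o)).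
  have nn : elen (- (w - o)) = elen (w - o) by apply: elen_eq; rewrite dotNl dotNr opprK.
  rewrite bF in h1; rewrite bF nn dotNr in h2.
  have h3 : b * elen (w - o) < b ^+ 2 by rewrite expr2 ltr_pM2l.
  rewrite ltr_norml; lra.
pose x := E + s *: (v - E).
have rx : relint e x.
  have [v1 [v2 [v12 vv1 vv2 seg only']]] := edge_endpoints pP ee.
  have [r [r0 r1 EE]] := segment_inner v12 seg iE.
  have -> : x = v1 + dot (v2 - v1) (x - v1) / dot (v2 - v1) (v2 - v1) *: (v2 - v1).
    have dd : dot (v2 - v1) (v2 - v1) != 0 by rewrite dot_eq0 subr_eq0; apply/eqP => /esym.
    have [q qE] : exists q, x = v1 + q *: (v2 - v1).
      by rewrite /x EE; case: (only' _ vv ev) => ->; [exists (r + s * - r)|exists (r + s * (1 - r))]; vring.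
    by rewrite qE; congr (_ + _ *: _); rewrite addrAC subrr add0r dotZr mulfK.
  set q := _ / _.
  have dd : 0 < dot (v2 - v1) (v2 - v1) by rewrite dot_gt0 subr_eq0; apply/eqP => /esym.
  have len u : kfaces P 0 [set u] -> e u -> elen (u - E) = b.
    by move=> uu eu; have [_ <-] := @uP (u, e, F) (And5 uu ee Ff eu eF).
  have ev1 : e v1 by apply/seg; exists 0; rewrite scale0r addr0; split.
  have ev2 : e v2 by apply/seg; exists 1; rewrite scale1r addrC subrK; split.
  have rr : r = 2^-1.
    have h1 := elen_eqE (etrans (len _ vv1 ev1) (esym (len _ vv2 ev2))).
    move: h1; rewrite EE.
    have -> : v1 - (v1 + r *: (v2 - v1)) = (- r) *: (v2 - v1) by vring.
    have -> : v2 - (v1 + r *: (v2 - v1)) = (1 - r) *: (v2 - v1) by vring.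
    rewrite !dotZl !dotZr !mulrA => /(mulIf (lt0r_neq0 dd)) h; nra.
  have qs : q = (1 - s) / 2 \/ q = (1 + s) / 2.
    case: (only' _ vv ev) => vE; [left|right]; rewrite /q /x EE rr vE.
      have -> : v1 + 2^-1 *: (v2 - v1) + s *: (v1 - (v1 + 2^-1 *: (v2 - v1))) - v1 =
        ((1 - s) / 2) *: (v2 - v1) by vfield.
      by rewrite dotZr mulfK// gt_eqF.
    have -> : v1 + 2^-1 *: (v2 - v1) + s *: (v2 - (v1 + 2^-1 *: (v2 - v1))) - v1 =
      ((1 + s) / 2) *: (v2 - v1) by vfield.
    by rewrite dotZr mulfK// gt_eqF.
  move: s1; rewrite ltr_norml => /andP[s2 s3].
  have [h1 h2 h3 h4] := half_bounds s2 s3.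
  by case: qs => qE; apply: segment_relint; rewrite ?qE.
have oxv : dot (v - E) (x - w) = 0.
  have -> : x - w = (E - o) - (w - o) + s *: (v - E) by rewrite /x; vring.
  by rewrite dotDr dotBr dotZr oEv bb /s mulfVK// sub0r addNr.
have ox : orthogonal_to (x - w) e.
  have [u [_ _ [a1 [a2 [_ ea1 ea2 lin]]]]] := (edgeP P e).1 ee.
  have vE0 : v - E != 0 by rewrite -dot_eq0 bb.
  have par y : e y -> exists t, y - E = t *: (v - E).
    move=> ey; have [t1 yE] := lin _ ey; have [t2 vE] := lin _ ev.
    have [t3 EE] := lin _ (proj1 iE).
    have t23 : t2 - t3 != 0.
      apply: contra_neq vE0 => t23; rewrite vE EE.
      by rewrite (_ : _ - _ = (t2 - t3) *: (a2 - a1)); [rewrite t23 scale0r|vring].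
    exists ((t1 - t3) / (t2 - t3)); rewrite yE vE EE; apply: rv3P; rewrite !mxE; field; exact: t23.
  move=> y y' /par[t yt] /par[t' yt'].
  have -> : y - y' = (t - t') *: (v - E).
    have -> : y - y' = (y - E) - (y' - E) by vring.
    by rewrite yt yt'; vring.
  by rewrite dotZr dotC oxv mulr0.
exists x; split=> // y [Py ney].
have [al [be [sy [al0 be0 yE]]]] := ang y Py.
pose Y := al *: (QF - E) + be *: (QG - E).
have mm : dot (QF - E) (QF - E) = a ^+ 2.
  by rewrite -opprB dotNl dotNr opprK -elen_sqr aF.
have nn : dot (QG - E) (QG - E) = a ^+ 2.
  by rewrite -opprB dotNl dotNr opprK -elen_sqr aG.
have vM : dot (QF - E) (v - E) = 0 by rewrite -opprB dotNl orth3 oppr0.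
have vN : dot (QG - E) (v - E) = 0 by rewrite -opprB dotNl orth3' oppr0.
have Mo : dot (QF - E) (o - E) = a ^+ 2.
  have -> : o - E = (QF - E) - (QF - o) by vring.
  rewrite dotBr mm [X in _ - X](_ : _ = 0) ?subr0//.
  by rewrite dotC -[QF - E]opprB dotNr orth1 oppr0.
have No : dot (QG - E) (o - E) = a ^+ 2.
  have -> : o - E = (QG - E) - (QG - o) by vring.
  rewrite dotBr nn [X in _ - X](_ : _ = 0) ?subr0//.
  by rewrite dotC -[QG - E]opprB dotNr orth1' oppr0.
have Yne : al + be != 0.
  apply: contra_notN ney; rewrite paddr_eq0// => /andP[/eqP al00 /eqP be00].
  have [u [_ eE _]] := (edgeP P e).1 ee.
  have eEq : e E by case: iE.
  have yEs : y = E + sy *: (v - E).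
    rewrite -[LHS](subrK E) yE al00 be00 !scale0r !add0r addrC//.
  rewrite eE in ev eEq *; apply: (amaxP eEq Py).
  by rewrite yEs !dotE (amax_eq ev eEq); lra.
have ab0 : 0 < al + be by rewrite lt_def Yne addr_ge0.
(* Only the part [Y] of [y - x] orthogonal to the edge contributes. Its product with [o - E] is
   [(al + be) * a ^+ 2] and its length at most [(al + be) * a], so a shift of [o] by less than [a]
   keeps the sum positive. *)
have -> : dot (y - x) (w - x) = dot Y (o - E) + dot Y (w - o).
  have -> : y - x = Y + (sy - s) *: (v - E).
    by rewrite /Y /x -[y](subrK E) yE; vring.
  have e1 : dot (v - E) (w - x) = 0 by rewrite dotC -opprB dotNl dotC oxv oppr0.
  rewrite dotDl dotZl e1 mulr0 addr0 -dotDr.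
  have -> : w - x = (o - E + (w - o)) - s *: (v - E) by rewrite /x; vring.
  rewrite dotBr dotZr [dot Y (v - E)](_ : _ = 0) ?mulr0 ?subr0//.
  by rewrite /Y dotDl !dotZl vM vN !mulr0 addr0.
have Yo : dot Y (o - E) = (al + be) * a ^+ 2 by rewrite /Y dotDl !dotZl Mo No; ring.
have Ylen : elen Y <= (al + be) * a.
  rewrite -(@ler_pXn2r _ 2)// ?nnegrE ?elen_ge0 ?mulr_ge0 ?(ltW ab0) ?(ltW a0)//.
  rewrite elen_sqr /Y !(dotDl, dotDr) !dotZl !dotZr mm nn.
  have := CS_elen (QF - E) (QG - E).
  have -> : elen (QF - E) = a by rewrite elenC aF.
  have -> : elen (QG - E) = a by rewrite elenC aG.
  rewrite [dot (QG - E) (QF - E)]dotC => cs.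
  have := ler_wpM2l (mulr_ge0 al0 be0) cs; lra.
have := CS_elen (- Y) (w - o); rewrite dotNl.
have -> : elen (- Y) = elen Y by apply: elen_eq; rewrite dotNl dotNr opprK.
move=> cs; rewrite Yo.
have h1 : elen Y * elen (w - o) <= (al + be) * a * elen (w - o) by rewrite ler_wpM2r// elen_ge0.
have h2 : (al + be) * a * elen (w - o) < (al + be) * a * a by rewrite ltr_pM2l// mulr_gt0.
by rewrite expr2 mulrA -ltrBlDr sub0r; exact: le_lt_trans cs (le_lt_trans h1 h2).
Qed.

End Fixed.
End Ball.

(** * The radius of the robust region of a regular polyhedron *)

Section Region.
Context {R : realType}.
Local Notation vec := 'rV[R]_3.
Implicit Types (u v w x y z c d p : vec) (P F G e : set vec).

(** For an equilibrium [x] different from [w] the supporting plane exposes a face to which [x - w]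
    is orthogonal. So [x] is the foot of [w] on that face, and this foot is the nondegenerate point
    supplied by the hypotheses. *)
Lemma nondegenerate_full P o w : good P o -> full_stable P w -> full_saddle P w ->
  full_unstable P w -> only_nondegenerate P w.
Proof.
move=> gP fS fH fU x [bx]; have [c sc] := good_strict gP; have pP := good_polytope gP.
have [F [Ff Fx]] := bd_facet pP sc (good_inside gP) (good_finite gP (k := 2) isT) bx.
have Px := kface_sub Ff Fx.
have main u : u != 0 -> (forall y y', amax P u y -> amax P u y' -> dot (x - w) (y - y') = 0) ->
    amax P u x -> (stable P w `|` saddle P w `|` unstable P w) x.
  move=> u0 orth ux; case: (face_trichotomy pP u0) => Gf.
  - right; have [v vE] := vertex_set Gf; rewrite vE in Gf ux; rewrite ux.
    by split=> //; exact: fU.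
  - left; right; have [y sy] := fH _ Gf; have [ry oy sy'] := sy.
    have -> : x = y by apply: (proj_unique ux orth (proj1 ry) oy).
    by exists (amax P u).
  - left; left; have [y ry oy] := fS _ Gf.
    have -> : x = y by apply: (proj_unique ux orth (proj1 ry) oy).
    by exists (amax P u).
case=> [xw|[u0 le _]|[u0 le _]].
- left; left; exists F; have [y ry oy] := fS _ Ff.
  have xy : x = y.
    by apply: (proj_unique Fx _ (proj1 ry) oy); rewrite -xw subrr => a b _ _; rewrite dot0l.
  by rewrite xy; split=> //.
- apply: (main (x - w)) => //.
  by move=> y y' uy uy'; rewrite dotBr (amax_eq uy uy') subrr.
- apply: (main (w - x)) => //.
  move=> y y' uy uy'; rewrite -opprB dotNl dotBr (amax_eq uy uy') subrr oppr0//.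
Qed.

Lemma uniform_radius P o a b S U H : is_center P o -> good P o -> 0 < a -> 0 < b ->
  uniform P o a b ->
  (forall x y, kfaces P 0 [set x] -> kfaces P 0 [set y] -> x <> y -> 2 * b <= elen (x - y)) ->
  (kfaces P 2 #= `I_S)%card -> (kfaces P 0 #= `I_U)%card -> (kfaces P 1 #= `I_H)%card ->
  radius P o = Num.min a b.
Proof.
move=> ho gP a0 b0 uP lmin hS hU hH.
have full w : elen (w - o) < Num.min a b -> [/\ full_stable P w, full_saddle P w & full_unstable P w].
  rewrite lt_min => /andP[wa wb]; split.
  - exact: (ball_stable gP a0 uP wa).
  - exact: (ball_saddle gP b0 a0 uP wa wb).
  - exact: (ball_unstable ho gP b0 lmin wb).
have m0 : 0 < Num.min a b by rewrite lt_min a0.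
have [|fS fH fU] := full o; first by rewrite subrr /elen dot0l sqrtr0.
have region w : elen (w - o) < Num.min a b -> robust_region P o w.
  move=> /full[gS gH gU]; split.
  - exact: nondegenerate_full gP gS gH gU.
  - by apply: card_eq_trans (card_esym _); apply/(stable_full _ hS).
  - by apply: card_eq_trans (card_esym _); apply/(saddle_full _ hH).
  - by apply: card_eq_trans (card_esym _); apply: unstable_full hU _.
have [i fi] := exists_flag gP.
have [aE bE] := uP _ fi.
apply: le_anti; apply/andP; split.
  by rewrite le_min -{1}aE -{1}bE (radius_le_legA gP hS hH fS fH fi) (radius_le_legB gP hS hH fS fH fi).
apply: lb_le_inf.
  by exists (elen (o + (legE o i - legQ o i) - o)), (o + (legE o i - legQ o i)) => //;
    exact: (legA_not_robust gP hS hH fS fH fi).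
move=> _ [w nw <-]; rewrite leNgt; apply/negP => /region; exact: nw.
Qed.

End Region.

(** * Comparison of robustness *)

Section Compare.
Context {R : realType}.
Local Notation vec := 'rV[R]_3.
Implicit Types (u v w x y z c d p : vec) (P F G e : set vec).

Lemma rho_compare P P' z z' (S H : nat) a b : good P z -> good P' z' ->
  (kfaces P 2 #= `I_S)%card -> (kfaces P 1 #= `I_H)%card ->
  (kfaces P' 2 #= `I_S)%card -> (kfaces P' 1 #= `I_H)%card ->
  full_stable P' z' -> full_saddle P' z' ->
  0 < a -> 0 < b -> uniform P z a b -> radius P z = Num.min a b ->
  rho_in P' z' <= rho_in P z /\
  (rho_in P' z' = rho_in P z -> exists2 k, 0 < k & uniform P' z' (k * a) (k * b)).
Proof.
move=> gP gP' hS hH hS' hH' fS fH a0 b0 uP rP.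
have m0 : 0 < Num.min a b by rewrite lt_min a0.
have [le eq] := surf_compare gP gP' hS hH hS' hH' a0 b0 uP (radius_ge0 P' z')
  (fun i fi => radius_le_legA gP' hS' hH' fS fH fi) (fun i fi => radius_le_legB gP' hS' hH' fS fH fi).
have s0 : 0 < surf P.
  rewrite (surf_uniform gP hH uP) !mulr_gt0// ltr0n lt0n; apply/eqP => H0.
  have [[[v e] F] [_ ee _ _ _]] := exists_flag gP.
  by move: hH; rewrite H0 II0 card_eq0 => /eqP E; rewrite E in ee.
rewrite /rho_in -/(radius P z) -/(radius P' z') rP.
have rho0 : 0 < Num.min a b / Num.sqrt (surf P) by rewrite divr_gt0// sqrtr_gt0.
(* Here the quotient is [0], as the root of a nonpositive number and the inverse of [0] are [0]. *)
have [s'0|s'0] := leP (surf P') 0.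
  by rewrite ler0_sqrtr// invr0 mulr0; split; [exact: ltW|move=> E; move: rho0; rewrite -E ltxx].
have q0 : 0 < Num.sqrt (surf P) by rewrite sqrtr_gt0.
have q'0 : 0 < Num.sqrt (surf P') by rewrite sqrtr_gt0.
have sq := sqr_sqrtr (ltW s0); have sq' := sqr_sqrtr (ltW s'0).
have r0 := radius_ge0 P' z'.
split.
  rewrite ler_pdivrMr// mulrAC ler_pdivlMr//.
  rewrite -(@ler_pXn2r _ 2)// ?nnegrE ?mulr_ge0 ?(ltW q0) ?(ltW q'0) ?(ltW m0)//.
  by rewrite !exprMn sq sq'.
move=> E; have r1 : 0 < radius P' z'.
  rewrite lt_def r0 andbT; apply: contraTneq rho0 => r0'.
  by rewrite -E r0' mul0r ltxx.
exists (radius P' z' / Num.min a b); first exact: divr_gt0.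
apply: eq => //; rewrite -sq -sq' -!exprMn; congr (_ ^+ 2).
have -> : radius P' z' = Num.min a b / Num.sqrt (surf P) * Num.sqrt (surf P').
  by rewrite -E mulfVK// gt_eqF.
by rewrite mulrAC divfK ?gt_eqF.
Qed.

Lemma regular_good P o (S U H : nat) : regular_polyhedron P -> is_center P o ->
  (kfaces P 2 #= `I_S)%card -> (kfaces P 0 #= `I_U)%card -> (kfaces P 1 #= `I_H)%card ->
  exists a b, [/\ good P o, full_stable P o & full_saddle P o] /\
    [/\ 0 < a, 0 < b, uniform P o a b & radius P o = Num.min a b].
Proof.
move=> hP ho hS hU hH.
have fin k : (k <= 2)%N -> finite_set (kfaces P k).
  by move: k => [|[|[|//]]] _; [exists U|exists H|exists S].
have [l l0 [lmin ledge]] := reg_edge_min hP ho fin.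
have gP := reg_good hP ho fin lmin ledge.
have [a [a0 uP]] := reg_uniform hP ho fin lmin ledge.
have b0 : 0 < l / 2 by rewrite divr_gt0.
have lmin' x y : kfaces P 0 [set x] -> kfaces P 0 [set y] -> x <> y -> 2 * (l / 2) <= elen (x - y).
  by move=> vx vy xy; rewrite mulrC divfK//; exact: lmin.
exists a, (l / 2); split; last by split=> //; exact: uniform_radius lmin' hS hU hH.
have oo : elen (o - o) = 0 by rewrite subrr /elen dot0l sqrtr0.
by split=> //; [apply: (ball_stable gP a0 uP)|apply: (ball_saddle gP b0 a0 uP)]; rewrite oo.
Qed.

End Compare.

(** * Connectivity and vertex figures *)

Section Connected.
Context {R : realType}.
Local Notation vec := 'rV[R]_3.
Implicit Types (u v w x y z c d p : vec) (P F G e : set vec).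

Lemma finite_max (T : choiceType) (A : set T) (f : T -> R) a : finite_set A -> A a ->
  exists2 b, A b & forall t, A t -> f t <= f b.
Proof.
move=> /finite_seqP[s sE] Aa.
have [|b bs bm] := @seq_max R T s f.
  by apply: contraPneq Aa => s0; rewrite sE s0.
by exists b; [rewrite sE|move=> t; rewrite sE => /bm].
Qed.

(** [f] is the maximal value, [g] and [k] are the values of the target normal and of the neighbour's
    normal at the foot of the current face, and the last hypothesis says that the exit point obeys
    the target inequality. It forces [t * f < 1], and then the neighbour's value exceeds [f]. *)
Lemma potential_lt (f k t g : R) : 0 < t -> f < 1 -> k < 1 -> g < 1 -> (1 - t * f) * g + t <= 1 ->
  f < f * k + t^-1 * (1 - k).
Proof.
move=> t0 f1 k1 g1 h; suff tf : t * f < 1.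
  have : f < t^-1 by rewrite -(ltr_pM2l t0) divff ?gt_eqF.
  nra.
rewrite ltNge; apply/negP => tf; nra.
Qed.

(* A facet that maximizes the value of its normal at the foot of the perpendicular on [G] is [G]:
   otherwise, walking from the foot of its own perpendicular towards the other one crosses an edge
   into a facet with a larger value. *)
Lemma facet_connected P z (X : set vec -> Prop) F : good P z ->
  (forall e F G, kfaces P 1 e -> kfaces P 2 F -> kfaces P 2 G -> e `<=` F -> e `<=` G -> F <> G ->
    X F -> X G) ->
  kfaces P 2 F -> X F -> forall G, kfaces P 2 G -> X G.
Proof.
move=> gP step Ff XF G Gf; have pP := good_polytope gP; have [c sc] := good_strict gP.
pose nrm K : vec := xget 0 [set y | facet_normal P z K y].
have nrmP K : kfaces P 2 K -> facet_normal P z K (nrm K).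
  move=> Kf; have [y yn] := facet_normal_exists (good_inside gP) Kf.
  by rewrite /nrm; case: xgetP => [t _ //|/(_ y)]; case.
pose A := kfaces P 2 `&` [set K | X K].
have fA : finite_set A by apply: (sub_finite_set _ (good_finite gP (k := 2) isT)) => K [].
have [[GQ iG] oG] := facet_proj gP Gf.
have [K [Kf XK] Kmax] : exists2 K : set vec, A K & forall L, A L ->
    dot (nrm L) (proj z G - z) <= dot (nrm K) (proj z G - z) :=
  finite_max (fun K => dot (nrm K) (proj z G - z)) fA (conj Ff XF).
have [->//|KG] := pselect (G = K); exfalso.
have {}KG : G <> K by [].
have nG := nrmP _ Gf; have nK := nrmP _ Kf.
set x := proj z G - z in Kmax.
have Gx : dot (nrm G) x = 1 by have [] := facet_normal_sub1 nG GQ.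
have f1 : dot (nrm K) x < 1 by apply: (facet_normal_inner pP Gf Kf KG _ nK); split.
have [iK oK] := facet_proj gP Kf; set p := proj z K in iK oK.
have Kp : dot (nrm K) (p - z) = 1 by have [] := facet_normal_sub1 nK (proj1 iK).
have Gp : dot (nrm G) (p - z) < 1.
  exact: (facet_normal_inner pP Kf Gf (fun h => KG (esym h)) iK nG).
pose f := dot (nrm K) x; pose d := x - f *: (p - z).
have nd : dot (nrm K) d = 0 by rewrite /d dotBr dotZr Kp mulr1 subrr.
have up d' : d' != 0 -> dot (nrm K) d' = 0 -> exists K' t, [/\ A K', 0 < t,
    dot (nrm K') (p - z) < 1, dot (nrm K') (p - z) + t * dot (nrm K') d' = 1 & P (p + t *: d')].
  move=> d'0 nd'; have [e [t [K' [y' [[ee eK eK' K'f K'K] [t0 yn y1 y2 ey]]]]]] :=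
    facet_neighbor pP sc (good_inside gP) Kf nK iK d'0 nd'.
  have K'n := nrmP _ K'f.
  have y'E : y' = nrm K' := facet_normal_eq K'f yn K'n (fun _ h => h).
  rewrite {}y'E in y1 y2; exists K', t; split=> //.
  - split=> //; apply: (step e K K') => // h; exact: K'K.
  - by rewrite -y2 -dotZr -dotDr; congr dot; vring.
  - exact: (@kface_sub _ P 2 K Kf _ (eK _ ey)).
have Ale K' : A K' -> dot (nrm K') x <= f by exact: Kmax.
(* Here the foot on [G] lies on the line through [z] and [p], on the other side of [z]; any
   direction then leads to a better facet. *)
have [d0|d0] := eqVneq d 0.
  have xE : x = f *: (p - z) by apply/eqP; rewrite -subr_eq0 -/d d0.
  have fneg : f < 0.
    by rewrite xE dotZr in Gx; rewrite -/f in f1; clear -Gx f1 Gp; nra.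
  have [m mK] := exists_indep (nrm K).
  have nK0 : nrm K != 0 by apply: contra_eq_neq Kp => ->; rewrite dot0l eq_sym oner_eq0.
  have [||K' [t [AK' t0 k1 _ _]]] := up (cross (nrm K) m).
  - exact: cross_neq0.
  - by rewrite !dot3 !mxE /=; ring.
  - by have := Ale _ AK'; rewrite xE dotZr; nra.
have [K' [t [AK' t0 k1 k2 Pt]]] := up _ d0 nd.
have Gt := proj1 nG _ Pt.
have h : (1 - t * f) * dot (nrm G) (p - z) + t <= 1.
  suff <- : dot (nrm G) (p + t *: d - z) = (1 - t * f) * dot (nrm G) (p - z) + t by [].
  have -> : p + t *: d - z = (1 - t * f) *: (p - z) + t *: x by rewrite /d; vring.
  by rewrite [LHS]dotDr !dotZr Gx mulr1.
have := potential_lt t0 f1 k1 Gp h; rewrite ltNge -/f => /negP; apply.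
have -> : f * dot (nrm K') (p - z) + t^-1 * (1 - dot (nrm K') (p - z)) = dot (nrm K') x.
  have -> : x = f *: (p - z) + d by rewrite /d; vring.
  have -> : 1 - dot (nrm K') (p - z) = t * dot (nrm K') d by rewrite -k2 addrAC subrr add0r.
  by rewrite mulKf ?gt_eqF// [RHS]dotDr dotZr.
exact: Ale.
Qed.

Lemma edge_sub_eq P e g : polytope P -> kfaces P 1 e -> kfaces P 1 g -> g `<=` e -> g = e.
Proof.
move=> pP ee ge sub; rewrite eqEsubset; split=> // x ex.
have [a [b [ab va vb seg only]]] := edge_endpoints pP ge.
have [a' [b' [_ va' vb' seg' only']]] := edge_endpoints pP ee.
have ga : g a by apply/seg; exists 0; rewrite scale0r addr0; split.
have gb : g b by apply/seg; exists 1; rewrite scale1r addrC subrK; split.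
have [w gE] := kface_exposed ge.
have pg : polytope g by rewrite gE; exact: polytope_amax.
have [t [t0 t1 ->]] := (seg' x).1 ex.
case: (only' _ va (sub _ ga)) (only' _ vb (sub _ gb)) => aE [] bE; try by exfalso; apply: ab; rewrite aE bE.
  by rewrite -aE -bE; exact: polytope_convex.
rewrite -aE -bE; have -> : b + t *: (a - b) = a + (1 - t) *: (b - a) by vring.
by apply: polytope_convex => //; lra.
Qed.

(** The endpoints are on opposite sides of the foot, so one of them lies in the direction [d]. *)
Lemma edge_direction P z e u m d : good P z -> kfaces P 1 e -> u != 0 -> m != 0 ->
  dot u m = 0 -> (forall x y, e x -> e y -> dot u (x - y) = 0 /\ dot m (x - y) = 0) ->
  d != 0 -> dot u d = 0 -> dot m d = 0 ->
  exists v t, [/\ kfaces P 0 [set v], e v, 0 < t & v = proj z e + t *: d].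
Proof.
move=> gP ee u0 m0 um eum d0 ud md; have pP := good_polytope gP.
have [v [v' [vv' vv wv [ev ev'] _]]] := edge_vertices pP ee.
have [k k0 vk] := flag_opposite gP ee vv wv ev ev' vv'.
have [[eE _] _] := edge_proj gP ee; have [ut mt] := eum _ _ ev eE.
have c0 : cross u m != 0.
  by apply/eqP => /(cross_eq0 u0); rewrite um mul0r scale0r => m0'; rewrite m0' eqxx in m0.
have dE := perp2 c0 ud md; have tE := perp2 c0 ut mt.
set al := _ / _ in dE; set be := _ / _ in tE.
have al0 : al != 0 by apply: contra_neq d0 => al0; rewrite dE al0 scale0r.
have be0 : be != 0.
  apply/eqP => be0; apply: vv'; have vE : v - proj z e = 0 by rewrite tE be0 scale0r.
  by move: vk; rewrite vE scaler0 => /eqP; rewrite subr_eq0 => /eqP ->; apply/eqP; rewrite -subr_eq0 vE.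
have td : v - proj z e = (be / al) *: d by rewrite dE scalerA mulfVK// -tE.
have [g0|g0] := ltP 0 (be / al).
  by exists v, (be / al); split=> //; rewrite -td addrC subrK.
exists v', (- k * (be / al)); split=> //; last by rewrite -scalerA -td -vk addrC subrK.
by rewrite mulNr -mulrN mulr_gt0// oppr_gt0 lt_neqAle g0 andbT mulf_neq0// invr_eq0.
Qed.

(* The argument of [facet_connected] inside the plane of a facet. *)
Lemma edge_connected P z F (X : set vec -> Prop) e : good P z -> kfaces P 2 F ->
  (forall v e e', kfaces P 0 [set v] -> kfaces P 1 e -> kfaces P 1 e' -> e `<=` F -> e' `<=` F ->
    e v -> e' v -> e <> e' -> X e -> X e') ->
  kfaces P 1 e -> e `<=` F -> X e -> forall g, kfaces P 1 g -> g `<=` F -> X g.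
Proof.
move=> gP Ff step ee eF Xe g ge gF; have pP := good_polytope gP.
have [u [u0 FE _]] := facetP Ff; have [iF oF] := facet_proj gP Ff; set c := proj z F in iF oF.
have uF x y : F x -> F y -> dot u (x - y) = 0.
  by rewrite FE => Fx Fy; rewrite dotBr (amax_eq Fx Fy) subrr.
pose nrm K : vec := xget 0 [set y | edge_normal F c K y /\ dot u y = 0].
have nrmP K : kfaces P 1 K -> K `<=` F -> edge_normal F c K (nrm K) /\ dot u (nrm K) = 0.
  move=> Kf KF; have [y yn] := edge_normal_exists Ff u0 FE iF Kf KF.
  by rewrite /nrm; case: xgetP => [t _ //|/(_ y)]; case.
have lt1 K L : kfaces P 1 K -> K `<=` F -> kfaces P 1 L -> L `<=` F -> K <> L ->
    dot (nrm K) (proj z L - c) < 1.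
  move=> Kf KF Lf LF KL; have [[le KE] _] := nrmP _ Kf KF; have [iL _] := edge_proj gP Lf.
  have FL := LF _ (proj1 iL).
  rewrite lt_neqAle le// andbT; apply/negP => /eqP E; apply: KL; apply/esym.
  have [w wE] := kface_exposed Kf.
  apply: (edge_sub_eq pP Kf Lf); apply: (inner_exposed iL (kface_sub Lf) wE).
  by rewrite KE.
pose A := kfaces P 1 `&` [set K | K `<=` F /\ X K].
have fA : finite_set A by apply: (sub_finite_set _ (good_finite gP (k := 1) isT)) => K [].
have [[GQ iG] oG] := edge_proj gP ge.
have [K [Kf [KF XK]] Kmax] : exists2 K : set vec, A K & forall L, A L ->
    dot (nrm L) (proj z g - c) <= dot (nrm K) (proj z g - c) :=
  finite_max (fun K => dot (nrm K) (proj z g - c)) fA (conj ee (conj eF Xe)).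
have [->//|KG] := pselect (g = K); exfalso.
have {}KG : g <> K by [].
have [nG uG] := nrmP _ ge gF; have [nK uK] := nrmP _ Kf KF.
set x := proj z g - c in Kmax.
have Gx : dot (nrm g) x = 1 by have := GQ; rewrite {1}(proj2 nG) => -[].
have f1 : dot (nrm K) x < 1 by apply: lt1 => // /esym.
have [iK oK] := edge_proj gP Kf; set p := proj z K in iK oK.
have Kp : dot (nrm K) (p - c) = 1 by have := proj1 iK; rewrite {1}(proj2 nK) => -[].
have Gp : dot (nrm g) (p - c) < 1 by exact: lt1.
pose f := dot (nrm K) x; pose d := x - f *: (p - c).
have nd : dot (nrm K) d = 0 by rewrite /d dotBr dotZr Kp mulr1 subrr.
have ud : dot u d = 0.
  by rewrite /d dotBr dotZr !uF ?mulr0 ?subrr//; [exact: gF|case: iF|exact: KF (proj1 iK)|case: iF].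
have nK0 : nrm K != 0 by apply: contra_eq_neq Kp => ->; rewrite dot0l eq_sym oner_eq0.
have par y y' : K y -> K y' -> dot u (y - y') = 0 /\ dot (nrm K) (y - y') = 0.
  move=> Ky Ky'; split; first by apply: uF; exact: KF.
  move: Ky Ky'; rewrite {1 2}(proj2 nK) => -[_ h1] [_ h2].
  have -> : y - y' = (y - c) - (y' - c) by vring.
  by rewrite dotBr h1 h2 subrr.
have up d' : d' != 0 -> dot u d' = 0 -> dot (nrm K) d' = 0 -> exists K' t, [/\ A K', 0 < t,
    dot (nrm K') (p - c) < 1, dot (nrm K') (p - c) + t * dot (nrm K') d' = 1 & F (p + t *: d')].
  move=> d'0 ud' nd'; have [v [t [vv Kv t0 vE]]] := edge_direction gP Kf u0 nK0 uK par d'0 ud' nd'.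
  have [K' [K'f K'F K'v K'K]] := other_edge pP Ff Kf KF vv Kv.
  have [n' uK'] := nrmP _ K'f K'F.
  exists K', t; split=> //.
  - by split=> //; split=> //; apply: (step v K K') => // h; exact: K'K.
  - exact: lt1.
  - have := K'v; rewrite {1}(proj2 n') vE => -[_ <-].
    by rewrite -dotZr -dotDr; congr dot; vring.
  - by rewrite -vE; exact: KF.
have Ale K' : A K' -> dot (nrm K') x <= f by exact: Kmax.
have [d0|d0] := eqVneq d 0.
  have xE : x = f *: (p - c) by apply/eqP; rewrite -subr_eq0 -/d d0.
  have fneg : f < 0.
    by rewrite xE dotZr in Gx; rewrite -/f in f1; clear -Gx f1 Gp; nra.
  have [|||K' [t [AK' t0 k1 _ _]]] := up (cross u (nrm K)).
  - apply/eqP => /(cross_eq0 u0); rewrite uK mul0r scale0r => m0'.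
    by rewrite m0' eqxx in nK0.
  - by rewrite !dot3 !mxE /=; ring.
  - by rewrite !dot3 !mxE /=; ring.
  - by have := Ale _ AK'; rewrite xE dotZr; nra.
have [K' [t [AK' t0 k1 k2 Ft]]] := up _ d0 ud nd.
have Gt := proj1 nG _ Ft.
have h : (1 - t * f) * dot (nrm g) (p - c) + t <= 1.
  suff <- : dot (nrm g) (p + t *: d - c) = (1 - t * f) * dot (nrm g) (p - c) + t by [].
  have -> : p + t *: d - c = (1 - t * f) *: (p - c) + t *: x by rewrite /d; vring.
  by rewrite [LHS]dotDr !dotZr Gx mulr1.
have := potential_lt t0 f1 k1 Gp h; rewrite ltNge -/f => /negP; apply.
have -> : f * dot (nrm K') (p - c) + t^-1 * (1 - dot (nrm K') (p - c)) = dot (nrm K') x.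
  have -> : x = f *: (p - c) + d by rewrite /d; vring.
  have -> : 1 - dot (nrm K') (p - c) = t * dot (nrm K') d by rewrite -k2 addrAC subrr add0r.
  by rewrite mulKf ?gt_eqF// [RHS]dotDr dotZr.
exact: Ale.
Qed.

End Connected.

(** * Orthogonal frames, reflections and the common height *)

Section Frame.
Context {R : realType}.
Local Notation vec := 'rV[R]_3.
Implicit Types (u v w x y z c d p : vec) (P F G e : set vec).

Lemma perp3 u v w x : cross u v != 0 -> w != 0 -> dot u w = 0 -> dot v w = 0 ->
  dot u x = 0 -> dot v x = 0 -> dot w x = 0 -> x = 0.
Proof.
move=> c0 w0 uw vw ux vx; rewrite (perp2 c0 uw vw) (perp2 c0 ux vx) dotZl dotZr.
have c1 : dot (cross u v) (cross u v) != 0 by rewrite dot_eq0.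
have k0 : dot (cross u v) w / dot (cross u v) (cross u v) != 0.
  by apply: contra_neq w0 => k0; rewrite (perp2 c0 uw vw) k0 scale0r.
by move=> /eqP; rewrite mulf_eq0 (negPf k0) mulf_eq0 (negPf c1) orbF /= => /eqP ->; rewrite scale0r.
Qed.

Lemma orthogonal_cross u v : u != 0 -> v != 0 -> dot u v = 0 -> cross u v != 0.
Proof.
move=> u0 v0 uv; apply/eqP => /(cross_eq0 u0); rewrite uv mul0r scale0r => v0'.
by rewrite v0' eqxx in v0.
Qed.

Lemma orthogonal_decomp u v w x : u != 0 -> v != 0 -> w != 0 ->
  dot u v = 0 -> dot u w = 0 -> dot v w = 0 ->
  x = (dot u x / dot u u) *: u + (dot v x / dot v v) *: v + (dot w x / dot w w) *: w.
Proof.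
move=> u0 v0 w0 uv uw vw; apply/eqP; rewrite -subr_eq0; apply/eqP.
have [vu wu wv] : [/\ dot v u = 0, dot w u = 0 & dot w v = 0].
  by rewrite [dot v u]dotC [dot w u]dotC [dot w v]dotC.
apply: (perp3 (orthogonal_cross u0 v0 uv) w0 uw vw);
  rewrite dotBr !dotDr !dotZr ?uv ?uw ?vw ?vu ?wu ?wv !mulr0 ?addr0 ?add0r mulfVK ?dot_eq0 ?subrr//.
Qed.

(* In a plane, two different vectors with the same length and the same product with [g] are
   mirror images of each other in the line of [g]. *)
Lemma reflection (n g : vec) y1 y2 r : n != 0 -> g != 0 -> dot n g = 0 -> dot n y1 = 0 -> dot n y2 = 0 ->
  dot y1 g = r -> dot y2 g = r -> dot y1 y1 = dot y2 y2 -> y1 <> y2 ->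
  y1 + y2 = (2 * r / dot g g) *: g.
Proof.
move=> n0 g0 ng n1 n2 g1 g2 yy ne; apply/eqP; rewrite -subr_eq0; apply/eqP.
have d0 : y1 - y2 != 0 by rewrite subr_eq0; apply/eqP.
have gg : dot g g != 0 by rewrite dot_eq0.
rewrite dotC in g1; rewrite dotC in g2.
apply: (perp3 (orthogonal_cross n0 g0 ng) d0).
- by rewrite dotBr n1 n2 subrr.
- by rewrite dotBr g1 g2 subrr.
- by rewrite dotBr dotZr dotDr n1 n2 ng mulr0 !subr0 addr0.
- by rewrite dotBr dotZr dotDr g1 g2 mulfVK//; ring.
- by rewrite dotBr dotZr [dot (_ - _) g]dotC dotBr g1 g2 subrr mulr0 subr0 dotDr !dotDl !dotNl [dot y2 y1]dotC yy; ring.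
Qed.

Lemma uniform_height P z a b : good P z -> uniform P z a b -> exists2 h, 0 < h &
  forall F, kfaces P 2 F -> dot (proj z F - z) (proj z F - z) = h ^+ 2.
Proof.
move=> gP uP; have [i fi] := exists_flag gP; have Q0 := legQ_neq gP fi.
have h2 : Num.sqrt (dot (legQ z i - z) (legQ z i - z)) ^+ 2 = dot (legQ z i - z) (legQ z i - z).
  by rewrite sqr_sqrtr// ltW.
exists (Num.sqrt (dot (legQ z i - z) (legQ z i - z))); first by rewrite sqrtr_gt0.
have [_ _ iF _ _] := fi; apply: (facet_connected gP _ iF) => // e F G ee Ff Gf eF eG _ <-.
have [v [_ [_ vv _ [ev _] _]]] := edge_vertices (good_polytope gP) ee.
have key K : kfaces P 2 K -> e `<=` K ->
    dot (proj z K - z) (proj z K - z) = dot (proj z e - z) (proj z e - z) - a ^+ 2.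
  move=> Kf eK; have fj : flags P (v, e, K) by split.
  have [orth1 _ _] := flag_orth gP fj; have [<- _] := uP _ fj.
  rewrite /legA elen_sqr; move: orth1; rewrite /legQ /legE /=.
  have -> : proj z e - z = (proj z e - proj z K) + (proj z K - z) by vring.
  move: (proj z e - proj z K) (proj z K - z) => A B.
  by rewrite !(dotDl, dotDr) [dot A B]dotC => ->; ring.
by rewrite (key F) ?(key G).
Qed.

(** A common point off the edge would make both normals orthogonal to two independent directions,
    hence parallel, and equal by their scaling. *)
Lemma facet_inter P z e F G x : good P z -> kfaces P 1 e -> kfaces P 2 F -> kfaces P 2 G ->
  F <> G -> e `<=` F -> e `<=` G -> F x -> G x -> e x.
Proof.
move=> gP ee Ff Gf FG eF eG Fx Gx; apply: contrapT => nex.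
have [v [w [vw _ _ [ev ew] _]]] := edge_vertices (good_polytope gP) ee.
have [u eE] := kface_exposed ee.
have cr := edge_line ee ev ew vw eE (kface_sub Ff Fx) nex.
have [yF nF] := facet_normal_exists (good_inside gP) Ff.
have [yG nG] := facet_normal_exists (good_inside gP) Gf.
have on y K : facet_normal P z K y -> e `<=` K -> K x -> dot y (v - z) = 1 /\
    y = (dot (cross (w - v) (x - v)) y / dot (cross (w - v) (x - v)) (cross (w - v) (x - v))) *:
      cross (w - v) (x - v).
  move=> nK eK Kx; have [_ yv] := facet_normal_sub1 nK (eK _ ev).
  have [_ yw] := facet_normal_sub1 nK (eK _ ew); have [_ yx] := facet_normal_sub1 nK Kx.
  split=> //; apply: (perp2 cr); rewrite dotC.
  - by have -> : w - v = (w - z) - (v - z) by [vring]; rewrite dotBr yw yv subrr.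
  - by have -> : x - v = (x - z) - (v - z) by [vring]; rewrite dotBr yx yv subrr.
have [F1 FE] := on _ _ nF eF Fx; have [G1 GE] := on _ _ nG eG Gx.
move: FE GE; set C := cross _ _; set k := _ / _; set l := _ / _ => FE GE.
have Cv : dot C (v - z) != 0 by apply: contra_eq_neq F1 => C0; rewrite FE dotZl C0 mulr0 eq_sym oner_eq0.
apply: FG; rewrite (proj2 nF) (proj2 nG) FE GE; suff -> : k = l by [].
by apply: (mulIf Cv); rewrite -[LHS]dotZl -[RHS]dotZl -FE -GE F1 G1.
Qed.

End Frame.

(** * The plane of a vertex figure *)

Section Figure.
Context {R : realType}.
Local Notation vec := 'rV[R]_3.
Local Notation T2 := (measurableTypeR R * measurableTypeR R)%type.
Local Notation leb2 := (@leb2 R).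
Implicit Types (u v w x y z c d p : vec) (P F G e : set vec) (i j : @triple R).
Context P z (gP : good P z) (a b h : R) (a0 : 0 < a) (b0 : 0 < b) (h0 : 0 < h).
Context (uP : uniform P z a b)
  (hP : forall F, kfaces P 2 F -> dot (proj z F - z) (proj z F - z) = h ^+ 2).

Let pP := good_polytope gP.
(** The squared distance from [z] to every vertex. *)
Let N : R := h ^+ 2 + a ^+ 2 + b ^+ 2.

Lemma flag_frame i : flags P i -> exists n1 n2 n3, [/\ legQ z i - z = n1, legE z i - legQ z i = n2
  & legV i - legE z i = n3] /\ [/\ dot n1 n1 = h ^+ 2, dot n2 n2 = a ^+ 2, dot n3 n3 = b ^+ 2 &
  [/\ dot n1 n2 = 0, dot n1 n3 = 0 & dot n2 n3 = 0]].
Proof.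
move=> fi; exists (legQ z i - z), (legE z i - legQ z i), (legV i - legE z i); split=> //.
have [vv ee Ff _ _] := fi; have [orth1 orth2 orth3] := flag_orth gP fi.
have [aE bE] := uP fi; split=> //; first exact: hP.
  by rewrite -elen_sqr -aE.
by rewrite -elen_sqr -bE.
Qed.

(* Orthogonal axes in the plane of the vertex figure, which is perpendicular to the line
   from [z] to the vertex: [figm] is the projection of the edge, [figw] is perpendicular to it. *)
Definition figm i : vec := (legE z i - legV i) + (b ^+ 2 / N) *: (legV i - z).
Definition figw i : vec := (legQ z i - legE z i) + (a ^+ 2 / (h ^+ 2 + a ^+ 2)) *: (legE z i - z).
Definition figM : R := Num.sqrt (b ^+ 2 * (h ^+ 2 + a ^+ 2) / N).
Definition figW : R := Num.sqrt (a ^+ 2 * h ^+ 2 / (h ^+ 2 + a ^+ 2)).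
(** The slope of the image of [legQ - legV] in these axes: the tangent of the angle, at the line
    from [z] to the vertex, between the half-planes through the two feet. *)
Definition figT : R := figW * figM * N / (b ^+ 2 * h ^+ 2).

Let h2 : 0 < h ^+ 2. Proof. exact: exprn_gt0. Qed.
Let a2 : 0 < a ^+ 2. Proof. exact: exprn_gt0. Qed.
Let b2 : 0 < b ^+ 2. Proof. exact: exprn_gt0. Qed.
Let ha : 0 < h ^+ 2 + a ^+ 2. Proof. exact: addr_gt0. Qed.
Let N0 : 0 < N. Proof. exact: addr_gt0. Qed.

Lemma figM2 : figM ^+ 2 = b ^+ 2 * (h ^+ 2 + a ^+ 2) / N.
Proof. by rewrite sqr_sqrtr// ltW// divr_gt0// mulr_gt0. Qed.

Lemma figW2 : figW ^+ 2 = a ^+ 2 * h ^+ 2 / (h ^+ 2 + a ^+ 2).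
Proof. by rewrite sqr_sqrtr// ltW// divr_gt0// mulr_gt0. Qed.

Lemma figM_gt0 : 0 < figM. Proof. by rewrite sqrtr_gt0 divr_gt0// mulr_gt0. Qed.
Lemma figW_gt0 : 0 < figW. Proof. by rewrite sqrtr_gt0 divr_gt0// mulr_gt0. Qed.

Lemma figT_gt0 : 0 < figT.
Proof. by rewrite divr_gt0 ?mulr_gt0 ?figM_gt0 ?figW_gt0. Qed.

(** Once the legs are fixed, only [h] varies on the right-hand side, and strictly monotonically; so
    this angle determines the height. *)
Lemma figT2 : figT ^+ 2 = a ^+ 2 / b ^+ 2 * (1 + (a ^+ 2 + b ^+ 2) / h ^+ 2).
Proof.
rewrite /figT !exprMn exprVn figM2 figW2 /N; field.
by rewrite -/N !gt_eqF.
Qed.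

Lemma figE i : flags P i ->
  [/\ dot (legV i - z) (legV i - z) = N, dot (figm i) (legV i - z) = 0 & dot (figw i) (legV i - z) = 0]
  /\ [/\ dot (figm i) (figm i) = figM ^+ 2, dot (figw i) (figw i) = figW ^+ 2 & dot (figm i) (figw i) = 0].
Proof.
move=> fi; have [n1 [n2 [n3 [[E1 E2 E3] [d1 d2 d3 [d12 d13 d23]]]]]] := flag_frame fi.
have Vz : legV i - z = n1 + n2 + n3 by rewrite -E1 -E2 -E3; vring.
have Ez : legE z i - z = n1 + n2 by rewrite -E1 -E2; vring.
have mE : figm i = - n3 + (b ^+ 2 / N) *: (n1 + n2 + n3) by rewrite /figm Vz -opprB E3.
have wE : figw i = - n2 + (a ^+ 2 / (h ^+ 2 + a ^+ 2)) *: (n1 + n2) by rewrite /figw Ez -opprB E2.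
have [d21 d31 d32] : [/\ dot n2 n1 = 0, dot n3 n1 = 0 & dot n3 n2 = 0].
  by rewrite [dot n2 n1]dotC [dot n3 n1]dotC [dot n3 n2]dotC.
have hN : h ^+ 2 + a ^+ 2 + b ^+ 2 != 0 by rewrite gt_eqF.
have hA : h ^+ 2 + a ^+ 2 != 0 by rewrite gt_eqF.
rewrite mE wE Vz figM2 figW2 /N.
split; split; rewrite !(dotDl, dotDr, dotNl, dotNr, dotZl, dotZr) ?d1 ?d2 ?d3 ?d12 ?d13 ?d23 ?d21 ?d31 ?d32; field;
  rewrite ?hN ?hA//.
Qed.

Lemma fig_coord i (al be s : R) d : flags P i ->
  d = al *: (legE z i - legV i) + be *: (legQ z i - legV i) + s *: (legV i - z) ->
  dot (figm i) d / figM = (al * figM ^+ 2 + be * (b ^+ 2 * h ^+ 2 / N)) / figM /\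
  dot (figw i) d / figW = be * figW.
Proof.
move=> fi ->; have [[_ mV wV] _] := figE fi.
have [n1 [n2 [n3 [[E1 E2 E3] [d1 d2 d3 [d12 d13 d23]]]]]] := flag_frame fi.
have Vz : legV i - z = n1 + n2 + n3 by rewrite -E1 -E2 -E3; vring.
have Ez : legE z i - z = n1 + n2 by rewrite -E1 -E2; vring.
have QV : legQ z i - legV i = - n2 - n3 by rewrite -E2 -E3; vring.
have EV : legE z i - legV i = - n3 by rewrite -E3; vring.
have [d21 d31 d32] : [/\ dot n2 n1 = 0, dot n3 n1 = 0 & dot n3 n2 = 0].
  by rewrite [dot n2 n1]dotC [dot n3 n1]dotC [dot n3 n2]dotC.
have hN : h ^+ 2 + a ^+ 2 + b ^+ 2 != 0 by rewrite gt_eqF.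
have hA : h ^+ 2 + a ^+ 2 != 0 by rewrite gt_eqF.
split.
- rewrite dotDr dotZr mV mulr0 addr0; congr (_ / _).
  rewrite /figm Vz QV EV figM2 /N !(dotDl, dotDr, dotNl, dotNr, dotZl, dotZr).
  by rewrite ?d1 ?d2 ?d3 ?d12 ?d13 ?d23 ?d21 ?d31 ?d32; field.
- rewrite dotDr dotZr wV mulr0 addr0.
  have -> : dot (figw i) (al *: (legE z i - legV i) + be *: (legQ z i - legV i)) = be * figW ^+ 2.
    have EQ : legQ z i - legE z i = - n2 by rewrite -E2; vring.
    rewrite /figw Ez EQ QV EV figW2 !(dotDl, dotDr, dotNl, dotNr, dotZl, dotZr).
    by rewrite ?d1 ?d2 ?d3 ?d12 ?d13 ?d23 ?d21 ?d31 ?d32; field.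
  by field; rewrite gt_eqF// figW_gt0.
Qed.

Lemma fig_decomp i d : flags P i -> exists al be s,
  d = al *: (legE z i - legV i) + be *: (legQ z i - legV i) + s *: (legV i - z).
Proof.
move=> fi; have [n1 [n2 [n3 [[E1 E2 E3] [d1 d2 d3 [d12 d13 d23]]]]]] := flag_frame fi.
have Vz : legV i - z = n1 + n2 + n3 by rewrite -E1 -E2 -E3; vring.
have QV : legQ z i - legV i = - n2 - n3 by rewrite -E2 -E3; vring.
have EV : legE z i - legV i = - n3 by rewrite -E3; vring.
have [n10 n20 n30] : [/\ n1 != 0, n2 != 0 & n3 != 0].
  by rewrite -!dot_eq0 d1 d2 d3 !gt_eqF.
have -> := orthogonal_decomp d n10 n20 n30 d12 d13 d23; rewrite Vz QV EV.
set c1 := _ / _; set c2 := _ / _; set c3 := _ / _.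
exists (c2 - c3), (c1 - c2), c1; vring.
Qed.

(** The cone is spanned by the images of [legE - legV] and [legQ - legV]; the component along
    [legV - z] is projected away. *)
Lemma fig_cone i (al be s : R) d : flags P i ->
  d = al *: (legE z i - legV i) + be *: (legQ z i - legV i) + s *: (legV i - z) ->
  (cone figT (dot (figm i) d / figM, dot (figw i) d / figW) <-> 0 < al /\ 0 < be) /\
  (ccone figT (dot (figm i) d / figM, dot (figw i) d / figW) <-> 0 <= al /\ 0 <= be).
Proof.
move=> fi dE; have [-> ->] := fig_coord fi dE.
have M0 := figM_gt0; have W0 := figW_gt0; have T0 := figT_gt0.
have TE : figT * ((al * figM ^+ 2 + be * (b ^+ 2 * h ^+ 2 / N)) / figM) =
    al * (figT * figM) + be * figW.
  by rewrite /figT; field; rewrite !gt_eqF.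
have TM : 0 < figT * figM by rewrite mulr_gt0.
rewrite /cone /ccone /= TE; split; rewrite ?pmulr_lgt0 ?pmulr_lge0//.
  by rewrite ltrDr pmulr_lgt0//; split=> -[].
by rewrite lerDr pmulr_lge0//; split=> -[].
Qed.

End Figure.

(** * The flags at a vertex tile its figure *)

Section VertexTiling.
Context {R : realType}.
Local Notation vec := 'rV[R]_3.
Local Notation T2 := (measurableTypeR R * measurableTypeR R)%type.
Local Notation leb2 := (@leb2 R).
Implicit Types (u v w x y z c d p : vec) (P F G e : set vec) (i j : @triple R).

Lemma good_center P z : good P z -> P z.
Proof.
move=> gP; have [c sc] := good_strict gP.
apply: (hrep (good_polytope gP) sc (good_inside gP) (good_finite gP (k := 2) isT)) => F y _ _.
by rewrite subrr dot0r ler01.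
Qed.

Lemma good_center_vertex P z : good P z -> ~ kfaces P 0 [set z].
Proof.
move=> gP /vertexP[m m0 mE]; have [c sc] := good_strict gP.
have mz : amax P m z by rewrite mE.
have [F [y [Ff _ ym Fx _]]] := ray_facet (good_polytope gP) sc (good_inside gP)
  (good_finite gP (k := 2) isT) m0.
have := (proj2 mz) _ (kface_sub Ff Fx); rewrite dotDr dotZr gerDl leNgt mulr_gt0 ?invr_gt0//.
by rewrite dot_gt0.
Qed.

Lemma vertex_flag P z v : good P z -> kfaces P 0 [set v] -> exists2 i, flags P i & legV i = v.
Proof.
move=> gP vv; have [c sc] := good_strict gP.
have vz : v <> z by move=> vz; apply: (good_center_vertex gP); rewrite -vz.
have [F [Ff Fv]] := vertex_facet (good_polytope gP) sc (good_inside gP) (good_center gP)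
  (good_finite gP (k := 2) isT) vv vz.
have [iF _] := facet_proj gP Ff.
have [e [ee eF ev]] := vertex_edge (good_polytope gP) Ff iF Fv vv.
by exists (v, e, F).
Qed.

Section Fixed.
Context P z (gP : good P z) (a b h : R) (a0 : 0 < a) (b0 : 0 < b) (h0 : 0 < h).
Context (uP : uniform P z a b)
  (hP : forall F, kfaces P 2 F -> dot (proj z F - z) (proj z F - z) = h ^+ 2).

Let pP := good_polytope gP.

(* The two edges of [F] at [v] are mirror images in the line from [v] to the foot of the
   perpendicular on [F]. *)
Lemma edge_mirror v e1 e2 F : flags P (v, e1, F) -> flags P (v, e2, F) -> e1 <> e2 ->
  (proj z e1 - v) + (proj z e2 - v) =
    (2 * b ^+ 2 / dot (proj z F - v) (proj z F - v)) *: (proj z F - v).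
Proof.
move=> f1 f2 e12; have Ff : kfaces P 2 F by case: f1.
have [n1 [n2 [n3 [[E1 E2 E3] [d1 d2 d3 [d12 d13 d23]]]]]] := flag_frame gP uP hP f1.
have [m1 [m2 [m3 [[G1 G2 G3] [c1 c2 c3 [c12 c13 c23]]]]]] := flag_frame gP uP hP f2.
rewrite /legV /legE /legQ /= in E1 E2 E3 G1 G2 G3.
have y1 : proj z e1 - v = - n3 by rewrite -E3; vring.
have y2 : proj z e2 - v = - m3 by rewrite -G3; vring.
have g1 : proj z F - v = - n2 - n3 by rewrite -E2 -E3; vring.
have g2 : proj z F - v = - m2 - m3 by rewrite -G2 -G3; vring.
have nm : m1 = n1 by rewrite -E1 -G1.
have n10 : n1 != 0 by rewrite -dot_eq0 d1 expf_neq0 ?gt_eqF.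
have [f1v f1e _ f1ev f1F] := f1; have [f2v f2e _ f2ev f2F] := f2.
apply: (reflection n10); rewrite ?y1 ?y2.
- rewrite g1 -dot_eq0 !(dotDl, dotDr, dotNl, dotNr) d2 d3 d23 [dot n3 n2]dotC d23 gt_eqF//.
  by have := exprn_gt0 2 a0; have := exprn_gt0 2 b0; lra.
- by rewrite g1 !(dotDr, dotNr) d12 d13; ring.
- by rewrite dotNr d13 oppr0.
- by rewrite dotNr -nm c13 oppr0.
- by rewrite g1 !(dotDr, dotNr, dotNl) [dot n3 n2]dotC d23 d3; ring.
- by rewrite g2 !(dotDr, dotNr, dotNl) [dot m3 m2]dotC c23 c3; ring.
- by rewrite !(dotNl, dotNr) !opprK d3 c3.
move=> E; apply: e12.
have EE : proj z e1 = proj z e2 by rewrite -[LHS](subrK v) -[RHS](subrK v) y1 y2 E.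
have [i1 _] := edge_proj gP f1e; have [i2 _] := edge_proj gP f2e.
have [w wE] := kface_exposed f2e.
apply: (edge_sub_eq pP f2e f1e).
by apply: (inner_exposed i1 (kface_sub f1e) wE); rewrite EE; case: i2.
Qed.

(** The relevant facet at [v] is the one whose normal is largest on [d]. Its two edges at [v] give
    coefficients whose signs come from the facets across them. By [edge_mirror] the sum of both edge
    directions points to the foot on the facet, so the smaller coefficient is exchanged for one at
    the foot. *)
Lemma fig_cover v d : kfaces P 0 [set v] -> exists i al be s, [/\ flags P i, legV i = v,
  0 <= al, 0 <= be & d = al *: (legE z i - legV i) + be *: (legQ z i - legV i) + s *: (legV i - z)].
Proof.
move=> vv; have [c sc] := good_strict gP.
have [i0 fi0 i0v] := vertex_flag gP vv.
pose nrm K : vec := xget 0 [set y | facet_normal P z K y].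
have nrmP K : kfaces P 2 K -> facet_normal P z K (nrm K).
  move=> Kf; have [y yn] := facet_normal_exists (good_inside gP) Kf.
  by rewrite /nrm; case: xgetP => [t _ //|/(_ y)]; case.
pose A := kfaces P 2 `&` [set K | K v].
have fA : finite_set A by apply: (sub_finite_set _ (good_finite gP (k := 2) isT)) => K [].
have A0 : A i0.2 by have [_ _ Ff ev eF] := fi0; split=> //=; rewrite -i0v; exact: eF.
have [F [Ff Fv] Fmax] : exists2 K : set vec, A K & forall L, A L -> dot (nrm L) d <= dot (nrm K) d :=
  finite_max (fun K => dot (nrm K) d) fA A0.
set s := dot (nrm F) d in Fmax;
have [d' d'E] : exists d', d' = d - s *: (v - z) by eexists.
have nv K : kfaces P 2 K -> K v -> dot (nrm K) (v - z) = 1.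
  by move=> Kf Kv; have [] := facet_normal_sub1 (nrmP _ Kf) Kv.
have F0 : dot (nrm F) d' = 0 by rewrite d'E dotBr dotZr nv// mulr1 subrr.
have G0 K : kfaces P 2 K -> K v -> dot (nrm K) d' <= 0.
  by move=> Kf Kv; rewrite d'E dotBr dotZr nv// mulr1 subr_le0; apply: Fmax.
have onv K x : kfaces P 2 K -> K v -> K x -> dot (nrm K) (x - v) = 0.
  move=> Kf Kv Kx; have -> : x - v = (x - z) - (v - z) by vring.
  by rewrite dotBr nv//; have [_ ->] := facet_normal_sub1 (nrmP _ Kf) Kx; rewrite subrr.
have [iF _] := facet_proj gP Ff.
have [e1 [ee1 e1F e1v]] := vertex_edge pP Ff iF Fv vv.
have [e2 [ee2 e2F e2v e21]] := other_edge pP Ff ee1 e1F vv e1v.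
have f1 : flags P (v, e1, F) by split.
have f2 : flags P (v, e2, F) by split.
have other e e' : kfaces P 1 e -> e `<=` F -> e v -> kfaces P 1 e' -> e' `<=` F -> e' <> e -> e' v ->
    exists G, [/\ kfaces P 2 G, G v, G <> F, dot (nrm G) (proj z e - v) = 0 &
      dot (nrm G) (proj z e' - v) < 0].
  move=> ee eF ev ee' e'F e'e e'v.
  have [G [Gf GF eG]] : exists G, [/\ kfaces P 2 G, G <> F & e `<=` G].
    have [G1 [G2 [G1f G2f G12 eG1 eG2]]] := edge_two_facets pP (strict_fulldim sc) ee.
    have [E|E] := pselect (G1 = F); last by exists G1.
    by exists G2; split=> // E2; apply: G12; rewrite E E2.
  have Gv := eG _ ev; exists G; split=> //.
    by apply: onv => //; apply: eG; case: (edge_proj gP ee) => -[].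
  have [iE' _] := edge_proj gP ee'.
  have -> : proj z e' - v = (proj z e' - z) - (v - z) by vring.
  rewrite dotBr nv// subr_lt0 lt_neqAle.
  rewrite (proj1 (nrmP _ Gf)) ?andbT; last exact: (kface_sub ee' (proj1 iE')).
  apply/negP => /eqP E; apply: e'e; apply: (edge_sub_eq pP ee ee').
  have GE' : G (proj z e').
    by rewrite (proj2 (nrmP _ Gf)); split=> //; exact: (kface_sub ee' (proj1 iE')).
  have [y0 GE] := facet_normal_amax Gf (nrmP _ Gf).
  have sub := inner_exposed iE' (kface_sub ee') GE GE'.
  move=> x e'x; exact: (facet_inter gP ee Ff Gf (fun h => GF (esym h)) eF eG (e'F _ e'x) (sub _ e'x)).
have [G1 [G1f G1v G1F p11 p12]] := other _ _ ee1 e1F e1v ee2 e2F e21 e2v.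
have [G2 [G2f G2v G2F p22 p21]] := other _ _ ee2 e2F e2v ee1 e1F (fun h => e21 (esym h)) e1v.
have q1 : dot (nrm F) (proj z e1 - v) = 0.
  by apply: onv => //; apply: e1F; case: (edge_proj gP ee1) => -[].
have q2 : dot (nrm F) (proj z e2 - v) = 0.
  by apply: onv => //; apply: e2F; case: (edge_proj gP ee2) => -[].
have g1 := G0 _ G1f G1v; have g2 := G0 _ G2f G2v.
pose al := dot (nrm G2) d' / dot (nrm G2) (proj z e1 - v).
pose be := dot (nrm G1) d' / dot (nrm G1) (proj z e2 - v).
have al0 : 0 <= al by rewrite /al -mulrNN -invrN divr_ge0 ?oppr_ge0// ltW.
have be0 : 0 <= be by rewrite /be -mulrNN -invrN divr_ge0 ?oppr_ge0// ltW.
have dE : d' = al *: (proj z e1 - v) + be *: (proj z e2 - v).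
  apply/eqP; rewrite -subr_eq0; apply/eqP; set D := (X in X = 0).
  have h1 : dot (nrm F) D = 0 by rewrite /D dotBr dotDr !dotZr F0 q1 q2 !mulr0 addr0 subrr.
  have h2 : dot (nrm G1) D = 0.
    by rewrite /D dotBr dotDr !dotZr p11 mulr0 add0r /be mulfVK ?lt_eqF// subrr.
  have h3 : dot (nrm G2) D = 0.
    by rewrite /D dotBr dotDr !dotZr p22 mulr0 addr0 /al mulfVK ?lt_eqF// subrr.
  have c0 : cross (nrm F) (nrm G1) != 0.
    have nF0 : nrm F != 0.
      by apply: contra_eq_neq (nv _ Ff Fv) => ->; rewrite dot0l eq_sym oner_eq0.
    apply/eqP => /(cross_eq0 nF0) => GE; move: p12.
    by rewrite GE dotZl q2 mulr0 ltxx.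
  have DE := perp2 c0 h1 h2; set kD := _ / _ in DE.
  have GC : dot (nrm G2) (cross (nrm F) (nrm G1)) != 0.
    by apply: contraTneq p21 => E; rewrite (perp2 c0 q1 p11) dotZr E mulr0 ltxx.
  clearbody kD; move: h3; rewrite DE dotZr => /eqP; rewrite mulf_eq0 (negPf GC) orbF => /eqP ->.
  by rewrite scale0r.
have mir := edge_mirror f1 f2 (fun h => e21 (esym h)).
set k := (_ / _) in mir.
have k0 : 0 <= k by rewrite /k divr_ge0 ?dot_ge0// mulr_ge0// sqr_ge0.
have dE' : d = d' + s *: (v - z) by rewrite d'E subrK.
have [ab|ab] := leP be al.
- exists (v, e1, F), (al - be), (be * k), s; split=> //; [by rewrite subr_ge0|exact: mulr_ge0 be0 k0|].
  rewrite /legE /legQ /legV /=.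
  have -> : (be * k) *: (proj z F - v) = be *: (k *: (proj z F - v)) by rewrite scalerA.
  by rewrite -mir dE' dE; vring.
- exists (v, e2, F), (be - al), (al * k), s; split=> //; [by rewrite subr_ge0 ltW|exact: mulr_ge0 al0 k0|].
  rewrite /legE /legQ /legV /=.
  have -> : (al * k) *: (proj z F - v) = al *: (k *: (proj z F - v)) by rewrite scalerA.
  by rewrite -mir dE' dE; vring.
Qed.

(** The coefficient of [legV - z] is the largest value on [d] of the normals at the vertex, attained
    only by the facet of the flag; so both flags have the same facet and coefficient. What remains
    lies in the plane of that facet, where [flag_disjoint] applies. *)
Lemma fig_disjoint i j al be s al' be' s' d : flags P i -> flags P j -> legV i = legV j ->
  0 < al -> 0 < be -> 0 < al' -> 0 < be' ->
  d = al *: (legE z i - legV i) + be *: (legQ z i - legV i) + s *: (legV i - z) ->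
  d = al' *: (legE z j - legV j) + be' *: (legQ z j - legV j) + s' *: (legV j - z) -> i = j.
Proof.
move=> fi fj ij al0 be0 al'0 be'0 dE dE'.
have main k l (p r t : R) : flags P k -> flags P l -> legV k = legV l -> 0 < p -> 0 < r ->
    d = p *: (legE z k - legV k) + r *: (legQ z k - legV k) + t *: (legV k - z) ->
    exists2 y, facet_normal P z l.2 y & dot y d <= t /\ (k.2 <> l.2 -> dot y d < t) /\
      (k.2 = l.2 -> dot y d = t).
  move=> fk fl kl p0 r0 kE; have [kv ke kF kev keF] := fk; have [lv le lF lev leF] := fl.
  have [y nl] := facet_normal_exists (good_inside gP) lF; exists y => //.
  have yV : dot y (legV k - z) = 1 by rewrite kl; have [] := facet_normal_sub1 nl (leF _ lev).
  have sub x : x - legV k = (x - z) - (legV k - z) by vring.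
  have [[QF _] _] := facet_proj gP kF; have [[EF _] _] := edge_proj gP ke.
  have le1 x : P x -> dot y (x - legV k) <= 0 by move=> Px; rewrite sub dotBr yV subr_le0 (proj1 nl).
  have yd : dot y d = p * dot y (legE z k - legV k) + r * dot y (legQ z k - legV k) + t.
    by rewrite kE [LHS]dotDr [X in X + _ = _]dotDr !dotZr yV mulr1.
  have hE : p * dot y (legE z k - legV k) <= 0.
    by rewrite pmulr_rle0//; apply: le1; exact: (kface_sub ke EF).
  have hQ : r * dot y (legQ z k - legV k) <= 0.
    by rewrite pmulr_rle0//; apply: le1; exact: (kface_sub kF QF).
  split; first by rewrite yd; lra.
  split=> [ne|kl2].
    suff : r * dot y (legQ z k - legV k) < 0 by rewrite yd; lra.
    rewrite pmulr_rlt0// sub dotBr yV subr_lt0.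
    exact: (facet_normal_inner pP kF lF ne (proj1 (facet_proj gP kF)) nl).
  have on x : k.2 x -> dot y (x - legV k) = 0.
    by rewrite kl2 sub dotBr yV => lx; have [_ ->] := facet_normal_sub1 nl lx; rewrite subrr.
  by rewrite yd !on ?mulr0 ?add0r//; exact: keF.
have [y ny [y1 [y2 y3]]] := main i j al be s fi fj ij al0 be0 dE.
have [x nx [x1 [x2 x3]]] := main j i al' be' s' fj fi (esym ij) al'0 be'0 dE'.
have [y' ny' [y1' [y2' y3']]] := main j j al' be' s' fj fj erefl al'0 be'0 dE'.
have [x' nx' [x1' [x2' x3']]] := main i i al be s fi fi erefl al0 be0 dE.
have [_ _ iF _ _] := fi; have [_ _ jF _ _] := fj.
have yy : y = y' := facet_normal_eq jF ny ny' (fun _ h => h).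
have xx : x = x' := facet_normal_eq iF nx nx' (fun _ h => h).
rewrite -yy in y3'; rewrite -xx in x3'.
have FF : i.2 = j.2.
  apply: contrapT => ne; have := y2 ne; have := x2 (fun h => ne (esym h)).
  by rewrite y3'// x3'//; lra.
have ss : s = s' by rewrite -y3// -y3'.
(* Small enough for the point, pulled towards the vertex, to lie in the open angle at the foot for
   both flags. *)
pose t := (al + be + (al' + be'))^-1.
have t0 : 0 < t by rewrite invr_gt0 !addr_gt0.
have tt : t * (al + be + (al' + be')) = 1 by rewrite mulVf// gt_eqF// !addr_gt0.
have pt k (p r : R) : flags P k -> 0 < p -> 0 < r -> 0 < 1 - t * r - t * p ->
    let x := legV k + t *: (p *: (legE z k - legV k) + r *: (legQ z k - legV k)) in
    dot (legQ z k - z) (x - legQ z k) = 0 /\ cone (slope z k) (flagX z k x, flagY z k x).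
  move=> fk p0 r0 pr w; have [n1 [n2 [n3 [[E1 E2 E3] [d1 d2 d3 [d12 d13 d23]]]]]] := flag_frame gP uP hP fk.
  have wE : w - legQ z k = (1 - t * r) *: n2 + (1 - t * r - t * p) *: n3.
    by rewrite /w -E2 -E3; vring.
  have [aE bE] := uP fk.
  split; first by rewrite wE E1 dotDr !dotZr d12 d13 !mulr0 addr0.
  rewrite /cone /flagX /flagY /slope aE bE wE E2 E3 /=.
  rewrite !dotDr !dotZr d2 d3 d23 [dot n3 n2]dotC d23 !mulr0 add0r addr0.
  have -> : b / a * ((1 - t * r) * a ^+ 2 / a) = (1 - t * r) * b by field; exact: lt0r_neq0.
  have -> : (1 - t * r - t * p) * b ^+ 2 / b = (1 - t * r - t * p) * b by field; exact: lt0r_neq0.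
  by split; [rewrite mulr_gt0|rewrite ltr_pM2r// gtrBl mulr_gt0].
have [|ni ci] := pt i al be fi al0 be0.
  by have := mulr_gt0 t0 al'0; have := mulr_gt0 t0 be'0; lra.
have [|nj cj] := pt j al' be' fj al'0 be'0.
  by have := mulr_gt0 t0 al0; have := mulr_gt0 t0 be0; lra.
apply: (flag_disjoint gP fi fj FF ni ci).
have dd : al *: (legE z i - legV i) + be *: (legQ z i - legV i) =
    al' *: (legE z j - legV j) + be' *: (legQ z j - legV j).
  apply: (@addIr _ (s *: (legV i - z))); rewrite -dE {1}dE' ij ss//.
by rewrite dd ij.
Qed.

End Fixed.
End VertexTiling.

(** * The angle sum at the vertices *)

Section VertexSum.
Context {R : realType}.
Local Notation vec := 'rV[R]_3.
Local Notation T2 := (measurableTypeR R * measurableTypeR R)%type.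
Local Notation leb2 := (@leb2 R).
Implicit Types (u v w x y z c d p : vec) (P F G e : set vec) (i j : @triple R).

Section Fixed.
Context P z (gP : good P z) (a b h : R) (a0 : 0 < a) (b0 : 0 < b) (h0 : 0 < h).
Context (uP : uniform P z a b)
  (hP : forall F, kfaces P 2 F -> dot (proj z F - z) (proj z F - z) = h ^+ 2).

Local Notation m := (figm z a b h).
Local Notation w := (figw z a h).
Local Notation M := (figM a b h).
Local Notation W := (figW a h).
Local Notation T := (figT a b h).

Let coord i (x : vec) : T2 := (dot (m i) x / M, dot (w i) x / W).

Lemma fig_plane i x : flags P i -> dot (legV i - z) x = 0 ->
  x = (dot (m i) x / M ^+ 2) *: m i + (dot (w i) x / W ^+ 2) *: w i.
Proof.
move=> fi nx; have [[nn mn wn] [mm ww mw]] := figE gP a0 b0 h0 uP hP fi.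
have M0 := figM_gt0 a0 b0 h0; have W0 := figW_gt0 a0 h0.
have m0 : m i != 0 by rewrite -dot_eq0 mm expf_neq0// gt_eqF.
have w0 : w i != 0 by rewrite -dot_eq0 ww expf_neq0// gt_eqF.
have n0 : legV i - z != 0.
  by rewrite -dot_eq0 nn gt_eqF//; have := exprn_gt0 2 a0; have := exprn_gt0 2 b0;
    have := exprn_gt0 2 h0; lra.
by rewrite {1}[x](orthogonal_decomp x m0 w0 n0 mw mn wn) nx mul0r scale0r addr0 mm ww.
Qed.

Lemma fig_norm i x : flags P i -> dot (legV i - z) x = 0 ->
  (coord i x).1 ^+ 2 + (coord i x).2 ^+ 2 = dot x x.
Proof.
move=> fi nx; have [_ [mm ww mw]] := figE gP a0 b0 h0 uP hP fi.
have M0 := figM_gt0 a0 b0 h0; have W0 := figW_gt0 a0 h0.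
rewrite /coord; have := fig_plane fi nx; move: (m i) (w i) => m' w' xE.
rewrite /= {3}xE dotDl !dotZl; field.
by rewrite !gt_eqF.
Qed.

(** A full turn about the line from [z] to the vertex, measured in the perpendicular plane through
    [v]; all flags at [v] contribute the same angle. *)
Lemma vertex_disc v : kfaces P 0 [set v] ->
  disc_area = \sum_(i \in flags P `&` [set i | [set i.1.1] = [set v]]) sector T.
Proof.
move=> vv; set D := _ `&` _.
(* Vertices are indexed by singletons because these are the members of [kfaces P 0]. *)
have DE i : D i <-> flags P i /\ legV i = v.
  split=> -[fi iv]; split=> //; last by rewrite /= -/(legV i) iv.
  by have : [set v] (legV i) by rewrite -iv.
have fD : finite_set D by apply: (sub_finite_set _ (flags_finite gP)) => i [].
have [i0 fi0 i0v] := vertex_flag gP vv.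
have M0 := figM_gt0 a0 b0 h0; have W0 := figW_gt0 a0 h0; have T0 := figT_gt0 a0 b0 h0.
have [[_ mn wn] [mm ww mw]] := figE gP a0 b0 h0 uP hP fi0.
rewrite i0v in mn wn.
have [p pE] : exists p : vec, p = M^-1 *: m i0 by eexists.
have [r rE] : exists r : vec, r = W^-1 *: w i0 by eexists.
have [pp rr pr] : [/\ dot p p = 1, dot r r = 1 & dot p r = 0].
  rewrite pE rE !dotZl !dotZr mm ww mw !mulr0; split=> //; field; exact: lt0r_neq0.
have pn : dot (v - z) p = 0 by rewrite pE dotZr dotC mn mulr0.
have rn : dot (v - z) r = 0 by rewrite rE dotZr dotC wn mulr0.
pose co i (st : T2) : T2 := coord i (chart v p r st - v).
have chn st : dot (v - z) (chart v p r st - v) = 0.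
  have -> : chart v p r st - v = st.1 *: p + st.2 *: r by rewrite /chart; vring.
  by rewrite dotDr !dotZr pn rn !mulr0 addr0.
have span x : dot (v - z) x = 0 -> exists al be, x = al *: p + be *: r.
  rewrite -i0v => /(fig_plane fi0) ->.
  exists (dot (m i0) x / M), (dot (w i0) x / W); rewrite pE rE !scalerA.
  by congr (_ *: _ + _ *: _); field; exact: lt0r_neq0.
have pco i : D i -> pres (co i).
  move=> /DE[fi iv]; have [[_ mni wni] [mmi wwi mwi]] := figE gP a0 b0 h0 uP hP fi.
  rewrite iv dotC in mni; rewrite iv dotC in wni.
  have [al [be mE]] := span _ mni; have [al' [be' wE]] := span _ wni.
  exact: (chart_pres v v pp rr pr M0 W0 mmi wwi mwi mE wE).
have Di0 : D i0 by apply/DE.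
have tiling X : measurable X -> leb2 X = (\sum_(i \in D) leb2 (X `&` co i @^-1` cone T))%E.
  move=> mX; apply: cone_tiling => //.
  - move=> i j st /DE[fi iv] /DE[fj jv] ci cj.
    have [al [be [s dE]]] := fig_decomp gP a0 b0 h0 uP hP (chart v p r st - v) fi.
    have [al' [be' [s' dE']]] := fig_decomp gP a0 b0 h0 uP hP (chart v p r st - v) fj.
    have [[al0 be0] [al'0 be'0]] : (0 < al /\ 0 < be) /\ (0 < al' /\ 0 < be').
      split; first by apply/(proj1 (fig_cone gP a0 b0 h0 uP hP fi dE)).
      by apply/(proj1 (fig_cone gP a0 b0 h0 uP hP fj dE')).
    apply: (fig_disjoint gP a0 b0 uP hP fi fj _ al0 be0 al'0 be'0 dE dE').
    by rewrite iv jv.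
  - move=> st _; have [i [al [be [s [fi iv al0 be0 dE]]]]] :=
      fig_cover gP a0 b0 h0 uP hP (chart v p r st - v) vv.
    exists i; first by apply/DE.
    by apply/(proj2 (fig_cone gP a0 b0 h0 uP hP fi dE)).
have mX : measurable (co i0 @^-1` disc).
  by rewrite -[X in measurable X]setTI; apply: (pco _ Di0).1 => //; exact: measurable_disc.
suff : disc_area%:E = (\sum_(i \in D) sector T)%:E by move=> [].
rewrite -disc_areaE -(proj2 (pco _ Di0)); last exact: measurable_disc.
rewrite tiling// -fsumEFin//; apply: eq_fsbigr => i /set_mem Di.
have [fi iv] := (DE i).1 Di.
have -> : co i0 @^-1` disc `&` co i @^-1` cone T = co i @^-1` (cone T `&` disc).
  have E st : (co i0 @^-1` disc) st <-> (co i @^-1` disc) st.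
    rewrite /disc /= !fig_norm//; first by rewrite iv.
    by rewrite i0v.
  rewrite predeqE => st; split=> [[x y]|[y x]]; [exact: (conj y ((E st).1 x))|exact: (conj ((E st).2 x) y)].
by rewrite (proj2 (pco _ Di)) ?sectorE//; exact: measurable_sector.
Qed.

Lemma vertex_disc_sum (U H : nat) : (kfaces P 0 #= `I_U)%card -> (kfaces P 1 #= `I_H)%card ->
  U%:R * disc_area = 4 * H%:R * sector T.
Proof.
move=> hU hH; rewrite -(flags_sum_const gP _ hH).
rewrite (@fsum_partition _ _ _ _ (kfaces P 0) (fun i => [set i.1.1])).
- rewrite -(fsum_const _ hU); apply: eq_fsbigr => V /set_mem VV.
  by have [v vE] := vertex_set VV; rewrite vE in VV *; exact: vertex_disc.
- exact: flags_finite gP.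
- exact: (good_finite gP).
- by move=> i [].
Qed.

End Fixed.

(* The sum of the angles of the vertex figures determines the height. *)
Lemma height_eq P P' z z' (U H : nat) a b h k h' : good P z -> good P' z' ->
  0 < a -> 0 < b -> 0 < h -> 0 < k -> 0 < h' ->
  uniform P z a b -> uniform P' z' (k * a) (k * b) ->
  (forall F, kfaces P 2 F -> dot (proj z F - z) (proj z F - z) = h ^+ 2) ->
  (forall F, kfaces P' 2 F -> dot (proj z' F - z') (proj z' F - z') = h' ^+ 2) ->
  (kfaces P 0 #= `I_U)%card -> (kfaces P 1 #= `I_H)%card ->
  (kfaces P' 0 #= `I_U)%card -> (kfaces P' 1 #= `I_H)%card -> h' = k * h.
Proof.
move=> gP gP' a0 b0 h0 k0 h'0 uP uP' hP hP' hU hH hU' hH'.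
have ka := mulr_gt0 k0 a0; have kb := mulr_gt0 k0 b0.
have s1 := vertex_disc_sum gP a0 b0 h0 uP hP hU hH.
have s2 := vertex_disc_sum gP' ka kb h'0 uP' hP' hU' hH'.
have H0 : 4 * H%:R != 0 :> R.
  rewrite mulf_neq0 ?pnatr_eq0// -lt0n lt0n; apply/eqP => H0.
  have [[[v e] F] [_ ee _ _ _]] := exists_flag gP.
  by move: hH; rewrite H0 II0 card_eq0 => /eqP E; rewrite E in ee.
have T1 := figT_gt0 a0 b0 h0; have T2 := figT_gt0 ka kb h'0.
have TT : figT a b h = figT (k * a) (k * b) h'.
  apply: (sector_inj T1 T2); apply: (mulfI H0); exact: (etrans (esym s1) s2).
have := congr1 (fun t => t ^+ 2) TT; rewrite (figT2 a0 b0 h0) (figT2 ka kb h'0).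
have aa := exprn_gt0 2 a0; have bb := exprn_gt0 2 b0; have hh := exprn_gt0 2 h0.
have hh' := exprn_gt0 2 h'0; have kk := exprn_gt0 2 k0.
have -> : (k * a) ^+ 2 / (k * b) ^+ 2 = a ^+ 2 / b ^+ 2.
  by field; rewrite !gt_eqF.
have ab : a ^+ 2 / b ^+ 2 != 0 by rewrite gt_eqF// divr_gt0.
move=> /(mulfI ab)/addrI.
have -> : (k * a) ^+ 2 + (k * b) ^+ 2 = k ^+ 2 * (a ^+ 2 + b ^+ 2) by ring.
have ab2 : a ^+ 2 + b ^+ 2 != 0 by rewrite gt_eqF// addr_gt0.
move=> E; have {}E : h'^+ 2 = (k * h) ^+ 2.
  have e1 : h' ^+ 2 * (a ^+ 2 + b ^+ 2) = (k * h) ^+ 2 * (a ^+ 2 + b ^+ 2).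
    have -> : h' ^+ 2 * (a ^+ 2 + b ^+ 2) = h' ^+ 2 * h ^+ 2 * ((a ^+ 2 + b ^+ 2) / h ^+ 2).
      by field; rewrite gt_eqF.
    by rewrite E; field; rewrite gt_eqF.
  exact: mulIf e1.
by apply/eqP; rewrite -(@eqrXn2 _ 2 _ _ isT (ltW h'0) (ltW (mulr_gt0 k0 h0))) E.
Qed.

End VertexSum.

(** * Similarity *)

Section Matching.
Context {R : realType}.
Local Notation vec := 'rV[R]_3.
Implicit Types (u v w x y z c d p : vec) (P F G e : set vec) (i j : @triple R) (f g : vec -> vec).

Lemma sim_comb2 k f x y w (s t : R) : sim k f ->
  f (x + s *: (y - x) + t *: (w - x)) = f x + s *: (f y - f x) + t *: (f w - f x).
Proof.
move=> /sim_affine[M [_ _ fE]].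
rewrite [f (_ + _)]fE [f x]fE [f y]fE [f w]fE !mulmxDl -!scalemxAl !mulmxBl; vring.
Qed.

Lemma frame_sim k z z' (n1 n2 n3 m1 m2 m3 : vec) : 0 < k -> n1 != 0 -> n2 != 0 -> n3 != 0 ->
  dot n1 n2 = 0 -> dot n1 n3 = 0 -> dot n2 n3 = 0 ->
  dot m1 m2 = 0 -> dot m1 m3 = 0 -> dot m2 m3 = 0 ->
  dot m1 m1 = k ^+ 2 * dot n1 n1 -> dot m2 m2 = k ^+ 2 * dot n2 n2 ->
  dot m3 m3 = k ^+ 2 * dot n3 n3 -> exists f, [/\ sim k f, f z = z', f (z + n1) = z' + m1,
    f (z + n1 + n2) = z' + m1 + m2 & f (z + n1 + n2 + n3) = z' + m1 + m2 + m3].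
Proof.
move=> k0 n10 n20 n30 n12 n13 n23 m12 m13 m23 m11 m22 m33.
pose co x n : R := dot n (x - z) / dot n n.
pose f x : vec := z' + co x n1 *: m1 + co x n2 *: m2 + co x n3 *: m3.
have [n21 n31 n32] : [/\ dot n2 n1 = 0, dot n3 n1 = 0 & dot n3 n2 = 0].
  by rewrite [dot n2 n1]dotC [dot n3 n1]dotC [dot n3 n2]dotC.
have [m21 m31 m32] : [/\ dot m2 m1 = 0, dot m3 m1 = 0 & dot m3 m2 = 0].
  by rewrite [dot m2 m1]dotC [dot m3 m1]dotC [dot m3 m2]dotC.
have [d1 d2 d3] : [/\ dot n1 n1 != 0, dot n2 n2 != 0 & dot n3 n3 != 0] by rewrite !dot_eq0.
exists f; split.
- split=> // x y.
  have -> : f x - f y = (dot n1 (x - y) / dot n1 n1) *: m1 + (dot n2 (x - y) / dot n2 n2) *: m2 +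
      (dot n3 (x - y) / dot n3 n3) *: m3.
    have e n : dot n (x - y) / dot n n = co x n - co y n.
      have -> : x - y = (x - z) - (y - z) by vring.
      by rewrite dotBr mulrBl.
    by rewrite !e /f; vring.
  have xyE := orthogonal_decomp (x - y) n10 n20 n30 n12 n13 n23.
  move: xyE; set c1 := _ / _; set c2 := _ / _; set c3 := _ / _ => xyE.
  clearbody c1 c2 c3; rewrite xyE /elen; set A := _ + _; set B := _ + _.
  suff -> : dot A A = k ^+ 2 * dot B B by rewrite sqrtrM ?sqr_ge0// sqrtr_sqr gtr0_norm.
  rewrite /A /B !(dotDl, dotDr, dotZl, dotZr) m11 m22 m33 m12 m13 m23 m21 m31 m32.
  by rewrite n12 n13 n23 n21 n31 n32; ring.
- rewrite /f /co subrr !dot0r !mul0r; vring.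
- have e n : co (z + n1) n = dot n n1 / dot n n by rewrite /co addrAC subrr add0r.
  by rewrite /f !e n21 n31 !mul0r divff//; vring.
- have e n : co (z + n1 + n2) n = (dot n n1 + dot n n2) / dot n n.
    by rewrite /co -dotDr; congr (dot _ _ / _); vring.
  by rewrite /f !e n12 n21 n31 n32 !(addr0, add0r) !mul0r !divff//; vring.
- have e n : co (z + n1 + n2 + n3) n = (dot n n1 + dot n n2 + dot n n3) / dot n n.
    by rewrite /co -!dotDr; congr (dot _ _ / _); vring.
  by rewrite /f !e n12 n21 n31 n32 n13 n23 !(addr0, add0r) !divff//; vring.
Qed.

(** The dual normal is the image of the foot under inversion in the unit sphere about [z], so the
    foot determines the facet inequality. *)
Lemma normal_proj P z F y : good P z -> kfaces P 2 F -> facet_normal P z F y ->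
  dot (proj z F - z) (proj z F - z) != 0 /\
  y = (dot (proj z F - z) (proj z F - z))^-1 *: (proj z F - z).
Proof.
move=> gP Ff nF; have [[FQ _] oQ] := facet_proj gP Ff.
have [y0 FE] := facet_normal_amax Ff nF.
have [_ yQ] := facet_normal_sub1 nF FQ.
have [k kE] : exists k, proj z F - z = k *: y.
  apply: (@facet_const _ P F y (proj z F - z) (dot (proj z F - z) (proj z F)) (dot y (proj z F)) Ff y0).
    by move=> t Ft; apply: (@amax_eq _ P); rewrite -FE.
  by move=> t Ft; have := oQ _ _ Ft FQ; rewrite dotBr; lra.
have k1 : k * dot y y = 1 by rewrite -yQ kE dotZr.
have k0 : k != 0 by apply: contra_eq_neq k1 => ->; rewrite mul0r eq_sym oner_eq0.
rewrite kE dotZl dotZr k1 mulr1; split=> //.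
by rewrite scalerA mulVf// scale1r.
Qed.

Section Two.
Context P P' z z' (gP : good P z) (gP' : good P' z') (k a b h : R).
Context (k0 : 0 < k) (a0 : 0 < a) (b0 : 0 < b) (h0 : 0 < h).
Context (uP : uniform P z a b) (uP' : uniform P' z' (k * a) (k * b)).
Context (hP : forall F, kfaces P 2 F -> dot (proj z F - z) (proj z F - z) = h ^+ 2).
Context (hP' : forall F, kfaces P' 2 F -> dot (proj z' F - z') (proj z' F - z') = (k * h) ^+ 2).

(** By [normal_proj] a facet inequality depends only on the foot, and it is invariant under
    similarities; so every inequality defining [P] at [y] is one satisfied by [P'] at [f y]. *)
Lemma match_image f y : sim k f -> f z = z' ->
  (forall F, kfaces P 2 F -> exists2 G, kfaces P' 2 G & proj z' G = f (proj z F)) ->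
  P' (f y) -> P y.
Proof.
move=> sf fz img P'y; have [c sc] := good_strict gP.
apply: (hrep (good_polytope gP) sc (good_inside gP) (good_finite gP (k := 2) isT)) => F n Ff nF.
have [G Gf GE] := img _ Ff; have [n' nG] := facet_normal_exists (good_inside gP') Gf.
have [q0 ->] := normal_proj gP Ff nF.
have := proj1 nG _ P'y; have [q'0 ->] := normal_proj gP' Gf nG.
have Q0 : 0 < dot (proj z F - z) (proj z F - z) by rewrite lt_def q0 dot_ge0.
have kk : 0 < k ^+ 2 by exact: exprn_gt0.
rewrite GE -fz !dotZl !(sim_dot _ _ _ _ sf) invfM.
rewrite mulrACA mulVf ?mul1r//; exact: lt0r_neq0.
Qed.

End Two.

Section Flips.
Context P z (gP : good P z) (a b h : R) (a0 : 0 < a) (b0 : 0 < b) (h0 : 0 < h).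
Context (uP : uniform P z a b).
Context (hP : forall F, kfaces P 2 F -> dot (proj z F - z) (proj z F - z) = h ^+ 2).

Lemma vertex_opposite v w e F : flags P (v, e, F) -> flags P (w, e, F) -> v <> w ->
  w = v + 2 *: (proj z e - v).
Proof.
move=> fv fw vw; have [vv ee _ ev _] := fv; have [ww _ _ ew _] := fw.
have [k k0 kE] := flag_opposite gP ee vv ww ev ew vw.
have [_ bv] := uP fv; have [_ bw] := uP fw.
have k1 : k = 1.
  have : dot (w - proj z e) (w - proj z e) = dot (v - proj z e) (v - proj z e).
    by rewrite -!elen_sqr; move: bv bw; rewrite /legB /legV /legE /= => -> ->.
  have v0 : dot (v - proj z e) (v - proj z e) != 0.
    rewrite -elen_sqr expf_neq0//; move: bv; rewrite /legB /legV /legE /= => ->.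
    exact: lt0r_neq0.
  rewrite kE dotZl dotZr mulrA -[RHS]mul1r => /(mulIf v0); nra.
by rewrite -[LHS](subrK (proj z e)) kE k1; vring.
Qed.

Lemma facet_mirror v e F G : flags P (v, e, F) -> flags P (v, e, G) -> F <> G ->
  proj z G = proj z e + (-1) *: (proj z F - proj z e) + (2 * a ^+ 2 / (h ^+ 2 + a ^+ 2)) *: (z - proj z e).
Proof.
move=> fF fG FG; have [_ ee Ff _ _] := fF; have [_ _ Gf _ _] := fG.
have [n1 [n2 [n3 [[E1 E2 E3] [d1 d2 d3 [d12 d13 d23]]]]]] := flag_frame gP uP hP fF.
have [m1 [m2 [m3 [[G1 G2 G3] [c1 c2 c3 [c12 c13 c23]]]]]] := flag_frame gP uP hP fG.
rewrite /legV /legE /legQ /= in E1 E2 E3 G1 G2 G3.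
have y1 : proj z F - proj z e = - n2 by rewrite -E2; vring.
have y2 : proj z G - proj z e = - m2 by rewrite -G2; vring.
have g1 : z - proj z e = - n1 - n2 by rewrite -E1 -E2; vring.
have g2 : z - proj z e = - m1 - m2 by rewrite -G1 -G2; vring.
have nm : m3 = n3 by rewrite -E3 -G3.
have n30 : n3 != 0 by rewrite -dot_eq0 d3 expf_neq0 ?gt_eqF.
have gg : dot (z - proj z e) (z - proj z e) = h ^+ 2 + a ^+ 2.
  by rewrite g1 !(dotDl, dotDr, dotNl, dotNr) [dot n2 n1]dotC d1 d2 d12; ring.
have gg0 : 0 < h ^+ 2 + a ^+ 2 by rewrite addr_gt0// exprn_gt0.
have : (proj z F - proj z e) + (proj z G - proj z e) =
    (2 * a ^+ 2 / dot (z - proj z e) (z - proj z e)) *: (z - proj z e).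
  apply: (reflection n30); rewrite ?y1 ?y2.
  - by rewrite -dot_eq0 gg gt_eqF.
  - by rewrite g1 !(dotDr, dotNr) [dot n3 n1]dotC [dot n3 n2]dotC d13 d23; ring.
  - by rewrite dotNr dotC d23 oppr0.
  - by rewrite dotNr -nm dotC c23 oppr0.
  - by rewrite g1 !(dotDr, dotNr, dotNl) [dot n2 n1]dotC d12 d2; ring.
  - by rewrite g2 !(dotDr, dotNr, dotNl) [dot m2 m1]dotC c12 c2; ring.
  - by rewrite !(dotNl, dotNr) !opprK d2 c2.
  move=> E; apply: FG.
  have QQ : proj z F = proj z G by rewrite -[LHS](subrK (proj z e)) -[RHS](subrK (proj z e)) y1 y2 E.
  have [iF _] := facet_proj gP Ff; have [iG _] := facet_proj gP Gf.
  have [w wE] := kface_exposed Gf.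
  apply: (facet_sub_eq Ff Gf).
  by apply: (inner_exposed iF (kface_sub Ff) wE); rewrite QQ; case: iG.
rewrite gg => E; rewrite -E; vring.
Qed.

Lemma edge_mirrorE v e1 e2 F : flags P (v, e1, F) -> flags P (v, e2, F) -> e1 <> e2 ->
  proj z e2 = v + (-1) *: (proj z e1 - v) + (2 * b ^+ 2 / (a ^+ 2 + b ^+ 2)) *: (proj z F - v).
Proof.
move=> f1 f2 e12; have := edge_mirror gP a0 b0 h0 uP hP f1 f2 e12.
have [n1 [n2 [n3 [[E1 E2 E3] [d1 d2 d3 [d12 d13 d23]]]]]] := flag_frame gP uP hP f1.
rewrite /legV /legE /legQ /= in E1 E2 E3.
have -> : dot (proj z F - v) (proj z F - v) = a ^+ 2 + b ^+ 2.
  have -> : proj z F - v = - n2 - n3 by rewrite -E2 -E3; vring.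
  by rewrite !(dotDl, dotDr, dotNl, dotNr) [dot n3 n2]dotC d2 d3 d23; ring.
by move=> <-; vring.
Qed.

End Flips.

End Matching.

(** * Propagation of a match from flag to flag *)

Section Propagation.
Context {R : realType}.
Local Notation vec := 'rV[R]_3.
Implicit Types (u v w x y z c d p : vec) (P F G e : set vec) (i j : @triple R) (f g : vec -> vec).

(** Only the three points are matched: that the image of a face is a face of [P'] is not yet
    known. *)
Definition matched z P' z' f i := exists j, [/\ flags P' j, legV j = f (legV i),
  legE z' j = f (legE z i) & legQ z' j = f (legQ z i)].

Section Two.
Context P P' z z' (gP : good P z) (gP' : good P' z') (k a b h : R).
Context (k0 : 0 < k) (a0 : 0 < a) (b0 : 0 < b) (h0 : 0 < h).
Context (uP : uniform P z a b) (uP' : uniform P' z' (k * a) (k * b)).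
Context (hP : forall F, kfaces P 2 F -> dot (proj z F - z) (proj z F - z) = h ^+ 2).
Context (hP' : forall F, kfaces P' 2 F -> dot (proj z' F - z') (proj z' F - z') = (k * h) ^+ 2).
Context f (sf : sim k f) (fz : f z = z').

Local Notation matched := (matched z P' z' f).
Let ka := mulr_gt0 k0 a0.
Let kb := mulr_gt0 k0 b0.
Let kh := mulr_gt0 k0 h0.

(** Here and in the next two lemmas the new point is a combination of [z] and the points of the
    flag, with coefficients that depend only on the ratios of [a], [b] and [h]; the same formula
    holds in [P'], and similarities respect it. *)
Lemma vertex_flip v w e F : flags P (v, e, F) -> flags P (w, e, F) ->
  matched (v, e, F) -> matched (w, e, F).
Proof.
move=> fv fw [[[v' e'] F'] [fj jV jE jQ]].
have [<-|/eqP vw] := eqVneq v w; first by exists (v', e', F').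
rewrite /legV /legE /legQ /= in jV jE jQ.
have [v'v' e'e F'f e'v' e'F'] := fj; rewrite /= in v'v' e'e F'f e'v' e'F'.
have [w' [w'v' w'0 e'w']] : exists w', [/\ w' <> v', kfaces P' 0 [set w'] & e' w'].
  have [x [y [xy vx vy [ex ey] _]]] := edge_vertices (good_polytope gP') e'e.
  have [E|E] := pselect (x = v'); last by exists x.
  by exists y; split=> // yE; apply: xy; rewrite E yE.
have fj' : flags P' (w', e', F') by split.
exists (w', e', F'); split=> //; rewrite /legV /legE /legQ /=.
rewrite (vertex_opposite gP' kb uP' fj fj' (fun h => w'v' (esym h))).
by rewrite (vertex_opposite gP b0 uP fv fw vw) (sim_comb _ _ _ sf) jV jE.
Qed.

Lemma facet_flip v e F G : flags P (v, e, F) -> flags P (v, e, G) ->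
  matched (v, e, F) -> matched (v, e, G).
Proof.
move=> fF fG [[[v' e'] F'] [fj jV jE jQ]].
have [<-|/eqP FG] := eqVneq F G; first by exists (v', e', F').
rewrite /legV /legE /legQ /= in jV jE jQ.
have [v'v' e'e F'f e'v' e'F'] := fj; rewrite /= in v'v' e'e F'f e'v' e'F'.
have [c sc] := good_strict gP'.
have [G' [G'f G'F' e'G']] : exists G', [/\ kfaces P' 2 G', G' <> F' & e' `<=` G'].
  have [G1 [G2 [G1f G2f G12 eG1 eG2]]] := edge_two_facets (good_polytope gP') (strict_fulldim sc) e'e.
  have [E|E] := pselect (G1 = F'); last by exists G1.
  by exists G2; split=> // E2; apply: G12; rewrite E E2.
have fj' : flags P' (v', e', G') by split.
exists (v', e', G'); split=> //; rewrite /legV /legE /legQ /=.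
rewrite (facet_mirror gP' ka kb kh uP' hP' fj fj' (fun h => G'F' (esym h))).
rewrite (facet_mirror gP a0 b0 h0 uP hP fF fG FG) (sim_comb2 _ _ _ _ _ sf) jE jQ fz.
have h2 := exprn_gt0 2 h0; have a2 := exprn_gt0 2 a0; have k2 := exprn_gt0 2 k0.
congr (_ + _ *: _); field; rewrite !gt_eqF//.
  by rewrite addr_gt0// exprn_gt0.
by rewrite addr_gt0.
Qed.

Lemma edge_flip v e1 e2 F : flags P (v, e1, F) -> flags P (v, e2, F) ->
  matched (v, e1, F) -> matched (v, e2, F).
Proof.
move=> f1 f2 [[[v' e'] F'] [fj jV jE jQ]].
have [<-|/eqP e12] := eqVneq e1 e2; first by exists (v', e', F').
rewrite /legV /legE /legQ /= in jV jE jQ.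
have [v'v' e'e F'f e'v' e'F'] := fj; rewrite /= in v'v' e'e F'f e'v' e'F'.
have [e'' [ee'' e''F' e''v' ne]] := other_edge (good_polytope gP') F'f e'e e'F' v'v' e'v'.
have fj' : flags P' (v', e'', F') by split.
exists (v', e'', F'); split=> //; rewrite /legV /legE /legQ /=.
rewrite (edge_mirrorE gP' ka kb kh uP' hP' fj fj' (fun h => ne (esym h))).
rewrite (edge_mirrorE gP a0 b0 h0 uP hP f1 f2 e12) (sim_comb2 _ _ _ _ _ sf) jE jQ jV.
have b2 := exprn_gt0 2 b0; have a2 := exprn_gt0 2 a0; have k2 := exprn_gt0 2 k0.
congr (_ + _ *: _); field; rewrite !gt_eqF//.
  by rewrite addr_gt0// exprn_gt0.
by rewrite addr_gt0.
Qed.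

Lemma facet_matched v e F : flags P (v, e, F) -> matched (v, e, F) ->
  forall w e', flags P (w, e', F) -> matched (w, e', F).
Proof.
move=> fi mi w e' fj; have [vv ee Ff ev eF] := fi.
have [ww ee' _ ew eF'] := fj; rewrite /= in vv ee Ff ev eF ww ee' ew eF'.
suff : forall G, kfaces P 1 G -> G `<=` F -> forall x, flags P (x, G, F) -> matched (x, G, F).
  by move=> /(_ _ ee' eF') h'; exact: h'.
apply: (edge_connected gP Ff _ ee eF).
  move=> x e1 e2 vx ee1 ee2 e1F e2F e1x e2x _ m1 y fy.
  have f2 : flags P (x, e2, F) by split.
  have f1 : flags P (x, e1, F) by split.
  by apply: (vertex_flip f2 fy); apply: (edge_flip f1 f2); exact: m1.
by move=> x fx; exact: (vertex_flip fi fx).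
Qed.

Lemma all_matched i : flags P i -> matched i -> forall j, flags P j -> matched j.
Proof.
case: i => [[v e] F] fi mi [[w g] G] fj; have [_ _ Ff _ _] := fi; have [_ _ Gf _ _] := fj.
suff : forall G, kfaces P 2 G -> forall x e', flags P (x, e', G) -> matched (x, e', G).
  by move=> /(_ _ Gf) h'; exact: h'.
apply: (facet_connected gP _ Ff); last exact: facet_matched fi mi.
move=> e1 F1 F2 ee F1f F2f eF1 eF2 _ m1.
have [x [_ [_ vx _ [ex _] _]]] := edge_vertices (good_polytope gP) ee.
have f1 : flags P (x, e1, F1) by split.
have f2 : flags P (x, e1, F2) by split.
by apply: (facet_matched f2); apply: (facet_flip f1 f2); exact: m1.
Qed.

Lemma preimage_sub i : flags P i -> matched i -> forall y, P' (f y) -> P y.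
Proof.
move=> fi mi y; apply: (match_image gP gP' k0 sf fz) => F Ff.
have [j [fj jF]] := facet_flag gP Ff.
have [j' [[_ _ Gf _ _] _ _ QE]] := all_matched fi mi fj.
by exists j'.2 => //; rewrite -jF.
Qed.

End Two.

Lemma uniform_similar P P' z z' k a b h : good P z -> good P' z' -> 0 < k -> 0 < a -> 0 < b -> 0 < h ->
  uniform P z a b -> uniform P' z' (k * a) (k * b) ->
  (forall F, kfaces P 2 F -> dot (proj z F - z) (proj z F - z) = h ^+ 2) ->
  (forall F, kfaces P' 2 F -> dot (proj z' F - z') (proj z' F - z') = (k * h) ^+ 2) ->
  exists f, [/\ sim k f, f z = z' & P' = f @` P].
Proof.
move=> gP gP' k0 a0 b0 h0 uP uP' hP hP'.
have [i fi] := exists_flag gP; have [j fj] := exists_flag gP'.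
have [n1 [n2 [n3 [[E1 E2 E3] [d1 d2 d3 [d12 d13 d23]]]]]] := flag_frame gP uP hP fi.
have [m1 [m2 [m3 [[G1 G2 G3] [c1 c2 c3 [c12 c13 c23]]]]]] := flag_frame gP' uP' hP' fj.
have [n10 n20 n30] : [/\ n1 != 0, n2 != 0 & n3 != 0].
  by rewrite -!dot_eq0 d1 d2 d3 !expf_neq0 ?gt_eqF.
have [|||f [sf fz f1 f2 f3]] := frame_sim z z' k0 n10 n20 n30 d12 d13 d23 c12 c13 c23.
- by rewrite c1 d1 exprMn.
- by rewrite c2 d2 exprMn.
- by rewrite c3 d3 exprMn.
have QE : f (legQ z i) = legQ z' j by rewrite -[legQ z i](subrK z) E1 addrC f1 -G1 addrC subrK.
have EE : f (legE z i) = legE z' j.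
  have -> : legE z i = z + n1 + n2 by rewrite -E1 -E2; vring.
  by rewrite f2 -G1 -G2; vring.
have VE : f (legV i) = legV j.
  have -> : legV i = z + n1 + n2 + n3 by rewrite -E1 -E2 -E3; vring.
  by rewrite f3 -G1 -G2 -G3; vring.
have [g [sg fg gf]] := sim_inverse sf.
exists f; split=> //.
have kV : k^-1 * k = 1 by rewrite mulVf// gt_eqF.
have ka := mulr_gt0 k0 a0; have kb := mulr_gt0 k0 b0; have kh := mulr_gt0 k0 h0.
have uP2 : uniform P z (k^-1 * (k * a)) (k^-1 * (k * b)) by rewrite !mulrA kV !mul1r.
have hP2 F : kfaces P 2 F -> dot (proj z F - z) (proj z F - z) = (k^-1 * (k * h)) ^+ 2.
  by rewrite mulrA kV mul1r; exact: hP.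
have k'0 : 0 < k^-1 by rewrite invr_gt0.
have gz : g z' = z by rewrite -fz fg.
(* One inclusion is [preimage_sub] for [f], the other is [preimage_sub] for its inverse. *)
rewrite eqEsubset; split=> [x P'x|_ [x Px <-]].
  exists (g x); last exact: gf.
  apply: (preimage_sub gP gP' k0 a0 b0 h0 uP uP' hP hP' sf fz fi); last by rewrite gf.
  by exists j.
apply: (preimage_sub gP' gP k'0 ka kb kh uP' uP2 hP' hP2 sg gz fj); last by rewrite fg.
by exists i; split=> //; rewrite -?QE -?EE -?VE fg.
Qed.

End Propagation.

(** * Images of regular polyhedra under similarities *)

Section Transport.
Context {R : realType}.
Local Notation vec := 'rV[R]_3.
Implicit Types (u v w x y z c d p : vec) (P F G e : set vec) (f g : vec -> vec).

Lemma sim_vertex k f P v : sim k f -> kfaces (f @` P) 0 [set v] ->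
  exists2 x, kfaces P 0 [set x] & v = f x.
Proof.
move=> sf /(sim_kface_surj sf (j := 0) isT)[V VV vE].
have [x xE] := vertex_set VV; rewrite xE in VV vE; exists x => //.
by have : (f @` [set x]) v by [rewrite -vE]; move=> [_ -> <-].
Qed.

Lemma sim_center k f P c : sim k f -> is_center P c -> is_center (f @` P) (f c).
Proof.
move=> sf hc v w /(sim_vertex sf)[x vx ->] /(sim_vertex sf)[y vy ->].
by rewrite !(proj2 sf); congr (_ * _); exact: hc.
Qed.

Lemma sim_regular k f P : sim k f -> regular_polyhedron P -> polyhedron (f @` P) ->
  regular_polyhedron (f @` P).
Proof.
move=> sf [_ tr] pP'; split=> // V1 E1 F1 V2 E2 F2.
have [g [sg fg gf]] := sim_inverse sf.
have back V E F : flag (f @` P) V E F -> exists V0 E0 F0, [/\ flag P V0 E0 F0,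
    V = f @` V0, E = f @` E0 & F = f @` F0].
  move=> [/(sim_kface_surj sf (j := 0) isT)[V0 v0 ->] /(sim_kface_surj sf (j := 1) isT)[E0 e0 ->]
    /(sim_kface_surj sf (j := 2) isT)[F0 f0 ->] VE EF].
  have sub (A B : set vec) : f @` A `<=` f @` B -> A `<=` B.
    by move=> AB x Ax; have [|y By /(sim_inj sf) <-//] := AB (f x); exists x.
  by exists V0, E0, F0; split=> //; split=> //; exact: sub.
move=> /back[V3 [E3 [F3 [fl -> -> ->]]]] /back[V4 [E4 [F4 [fl' -> -> ->]]]].
have [t [it tP tV tE tF]] := tr _ _ _ _ _ _ fl fl'.
have im A : (f \o t \o g) @` (f @` A) = f @` (t @` A).
  rewrite predeqE => x; split=> [[_ [y Ay <-] <-]|[_ [y Ay <-] <-]].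
    by exists (t y); [exists y|rewrite /= fg].
  by exists (f y); [exists y|rewrite /= fg].
exists (f \o t \o g); split; rewrite ?im ?tP ?tV ?tE ?tF//.
move=> x y /=; rewrite (proj2 sf) it (proj2 sg) mulrA mulfV ?mul1r// gt_eqF//.
by case: sf.
Qed.

End Transport.

Theorem theorem3 (R : realType) (S U H : nat)
    (P P' : set 'rV[R]_3) (o q : 'rV[R]_3)
    (hH : H = (S + U - 2)%N)
    (hP : regular_polyhedron P)
    (hPS : (kfaces P 2 #= `I_S)%card)
    (hPU : (kfaces P 0 #= `I_U)%card)
    (hPH : (kfaces P 1 #= `I_H)%card)
    (ho : is_center P o)
    (hPo : only_nondegenerate P o)
    (hP' : polyhedron P')
    (hP'S : (kfaces P' 2 #= `I_S)%card)
    (hP'U : (kfaces P' 0 #= `I_U)%card)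
    (hP'H : (kfaces P' 1 #= `I_H)%card)
    (hq : interior P' q)
    (hP'q : only_nondegenerate P' q)
    (hface : forall F, kfaces P' 2 F -> exists2 x, relint F x & equilibrium P' q x)
    (hedge : forall e, kfaces P' 1 e -> exists2 x, relint e x & equilibrium P' q x)
    (hvert : forall v, kfaces P' 0 [set v] -> equilibrium P' q v) :
  rho_in P' q <= rho_in P o /\
  (rho_in P' q = rho_in P o <-> similar_copy P P' /\ is_center P' q).
Proof.
have [a [b [[gP fS fH] [a0 b0 uP rP]]]] := regular_good hP ho hPS hPU hPH.
have [gP' fS' fH'] := good_of_equilibria hP' hP'S hP'U hP'H hq hP'q hface hedge.
have [le eq] := rho_compare gP gP' hPS hPH hP'S hP'H fS' fH' a0 b0 uP rP.
split=> //; split=> [/eq[k k0 uP']|[[k [f [k0 sf P'E]]] hq']].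
  have [h h0 hh] := uniform_height gP uP; have [h' h'0 hh'] := uniform_height gP' uP'.
  have hE := height_eq gP gP' a0 b0 h0 k0 h'0 uP uP' hh hh' hPU hPH hP'U hP'H.
  rewrite hE in hh'.
  have [f [[_ sf] fo P'E]] := uniform_similar gP gP' k0 a0 b0 h0 uP uP' hh hh'.
  split; first by exists k, f.
  by rewrite P'E -fo; apply: (sim_center (k := k)).
(* Regularity passes to [P'] by conjugating the symmetries of [P], which lets the two polyhedra
   exchange roles. *)
have rP' : regular_polyhedron P' by rewrite P'E in hP' *; exact: (sim_regular (k := k)) hP hP'.
have [a' [b' [_ [a'0 b'0 uP' r']]]] := regular_good rP' hq' hP'S hP'U hP'H.
by apply: le_anti; rewrite le /= (rho_compare gP' gP hP'S hP'H hPS hPH fS fH a'0 b'0 uP' r').1.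
Qed.
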